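(* Let $\Omega\subset\mathbb{R}^3$ be a bounded domain, $\nu>0$ and $\mathbf{f}\in V'$. Let $B$ be a weakly compact subset of $H$ for which $\mathcal{P}_{\mathrm{fpsss}}(B)$ is non-empty. Let $\phi:V\cap B\to\mathbb{R}$ be (sequentially) continuous with respect to the weak topology of $V$ and have sub-quadratic growth on $V$, i.e. there exist $C_0,C_1\ge 0$ and $0<\delta\le 2$ such that $|\phi(\mathbf{u})|\le C_0+C_1\|\nabla\mathbf{u}\|_{L^2}^{2-\delta}$ for all $\mathbf{u}\in V\cap B$. Then $$\min_{\mu\in\mathcal{P}_{\mathrm{fpsss}}(B)}\int_H\phi(\mathbf{u})\,d\mu(\mathbf{u})=\sup_{\Psi\in\mathcal{T}^{\mathrm{cyl}}}\ \min_{(\theta_1,\theta_2,\mathbf{u}_1,\mathbf{u}_2)\in\mathcal{B}_f}\ \sum_{i=1}^2\theta_i\left\{\phi(\mathbf{u}_i)+\langle\mathbf{F}(\mathbf{u}_i),\mathbf{D}\Psi(\mathbf{u}_i)\rangle_{V',V}\right\}.$$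
   Context: Spaces: $H$ (resp. $V$) is the closure of $\{\mathbf{u}\in C_c^\infty(\Omega)^3:\nabla\cdot\mathbf{u}=0\}$ in $L^2(\Omega)^3$ (resp. in $H_0^1(\Omega)^3$), with norm $\|\mathbf{u}\|_{L^2}$ (resp. $\|\nabla\mathbf{u}\|_{L^2}$). $H$ is identified with its dual, so $V\subset H=H'\subset V'$; $\langle\cdot,\cdot\rangle_{V',V}$ is the duality pairing (extending the $L^2$ inner product) and $\|\cdot\|_{V'}$ the dual norm. $\mathbf{F}:V\to V'$ is given by $\langle\mathbf{F}(\mathbf{u}),\mathbf{w}\rangle_{V',V}=\langle\mathbf{f},\mathbf{w}\rangle_{V',V}-\nu\int_\Omega\nabla\mathbf{u}:\nabla\mathbf{w}\,d\mathbf{x}-\int_\Omega(\mathbf{u}\cdot\nabla)\mathbf{u}\cdot\mathbf{w}\,d\mathbf{x}$ for $\mathbf{w}\in V$. Test functionals: $\mathcal{T}^{\mathrm{cyl}}$ is the set of $\Psi:V'\to\mathbb{R}$ of the form $\Psi(\mathbf{u})=\psi(\langle\mathbf{u},\mathbf{w}_1\rangle_{V',V},\dots,\langle\mathbf{u},\mathbf{w}_m\rangle_{V',V})$ with $m\in\mathbb{N}$, $\mathbf{w}_1,\dots,\mathbf{w}_m\in V$, $\psi\in C_c^1(\mathbb{R}^m)$; its differential is $\mathbf{D}\Psi(\mathbf{u})=\sum_{j=1}^m\partial_j\psi(\langle\mathbf{u},\mathbf{w}_1\rangle_{V',V},\dots,\langle\mathbf{u},\mathbf{w}_m\rangle_{V',V})\,\mathbf{w}_j\in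 V$. Stationary statistical solutions: $\mathcal{P}_{\mathrm{fpsss}}(H)$ is the set of Borel probability measures $\mu$ on $H$ such that (i) $\int_H\|\nabla\mathbf{u}\|_{L^2}^2\,d\mu(\mathbf{u})<\infty$ (with $\|\nabla\mathbf{u}\|_{L^2}=+\infty$ if $\mathbf{u}\notin V$, so $\mu(H\setminus V)=0$ and integrands defined only on $V$ make sense); (ii) $\int_H\psi'(\|\mathbf{u}\|_{L^2}^2)(\nu\|\nabla\mathbf{u}\|_{L^2}^2-\langle\mathbf{f},\mathbf{u}\rangle_{V',V})\,d\mu(\mathbf{u})\le 0$ for every nonnegative, non-decreasing, continuously differentiable $\psi:[0,\infty)\to\mathbb{R}$ with bounded derivative; (iii) $\int_H\langle\mathbf{F}(\mathbf{u}),\mathbf{D}\Psi(\mathbf{u})\rangle_{V',V}\,d\mu(\mathbf{u})=0$ for all $\Psi\in\mathcal{T}^{\mathrm{cyl}}$. For a Borel set $B\subset H$, $\mathcal{P}_{\mathrm{fpsss}}(B)=\{\mu\in\mathcal{P}_{\mathrm{fpsss}}(H):\mu(H\setminus B)=0\}$. The set $\mathcal{B}_f$: let $\ell(\mathbf{u})=\nu\|\nabla\mathbf{u}\|_{L^2}^2-\langle\mathbf{f},\mathbf{u}\rangle_{V',V}$ for $\mathbf{u}\in V$. Then $\mathcal{B}_f=\mathcal{B}_{f,1}\cup\mathcal{B}_{f,2}$, where $\mathcal{B}_{f,1}=\{(1,0,\mathbf{u},\mathbf{u}):\mathbf{u}\in B\cap V,\ \ell(\mathbf{u})\le 0\}$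 and $\mathcal{B}_{f,2}$ is the set of $(\theta_1,\theta_2,\mathbf{u}_1,\mathbf{u}_2)$ with $0<\theta_1<1$, $\theta_2=1-\theta_1$, $\mathbf{u}_1,\mathbf{u}_2\in B\cap V$, $\|\mathbf{u}_1\|_{L^2}=\|\mathbf{u}_2\|_{L^2}$, $\ell(\mathbf{u}_1)<0<\ell(\mathbf{u}_2)$ and $\theta_1\ell(\mathbf{u}_1)+\theta_2\ell(\mathbf{u}_2)=0$. *)

(* Defs.v *)
From HB Require Import structures.
From mathcomp Require Import all_boot all_order all_algebra.
From mathcomp Require Import all_classical all_reals all_analysis.
From mathcomp Require Import measurable_realfun.

Set Implicit Arguments.
Unset Strict Implicit.
Unset Printing Implicit Defensive.
Import Order.TTheory GRing.Theory Num.Theory.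
Import numFieldNormedType.Exports.

Local Open Scope classical_set_scope.
Local Open Scope quotient_scope.
Local Open Scope ring_scope.

(* L^2(mu) as the quotient of the square-integrable functions by equality mu-a.e. *)
Section L2.
Context {d} {T : measurableType d} {R : realType}.
Variable mu : {measure set T -> \bar R}.

Definition L2fun := LfunType mu (lee1n 2).

Definition ae_eqb (f g : L2fun) : bool := `[< f = g %[ae mu] >].

Lemma ae_eqb_refl : reflexive ae_eqb.
Proof. by move=> f; apply/asboolP; apply: nearW. Qed.

Lemma ae_eqb_sym : symmetric ae_eqb.
Proof. by move=> f g; apply/idP/idP => /asboolP h; apply/asboolP/ae_eq_sym. Qed.

Lemma ae_eqb_trans : transitive ae_eqb.
Proof.
by move=> f g h /asboolP gf /asboolP fh; apply/asboolP/(ae_eq_trans gf fh).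
Qed.

Canonical ae_eqb_equiv := EquivRel ae_eqb ae_eqb_refl ae_eqb_sym ae_eqb_trans.

Definition L2 : Type := {eq_quot ae_eqb}.
HB.instance Definition _ := Choice.on L2.
HB.instance Definition _ := EqQuotient.on L2.

Definition L2_fun (u : L2) : T -> R := repr u : L2fun.

Lemma L2_eqP (f g : L2fun) : reflect (f = g %[ae mu]) (\pi_L2 f == \pi_L2 g).
Proof. by apply/(iffP idP); rewrite eqmodE => /asboolP. Qed.

Lemma L2_reprP (f : L2fun) : (repr (\pi_L2 f) : L2fun) = f %[ae mu].
Proof. by apply/L2_eqP; rewrite reprK. Qed.

Let zero : L2 := \pi_L2 0.
Let opp (u : L2) : L2 := \pi_L2 (- repr u).
Let add (u v : L2) : L2 := \pi_L2 (repr u + repr v).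
Let scale (a : R) (u : L2) : L2 := \pi_L2 (a *: repr u).

Let addE (f g : L2fun) : add (\pi_L2 f) (\pi_L2 g) = \pi_L2 (f + g).
Proof.
apply/eqP/L2_eqP; have := L2_reprP f; have := L2_reprP g.
by apply: filterS2 => x hg hf _; congr (_ + _); [exact: hf|exact: hg].
Qed.

Let oppE (f : L2fun) : opp (\pi_L2 f) = \pi_L2 (- f).
Proof.
apply/eqP/L2_eqP; have := L2_reprP f.
by apply: filterS => x hf _; congr (- _); exact: hf.
Qed.

Let scaleE a (f : L2fun) : scale a (\pi_L2 f) = \pi_L2 (a *: f).
Proof.
apply/eqP/L2_eqP; have := L2_reprP f.
by apply: filterS => x hf _; congr (_ * _); exact: hf.
Qed.

Let addA : associative add.
Proof.
move=> u v w; rewrite -[u]reprK -[v]reprK -[w]reprK; set f := repr u.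
set g := repr v; set h := repr w.
by rewrite (addE g h) (addE f g) (addE f (g + h)) (addE (f + g) h) addrA.
Qed.

Let addC : commutative add.
Proof. by move=> u v; rewrite /add addrC. Qed.

Let add0 : left_id zero add.
Proof. by move=> u; rewrite -[u]reprK addE add0r. Qed.

Let addN : left_inverse zero opp add.
Proof. by move=> u; rewrite -[u]reprK oppE addE addNr. Qed.

HB.instance Definition _ := GRing.isZmodule.Build L2 addA addC add0 addN.

Let scaleA a b (u : L2) : scale a (scale b u) = scale (a * b) u.
Proof. by rewrite -[u]reprK; set f := repr u; rewrite (scaleE b f) !scaleE scalerA. Qed.

Let scale1 : left_id 1 scale.
Proof. by move=> u; rewrite -[u]reprK scaleE scale1r. Qed.

Let scaleDr : right_distributive scale +%R.
Proof.
move=> a u v; rewrite -[u]reprK -[v]reprK; set f := repr u; set g := repr v.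
rewrite [LHS]/(scale a (add _ _)) [RHS]/(add _ _) (addE f g).
by rewrite [LHS](scaleE _ (f + g)) (scaleE a f) (scaleE a g) [RHS]addE scalerDr.
Qed.

Let scaleDl (u : L2) : {morph scale^~ u : a b / a + b}.
Proof.
move=> a b; rewrite -[u]reprK [RHS]/(add _ _); set f := repr u.
by rewrite [LHS](scaleE _ f) (scaleE a f) (scaleE b f) [RHS]addE scalerDl.
Qed.

HB.instance Definition _ :=
  GRing.Zmodule_isLmodule.Build R L2 scaleA scale1 scaleDr scaleDl.

Definition L2norm (u : L2) : R := fine ('N[mu]_2[EFin \o L2_fun u])%E.

Let normE (f : L2fun) : L2norm (\pi_L2 f) = fine ('N[mu]_2[EFin \o f])%E.
Proof.
congr fine; rewrite unlock; congr (_ `^ _)%E.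
have mf (g : L2fun) :
    @measurable_fun _ _ T (\bar R) setT (fun x => `|(g x)%:E| `^ 2)%E.
  have /measurable_EFinP mg : measurable_fun setT (g : T -> R) by [].
  have mag := measurableT_comp (@abse_measurable R setT) mg.
  exact: (measurableT_comp (measurable_poweR _) mag).
apply: (@ae_eq_integral _ _ _ mu _ _ _ measurableT (mf (repr (\pi_L2 f))) (mf f)).
have := L2_reprP f.
by apply: filterS => x hf _; rewrite /= (hf I).
Qed.

Let normD (u v : L2) : L2norm (u + v) <= L2norm u + L2norm v.
Proof. by rewrite normE; exact: ler_LnormD. Qed.

Let normZ (a : R) (u : L2) : L2norm (a *: u) = `|a| * L2norm u.
Proof.
rewrite normE; apply: EFin_inj; rewrite EFinM !finite_norm_fine; exact: LnormZ.
Qed.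

Let norm0 (u : L2) : L2norm u = 0 -> u = 0.
Proof. by move=> /fine_Lnormr_eq0 u0; rewrite -[u]reprK; apply/eqP/L2_eqP. Qed.

HB.instance Definition _ := Lmodule_isNormed.Build R L2 normD normZ norm0.

End L2.

(* Finite families in a normed space, with the Euclidean combination of the
   norms of the entries. *)
Definition l2fam (I : finType) (R : realType) (W : normedModType R) : Type :=
  {ffun I -> W}.

Section l2fam.
Variables (I : finType) (R : realType) (W : normedModType R).

HB.instance Definition _ := GRing.Lmodule.copy (l2fam I W) {ffun I -> W}.

Definition l2fam_fun (u : l2fam I W) : I -> W := fun_of_fin u.

Let nm (u : l2fam I W) : R := Num.sqrt (\sum_i `|l2fam_fun u i| ^+ 2).

Let sq_ge0 (a : I -> R) : 0 <= \sum_i a i ^+ 2.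
Proof. by apply: sumr_ge0 => i _; exact: sqr_ge0. Qed.

Let cauchy_schwarz (a b : I -> R) :
  \sum_i a i * b i <=
  Num.sqrt (\sum_i a i ^+ 2) * Num.sqrt (\sum_i b i ^+ 2).
Proof.
set A := \sum_i a i ^+ 2; set B := \sum_i b i ^+ 2.
have vanish (c d : I -> R) : \sum_i c i ^+ 2 = 0 -> \sum_i c i * d i = 0.
  move=> /psumr_eq0P h; apply: big1 => i _.
  have /eqP := h (fun i _ => sqr_ge0 (c i)) i isT.
  by rewrite sqrf_eq0 => /eqP ->; rewrite mul0r.
have [A0|A0] := eqVneq A 0; first by rewrite (vanish a b)// A0 sqrtr0 mul0r.
have [B0|B0] := eqVneq B 0.
  under eq_bigr do rewrite mulrC.
  by rewrite (vanish b a)// B0 sqrtr0 mulr0.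
have sA : 0 < Num.sqrt A by rewrite sqrtr_gt0 lt_neqAle eq_sym A0 sq_ge0.
have sB : 0 < Num.sqrt B by rewrite sqrtr_gt0 lt_neqAle eq_sym B0 sq_ge0.
have : 0 <= \sum_i (Num.sqrt B * a i - Num.sqrt A * b i) ^+ 2 by exact: sq_ge0.
under eq_bigr => i _ do rewrite sqrrB !exprMn !sqr_sqrtr ?sq_ge0//.
rewrite big_split/= sumrB -!mulr_sumr -/A -/B.
rewrite (eq_bigr (fun i => (Num.sqrt A * Num.sqrt B *+ 2) * (a i * b i))).
  rewrite -mulr_sumr; set S := \sum_i _ * _ => h.
  have sAB : 0 < Num.sqrt A * Num.sqrt B *+ 2 by rewrite mulrn_wgt0// mulr_gt0.
  rewrite -(ler_pM2l sAB); move: h.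
  rewrite -addrAC subr_ge0 => /le_trans; apply.
  rewrite mulrnAl mulrACA -!expr2 !sqr_sqrtr ?sq_ge0//.
  by rewrite [B * A]mulrC mulr2n.
move=> i _; rewrite mulrnAl; congr (_ *+ _).
by rewrite mulrACA [Num.sqrt B * _]mulrC.
Qed.

Let nmD (u v : l2fam I W) : nm (u + v) <= nm u + nm v.
Proof.
rewrite /nm -ler_sqr ?nnegrE ?addr_ge0 ?sqrtr_ge0//.
rewrite sqrrD !sqr_sqrtr ?sq_ge0//.
apply: (@le_trans _ _ (\sum_i (`|l2fam_fun u i| + `|l2fam_fun v i|) ^+ 2)).
  apply: ler_sum => i _; rewrite ler_sqr ?nnegrE ?addr_ge0//.
  by rewrite /l2fam_fun ffunE ler_normD.
under eq_bigr do rewrite sqrrD.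
rewrite !big_split/= lerD2r lerD2l -mulr2n lerMn2r/=.
exact: cauchy_schwarz.
Qed.

Let nmZ (a : R) (u : l2fam I W) : nm (a *: u) = `|a| * nm u.
Proof.
rewrite /nm -[`|a|]ger0_norm// -sqrtr_sqr -sqrtrM ?sqr_ge0// mulr_sumr.
by congr Num.sqrt; apply: eq_bigr => i _; rewrite /l2fam_fun ffunE normrZ exprMn.
Qed.

Let nm0 (u : l2fam I W) : nm u = 0 -> u = 0.
Proof.
move=> /eqP; rewrite sqrtr_eq0 => s0.
have /psumr_eq0P h : \sum_i `|l2fam_fun u i| ^+ 2 = 0.
  by apply/eqP; rewrite eq_le s0 sq_ge0.
apply/ffunP => i; rewrite [RHS]ffunE; apply/eqP; rewrite -normr_eq0 -sqrf_eq0.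
by rewrite (h (fun i _ => sqr_ge0 _)).
Qed.

HB.instance Definition _ := Lmodule_isNormed.Build R (l2fam I W) nmD nmZ nm0.

End l2fam.
Coercion l2fam_fun : l2fam >-> Funclass.

Notation R3 R := (measurableTypeR R * measurableTypeR R * measurableTypeR R)%type.

Definition leb3 (R : realType) : {measure set (R3 R) -> \bar R} :=
  ((@lebesgue_measure R \x @lebesgue_measure R) \x @lebesgue_measure R)%E.

Lemma open_measurable3 (R : realType) (U : set (R3 R)) :
  open U -> measurable U.
Proof.
move=> oU.
pose I (q : rat * rat) : set (measurableTypeR R) :=
  `]ratr q.1, ratr q.2[%classic.
pose Bx (q : (rat * rat) * (rat * rat) * (rat * rat)) : set (R3 R) :=
  (I q.1.1 `*` I q.1.2) `*` I q.2.
have mI q : measurable (I q) by exact: measurable_itv.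
have mB q : measurable (Bx q) by do 2 apply: measurableX => //.
have -> : U = \bigcup_(q in [set q | Bx q `<=` U]) Bx q.
  apply/seteqP; split => [x Ux|x [q /= qU xq]]; last exact: qU.
  have /nbhs_ballP[e /= e0 xeU] : nbhs x U by exact: open_nbhs_nbhs.
  have rI (y : R) : exists q : rat * rat, I q y /\
      forall z, I q z -> ball y e z.
    have [|a] := @rat_in_itvoo R (y - e) y; first by rewrite ltrBlDr ltrDl.
    have [|b] := @rat_in_itvoo R y (y + e); first by rewrite ltrDl.
    rewrite !in_itv/= => /andP[yb be] /andP[ae ay]; exists (a, b).
    split => [|z]; rewrite /I/= in_itv/= ?ay// => /andP[az zb].
    rewrite /ball/= ltr_distlC (lt_trans ae az)/=; exact: lt_trans zb be.
  have [q1 [xq1 Iq1]] := rI x.1.1.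
  have [q2 [xq2 Iq2]] := rI x.1.2.
  have [q3 [xq3 Iq3]] := rI x.2.
  exists (q1, q2, q3); last by split => //; split.
  move=> [[z1 z2] z3] [[/= z1q z2q] z3q]; apply: xeU.
  by split; [split|]; [exact: Iq1|exact: Iq2|exact: Iq3].
rewrite bigcup_mkcond; apply: countable_bigcupT_measurable => // q.
by case: ifPn.
Qed.

Record bounded_domain (R : realType) := BoundedDomain {
  dom : set (R3 R) ;
  dom_nonempty : dom !=set0 ;
  dom_open : open dom ;
  dom_connected : connected dom ;
  dom_bounded : bounded_set dom }.

Definition e3 (R : realType) (j : 'I_3) : R3 R :=
  ((j == 0)%:R, (j == 1)%:R, (j == 2)%:R).

Definition minimum d (T : porderType d) (S : set T) (m : T) : Prop :=
  S m /\ lbound S m.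

Definition C1c (R : realType) (m : nat) (psi : 'rV[R]_m -> R) : Prop :=
  [/\ continuous psi,
      forall j, (forall x, derivable psi x (delta_mx 0 j)) /\
        continuous ('D_(delta_mx 0 j) psi) &
      compact (closure [set x | psi x != 0])].

(* psi is continuously differentiable on [0, +oo[, with derivative dpsi; the
   derivative at 0 is one-sided. *)
Definition C1_halfline (R : realType) (psi dpsi : R -> R) : Prop :=
  (forall x, 0 <= x -> (psi y - psi x) / (y - x)
     @[y --> within `[0, +oo[%classic x^'] --> dpsi x) /\
  {within `[0, +oo[%classic, continuous dpsi}.

Section function_spaces.
Context {R : realType}.
Variable Omega : bounded_domain R.

Definition leb_dom : {measure set (R3 R) -> \bar R} :=
  mrestr (leb3 R) (open_measurable3 (@dom_open R Omega)).

(* Functions are defined on R^3, but L2s identifies those which agree a.e. on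
   Omega, so that L2s is L^2(Omega) and L2v is L^2(Omega)^3. *)
Local Notation L2s := (L2 leb_dom).
Local Notation L2v := (l2fam 'I_3 L2s).

Fixpoint Ck (k : nat) (g : R3 R -> R) : Prop :=
  continuous g /\
  if k is k'.+1 then
    forall j, (forall x, derivable g x (e3 R j)) /\ Ck k' ('D_(e3 R j) g)
  else True.

Definition smooth (g : R3 R -> R) : Prop := forall k, Ck k g.

Definition Ccinfty (g : R3 R -> R) : Prop :=
  [/\ smooth g, compact (closure [set x | g x != 0]) &
      closure [set x | g x != 0] `<=` dom Omega].

Definition L2inner (I : finType) (u v : l2fam I L2s) : R :=
  \sum_i \int[leb_dom]_x (L2_fun (u i) x * L2_fun (v i) x).

Definition solenoidal_tests : set L2v :=
  [set u : L2v | exists phi : 'I_3 -> R3 R -> R,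
  [/\ forall i, Ccinfty (phi i),
      forall x, \sum_i 'D_(e3 R i) (phi i) x = 0 &
      forall i, L2_fun (u i) = phi i %[ae leb_dom] ] ].

(* is_weak_partial j u g : g is the derivative of u in direction j in the sense
   of distributions on Omega. *)
Definition is_weak_partial (j : 'I_3) (u g : L2s) : Prop :=
  forall eta, Ccinfty eta ->
    \int[leb_dom]_x (L2_fun u x * 'D_(e3 R j) eta x) =
    - \int[leb_dom]_x (L2_fun g x * eta x).

(* Weak derivatives are unique when they exist; the value is 0 when the
   distributional derivative is not in L^2. *)
Definition weak_partial (j : 'I_3) (u : L2s) : L2s :=
  xget 0 [set g | is_weak_partial j u g].

Definition H1_space : set L2s :=
  [set u : L2s | forall j, exists g, is_weak_partial j u g].

Definition H1_norm (u : L2s) : R :=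
  Num.sqrt (`|u| ^+ 2 + \sum_j `|weak_partial j u| ^+ 2).

(* Closure of C_c^oo(Omega) in H^1(Omega). *)
Definition H10_space : set L2s :=
  [set u : L2s | H1_space u /\ forall e : R, 0 < e ->
  exists v : L2s, (exists2 eta, Ccinfty eta & L2_fun v = eta %[ae leb_dom]) /\
    H1_norm (u - v) < e].

(* The entry (i, j) is the j-th partial derivative of the i-th component. *)
Definition grad (u : L2v) : l2fam ('I_3 * 'I_3)%type L2s :=
  [ffun ij => weak_partial ij.2 (u ij.1)].

(* The norm of H_0^1(Omega)^3 is the L^2 norm of the gradient. *)
Definition Vspace : set L2v := [set u : L2v | (forall i, H10_space (u i)) /\
  forall e : R, 0 < e -> exists2 v, solenoidal_tests v & `|grad (u - v)| < e].

Definition Hspace : Type := closure solenoidal_tests.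

HB.instance Definition _ := Topological.copy Hspace (closure solenoidal_tests).

Let zero_in_H : (0 : L2v) \in closure solenoidal_tests.
Proof.
have Dc j : 'D_(e3 R j) (fun=> 0 : R) = (fun=> 0).
  by apply/funext => x; exact: derive_cst.
have sm : smooth (fun=> 0 : R).
  have c0 : continuous ((fun=> 0) : R3 R -> R) by exact: cst_continuous.
  by elim=> [|k IH]; split => // j; rewrite Dc.
have s0 : closure [set x : R3 R | (0 : R) != 0] = set0.
  by rewrite -closure0; congr closure; apply/seteqP; split => x //=; rewrite eqxx.
apply/mem_set/subset_closure; exists (fun _ _ => 0); split => [i|x|i].
- by split; rewrite ?s0//; exact: compact0.
- by rewrite big1// => i _; exact: (congr1 (@^~ x) (Dc i)).
- rewrite /l2fam_fun ffunE; exact: L2_reprP.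
Qed.

HB.instance Definition _ := isPointed.Build Hspace
  (@exist _ (fun u : L2v => u \in closure solenoidal_tests) 0 zero_in_H).

Definition H_val (u : Hspace) : L2v := set_val u.
Local Coercion H_val : Hspace >-> l2fam.

(* The topology generated by the functionals (_, w), w in H; these are all the
   continuous ones by the identification of H with its dual. *)
Definition weakH : topologicalType := initial_topology
  (fun u : Hspace => (fun w : Hspace => L2inner u w) : prod_topology (fun=> R)).

Definition borelH : measurableType _ := g_sigma_algebraType (@open Hspace).

(* Elements of V' are represented by functionals on L^2, of which only the values
   on V are relevant. *)
Definition Vdual (l : L2v -> R) : Prop :=
  (forall (a : R) u v, Vspace u -> Vspace v -> l (a *: u + v) = a * l u + l v) /\
  exists C : R, forall u, Vspace u -> `|l u| <= C * `|grad u|.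

(* The inclusion of H in V'. *)
Definition H_to_Vdual (u : Hspace) : L2v -> R := L2inner u.

Definition VinH : set Hspace := [set u : Hspace | Vspace u].

(* Sequential continuity on A, a subset of V, for the weak topology of V. *)
Definition weakV_seq_continuous (A : set Hspace) (phi : Hspace -> R) : Prop :=
  forall (u_ : nat -> Hspace) (u : Hspace), (forall n, A (u_ n)) -> A u ->
    (forall l, Vdual l -> l (u_ n) @[n --> \oo] --> l u) ->
    phi (u_ n) @[n --> \oo] --> phi u.

(* The integral of (u . grad) v . w. *)
Definition convection (u v w : L2v) : R :=
  \int[leb_dom]_x \sum_i
    (\sum_j L2_fun (u j) x * L2_fun (grad v (i, j)) x) * L2_fun (w i) x.

Definition NSop (nu : R) (f : L2v -> R) (u : L2v) : L2v -> R := fun w =>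
  f w - nu * L2inner (grad u) (grad w) - convection u u w.

Definition ell (nu : R) (f : L2v -> R) (u : L2v) : R :=
  nu * `|grad u| ^+ 2 - f u.

(* A cylindrical functional Psi on V' is given with a representation; the
   differential D Psi computed from it does not depend on this choice. *)
Record Tcyl := Cylindrical {
  cyl_dim : nat ;
  cyl_psi : 'rV[R]_cyl_dim -> R ;
  cyl_psi_C1c : C1c cyl_psi ;
  cyl_w : 'I_cyl_dim -> L2v ;
  cyl_w_V : forall j, Vspace (cyl_w j) }.

Arguments cyl_psi : clear implicits.
Arguments cyl_w : clear implicits.

Definition cyl_proj (Psi : Tcyl) (l : L2v -> R) : 'rV[R]_(cyl_dim Psi) :=
  \row_j l (cyl_w Psi j).

Definition cyl_fun (Psi : Tcyl) (l : L2v -> R) : R :=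
  cyl_psi Psi (cyl_proj Psi l).

Definition cyl_diff (Psi : Tcyl) (l : L2v -> R) : L2v :=
  \sum_j 'D_(delta_mx 0 j) (cyl_psi Psi) (cyl_proj Psi l) *: cyl_w Psi j.

Definition enstrophy (u : L2v) : \bar R :=
  if `[< Vspace u >] then (`|grad u| ^+ 2)%:E else +oo%E.

(* The integrals of functions which are meaningful on V only are taken over V;
   the first condition implies that mu (H \ V) = 0. *)
Definition Pfpsss (nu : R) (f : L2v -> R) : set (probability borelH R) :=
  [set mu : probability borelH R |
    [/\ (\int[mu]_(u in [set: Hspace]) enstrophy (H_val u) < +oo)%E,
        forall psi dpsi : R -> R, C1_halfline psi dpsi ->
          (forall x, 0 <= x -> 0 <= psi x) ->
          (forall x y, 0 <= x -> x <= y -> psi x <= psi y) ->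
          (exists M, forall x, 0 <= x -> `|dpsi x| <= M) ->
          (\int[mu]_(u in VinH)
             (dpsi (`|H_val u| ^+ 2) * ell nu f (H_val u))%:E <= 0)%E &
        forall Psi : Tcyl,
          (\int[mu]_(u in VinH)
             (NSop nu f (H_val u) (cyl_diff Psi (H_to_Vdual u)))%:E = 0)%E ] ].

Definition Pfpsss_on (nu : R) (f : L2v -> R) (B : set Hspace) :
    set (probability borelH R) :=
  [set mu | Pfpsss nu f mu /\ mu (~` B) = 0%E].

Definition Bf1 (nu : R) (f : L2v -> R) (B : set Hspace) :
    set (R * R * Hspace * Hspace) :=
  [set b | exists u : Hspace,
    [/\ B u, Vspace u, ell nu f u <= 0 & b = (1, 0, u, u)] ].

Definition Bf2 (nu : R) (f : L2v -> R) (B : set Hspace) :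
    set (R * R * Hspace * Hspace) :=
  [set b | let: (t1, t2, u1, u2) := b in
    [/\ 0 < t1 < 1, t2 = 1 - t1, [/\ B u1, Vspace u1, B u2 & Vspace u2],
        `|H_val u1| = `|H_val u2| &
        ell nu f u1 < 0 < ell nu f u2 /\
        t1 * ell nu f u1 + t2 * ell nu f u2 = 0] ].

Definition Bf (nu : R) (f : L2v -> R) (B : set Hspace) :
    set (R * R * Hspace * Hspace) :=
  Bf1 nu f B `|` Bf2 nu f B.

Definition dual_objective (nu : R) (f : L2v -> R) (phi : Hspace -> R) (Psi : Tcyl)
    (b : R * R * Hspace * Hspace) : R :=
  let: (t1, t2, u1, u2) := b in
  let g (u : Hspace) := phi u + NSop nu f u (cyl_diff Psi (H_to_Vdual u)) in
  t1 * g u1 + t2 * g u2.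

End function_spaces.

Notation L2vec Omega := (l2fam 'I_3 (L2 (leb_dom Omega))).
Arguments VinH {R} Omega.

(* Main.v *)
Require Import Defs.
From HB Require Import structures.
From mathcomp Require Import all_boot all_order all_algebra.
From mathcomp Require Import all_classical all_reals all_analysis.
From mathcomp Require Import measurable_realfun.
From mathcomp Require Import zify ring lra.
Set Implicit Arguments.
Unset Strict Implicit.
Unset Printing Implicit Defensive.
Import Order.TTheory GRing.Theory Num.Theory.
Import numFieldNormedType.Exports.
Local Open Scope classical_set_scope.
Local Open Scope ring_scope.

(* Let N be the dissipation, e = |u|^2 and l = N - f. The proof has two halves.

   Weak duality. If phi + g_Psi has minimum q over B_f, then on each sphere e = r
   some multiplier h(r) >= 0 makes phi + g_Psi + h(r) l >= q. Up to a small error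
   h can be chosen continuous, because the sublevel sets of the coercive
   functions (h + kappa) N + ... are compact in H; then psi' = h in the energy
   inequality gives int phi dmu >= q.

   Strong duality. Let lam be the supremum of the right-hand side. Hahn-Banach
   yields a positive linear functional E on the functions of quadratic growth
   which is dominated by sup over B_f, vanishes on all g_Psi and satisfies
   E(phi) <= lam. The finitely additive set function E(1_A) is tight on compact
   sets and so defines a Borel probability mu with int h dmu <= E(h) for every
   h >= 0 with closed sublevel sets. Applied to kappa N + G + C with G
   subquadratic and kappa -> 0, this gives int G dmu = E(G), while for k >= 0 it
   gives int k(e) l dmu <= E(k(e) l) <= 0: hence mu is a stationary statistical
   solution with int phi dmu <= lam.

   The analytic input is the compactness of the balls of V in H (Friedrichs'
   inequality on small cubes) and the bound of the trilinear form through
   Ladyzhenskaya's inequality in L^4, which makes g_Psi subquadratic. *)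

(** * The Hilbert space L^2 *)

(** The energy inequality for all psi says that, conditionally on the sphere |u| = r, the mean of l
    is at most 0. Probabilities on a sphere under one such linear constraint have extreme points
    with at most two atoms: this is where the two-point form of B_f comes from.

    The obstacle is the dissipation N. Its growth is exactly quadratic and it is only lower
    semicontinuous in H: in a limit N may drop, and a vanishing weight may carry a positive amount
    of N to infinity. Subquadratic functions see neither effect. So every statement about N is an
    inequality of the right sign: the constraint of B_f is relaxed before minimising, E(N) may
    exceed int N, and the energy condition survives because psi' is nonnegative.

    The domain of E contains indicators and N itself, and no continuity is available there; mu is
    therefore rebuilt from the values of E on indicators and compared with E afterwards.

    The duality is proved on an abstract Hausdorff space with a function N whose sublevel sets are
    compact. The equations enter through the continuity and growth of f and of the functions
    g_Psi. *)

Section L2_inner.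
Context {d} {T : measurableType d} {R : realType}.
Variable mu : {measure set T -> \bar R}.
Local Notation L2 := (L2 mu).

Lemma L2_fun_Lfun (u : L2) : L2_fun u \in Lfun mu 2%:E.
Proof. exact: LfunP. Qed.

Lemma L2_fun_measurable (u : L2) : measurable_fun setT (L2_fun u).
Proof. by have := L2_fun_Lfun u; rewrite inE => /andP[]; rewrite inE. Qed.

Lemma Lfun2_mul_integrable (f g : T -> R) :
  f \in Lfun mu 2%:E -> g \in Lfun mu 2%:E ->
  mu.-integrable setT (EFin \o (fun x => f x * g x)).
Proof. by move=> f2 g2; apply/Lfun1_integrable; exact: Lfun2_mul_Lfun1. Qed.

Lemma L2_mul_integrable (u v : L2) :
  mu.-integrable setT (EFin \o (fun x => L2_fun u x * L2_fun v x)).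
Proof. by apply: Lfun2_mul_integrable; exact: L2_fun_Lfun. Qed.

Lemma measurable_sqr_Lfun2 (f : T -> R) : measurable_fun setT f ->
  (\int[mu]_x (f x ^+ 2)%:E < +oo)%E -> f \in Lfun mu 2%:E.
Proof.
move=> mf fi; rewrite inE; apply/andP; split; first by rewrite inE.
rewrite inE /finite_norm unlock /Lnorm; apply: poweR_lty.
apply: le_lt_trans fi; rewrite le_eqVlt; apply/orP; left; apply/eqP.
by apply: eq_integral => x _ /=; rewrite powR_mulrn// real_normK// num_real.
Qed.

Lemma ae_eq_Rintegral (f g : T -> R) : measurable_fun setT f ->
  measurable_fun setT g -> f = g %[ae mu] ->
  \int[mu]_x f x = \int[mu]_x g x.
Proof.
move=> mf mg fg; congr fine; apply: ae_eq_integral => //.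
- exact/measurable_EFinP.
- exact/measurable_EFinP.
- by move: fg; apply: filterS => x h _ /=; rewrite h.
Qed.

Definition L2ip (u v : L2) : R := \int[mu]_x (L2_fun u x * L2_fun v x).

Lemma L2_funD (u v : L2) : L2_fun (u + v) = L2_fun u \+ L2_fun v %[ae mu].
Proof. exact: L2_reprP. Qed.

Lemma L2_funZ a (u : L2) : L2_fun (a *: u) = a \*o L2_fun u %[ae mu].
Proof. exact: L2_reprP. Qed.

Lemma L2_funN (u : L2) : L2_fun (- u) = \- L2_fun u %[ae mu].
Proof. exact: L2_reprP. Qed.

Lemma L2_fun0 : L2_fun (0 : L2) = cst 0 %[ae mu].
Proof. exact: L2_reprP. Qed.

Lemma L2_funP (u v : L2) : L2_fun u = L2_fun v %[ae mu] -> u = v.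
Proof. by move=> h; rewrite -[u]reprK -[v]reprK; apply/eqP/L2_eqP. Qed.

Lemma Lfun2_L2 (f : T -> R) : f \in Lfun mu 2%:E ->
  exists u : L2, L2_fun u = f %[ae mu].
Proof.
move=> f2; exists (\pi_L2 (Lfun_Sub (lee1n 2) f2))%qT.
exact: (L2_reprP (Lfun_Sub (lee1n 2) f2)).
Qed.

Lemma L2ip_fun (u v : L2) (f g : T -> R) : measurable_fun setT f ->
  measurable_fun setT g -> L2_fun u = f %[ae mu] -> L2_fun v = g %[ae mu] ->
  L2ip u v = \int[mu]_x (f x * g x).
Proof.
move=> mf mg uf vg; apply: ae_eq_Rintegral.
- by apply: measurable_funM; exact: L2_fun_measurable.
- exact: measurable_funM.
- by apply: filterS2 uf vg => x h1 h2 _; rewrite h1// h2.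
Qed.

Lemma L2ipC (u v : L2) : L2ip u v = L2ip v u.
Proof. by apply: eq_Rintegral => x _; rewrite mulrC. Qed.

Lemma L2ipDl (u v w : L2) : L2ip (u + v) w = L2ip u w + L2ip v w.
Proof.
have mF := L2_fun_measurable.
rewrite (@L2ip_fun (u + v) w (fun x => L2_fun u x + L2_fun v x) (L2_fun w))//.
- rewrite -RintegralD//; [|exact: L2_mul_integrable|exact: L2_mul_integrable].
  by apply: eq_Rintegral => x _; rewrite mulrDl.
- exact: measurable_funD.
- exact: L2_funD.
- exact: nearW.
Qed.

Lemma L2ipZl a (u w : L2) : L2ip (a *: u) w = a * L2ip u w.
Proof.
have mF := L2_fun_measurable.
rewrite (@L2ip_fun (a *: u) w (fun x => a * L2_fun u x) (L2_fun w))//.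
- rewrite -RintegralZl//; last exact: L2_mul_integrable.
  by apply: eq_Rintegral => x _; rewrite mulrA.
- exact: measurable_funM.
- exact: L2_funZ.
- exact: nearW.
Qed.

Lemma L2ip_norm (u : L2) : L2ip u u = `|u| ^+ 2.
Proof.
have -> : `|u| = fine ('N[mu]_2[EFin \o L2_fun u])%E by [].
rewrite -powR_mulrn ?fine_ge0 ?Lnorm_ge0// -fine_poweR powR_Lnorm//.
by congr fine; apply: eq_integral => x _ /=; rewrite powR_mulrn// real_normK// num_real.
Qed.

End L2_inner.

(** The increments are at most [Num.sqrt S * 2^-n], so their series converges absolutely. It serves
    pointwise in the proof of completeness, where [S] is the value at one point of a series of
    functions. *)
Lemma quad_geometric_cvg (R : realType) (a : nat -> R) (S : R) :
  (forall n, 4 ^+ n * (a n.+1 - a n) ^+ 2 <= S) -> cvgn a.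
Proof.
move=> aS.
have S0 : 0 <= S by apply: le_trans (aS 0%N); rewrite mulr_ge0 ?sqr_ge0 ?exprn_ge0//.
have h n : `|telescope a n| <= geometric (Num.sqrt S) 2^-1 n.
  rewrite /telescope /geometric /= -sqrtr_sqr -[2^-1 ^+ n]ger0_norm ?exprn_ge0//.
  rewrite -sqrtr_sqr -sqrtrM// ler_wsqrtr// -exprM mulnC exprM.
  have -> : (2^-1 : R) ^+ 2 = 4^-1 by rewrite exprVn; congr (_^-1); ring.
  rewrite exprVn ler_pdivlMr ?exprn_gt0// mulrC; exact: aS.
have c : cvgn (series (telescope a)).
  apply: normed_cvg; apply: (series_le_cvg _ _ h) => //.
  - by move=> n; rewrite /geometric /= mulr_ge0 ?sqrtr_ge0 ?exprn_ge0.
  - by apply: is_cvg_geometric_series; rewrite ger0_norm//; lra.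
rewrite (_ : a = (fun n => a 0 + series (telescope a) n)).
  by apply: is_cvgD => //; exact: is_cvg_cst.
by apply/funext => n; rewrite -eq_sum_telescope.
Qed.

(** * Completeness of L^2 and of finite families in L^2 *)

Section L2_complete.
Context {d} {T : measurableType d} {R : realType}.
Variable mu : {measure set T -> \bar R}.
Local Notation L2 := (L2 mu).

Lemma L2_funB (u v : L2) : L2_fun (u - v) = L2_fun u \- L2_fun v %[ae mu].
Proof.
apply: filterS2 (L2_funD u (- v)) (L2_funN v) => x h1 h2 _.
by rewrite h1//= h2.
Qed.

Lemma L2_norm_integral (u : L2) :
  (\int[mu]_x ((L2_fun u x) ^+ 2)%:E = (`|u| ^+ 2)%:E)%E.
Proof.
rewrite -L2ip_norm /L2ip /Rintegral fineK//.
by apply: integrable_fin_num => //; exact: L2_mul_integrable.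
Qed.

Lemma L2_norm_le (u : L2) (f : T -> R) (C : R) : 0 <= C ->
  L2_fun u = f %[ae mu] -> measurable_fun setT f ->
  (\int[mu]_x (f x ^+ 2)%:E <= (C ^+ 2)%:E)%E -> `|u| <= C.
Proof.
move=> C0 uf mf; rewrite -(ler_pXn2r (n:=2)) ?nnegrE// -lee_fin; apply: le_trans.
rewrite -L2_norm_integral le_eqVlt; apply/orP; left; apply/eqP.
apply: ae_eq_integral => //.
- by apply/measurable_EFinP/measurable_funX; exact: L2_fun_measurable.
- by apply/measurable_EFinP/measurable_funX.
- by apply: filterS uf => x h _; rewrite h.
Qed.

(** Riesz-Fischer. The squared increments are at most [16^-n] and beat the weights [4^n], so the
    weighted series of squares has a finite integral and is finite almost everywhere. There the
    sequence converges pointwise, and Fatou's lemma shows that the pointwise limit is the limit in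
    norm. *)
Lemma L2_fast_cauchy_cvg (u_ : nat -> L2) :
  (forall n, `|u_ n.+1 - u_ n| <= 4^-1 ^+ n) -> exists u : L2, u_ n @[n --> \oo] --> u.
Proof.
move=> hu.
pose D n x := (4 ^+ n * L2_fun (u_ n.+1 - u_ n) x ^+ 2)%:E.
have mD n : measurable_fun setT (D n).
  by apply/measurable_EFinP/measurable_funM => //; apply/measurable_funX; exact: L2_fun_measurable.
have D0 n x : (0 <= D n x)%E by rewrite lee_fin mulr_ge0 ?sqr_ge0 ?exprn_ge0//.
have iD : (\int[mu]_x (\sum_(n <oo) D n x) < +oo)%E.
  rewrite integral_nneseries//.
  apply: (@le_lt_trans _ _ (\sum_(n <oo) (4^-1 ^+ n)%:E)%E).
    apply: lee_nneseries => n _; first by move=> _; apply: integral_ge0.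
    rewrite /D; under eq_integral do rewrite EFinM.
    rewrite ge0_integralZl//; last 2 first.
    - by apply/measurable_EFinP/measurable_funX; exact: L2_fun_measurable.
    - by move=> x _; rewrite lee_fin sqr_ge0.
    rewrite L2_norm_integral -EFinM lee_fin.
    have : `|u_ n.+1 - u_ n| ^+ 2 <= (4^-1 ^+ n) ^+ 2 by rewrite ler_pXn2r ?nnegrE ?exprn_ge0.
    move=> /(ler_wpM2l (exprn_ge0 n (ler0n R 4))) /le_trans; apply.
    by rewrite expr2 mulrA -exprMn mulfV ?expr1n ?mul1r ?pnatr_eq0.
  have c : series (geometric 1 (4^-1 : R)) @ \oo --> 1 * (1 - 4^-1 : R)^-1.
    by apply: cvg_geometric_series; rewrite ger0_norm//; lra.
  rewrite (_ : (\sum_(n <oo) _)%E = (1 * (1 - 4^-1 : R)^-1)%:E) ?ltry//.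
  apply/cvg_lim => //; apply: cvg_EFin; first by apply: nearW => n; rewrite sumEFin.
  rewrite (_ : _ \o _ = series (geometric 1 (4^-1 : R)))//.
  by apply/funext => n /=; rewrite sumEFin/=; rewrite /series /geometric/=;
    apply: eq_bigr => i _; rewrite mul1r.
have mS : measurable_fun setT (fun x => \sum_(n <oo) D n x)%E.
  by apply: ge0_emeasurable_sum => // n x _ _; exact: D0.
have aeS : {ae mu, forall x, (\sum_(n <oo) D n x)%E \is a fin_num}.
  have := @integrable_ae _ _ _ mu setT measurableT (fun x => \sum_(n <oo) D n x)%E.
  move=> h; have /h : mu.-integrable setT (fun x => \sum_(n <oo) D n x)%E.
    apply/integrableP; split => //.
    under eq_integral => x _ do rewrite gee0_abs ?nneseries_ge0//.
    by [].
  by apply: filterS => x; apply.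
have aeD : {ae mu, forall x, forall n,
    L2_fun (u_ n.+1 - u_ n) x = L2_fun (u_ n.+1) x - L2_fun (u_ n) x}.
  apply/ae_foralln => n; apply: filterS (L2_funB (u_ n.+1) (u_ n)).
  by move=> x ->.
(* The upper limit is measurable without any exceptional set, and it is the limit wherever the
   sequence converges. *)
pose f x := fine (limn_esup (fun n => (L2_fun (u_ n) x)%:E)).
have mf : measurable_fun setT f.
  apply: measurableT_comp => //; apply: measurable_fun_limn_esup => n.
  by apply/measurable_EFinP; exact: L2_fun_measurable.
have aef : {ae mu, forall x, L2_fun (u_ n) x @[n --> \oo] --> f x}.
  apply: filterS2 aeS aeD => x xS xD.
  have /cvg_ex[l hl] : cvgn (fun n => L2_fun (u_ n) x).
    apply: (@quad_geometric_cvg _ _ (fine (\sum_(n <oo) D n x)%E)) => n.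
    rewrite -lee_fin fineK// -xD.
    apply: le_trans (nneseries_lim_ge n.+1 (fun k _ _ => D0 k x)).
    rewrite big_nat_recr//= -[leLHS]add0e leeD2r//; exact: sume_ge0.
  suff -> : f x = l by [].
  rewrite /f (_ : limn_esup _ = l%:E)//.
  by apply: (cvg_limn_einf_sup _).2; apply: cvg_EFin; [exact: nearW|exact: hl].
have key n : (\int[mu]_x ((f x - L2_fun (u_ n) x) ^+ 2)%:E <= ((2 * 4^-1 ^+ n) ^+ 2)%:E)%E.
  have near_u m : `|u_ (n + m)%N - u_ n| <= 2 * 4^-1 ^+ n.
    suff : `|u_ (n + m)%N - u_ n| <= (2 - 2 * 4^-1 ^+ m) * 4^-1 ^+ n.
      by move=> /le_trans; apply; rewrite ler_wpM2r ?exprn_ge0// gerBl mulr_ge0 ?exprn_ge0.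
    elim: m => [|m IH].
      by rewrite addn0 subrr normr0 expr0 mulr1 subrr mul0r.
    have -> : u_ (n + m.+1)%N - u_ n = (u_ (n + m).+1 - u_ (n + m)%N) + (u_ (n + m)%N - u_ n).
      by rewrite addnS addrA subrK.
    apply: le_trans (ler_normD _ _) _; apply: le_trans (lerD (hu _) IH) _.
    rewrite exprD [_ ^+ n * _]mulrC -mulrDl ler_wpM2r ?exprn_ge0// exprS.
    have : 0 <= (4^-1 : R) ^+ m by rewrite exprn_ge0.
    lra.
  have -> : (\int[mu]_x ((f x - L2_fun (u_ n) x) ^+ 2)%:E =
    \int[mu]_x limn_einf (fun m => ((L2_fun (u_ (n + m)%N) x - L2_fun (u_ n) x) ^+ 2)%:E))%E.
    apply: ae_eq_integral => //.
    - apply/measurable_EFinP/measurable_funX/measurable_funB => //; exact: L2_fun_measurable.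
    - rewrite /limn_einf; apply: measurableT_comp => //; apply: measurable_fun_limn_esup => m.
      apply: measurableT_comp => //.
      by apply/measurable_EFinP/measurable_funX/measurable_funB; exact: L2_fun_measurable.
    - apply: filterS aef => x xf _; symmetry; apply: (cvg_limn_einf_sup _).1.
      apply: cvg_EFin; first exact: nearW.
      have -> : fine \o (fun m => ((L2_fun (u_ (n + m)%N) x - L2_fun (u_ n) x) ^+ 2)%:E) =
        (fun m => (L2_fun (u_ (n + m)%N) x - L2_fun (u_ n) x) * (L2_fun (u_ (n + m)%N) x - L2_fun (u_ n) x)).
        by apply/funext => m /=; rewrite expr2.
      have c : L2_fun (u_ (n + m)%N) x - L2_fun (u_ n) x @[m --> \oo] --> f x - L2_fun (u_ n) x.
        apply: cvgB; last exact: cvg_cst.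
        rewrite (_ : (fun m => L2_fun (u_ (n + m)%N) x) = [sequence L2_fun (u_ (m + n)%N) x]_m).
          by rewrite (cvg_shiftn n (fun m => L2_fun (u_ m) x)).
        by apply/funext => m; rewrite addnC.
      by rewrite expr2; exact: cvgM.
  apply: le_trans (fatou _ _ _ _) _ => //.
  - by move=> m; apply/measurable_EFinP/measurable_funX/measurable_funB; exact: L2_fun_measurable.
  - by move=> m x _; rewrite lee_fin sqr_ge0.
  rewrite limn_einf_lim; apply: lime_le; first exact: is_cvg_einfs.
  apply: nearW => k; apply: ereal_inf_le.
  exists (\int[mu]_x ((L2_fun (u_ (n + k)%N) x - L2_fun (u_ n) x) ^+ 2)%:E)%E; first by exists k => /=.
  rewrite (_ : (\int[mu]_x _)%E = (`|u_ (n + k)%N - u_ n| ^+ 2)%:E).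
    by rewrite lee_fin ler_pXn2r ?nnegrE// mulr_ge0 ?exprn_ge0.
  rewrite -L2_norm_integral; apply: ae_eq_integral => //.
  - by apply/measurable_EFinP/measurable_funX/measurable_funB; exact: L2_fun_measurable.
  - by apply/measurable_EFinP/measurable_funX; exact: L2_fun_measurable.
  - apply: filterS (L2_funB (u_ (n + k)%N) (u_ n)) => x h _.
    by rewrite h.
(* [f] is not yet known to be square integrable, but [f - u_ 0] is, by [key] at [n = 0]. *)
have [v vE] : exists v : L2, L2_fun v = (fun x => f x - L2_fun (u_ 0%N) x) %[ae mu].
  apply: Lfun2_L2; apply: measurable_sqr_Lfun2; last by apply: le_lt_trans (key 0) _; exact: ltry.
  by apply: measurable_funB => //; exact: L2_fun_measurable.
exists (v + u_ 0%N).
have uE : L2_fun (v + u_ 0%N) = f %[ae mu].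
  apply: filterS2 (L2_funD v (u_ 0%N)) vE => x -> //= h _.
  by rewrite h// subrK.
have est n : `|v + u_ 0%N - u_ n| <= 2 * 4^-1 ^+ n.
  apply: (L2_norm_le _ _ _ (key n)).
  - by rewrite mulr_ge0 ?exprn_ge0.
  - apply: filterS2 (L2_funB (v + u_ 0%N) (u_ n)) uE => x h1 h2 _.
    by rewrite h1//= h2.
  - apply: measurable_funB => //; exact: L2_fun_measurable.
apply/cvgrPdist_le => e e0.
have c : (2 : R) * 4^-1 ^+ n @[n --> \oo] --> (0 : R).
  rewrite -(mulr0 (2 : R)); apply: cvgM; first exact: cvg_cst.
  apply: cvg_expr; by rewrite ger0_norm//; lra.
move/cvgrPdist_le : c => /(_ e e0); apply: filterS => n.
rewrite sub0r normrN ger0_norm ?mulr_ge0 ?exprn_ge0// => h.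
exact: le_trans (est n) h.
Qed.

End L2_complete.

Section fast_cauchy.
Context {R : realType} {V : normedModType R}.

Lemma fast_cauchy_complete (u_ : nat -> V) :
  (forall v_ : nat -> V, (forall n, `|v_ n.+1 - v_ n| <= 4^-1 ^+ n) ->
    exists v : V, v_ n @[n --> \oo] --> v) ->
  (forall e, 0 < e -> exists N, forall m n, (N <= m)%N -> (N <= n)%N ->
    `|u_ m - u_ n| <= e) ->
  exists u : V, u_ n @[n --> \oo] --> u.
Proof.
move=> fast cau.
have p0 k : 0 < (4^-1 : R) ^+ k by rewrite exprn_gt0.
have [N hN] := choice (fun k => cau _ (p0 k)).
(* The partial sums are nondecreasing and dominate each [N k], so the terms of index [M k] have
   increments at most [4^-k]. *)
pose M k := (\sum_(i < k.+1) N i)%N.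
have NM k : (N k <= M k)%N by rewrite /M big_ord_recr/= leq_addl.
have MM k : (M k <= M k.+1)%N by rewrite /M [leqRHS]big_ord_recr/= leq_addr.
have [n|v hv] := fast (fun k => u_ (M k)).
  by apply: (hN n); [exact: leq_trans (NM n) (MM n)|exact: NM].
exists v; apply/cvgrPdist_le => e e0.
have [K hK] := cau _ (divr_gt0 e0 (ltr0Sn R 1)).
have MK k : (k <= K)%N -> True by [].
move/cvgrPdist_le : hv => /(_ _ (divr_gt0 e0 (ltr0Sn R 1))) hv.
have c : \forall k \near \oo, (4^-1 : R) ^+ k <= e / 2.
  have : (4^-1 : R) ^+ n @[n --> \oo] --> (0 : R).
    by apply: cvg_expr; rewrite ger0_norm//; lra.
  move/cvgrPdist_le => /(_ _ (divr_gt0 e0 (ltr0Sn R 1))); apply: filterS => n.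
  by rewrite sub0r normrN ger0_norm// exprn_ge0.
near \oo => k.
exists (N k) => // n /= kn.
have -> : v - u_ n = (v - u_ (M k)) + (u_ (M k) - u_ n) by rewrite addrA subrK.
apply: le_trans (ler_normD _ _) _; rewrite [leRHS]splitr lerD//.
  by near: k.
apply: (@le_trans _ _ (4^-1 ^+ k)); first exact: hN (NM k) kn.
by near: k.
Unshelve. all: end_near. Qed.

End fast_cauchy.

Section L2_cauchy.
Context {d} {T : measurableType d} {R : realType}.
Variables (mu : {measure set T -> \bar R}) (I : finType).
Local Notation L2 := (L2 mu).

Lemma l2fam_norm (W : normedModType R) (u : l2fam I W) : `|u| = Num.sqrt (\sum_i `|u i| ^+ 2).
Proof. by []. Qed.

Lemma l2fam_le (W : normedModType R) (u : l2fam I W) i : `|u i| <= `|u|.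
Proof.
rewrite l2fam_norm -[leLHS]ger0_norm// -sqrtr_sqr ler_wsqrtr// (bigD1 i)//= lerDl.
by apply: sumr_ge0 => j _; exact: sqr_ge0.
Qed.

Lemma l2fam_norm_le (W : normedModType R) (u : l2fam I W) : `|u| <= \sum_i `|u i|.
Proof.
have s0 : 0 <= \sum_i `|u i| by exact: sumr_ge0.
rewrite l2fam_norm -[leRHS]ger0_norm// -sqrtr_sqr ler_wsqrtr//.
have gen (s : seq I) : \sum_(i <- s) `|u i| ^+ 2 <= (\sum_(i <- s) `|u i|) ^+ 2.
  elim: s => [|i s IH]; first by rewrite !big_nil expr0n.
  rewrite !big_cons sqrrD; apply: (@le_trans _ _ (`|u i| ^+ 2 + (\sum_(j <- s) `|u j|) ^+ 2)).
    by rewrite lerD2l.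
  rewrite lerD2r lerDl mulrn_wge0// mulr_ge0//; exact: sumr_ge0.
exact: gen.
Qed.

Lemma l2famB (W : normedModType R) (u v : l2fam I W) i : l2fam_fun (u - v) i = u i - v i.
Proof. by rewrite /l2fam_fun !ffunE. Qed.

Lemma l2famD (W : normedModType R) (u v : l2fam I W) i : l2fam_fun (u + v) i = u i + v i.
Proof. by rewrite /l2fam_fun !ffunE. Qed.

Lemma l2famZ (W : normedModType R) (a : R) (u : l2fam I W) i : l2fam_fun (a *: u) i = a *: u i.
Proof. by rewrite /l2fam_fun !ffunE. Qed.

Lemma l2fam_cvg (W : normedModType R) (F : set_system (l2fam I W)) (FF : Filter F)
   (u : l2fam I W) :
  (forall i, (fun v : l2fam I W => v i : W) @ F --> u i) -> F --> u.
Proof.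
move=> h; suff aux (e : R) : 0 < e -> nbhs F [set v : l2fam I W | `|u - v| < e].
  by apply/cvgrPdist_lt => e; exact: aux.
move=> e0; have n0 : 0 < #|I|%:R + 1 :> R by rewrite ltr_wpDl.
have : nbhs F [set v : l2fam I W | forall i : I, `|u i - v i| < e / (#|I|%:R + 1)].
  apply: filter_forall => i; have /cvgrPdist_lt := h i; apply; exact: divr_gt0.
apply: filterS => v hv; apply: le_lt_trans (l2fam_norm_le _) _.
apply: (@le_lt_trans _ _ (\sum_(i : I) e / (#|I|%:R + 1))).
  by apply: ler_sum => i _; have := ltW (hv i); rewrite -l2famB; exact.
by rewrite sumr_const -[ltLHS]mulr_natl mulrCA gtr_pMr// ltr_pdivrMr// mul1r ltrDl.
Qed.

Lemma l2fam_L2_complete (u_ : nat -> l2fam I L2) :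
  (forall e : R, 0 < e -> exists N, forall m n, (N <= m)%N -> (N <= n)%N ->
    `|u_ m - u_ n| <= e) ->
  exists u : l2fam I L2, u_ n @[n --> \oo] --> u.
Proof.
apply: fast_cauchy_complete => v_ hv.
have h i : exists w : L2, v_ n i @[n --> \oo] --> w.
  apply: L2_fast_cauchy_cvg => n; apply: le_trans (hv n).
  by rewrite -l2famB l2fam_le.
have [w hw] := choice h.
exists ([ffun i => w i] : l2fam I L2).
apply: l2fam_cvg => i; rewrite /l2fam_fun ffunE; exact: hw.
Qed.

End L2_cauchy.

(** * Test functions and the fundamental lemma *)

Section theta.
Context {R : realType}.

(** The factor [t^-n] makes the family stable under differentiation: the derivative of [theta n] is
    [theta n.+2 - n * theta n.+1]. Smoothness of [theta 0] then follows by an induction that treats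
    every [n] at once. *)
Definition theta (n : nat) (t : R) : R :=
  if 0 < t then t^-1 ^+ n * expR (- t^-1) else 0.

Lemma theta_ge0 n t : 0 <= theta n t.
Proof.
rewrite /theta; case: ifPn => // t0.
by rewrite mulr_ge0 ?expR_ge0// exprn_ge0// invr_ge0 ltW.
Qed.

(** From [expR s >= s^(n+2) / (n+2)!] at [s = t^-1]. Quadratic decay at 0 makes the derivative exist
    and vanish there. *)
Lemma theta_bound n t : theta n t <= n.+2`!%:R * t ^+ 2.
Proof.
rewrite /theta; case: ifPn => t0; last by rewrite mulr_ge0 ?sqr_ge0.
have s0 : 0 < t^-1 by rewrite invr_gt0.
have := expR_ge1Dxn n.+1 (ltW s0); rewrite expRN => h.
have e0 : 0 < expR t^-1 by exact: expR_gt0.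
rewrite ler_pdivrMr//.
have f0 : (0 : R) < n.+2`!%:R by rewrite ltr0n fact_gt0.
apply: (@le_trans _ _ (n.+2`!%:R * t ^+ 2 * (t^-1 ^+ n.+2 / n.+2`!%:R))).
  have -> : n.+2`!%:R * t ^+ 2 * (t^-1 ^+ n.+2 / n.+2`!%:R) = t^-1 ^+ n; last by [].
  rewrite [t^-1 ^+ n.+2]exprS [t^-1 ^+ n.+1]exprS; set X := t^-1 ^+ n.
  by field; rewrite !gt_eqF.
apply: ler_wpM2l; first by rewrite mulr_ge0 ?sqr_ge0.
apply: le_trans h; rewrite lerDr//.
Qed.

Lemma theta0_le1 t : theta 0 t <= 1.
Proof.
rewrite /theta; case: ifPn => // t0.
by rewrite expr0 mul1r -expR0 ler_expR oppr_le0 invr_ge0 ltW.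
Qed.

Lemma is_derive_theta n (t : R) :
  is_derive t 1 (theta n) (theta n.+2 t - n%:R * theta n.+1 t).
Proof.
have [t0|t0|<-] := ltgtP 0 t.
- have tn0 : t != 0 by rewrite gt_eqF.
  have dV := @is_deriveV R id t 1 1 tn0 (is_derive_id t 1).
  have dX := @is_deriveX R R (fun x => x^-1) n t 1 _ dV.
  have dE : is_derive t 1 (fun x : R => expR (- x^-1)) (t^-1 ^+ 2 * expR (- t^-1)).
    have dN := is_deriveN dV.
    have := @is_derive1_comp _ expR (fun x : R => - x^-1) t _ _ (is_derive_expR _) dN.
    move=> H; apply: is_derive_eq H _; rewrite exprVn /GRing.scale/=; ring.
  have dM := @is_deriveM _ _ _ _ _ _ _ _ dX dE.
  apply: (near_eq_is_derive (f := (fun x : R => x^-1 ^+ n * expR (- x^-1)))); last first.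
  + move: dM; rewrite exprfctE => dM; apply: is_derive_eq dM _; rewrite /theta t0 /GRing.scale/= -exprVn.
    case: n {dX} => [|n] /=; first by rewrite !expr0 !mul0r mulr0 addr0 subr0 mul1r.
    rewrite !(exprS _ n.+2) !(exprS _ n.+1) !(exprS _ n) !(exprS _ 1) expr1.
    by move: (t^-1 ^+ n) (n.+1%:R : R) => X c; ring.
  + near=> y; rewrite /theta ifT//; near: y; exact: lt_nbhsr.
- have E (m : nat) : theta m t = 0 by rewrite /theta ltNge (ltW t0).
  rewrite !E mulr0 subr0.
  apply: (near_eq_is_derive (f := cst 0)) => //.
  near=> y; rewrite /theta ifF//; apply/negbTE; rewrite -leNgt; apply: ltW.
  near: y; exact: lt_nbhsl.
- have E (m : nat) : theta m 0 = 0 by rewrite /theta ltxx.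
  rewrite !E mulr0 subr0.
  have c : h^-1 *: ((theta n \o shift (0 : R)) (h *: (1 : R)) - theta n 0) @[h --> 0^'] --> (0 : R).
    apply/cvgrPdist_le => e e0; rewrite /= E.
    have f0 : (0 : R) < n.+2`!%:R by rewrite ltr0n fact_gt0.
    exists (e / n.+2`!%:R); first by rewrite /= divr_gt0.
    move=> h /=; rewrite sub0r normrN => hd hn0; rewrite sub0r normrN subr0 addr0 /GRing.scale/= mulr1.
    rewrite normrM normfV [X in _ * X]ger0_norm ?theta_ge0// ler_pdivrMl ?normr_gt0//.
    apply: le_trans (theta_bound n h) _; rewrite -[h ^+ 2]ger0_norm ?sqr_ge0// normrX expr2 mulrA mulrC.
    rewrite ler_wpM2l// mulrC -ler_pdivlMr//; exact: ltW.
  by apply: DeriveDef; [apply/cvg_ex; exists 0|exact: cvg_lim c].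
Unshelve. all: end_near. Qed.

Lemma theta_continuous n : continuous (theta n).
Proof.
move=> t; apply: differentiable_continuous; apply/derivable1_diffP.
by have [] := is_derive_theta n t.
Qed.

End theta.

Section Ck.
Context {R : realType}.
Implicit Types (f g : R3 R -> R) (j : 'I_3).

Lemma Ck_continuous k g : Ck k g -> continuous g.
Proof. by case: k => [|k] []. Qed.

Lemma CkS k g : Ck k.+1 g -> Ck k g.
Proof.
elim: k g => [|k IH] g [cg dg]; split => // j.
have [dj cj] := dg j; split => //; exact: IH.
Qed.

Lemma Ck_cst k (c : R) : Ck k (fun=> c).
Proof.
elim: k c => [|k IH] c; split => //.
- exact: cst_continuous.
- exact: cst_continuous.
- move=> j; split => [x|]; first exact: derivable_cst.
  by rewrite (_ : 'D__ _ = fun=> 0)//; apply/funext => x; exact: derive_cst.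
Qed.

Lemma CkD k f g : Ck k f -> Ck k g -> Ck k (fun x => f x + g x).
Proof.
have cD (u v : R3 R -> R) : continuous u -> continuous v -> continuous (fun x => u x + v x).
  by move=> cu cv x; apply: cvgD; [exact: cu|exact: cv].
elim: k f g => [|k IH] f g [cf df] [cg dg]; split => //; try exact: cD.
move=> j; have [dfj cfj] := df j; have [dgj cgj] := dg j.
split => [x|]; first exact: derivableD.
rewrite (_ : 'D__ _ = fun x => 'D_(e3 R j) f x + 'D_(e3 R j) g x); first exact: IH.
by apply/funext => x; exact: deriveD.
Qed.

Lemma CkM k f g : Ck k f -> Ck k g -> Ck k (fun x => f x * g x).
Proof.
have cM (u v : R3 R -> R) : continuous u -> continuous v -> continuous (fun x => u x * v x).
  by move=> cu cv x; apply: cvgM; [exact: cu|exact: cv].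
elim: k f g => [|k IH] f g Cf Cg.
  by split => //; apply: cM; exact: (@Ck_continuous 0).
have [cf df] := Cf; have [cg dg] := Cg.
split; first exact: cM.
move=> j; have [dfj cfj] := df j; have [dgj cgj] := dg j.
split => [x|]; first exact: derivableM.
rewrite (_ : 'D__ _ = fun x => f x * 'D_(e3 R j) g x + g x * 'D_(e3 R j) f x).
  apply: CkD; apply: IH => //; exact: CkS.
by apply/funext => x; exact: deriveM.
Qed.

Definition coord3 (i : 'I_3) (p : R3 R) : R :=
  if i == 0 then p.1.1 else if i == 1 then p.1.2 else p.2.

Lemma coord3_continuous i : continuous (coord3 i).
Proof.
rewrite /coord3; case: (i == 0); last case: (i == 1).
- move=> p; apply: (@continuous_comp _ _ _ fst fst); exact: cvg_fst.
- move=> p; apply: (@continuous_comp _ _ _ fst snd); [exact: cvg_fst|exact: cvg_snd].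
- move=> p; exact: cvg_snd.
Qed.

Lemma coord3_line i j (h : R) (p : R3 R) :
  coord3 i (h *: e3 R j + p) = h * (i == j)%:R + coord3 i p.
Proof.
have i3 (k : 'I_3) : [|| k == 0, k == 1 | k == 2].
  by case: k => -[|[|[|]]].
rewrite /coord3 /e3 /=; have := i3 i; have := i3 j.
by move=> /or3P[]/eqP-> /or3P[]/eqP->.
Qed.

Lemma is_derive_coord3 i j (g : R -> R) (p : R3 R) (dg : R) :
  is_derive (coord3 i p) 1 g dg ->
  is_derive p (e3 R j) (fun q => g (coord3 i q)) ((i == j)%:R * dg).
Proof.
move=> [dg1 dg2]; have [ij|ij] := eqVneq i j.
  rewrite mul1r -dg2 /derive /derivable in dg1 *.
  have E : (fun h => h^-1 *: (((fun q => g (coord3 i q)) \o shift p) (h *: e3 R j) - g (coord3 i p))) =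
    (fun h => h^-1 *: ((g \o shift (coord3 i p)) (h *: (1 : R)) - g (coord3 i p))).
    by apply/funext => h /=; rewrite coord3_line ij eqxx.
  by apply: DeriveDef; rewrite /derivable /derive E.
rewrite mul0r.
have E : (fun h => h^-1 *: (((fun q => g (coord3 i q)) \o shift p) (h *: e3 R j) - g (coord3 i p))) =
    (fun h => 0).
  by apply/funext => h /=; rewrite coord3_line (negbTE ij) mulr0 add0r subrr scaler0.
apply: DeriveDef; rewrite /derivable /derive E; first exact: is_cvg_cst.
exact: lim_cst.
Qed.

Lemma Ck_theta k n i (c d : R) : Ck k (fun p => theta n (c * coord3 i p + d)).
Proof.
elim: k n => [|k IH] n.
  split => // p; apply: (@continuous_comp _ _ _ (fun p => c * coord3 i p + d) (theta n)).
    apply: cvgD; last exact: cvg_cst.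
    by apply: cvgM; [exact: cvg_cst|exact: coord3_continuous].
  exact: theta_continuous.
have Dj p j : is_derive p (e3 R j) (fun p => theta n (c * coord3 i p + d))
    ((i == j)%:R * (c * (theta n.+2 (c * coord3 i p + d) - n%:R * theta n.+1 (c * coord3 i p + d)))).
  apply: (@is_derive_coord3 i j (fun t => theta n (c * t + d))).
  have dg : is_derive (coord3 i p) 1 (fun t => c * t + d) c.
    have := is_deriveD (is_deriveZ c (is_derive_id (coord3 i p) 1)) (is_derive_cst d (coord3 i p) 1).
    by move=> H; apply: is_derive_eq H _; rewrite /GRing.scale/= mulr1 addr0.
  have := @is_derive1_comp _ (theta n) (fun t => c * t + d) (coord3 i p) _ _ (is_derive_theta n _) dg.
  by move=> H; apply: is_derive_eq H _; rewrite mulrC.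
split.
  by have := Ck_continuous (IH n).
move=> j; split => [p|]; first by have [] := Dj p j.
rewrite (_ : 'D__ _ = fun p => (i == j)%:R * (c * (theta n.+2 (c * coord3 i p + d) +
    (- n%:R) * theta n.+1 (c * coord3 i p + d)))).
  apply: CkM; first exact: Ck_cst.
  apply: CkM; first exact: Ck_cst.
  apply: CkD; first exact: IH.
  by apply: CkM; [exact: Ck_cst|exact: IH].
by apply/funext => p; have [_ ->] := Dj p j; rewrite mulNr.
Qed.

End Ck.

(** * Boxes and the sigma-algebra that they generate *)

Section boxes.
Context {R : realType}.
Implicit Types a b : 'I_3 -> R.

Definition box3 a b : set (R3 R) := [set p | forall i, a i < coord3 i p < b i].
Definition cbox3 a b : set (R3 R) := [set p | forall i, a i <= coord3 i p <= b i].

Lemma I3_cases (P : 'I_3 -> Prop) : P 0 -> P 1 -> P 2 -> forall i, P i.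
Proof.
move=> P0 P1 P2 i; have i3 : [|| i == 0, i == 1 | i == 2].
  by case: i => -[|[|[|]]].
by move: i3 => /or3P[]/eqP->.
Qed.

Lemma cbox3E a b : cbox3 a b =
  (`[a 0, b 0]%classic `*` `[a 1, b 1]%classic) `*` `[a 2, b 2]%classic.
Proof.
apply/seteqP; split => [p h|[[x y] z] [[/= h0 h1] h2]].
  split; [split|]; rewrite /= in_itv/=; [exact: (h 0)|exact: (h 1)|exact: (h 2)].
by apply: I3_cases; rewrite /coord3/=; rewrite in_itv/= in h0 h1 h2.
Qed.

Lemma cbox3_compact a b : compact (cbox3 a b).
Proof.
rewrite cbox3E; apply: compact_setX; last exact: segment_compact.
by apply: compact_setX; exact: segment_compact.
Qed.

Lemma box3_setI a b a' b' :
  box3 a b `&` box3 a' b' = box3 (fun i => Num.max (a i) (a' i)) (fun i => Num.min (b i) (b' i)).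
Proof.
apply/seteqP; split => [p [h h'] i|p h].
  have /andP[h1 h2] := h i; have /andP[h3 h4] := h' i.
  by rewrite gt_max lt_min h1 h2 h3 h4.
split => i; have := h i; rewrite gt_max lt_min => /andP[/andP[h1 h2] /andP[h3 h4]];
  by rewrite ?h1 ?h2 ?h3 ?h4.
Qed.

Lemma sub_box3_cbox3 a b : box3 a b `<=` cbox3 a b.
Proof. by move=> p h i; have /andP[/ltW -> /ltW ->] := h i. Qed.

Lemma box3_open a b : open (box3 a b).
Proof.
have -> : box3 a b = (coord3 0 @^-1` `]a 0, b 0[%classic `&` coord3 1 @^-1` `]a 1, b 1[%classic)
    `&` coord3 2 @^-1` `]a 2, b 2[%classic.
  apply/seteqP; split => [p h|p [[h0 h1] h2]].
    by split; [split|]; rewrite /= in_itv/=; exact: h.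
  by rewrite /= !in_itv/= in h0 h1 h2; exact: I3_cases.
have oc i : open (coord3 i @^-1` `]a i, b i[%classic : set (R3 R)).
  apply: open_comp => [p _|]; [exact: coord3_continuous|exact: interval_open].
by apply: openI => //; exact: openI.
Qed.

Lemma box3_measurable a b : measurable (box3 a b).
Proof. apply: open_measurable3; exact: box3_open. Qed.

(** A slab in one coordinate is the union of the boxes whose other sides are []-n, n[], so the three
    coordinates, and with them the identity, are measurable for the sigma-algebra generated by
    boxes. *)
Lemma measurable_box3 : @measurable _ (R3 R) `<=` <<s range (fun ab => box3 ab.1 ab.2) >>.
Proof.
move=> A mA.
pose T' := g_sigma_algebraType (range (fun ab => box3 ab.1 ab.2)).
have mc i : measurable_fun setT (fun p : T' => coord3 i (p : R3 R) : measurableTypeR R).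
  apply: (measurability _ (RGenOpens.measurableE R)).
  move=> _ [_ [x [y ->]] <-]; rewrite setTI.
  rewrite (_ : _ @^-1` _ = \bigcup_n box3 (fun k => if k == i then x else - n%:R)
      (fun k => if k == i then y else n%:R)).
    apply: bigcupT_measurable => n; apply: sub_sigma_algebra.
    by exists (fun k => if k == i then x else - n%:R, fun k => if k == i then y else n%:R).
  apply/seteqP; split => [p /=|p [n _] h /=].
    rewrite in_itv/= => hp.
    have [N hN] : exists N : nat, forall k, `|coord3 k p| < N%:R.
      exists (\sum_(k : 'I_3) (Num.truncn `|coord3 k p|%R).+1)%N => k.
      apply: lt_le_trans (truncnS_gt _) _; rewrite ler_nat (bigD1 k)//= leq_addr//.
    exists N => // k; case: eqP => [->//|_].
    by have := hN k; rewrite ltr_norml.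
  by have := h i; rewrite eqxx in_itv.
have m_id : measurable_fun setT (fun p : T' => (p : R3 R)).
  rewrite (_ : (fun p : T' => (p : R3 R)) = (fun p : T' =>
    ((coord3 0 (p : R3 R), coord3 1 (p : R3 R)), coord3 2 (p : R3 R)) : R3 R)).
    apply: measurable_fun_pair; last exact: mc.
    by apply: measurable_fun_pair; exact: mc.
  by apply/funext => -[[x y] z].
have := m_id measurableT A mA; rewrite setTI; exact.
Qed.

End boxes.

Section pi_lambda_integral.
Context {d} {T : measurableType d} {R : realType}.
Variable mu : {measure set T -> \bar R}.

(** Dynkin's argument: the sets over which the integral vanishes form a lambda-system, increasing
    unions being handled by dominated convergence. *)
Lemma integral_pi_lambda (G : set (set T)) (h : T -> \bar R) :
  setI_closed G -> G `<=` measurable -> measurable `<=` <<s G >> ->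
  mu.-integrable setT h -> (\int[mu]_x h x = 0)%E ->
  (forall E, G E -> \int[mu]_(x in E) h x = 0)%E ->
  forall E, measurable E -> (\int[mu]_(x in E) h x = 0)%E.
Proof.
move=> GI Gm mG ih hT hG E mE.
pose D := [set E | measurable E /\ (\int[mu]_(x in E) h x = 0)%E].
have mh := measurable_int _ ih.
have DL : lambda_system setT D.
  split => //.
  - move=> A B BA [mA A0] [mB B0]; split; first exact: measurableD.
    have AE : A = (A `\` B) `|` B by rewrite setUC setDUK.
    have := @integral_setU _ _ _ mu (A `\` B) B h (measurableD mA mB) mB.
    rewrite -AE A0 B0 adde0 => -> //; first exact: measurable_funTS.
    by apply/disj_setPS => x [[_ nB] /nB].
  - move=> F ndF DF.
    have mF n : measurable (F n) by have [] := DF n.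
    split; first exact: bigcupT_measurable.
    have mb : measurable (\bigcup_i F i) by exact: bigcupT_measurable.
    have := @dominated_convergence _ _ _ mu setT measurableT (fun n => h \_ (F n))
      (h \_ (\bigcup_i F i)) (abse \o h).
    case.
    + by move=> n; apply/(measurable_restrictT _ (mF n)); exact: measurable_funTS.
    + by apply/(measurable_restrictT _ mb); exact: measurable_funTS.
    + apply: nearW => x _; rewrite patchE; case: ifPn => [/set_mem[n _ Fnx]|nF].
        apply: cvg_near_cst; exists n => // m /= nm; rewrite patchE ifT//.
        by apply: mem_set; have /subsetPset := ndF _ _ nm; apply.
      apply: cvg_near_cst; apply: nearW => m; rewrite patchE ifF//.
      apply/negP => /set_mem Fx; move/negP : nF; apply; apply: mem_set; by exists m.
    + exact: integrable_abse.
    + apply: nearW => x n _; rewrite patchE/=; case: ifPn => // _.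
      by rewrite abse0.
    move=> _ _; rewrite -integral_mkcond => /cvg_lim <- //.
    apply: lim_near_cst => //; apply: nearW => n.
    by rewrite /= -integral_mkcond; have [] := DF n.
have := @lambda_system_subset _ G GI setT D DL.
by move=> H; have [] := H (fun E GE => conj (Gm E GE) (hG E GE)) (fun _ _ => @subsetT _ _) E (mG E mE).
Qed.

End pi_lambda_integral.

(** * The fundamental lemma of the calculus of variations *)

Section fundamental.
Context {R : realType}.

Lemma leb3_prod (A B C : set R) : @measurable _ (measurableTypeR R) A ->
  @measurable _ (measurableTypeR R) B -> @measurable _ (measurableTypeR R) C ->
  leb3 R ((A `*` B) `*` C) =
    (@lebesgue_measure R A * @lebesgue_measure R B * @lebesgue_measure R C)%E.
Proof.
move=> mA mB mC; rewrite /leb3; apply: etrans (product_measure1E _ _ _ _) _ => //.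
  exact: measurableX.
by congr (_ * _)%E; exact: product_measure1E.
Qed.

Lemma leb3_cbox3 (a b : 'I_3 -> R) : leb3 R (cbox3 a b) =
  (Num.max 0 (b 0 - a 0) * Num.max 0 (b 1 - a 1) * Num.max 0 (b 2 - a 2))%:E.
Proof.
have h (x y : R) : @lebesgue_measure R `[x, y]%classic = (Num.max 0 (y - x))%:E.
  rewrite lebesgue_measure_itv/= lte_fin; case: ifPn => xy.
    by rewrite -EFinB max_r// subr_ge0 ltW.
  by rewrite max_l// subr_le0 leNgt.
by rewrite cbox3E leb3_prod ?h//; exact: measurable_itv.
Qed.

Lemma continuous_measurable_R3 (g : R3 R -> R) : continuous g -> measurable_fun setT g.
Proof.
move=> cg; apply: (measurability _ (RGenOpens.measurableE R)).
move=> _ [_ [a [b ->] <-]]; rewrite setTI; apply: open_measurable3.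
by apply: open_comp => [p _|]; [exact: cg|exact: interval_open].
Qed.
Variable Omega : bounded_domain R.

Lemma dom_bounded_box : exists2 M : R, 0 < M &
  dom Omega `<=` cbox3 (fun=> - M) (fun=> M).
Proof.
have [M [Mr hM]] := dom_bounded Omega.
pose N := Num.max M 0 + 1.
have N0 : 0 < N by rewrite /N ltr_wpDl// le_max lexx orbT.
exists N => // p Op i; rewrite -ler_norml.
have /= h := hM N _ p Op; apply: le_trans (h _).
  rewrite /coord3; case: p {h Op} => [[x y] z] /=.
  by case: ifP => _; [|case: ifP => _]; rewrite !prod_normE/= !le_max ?lexx ?orbT.
by rewrite /N (@le_lt_trans _ _ (Num.max M 0))// ?le_max ?lexx// ltrDl.
Qed.

Lemma leb_dom_fin : leb_dom Omega [set: R3 R] \is a fin_num.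
Proof.
have [M M0 OM] := dom_bounded_box.
rewrite ge0_fin_numE//= /leb_dom/= /mrestr setTI.
apply: (@le_lt_trans _ _ (leb3 R (cbox3 (fun=> - M) (fun=> M)))).
  apply: le_measure => //; rewrite inE.
  - exact: open_measurable3 (@dom_open R Omega).
  - by rewrite cbox3E; apply: measurableX; [apply: measurableX|]; exact: measurable_itv.
by rewrite leb3_cbox3 ltry.
Qed.

Lemma L2_integrable (u : L2 (leb_dom Omega)) : (leb_dom Omega).-integrable setT (EFin \o L2_fun u).
Proof.
apply/Lfun1_integrable; apply: Lfun_subset12; first exact: leb_dom_fin.
exact: L2_fun_Lfun.
Qed.

(** [theta 0] is [exp (-1/t)] on the positive axis, so both factors vanish outside the slab and tend
    to 1 inside it as [n] grows. The test functions [bump n] thus converge boundedly to the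
    indicator of a box. *)
Definition bump1 (n : nat) (a b : 'I_3 -> R) (i : 'I_3) (p : R3 R) : R :=
  theta 0 (n%:R * coord3 i p + - n%:R * a i) * theta 0 (- n%:R * coord3 i p + n%:R * b i).

Definition bump (n : nat) a b p : R := bump1 n a b 0 p * bump1 n a b 1 p * bump1 n a b 2 p.

Lemma bump1_ge0_le1 n a b i p : 0 <= bump1 n a b i p <= 1.
Proof.
by rewrite /bump1 mulr_ge0 ?theta_ge0//= mulr_ile1 ?theta_ge0 ?theta0_le1.
Qed.

Lemma bump_ge0_le1 n a b p : 0 <= bump n a b p <= 1.
Proof.
have := bump1_ge0_le1 n a b 0 p; have := bump1_ge0_le1 n a b 1 p.
have := bump1_ge0_le1 n a b 2 p; rewrite /bump.
move: (bump1 n a b 0 p) (bump1 n a b 1 p) (bump1 n a b 2 p) => x y z.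
move=> /andP[z0 z1] /andP[y0 y1] /andP[x0 x1].
by rewrite !mulr_ge0//= mulr_ile1// ?mulr_ile1// mulr_ge0.
Qed.

Lemma theta0_eq0 (t : R) : t <= 0 -> theta 0 t = 0.
Proof. by move=> t0; rewrite /theta ltNge t0. Qed.

Lemma bump1_eq0 n a b i p : ~~ (a i < coord3 i p < b i) -> bump1 n a b i p = 0.
Proof.
have n0 : 0 <= n%:R :> R by [].
rewrite negb_and -!leNgt /bump1 => /orP[h|h].
  by rewrite theta0_eq0 ?mul0r// mulNr -mulrBr mulr_ge0_le0// subr_le0.
by rewrite [X in _ * X]theta0_eq0 ?mulr0// mulNr addrC -mulrBr mulr_ge0_le0// subr_le0.
Qed.

Lemma bump_neq0 n a b p : bump n a b p != 0 -> box3 a b p.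
Proof.
move=> h; apply: I3_cases; apply: contraNT h => h; rewrite /bump (bump1_eq0 _ h) ?mul0r ?mulr0//.
by rewrite mul0r.
Qed.

Lemma bump_smooth n a b : smooth (bump n a b).
Proof.
move=> k; rewrite /bump /bump1.
by apply: CkM; [apply: CkM|]; apply: CkM; exact: Ck_theta.
Qed.

Lemma theta0_cvg (t : R) : 0 < t -> theta 0 (n.+1%:R * t) @[n --> \oo] --> (1 : R).
Proof.
move=> t0.
have -> : (fun n => theta 0 (n.+1%:R * t)) = (fun n => expR (- (harmonic n * t^-1))).
  apply/funext => n; rewrite /theta mulr_gt0 ?ltr0n// expr0 mul1r invfM//.
rewrite -expR0; apply: continuous_cvg; first exact: continuous_expR.
rewrite -oppr0; apply: cvgN; rewrite -(mul0r t^-1).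
by apply: cvgM; [exact: cvg_harmonic|exact: cvg_cst].
Qed.

Lemma bump_cvg a b p : bump n.+1 a b p @[n --> \oo] --> (\1_(box3 a b) p : R).
Proof.
rewrite indicE; have [/set_mem pab|pab] := boolP (p \in box3 a b).
  have h i : bump1 n.+1 a b i p @[n --> \oo] --> (1 : R).
    rewrite -(mulr1 (1 : R)); have /andP[h1 h2] := pab i; apply: cvgM.
      under eq_fun do rewrite mulNr -mulrBr; apply: theta0_cvg; by rewrite subr_gt0.
    under eq_fun do rewrite mulNr addrC -mulrBr; apply: theta0_cvg; by rewrite subr_gt0.
  rewrite -(mulr1 (1 : R)) -[X in X * _](mulr1 (1 : R)).
  by apply: cvgM => //; apply: cvgM.
apply: cvg_near_cst; apply: nearW => n.
by apply/eqP; apply: contraNT pab => /bump_neq0/mem_set.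
Qed.

Lemma bump_Ccinfty n a b : cbox3 a b `<=` dom Omega -> Ccinfty Omega (bump n a b).
Proof.
move=> abO.
have sub : closure [set x | bump n a b x != 0] `<=` cbox3 a b.
  have /closure_id -> : closed (cbox3 a b).
    by apply: compact_closed; [exact: (@norm_hausdorff _ (R3 R))|exact: cbox3_compact].
  by apply: closure_subset => p /bump_neq0; exact: sub_box3_cbox3.
split; first exact: bump_smooth.
  by apply: (subclosed_compact _ (@cbox3_compact _ a b)) => //; exact: closed_closure.
exact: subset_trans sub abO.
Qed.

Lemma box3_integral_eq0 (u : L2 (leb_dom Omega)) a b : cbox3 a b `<=` dom Omega ->
  (forall eta, Ccinfty Omega eta -> \int[leb_dom Omega]_x (L2_fun u x * eta x) = 0) ->
  (\int[leb_dom Omega]_(x in box3 a b) (L2_fun u x)%:E = 0)%E.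
Proof.
move=> abO h.
have mu := L2_fun_measurable u.
have mb n : measurable_fun setT (bump n a b).
  by apply: continuous_measurable_R3; exact: (Ck_continuous (bump_smooth n a b 0)).
have := @dominated_convergence _ _ _ (leb_dom Omega) setT measurableT
  (fun n x => (L2_fun u x * bump n.+1 a b x)%:E)
  ((EFin \o L2_fun u) \_ (box3 a b)) (abse \o (EFin \o L2_fun u)).
case.
- by move=> n; apply/measurable_EFinP; apply: measurable_funM.
- apply/(measurable_restrictT _ (box3_measurable _ _)); apply: measurable_funTS.
  exact/measurable_EFinP.
- apply: nearW => x _; rewrite (_ : _ x = (L2_fun u x * \1_(box3 a b) x)%:E).
    apply: cvg_EFin; first exact: nearW.
    by apply: cvgM; [exact: cvg_cst|exact: bump_cvg].
  by rewrite patchE indicE; case: ifPn => _; rewrite ?mulr1 ?mulr0.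
- exact: integrable_abse (L2_integrable u).
- apply: nearW => x n _; rewrite /= lee_fin normrM ler_piMr//.
  by have /andP[b0 b1] := bump_ge0_le1 n.+1 a b x; rewrite ger0_norm.
move=> _ _; rewrite -integral_mkcond => /cvg_lim <- //.
apply: lim_near_cst => //; apply: nearW => n /=.
have ii : (leb_dom Omega).-integrable setT (EFin \o (fun x => L2_fun u x * bump n.+1 a b x)).
  apply: le_integrable (L2_integrable u) => //.
    by apply/measurable_EFinP; apply: measurable_funM.
  move=> x _; rewrite /= lee_fin normrM ler_piMr//.
  by have /andP[b0 b1] := bump_ge0_le1 n.+1 a b x; rewrite ger0_norm.
by rewrite -[LHS]fineK ?(integrable_fin_num _ ii)//; congr EFin; exact: h (bump_Ccinfty _ abO).
Qed.

(** Approximating indicators by bumps, the integral of [u] vanishes over every box whose closure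
    lies in the domain, hence over all Borel subsets of such a box; so [u = 0] almost everywhere in
    it. Boxes with rational corners cover the domain. *)
Theorem L2_test_eq0 (u : L2 (leb_dom Omega)) :
  (forall eta, Ccinfty Omega eta -> \int[leb_dom Omega]_x (L2_fun u x * eta x) = 0) ->
  u = 0.
Proof.
move=> h; apply: L2_funP.
have mu := L2_fun_measurable u.
have local a b : cbox3 a b `<=` dom Omega ->
    {ae leb_dom Omega, forall x, box3 a b x -> L2_fun u x = 0}.
  move=> abO.
  pose k := (EFin \o L2_fun u) \_ (box3 a b).
  have ik : (leb_dom Omega).-integrable setT k.
    apply/(integrable_mkcond _ (box3_measurable _ _)).
    by apply: (integrableS measurableT) (L2_integrable u) => //; exact: box3_measurable.
  have k0 E : measurable E -> (\int[leb_dom Omega]_(x in E) k x = 0)%E.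
    apply: (@integral_pi_lambda _ _ _ _ (range (fun ab => box3 ab.1 ab.2))).
    - move=> _ _ [[a1 b1] _ <-] [[a2 b2] _ <-]; rewrite box3_setI.
      by eexists (_, _).
    - by move=> _ [[a1 b1] _ <-]; exact: box3_measurable.
    - exact: measurable_box3.
    - exact: ik.
    - by rewrite /k -integral_mkcond; exact: box3_integral_eq0.
    - move=> _ [[a1 b1] _ <-]; rewrite /k -integral_mkcondr/= box3_setI.
      apply: box3_integral_eq0 => //; apply: subset_trans abO => p hp i.
      have := hp i; rewrite ge_max le_min => /andP[/andP[_ ->] /andP[_ ->]]//.
  have := @integral_ae_eq _ _ _ (leb_dom Omega) setT measurableT (cst 0%E) k ik.
  move=> H; have {}H := H (measurable_cst _).
  apply: filterS (H _) => [x /(_ I) + xab|E _ mE].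
    by rewrite /k patchE mem_set// => -[].
  by rewrite k0// integral0.
pose Q (q : {ffun 'I_3 -> rat * rat}) := box3 (fun i => ratr (q i).1) (fun i => ratr (q i).2 : R).
pose CQ (q : {ffun 'I_3 -> rat * rat}) := cbox3 (fun i => ratr (q i).1) (fun i => ratr (q i).2 : R).
(* Enumerating the rational boxes by [unpickle] turns the exceptional sets into a countable family
   of null sets. *)
have aeQ : {ae leb_dom Omega, forall x, forall n : nat,
    forall q, unpickle n = Some q -> CQ q `<=` dom Omega -> Q q x -> L2_fun u x = 0}.
  apply/ae_foralln => n; case: (unpickle n) => [q|]; last exact: nearW.
  have [qO|qO] := pselect (CQ q `<=` dom Omega).
    by apply: filterS (local _ _ qO) => x hx q' [<-] _.
  by apply: nearW => x q' [<-] /qO.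
have aeO : {ae leb_dom Omega, forall x, dom Omega x}.
  exists (~` dom Omega); split => //.
  - exact: measurableC (open_measurable3 (@dom_open R Omega)).
  - by rewrite /leb_dom/= /mrestr setICl measure0.
apply: filterS3 aeQ aeO (L2_fun0 (leb_dom Omega)) => x xQ xO x0 _; rewrite x0//=.
have /nbhs_ballP[e /= e0 xeO] : nbhs x (dom Omega).
  by apply: open_nbhs_nbhs; split => //; exact: dom_open.
have /choice[q hq] i : exists q : rat * rat, [/\ ratr q.1 < coord3 i x, coord3 i x < ratr q.2,
    coord3 i x - e < ratr q.1 & ratr q.2 < coord3 i x + e].
  have [|a] := @rat_in_itvoo R (coord3 i x - e) (coord3 i x); first by rewrite ltrBlDr ltrDl.
  have [|b] := @rat_in_itvoo R (coord3 i x) (coord3 i x + e); first by rewrite ltrDl.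
  by rewrite !in_itv/= => /andP[h1 h2] /andP[h3 h4]; exists (a, b).
apply: (xQ (pickle [ffun i => q i]) [ffun i => q i]).
- by rewrite pickleK.
- move=> p hp; apply: xeO.
  have hc i : ball (coord3 i x) e (coord3 i p).
    have /andP[] := hp i; rewrite ffunE; have [h1 h2 h3 h4] := hq i => h5 h6.
    rewrite /ball/= ltr_distlC (lt_le_trans h3 h5)/=; exact: le_lt_trans h6 h4.
  by split; [split|]; [exact: (hc 0)|exact: (hc 1)|exact: (hc 2)].
- by move=> i; rewrite ffunE; have [-> -> _ _] := hq i.
Qed.

End fundamental.

(** * Integration by parts and Ladyzhenskaya's inequality *)

Section cauchy_schwarz.
Context {d} {T : measurableType d} {R : realType}.
Variable mu : {measure set T -> \bar R}.

(** In extended reals and for measurable functions only, so that it applies before any finiteness is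
    known. *)
Lemma integral_cauchy_schwarz (f g : T -> R) :
  measurable_fun setT f -> measurable_fun setT g ->
  ((\int[mu]_x `|f x * g x|%:E) ^+ 2 <=
   (\int[mu]_x (f x ^+ 2)%:E) * (\int[mu]_x (g x ^+ 2)%:E))%E.
Proof.
move=> mf mg.
have h22 : (2^-1 + 2^-1 = 1 :> R)%R by rewrite [RHS]splitr !div1r.
have := @hoelder _ _ _ mu f g 2 2 mf mg (ltr0n _ 2) (ltr0n _ 2) h22.
rewrite Lnorm1.
have poweR2 (x : \bar R) : (0 <= x -> x `^ 2 = x ^+ 2)%E.
  case: x => [r r0| _|//]; first by rewrite poweR_EFin powR_mulrn// EFin_expe.
  by rewrite poweRyr.
have sq (k : T -> R) : (('N[mu]_2[EFin \o k]) ^+ 2 = \int[mu]_x (k x ^+ 2)%:E)%E.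
  rewrite -poweR2 ?Lnorm_ge0// powR_Lnorm//; apply: eq_integral => x _ /=.
  by rewrite powR_mulrn// real_normK// num_real.
move=> h; rewrite -!sq !expe2 muleACA.
by apply: lee_pmul => //; apply: integral_ge0 => x _; rewrite lee_fin.
Qed.

End cauchy_schwarz.

Section one_dim.
Context {R : realType}.
Local Notation leb := (@lebesgue_measure R).
Implicit Types (g dg : R -> R).

Lemma FTC_segment g dg (a b : R) : (forall x : R, is_derive x 1 g (dg x)) ->
  continuous dg -> a < b ->
  (\int[leb]_(x in `[a, b]) (dg x)%:E = (g b - g a)%:E)%E.
Proof.
move=> gd cdg ab; rewrite EFinB; apply: continuous_FTC2 => //.
- exact: continuous_subspaceT.
- have cg : continuous g.
    move=> x; apply: differentiable_continuous; apply/derivable1_diffP.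
    by have [] := gd x.
  split.
  + by move=> x _; have [] := gd x.
  + by apply: cvg_at_right_filter; exact: cg.
  + by apply: cvg_at_left_filter; exact: cg.
- by move=> x _; rewrite derive1E; have [] := gd x.
Qed.

Lemma continuous_measurable_R g : continuous g ->
  measurable_fun setT (g : measurableTypeR R -> R).
Proof. by move=> cg; exact: continuous_measurable_fun. Qed.

Lemma is_derive_continuous g dg : (forall x : R, is_derive x 1 g (dg x)) -> continuous g.
Proof.
move=> gd x; apply: differentiable_continuous; apply/derivable1_diffP.
by have [] := gd x.
Qed.

Lemma integral_derive_csupp g dg (M : R) : (forall x : R, is_derive x 1 g (dg x)) ->
  continuous dg -> 0 < M -> (forall x, M <= `|x| -> g x = 0) ->
  (\int[leb]_x (dg x)%:E = 0)%E.
Proof.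
move=> gd cdg M0 gM.
have dM x : M < `|x| -> dg x = 0.
  move=> xM; have [_ <-] := gd x.
  rewrite (@near_eq_derive _ _ _ g (cst 0)); first exact: derive_cst.
  near=> y; apply: gM; apply: ltW; near: y.
  have c : {for x, continuous (fun y : R => `|y|)} by exact: norm_continuous.
  by apply: (c [set t | M < t]); exact: lt_nbhsr.
have E : (EFin \o dg) \_ `[- (M + 1), M + 1] = EFin \o dg.
  apply/funext => x; rewrite patchE; case: ifPn => // xM; rewrite /= dM//.
  apply: contraNT xM; rewrite -leNgt ler_norml => /andP[h1 h2]; apply: mem_set => /=.
  rewrite in_itv/=; apply/andP; split; lra.
rewrite -[X in (\int[_]_x X x)%E]/(EFin \o dg) -E -integral_mkcond.
rewrite (FTC_segment gd cdg); last by lra.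
by rewrite !gM ?subrr// ?normrN ger0_norm; lra.
Unshelve. all: end_near. Qed.

(** [g ^+ 2] is the integral of its derivative [2 g dg] from [-M], where [g] vanishes. *)
Lemma sqr_le_integral g dg (M : R) : (forall x : R, is_derive x 1 g (dg x)) ->
  continuous dg -> 0 < M -> (forall x, M <= `|x| -> g x = 0) ->
  forall t, ((g t ^+ 2)%:E <= \int[leb]_x (2 * `|g x * dg x|)%:E)%E.
Proof.
move=> gd cdg M0 gM t.
have cg := is_derive_continuous gd.
have [tM|tM] := leP M `|t|.
  by rewrite gM// expr0n; apply: integral_ge0 => x _; rewrite lee_fin.
have g2d (x : R) : is_derive x 1 (fun y => g y ^+ 2) (2 * (g x * dg x)).
  have := is_deriveM (gd x) (gd x) => H; rewrite (_ : (fun y => _) = (fun y => g y * g y)).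
    by apply: is_derive_eq H _; rewrite /GRing.scale/=; ring.
  by apply/funext => y; rewrite expr2.
have c2 : continuous (fun x => 2 * (g x * dg x)).
  by move=> x; apply: cvgM; [exact: cvg_cst|apply: cvgM; [exact: cg|exact: cdg]].
have Mt : - M < t by move: tM; rewrite ltr_norml => /andP[].
have <- : (\int[leb]_(x in `[(- M)%R, t]) (2 * (g x * dg x))%:E = (g t ^+ 2)%:E)%E.
  by rewrite (FTC_segment g2d c2 Mt) (gM (- M)) ?normrN ?ger0_norm ?(ltW M0)// expr0n subr0.
have mp : measurable_fun setT (fun x : measurableTypeR R => (2 * `|g x * dg x|)%:E).
  apply/measurable_EFinP; apply: measurable_funM => //; apply: measurableT_comp => //.
  by apply: measurable_funM; exact: continuous_measurable_R.
apply: (@le_trans _ _ (\int[leb]_(x in `[(- M)%R, t]) (2 * `|g x * dg x|)%:E)%E).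
  apply: le_trans (lee_abs _) _; apply: le_trans (le_abse_integral _ _ _) _.
  - exact: measurable_itv.
  - apply/measurable_EFinP; apply: measurable_funTS; exact: continuous_measurable_R.
  apply: ge0_le_integral => //.
  - apply: measurableT_comp => //; apply/measurable_EFinP; apply: measurable_funTS.
    exact: continuous_measurable_R.
  - exact: measurable_funTS.
  - by move=> x _; rewrite /= lee_fin normrM ger0_norm.
apply: ge0_subset_integral => //.
Qed.

(** The fundamental theorem of calculus, and Cauchy-Schwarz against the indicator of [[s, t]]. This
    is the one-dimensional source of Poincare's inequality. *)
Lemma sqr_diff_le_integral g dg (a h s t : R) : (forall x : R, is_derive x 1 g (dg x)) ->
  continuous dg -> s \in `[a, a + h] -> t \in `[a, a + h] ->
  (((g s - g t) ^+ 2)%:E <= h%:E * \int[leb]_(x in `[a, (a + h)%R]) (dg x ^+ 2)%:E)%E.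
Proof.
move=> gd cdg.
have h0 : s \in `[a, a + h] -> 0 <= h.
  by rewrite in_itv/= => /andP[h1 h2]; have := le_trans h1 h2; rewrite lerDl.
have I0 : (0 <= \int[leb]_(x in `[a, (a + h)%R]) (dg x ^+ 2)%:E)%E.
  by apply: integral_ge0 => x _; rewrite lee_fin sqr_ge0.
wlog st : s t h0 / s < t.
  move=> H sI tI; have [st|st|->] := ltgtP s t; first exact: H.
    by rewrite -sqrrN opprB; apply: H => // _; exact: h0.
  by rewrite subrr expr0n /= mule_ge0// lee_fin h0.
move=> sI tI; have {}h0 := h0 sI.
have mdg : measurable_fun setT (dg : measurableTypeR R -> R) by exact: continuous_measurable_R.
have sub : `[s, t] `<=` `[a, (a + h)%R]%classic.
  move=> x /=; rewrite !in_itv/= in sI tI * => /andP[h1 h2].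
  move: sI tI => /andP[h3 h4] /andP[h5 h6].
  by rewrite (le_trans h3 h1) (le_trans h2 h6).
have E : (\int[leb]_x `|(dg \_ `[s, t]) x * \1_(`[s, t]) x|%:E =
          \int[leb]_(x in `[s, t]) `|dg x|%:E)%E.
  rewrite [RHS]integral_mkcond; apply: eq_integral => x _.
  by rewrite !patchE indicE; case: ifPn => _; rewrite ?mulr1// mulr0 normr0.
have m1 : measurable_fun setT (dg \_ `[s, t] : measurableTypeR R -> R).
  by apply/(measurable_restrictT _ (measurable_itv _)); exact: measurable_funTS.
have m2 : measurable_fun setT (\1_(`[s, t]) : measurableTypeR R -> R).
  by apply: measurable_indic; exact: measurable_itv.
have := integral_cauchy_schwarz leb m1 m2; rewrite E => CS.
rewrite -sqrrN opprB.
apply: (@le_trans _ _ ((\int[leb]_(x in `[s, t]) `|dg x|%:E) ^+ 2)%E).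
  have -> : ((g t - g s) ^+ 2)%:E = (`|(g t - g s)%:E| ^+ 2)%E.
    by rewrite -EFin_expe real_normK// num_real.
  rewrite -(FTC_segment gd cdg st) !expe2.
  have ab : (`|\int[leb]_(x in `[s, t]) (dg x)%:E| <= \int[leb]_(x in `[s, t]) `|dg x|%:E)%E.
    apply: le_abse_integral => //; apply/measurable_EFinP; exact: measurable_funTS.
  by apply: lee_pmul => //; exact: abse_ge0.
apply: le_trans CS _; rewrite muleC; apply: lee_pmul.
- by apply: integral_ge0 => x _; rewrite lee_fin sqr_ge0.
- by apply: integral_ge0 => x _; rewrite lee_fin sqr_ge0.
- have -> : (\int[leb]_x ((\1_(`[s, t]) x : R) ^+ 2)%:E = leb `[s, t]%classic)%E.
    transitivity (\int[leb]_x (\1_(`[s, t]) x : R)%:E)%E; last by rewrite integral_indic// setIT.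
    by apply: eq_integral => x _; rewrite indicE; case: (x \in _); rewrite ?expr1n ?expr0n.
  rewrite lebesgue_measure_itv/= lte_fin st -EFinB lee_fin.
  move: sI tI; rewrite !in_itv/= => /andP[h3 h4] /andP[h5 h6]; lra.
- have -> : (\int[leb]_x ((dg \_ `[s, t]) x ^+ 2)%:E = \int[leb]_(x in `[s, t]) (dg x ^+ 2)%:E)%E.
    rewrite [RHS]integral_mkcond; apply: eq_integral => x _.
    by rewrite !patchE; case: ifPn => _; rewrite ?expr0n.
  apply: ge0_subset_integral => //.
    by apply: measurable_funTS; apply/measurable_EFinP; exact: measurable_funX.
  by move=> x _; rewrite lee_fin sqr_ge0.
Qed.

End one_dim.

Notation R2 R := (measurableTypeR R * measurableTypeR R)%type.

Section leb2.
Variable R : realType.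
(** Named so as to carry the sigma-finiteness instance that Fubini's theorem asks for; [leb3] is the
    product of this measure with the Lebesgue measure of the line. *)
Definition leb2 : set (R2 R) -> \bar R := (@lebesgue_measure R \x @lebesgue_measure R)%E.
HB.instance Definition _ := Measure.on leb2.

Lemma leb2_prod (A B : set R) : @measurable _ (measurableTypeR R) A ->
  @measurable _ (measurableTypeR R) B ->
  leb2 (A `*` B) = (@lebesgue_measure R A * @lebesgue_measure R B)%E.
Proof. by move=> mA mB; exact: product_measure1E. Qed.

Let leb2_sigma_finite : sigma_finite setT leb2.
Proof.
pose F (n : nat) : set (measurableTypeR R) := `[- n%:R, n%:R]%classic.
exists (fun n => F n `*` F n).
  apply/seteqP; split => // -[x y] _.
  exists (maxn (Num.truncn `|x|%R).+1 (Num.truncn `|y|%R).+1) => //.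
  split; rewrite /F/= in_itv/= -ler_norml; apply: ltW; apply: lt_le_trans (truncnS_gt _) _;
    by rewrite ler_nat leq_max leqnn ?orbT.
move=> n; split; first by apply: measurableX; exact: measurable_itv.
rewrite leb2_prod; try exact: measurable_itv.
rewrite lebesgue_measure_itv/=; case: ifP => _; last by rewrite mul0e.
by rewrite -EFinB -EFinM ltry.
Qed.

HB.instance Definition _ := Measure_isSigmaFinite.Build _ _ _ leb2 leb2_sigma_finite.
End leb2.
Arguments leb2 : clear implicits.

Section tests.
Context {R : realType}.
Variable Omega : bounded_domain R.
Local Notation leb := (@lebesgue_measure R).
Implicit Types (eta : R3 R -> R).

Lemma Ccinfty_out eta p : Ccinfty Omega eta -> ~ dom Omega p -> eta p = 0.
Proof.
move=> [_ _ sub] pO; apply/eqP; apply: contra_notT pO => p0.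
by apply: sub; exact: subset_closure.
Qed.

Lemma Ccinfty_supp eta : Ccinfty Omega eta -> exists2 M : R, 0 < M &
  forall p i, M <= `|coord3 i p| -> eta p = 0.
Proof.
move=> ceta; have [M M0 OM] := dom_bounded_box Omega.
exists (M + 1); first by rewrite addr_gt0.
move=> p i Mp; apply: (Ccinfty_out ceta) => /OM /(_ i).
rewrite -ler_norml => h; have := le_trans Mp h; lra.
Qed.

Lemma Ccinfty_deriv eta j : Ccinfty Omega eta -> Ccinfty Omega ('D_(e3 R j) eta).
Proof.
move=> [sm cs sub].
have cl : closure [set x | 'D_(e3 R j) eta x != 0] `<=` closure [set x | eta x != 0].
  rewrite closureE; apply: smallest_sub; first exact: closed_closure.
  move=> x /= dx; apply: contrapT => nx; move/negP: dx; apply.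
  rewrite (@near_eq_derive _ _ _ eta (cst 0)); first by rewrite derive_cst.
  have oC : open (~` closure [set x | eta x != 0]) by rewrite openC; exact: closed_closure.
  have : nbhs x (~` closure [set x | eta x != 0]) by exact: open_nbhs_nbhs.
  apply: filterS => y ny; apply/eqP; apply: contra_notT ny => y0.
  exact: subset_closure.
split.
- by move=> k; have [_ /(_ j)[]] := sm k.+1.
- by apply: (subclosed_compact _ cs) => //; exact: closed_closure.
- exact: subset_trans cl sub.
Qed.

Lemma Ccinfty_continuous eta : Ccinfty Omega eta -> continuous eta.
Proof. by move=> [sm _ _]; exact: (Ck_continuous (sm 0)). Qed.

Lemma Ccinfty_derivable eta p j : Ccinfty Omega eta -> derivable eta p (e3 R j).
Proof. by move=> [sm _ _]; have [_ /(_ j)[]] := sm 1. Qed.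

Lemma Ccinfty_measurable eta : Ccinfty Omega eta -> measurable_fun setT eta.
Proof. by move=> /Ccinfty_continuous; exact: continuous_measurable_R3. Qed.

Lemma integral_leb_dom (g : R3 R -> \bar R) : (forall x, ~ dom Omega x -> g x = 0%E) ->
  (\int[leb_dom Omega]_x g x = \int[leb3 R]_x g x)%E.
Proof.
move=> g0; have -> : g = g \_ (dom Omega).
  apply/funext => x; rewrite patchE; case: ifPn => // /negP xO.
  by rewrite g0// => /mem_set.
rewrite -!integral_mkcond; apply: eq_measure_integral => A mA AO.
by rewrite /leb_dom/= /mrestr setIidl.
Qed.

Lemma slice0_derive eta y z : Ccinfty Omega eta -> forall x : R,
  is_derive x 1 (fun x => eta ((x, y), z)) ('D_(e3 R 0) eta ((x, y), z)).
Proof.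
move=> ceta x; have dx := @Ccinfty_derivable eta ((x, y), z) 0 ceta.
have E : (fun h : R => h^-1 *: (((fun x => eta ((x, y), z)) \o shift x) (h *: (1 : R)) - eta ((x, y), z)))
  = (fun h : R => h^-1 *: ((eta \o shift ((x, y), z)) (h *: e3 R 0) - eta ((x, y), z))).
  apply/funext => h /=; congr (_ *: (eta _ - _)).
  by congr ((_, _), _); rewrite /e3/= /GRing.scale/= ?mulr0 ?add0r.
by apply: DeriveDef; rewrite /derivable /derive E.
Qed.

Lemma slice1_derive eta x z : Ccinfty Omega eta -> forall y : R,
  is_derive y 1 (fun y => eta ((x, y), z)) ('D_(e3 R 1) eta ((x, y), z)).
Proof.
move=> ceta y; have dx := @Ccinfty_derivable eta ((x, y), z) 1 ceta.
have E : (fun h : R => h^-1 *: (((fun y => eta ((x, y), z)) \o shift y) (h *: (1 : R)) - eta ((x, y), z)))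
  = (fun h : R => h^-1 *: ((eta \o shift ((x, y), z)) (h *: e3 R 1) - eta ((x, y), z))).
  apply/funext => h /=; congr (_ *: (eta _ - _)).
  by congr ((_, _), _); rewrite /e3/= /GRing.scale/= ?mulr0 ?add0r.
by apply: DeriveDef; rewrite /derivable /derive E.
Qed.

Lemma slice2_derive eta x y : Ccinfty Omega eta -> forall z : R,
  is_derive z 1 (fun z => eta ((x, y), z)) ('D_(e3 R 2) eta ((x, y), z)).
Proof.
move=> ceta z; have dx := @Ccinfty_derivable eta ((x, y), z) 2 ceta.
have E : (fun h : R => h^-1 *: (((fun z => eta ((x, y), z)) \o shift z) (h *: (1 : R)) - eta ((x, y), z)))
  = (fun h : R => h^-1 *: ((eta \o shift ((x, y), z)) (h *: e3 R 2) - eta ((x, y), z))).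
  apply/funext => h /=; congr (_ *: (eta _ - _)).
  by congr ((_, _), _); rewrite /e3/= /GRing.scale/= ?mulr0 ?add0r.
by apply: DeriveDef; rewrite /derivable /derive E.
Qed.

Lemma slice_continuous eta : continuous eta ->
  [/\ forall y z, continuous (fun x : R => eta ((x, y), z)),
      forall x z, continuous (fun y : R => eta ((x, y), z)) &
      forall x y, continuous (fun z : R => eta ((x, y), z))].
Proof.
move=> ce; split => a b c.
- apply: (@continuous_comp _ _ _ (fun x : R => ((x, a), b) : R3 R) eta) => //; last exact: ce.
  apply: (@cvg_pair _ _ _ _ (nbhs (c, a)) (nbhs b)); last exact: cvg_cst.
  by apply: (@cvg_pair _ _ _ _ (nbhs c) (nbhs a)); [exact: cvg_id|exact: cvg_cst].
- apply: (@continuous_comp _ _ _ (fun x : R => ((a, x), b) : R3 R) eta) => //; last exact: ce.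
  apply: (@cvg_pair _ _ _ _ (nbhs (a, c)) (nbhs b)); last exact: cvg_cst.
  by apply: (@cvg_pair _ _ _ _ (nbhs a) (nbhs c)); [exact: cvg_cst|exact: cvg_id].
- apply: (@continuous_comp _ _ _ (fun x : R => ((a, b), x) : R3 R) eta) => //; last exact: ce.
  by apply: (@cvg_pair _ _ _ _ (nbhs (a, b)) (nbhs c)); [exact: cvg_cst|exact: cvg_id].
Qed.

Lemma bounded_supp_integrable d (T : measurableType d) (m : {measure set T -> \bar R})
    (A : set T) (g : T -> R) (K : R) :
  measurable A -> (m A < +oo)%E -> measurable_fun setT g -> (forall x, `|g x| <= K) ->
  (forall x, ~ A x -> g x = 0) -> m.-integrable setT (EFin \o g).
Proof.
move=> mA Aoo mg gK g0; have E : EFin \o g = (EFin \o g) \_ A.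
  by apply/funext => x; rewrite patchE; case: ifPn => // /negP xA; rewrite /= g0// => /mem_set.
rewrite E; apply/(integrable_mkcond _ mA); apply: measurable_bounded_integrable => //.
  exact: measurable_funTS.
by exists K; split; [exact: num_real|move=> M KM x _; apply: le_trans (gK x) (ltW KM)].
Qed.

Lemma Ccinfty_bounded eta : Ccinfty Omega eta -> exists2 K : R, 0 < K & forall p, `|eta p| <= K.
Proof.
move=> ceta; have [M M0 hM] := Ccinfty_supp ceta.
have : compact (eta @` cbox3 (fun=> - M) (fun=> M)).
  apply: continuous_compact; last exact: cbox3_compact.
  by apply: continuous_subspaceT; exact: Ccinfty_continuous.
move=> /compact_bounded[K [Kr hK]]; exists (Num.max K 0 + 1).
  by rewrite ltr_wpDl// le_max lexx orbT.
move=> p; have [pM|] := pselect (cbox3 (fun=> - M) (fun=> M) p).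
  apply: (hK _ _ (eta p)); last by exists p.
  by apply: (@le_lt_trans _ _ (Num.max K 0)); rewrite ?le_max ?lexx// ltrDl.
move=> /existsNP[i] /negP; rewrite -ler_norml -ltNge => /ltW /hM ->.
by rewrite normr0 addr_ge0// le_max lexx orbT.
Qed.

Lemma segment_fin (a b : R) : (leb `[a, b]%classic < +oo)%E.
Proof. by rewrite lebesgue_measure_itv/=; case: ifP => _; rewrite -?EFinB ltry. Qed.

Lemma Ccinfty_integrable3 eta : Ccinfty Omega eta -> (leb3 R).-integrable setT (EFin \o eta).
Proof.
move=> ceta; have [M M0 hM] := Ccinfty_supp ceta; have [K K0 hK] := Ccinfty_bounded ceta.
apply: (@bounded_supp_integrable _ _ _ (cbox3 (fun=> - M) (fun=> M)) _ K) => //.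
- by rewrite cbox3E; apply: measurableX; [apply: measurableX|]; exact: measurable_itv.
- by rewrite leb3_cbox3 ltry.
- exact: Ccinfty_measurable ceta.
- by move=> p /existsNP[i] /negP; rewrite -ler_norml -ltNge => /ltW /hM.
Qed.

Lemma fubini_leb3_12 (f : R3 R -> \bar R) : (leb3 R).-integrable setT f ->
  (\int[leb3 R]_x f x = \int[leb2 R]_p \int[leb]_z f (p, z))%E.
Proof. by move=> fi; rewrite -(@integral12_prod_meas1 _ _ _ _ R (leb2 R) leb f fi). Qed.

Lemma fubini_leb3_21 (f : R3 R -> \bar R) : (leb3 R).-integrable setT f ->
  (\int[leb3 R]_x f x = \int[leb]_z \int[leb2 R]_p f (p, z))%E.
Proof. by move=> fi; rewrite -(@integral21_prod_meas1 _ _ _ _ R (leb2 R) leb f fi). Qed.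

Lemma Ccinfty_integrable2 eta z : Ccinfty Omega eta ->
  (leb2 R).-integrable setT (EFin \o (fun p => eta (p, z))).
Proof.
move=> ceta; have [M M0 hM] := Ccinfty_supp ceta; have [K K0 hK] := Ccinfty_bounded ceta.
apply: (@bounded_supp_integrable _ _ (leb2 R)
  ((`[- M, M]%classic : set (measurableTypeR R)) `*` (`[- M, M]%classic : set (measurableTypeR R))) _ K) => //.
- by apply: measurableX; exact: measurable_itv.
- rewrite [X in (X < _)%E](_ : _ = (leb `[(- M)%R, M]%classic * leb `[(- M)%R, M]%classic)%E); last first.
    by apply: leb2_prod; exact: measurable_itv.
  by apply: lte_mul_pinfty; rewrite ?ge0_fin_numE ?segment_fin.
- apply: measurable_fun_pair1; exact: Ccinfty_measurable ceta.
- move=> [x y] /= h; have [xM|xM] := leP M `|x|; first exact: (hM ((x, y), z) 0).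
  have [yM|yM] := leP M `|y|; first exact: (hM ((x, y), z) 1).
  exfalso; apply: h; split; rewrite /= in_itv/= -ler_norml; exact: ltW.
Qed.

Lemma slice_supp eta : Ccinfty Omega eta -> exists2 M : R, 0 < M &
  [/\ forall y z x, M <= `|x| -> eta ((x, y), z) = 0,
      forall x z y, M <= `|y| -> eta ((x, y), z) = 0 &
      forall x y z, M <= `|z| -> eta ((x, y), z) = 0].
Proof.
move=> ceta; have [M M0 hM] := Ccinfty_supp ceta; exists M => //.
by split => a b c cM; [apply: (hM _ 0)|apply: (hM _ 1)|apply: (hM _ 2)].
Qed.

(** By Fubini the variable of differentiation can be integrated first, and along that line the
    integral of the derivative is 0. *)
Lemma integral_Ccinfty_deriv eta j : Ccinfty Omega eta ->
  (\int[leb3 R]_x ('D_(e3 R j) eta x)%:E = 0)%E.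
Proof.
move=> ceta; have [M M0 [s0 s1 s2]] := slice_supp ceta.
have cd k := Ccinfty_deriv k ceta.
have cont k := slice_continuous (Ccinfty_continuous (cd k)).
move: j; apply: I3_cases.
- rewrite (fubini_leb3_21 (Ccinfty_integrable3 (cd 0))).
  apply: integral0_eq => z _.
  rewrite -(integral21_prod_meas1 (Ccinfty_integrable2 z (cd 0))).
  apply: integral0_eq => y _; rewrite /fubini_G /=.
  apply: (integral_derive_csupp (slice0_derive y z ceta) _ M0 (s0 y z)).
  by have [c _ _] := cont 0; exact: c.
- rewrite (fubini_leb3_21 (Ccinfty_integrable3 (cd 1))).
  apply: integral0_eq => z _.
  rewrite -(integral12_prod_meas1 (Ccinfty_integrable2 z (cd 1))).
  apply: integral0_eq => x _; rewrite /fubini_F /=.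
  apply: (integral_derive_csupp (slice1_derive x z ceta) _ M0 (s1 x z)).
  by have [_ c _] := cont 1; exact: c.
- rewrite (fubini_leb3_12 (Ccinfty_integrable3 (cd 2))).
  apply: integral0_eq => -[x y] _ /=.
  apply: (integral_derive_csupp (slice2_derive x y ceta) _ M0 (s2 x y)).
  by have [_ _ c] := cont 2; exact: c.
Qed.

Lemma CcinftyM eta phi : Ccinfty Omega eta -> Ccinfty Omega phi ->
  Ccinfty Omega (fun x => eta x * phi x).
Proof.
move=> [sm cs sub] [sm' _ _].
have cl : closure [set x | eta x * phi x != 0] `<=` closure [set x | eta x != 0].
  by apply: closure_subset => x /=; apply: contra => /eqP ->; rewrite mul0r.
split.
- by move=> k; exact: CkM.
- by apply: (subclosed_compact _ cs) => //; exact: closed_closure.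
- exact: subset_trans cl sub.
Qed.

Lemma Ccinfty_integrable eta : Ccinfty Omega eta ->
  (leb_dom Omega).-integrable setT (EFin \o eta).
Proof.
move=> ceta; have [K K0 hK] := Ccinfty_bounded ceta.
apply: (@bounded_supp_integrable _ _ _ setT _ K) => //.
- by rewrite -ge0_fin_numE// leb_dom_fin.
- exact: Ccinfty_measurable ceta.
- by move=> x /(_ I).
Qed.

Lemma Ccinfty_parts eta phi j : Ccinfty Omega eta -> Ccinfty Omega phi ->
  \int[leb_dom Omega]_x (eta x * 'D_(e3 R j) phi x) =
  - \int[leb_dom Omega]_x ('D_(e3 R j) eta x * phi x).
Proof.
move=> ceta cphi; apply/eqP; rewrite -subr_eq0 opprK; apply/eqP.
rewrite -RintegralD//; last 2 first.
- exact: Ccinfty_integrable (CcinftyM ceta (Ccinfty_deriv j cphi)).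
- exact: Ccinfty_integrable (CcinftyM (Ccinfty_deriv j ceta) cphi).
rewrite /Rintegral integral_leb_dom; last first.
  by move=> x xO; rewrite (Ccinfty_out ceta xO) (Ccinfty_out cphi xO) mul0r mulr0 addr0.
have E x : eta x * 'D_(e3 R j) phi x + 'D_(e3 R j) eta x * phi x =
    'D_(e3 R j) (fun x => eta x * phi x) x.
  have := deriveM (Ccinfty_derivable (p:=x) (j:=j) ceta) (Ccinfty_derivable (p:=x) (j:=j) cphi).
  by rewrite /GRing.scale/= [phi x * _]mulrC => <-.
under eq_integral do rewrite E.
by rewrite integral_Ccinfty_deriv//; exact: CcinftyM.
Qed.

End tests.

(** * Ladyzhenskaya's inequality for test functions *)

Section ladyzhenskaya.
Context {R : realType}.
Local Notation leb := (@lebesgue_measure R).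
Local Notation leb2 := (leb2 R).

Lemma tonelli_leb3_12 (f : R3 R -> \bar R) : measurable_fun setT f -> (forall x, 0 <= f x)%E ->
  (\int[leb3 R]_x f x = \int[leb2]_p \int[leb]_z f (p, z))%E.
Proof. by move=> mf f0; exact: (@fubini_tonelli1 _ _ _ _ R leb2 leb f mf f0). Qed.

Lemma tonelli_leb3_21 (f : R3 R -> \bar R) : measurable_fun setT f -> (forall x, 0 <= f x)%E ->
  (\int[leb3 R]_x f x = \int[leb]_z \int[leb2]_p f (p, z))%E.
Proof. by move=> mf f0; exact: (@fubini_tonelli2 _ _ _ _ R leb2 leb f mf f0). Qed.

Lemma tonelli_leb2_12 (f : R2 R -> \bar R) : measurable_fun setT f -> (forall x, 0 <= f x)%E ->
  (\int[leb2]_x f x = \int[leb]_x \int[leb]_y f (x, y))%E.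
Proof. by move=> mf f0; exact: (@fubini_tonelli1 _ _ _ _ R leb leb f mf f0). Qed.

Lemma tonelli_leb2_21 (f : R2 R -> \bar R) : measurable_fun setT f -> (forall x, 0 <= f x)%E ->
  (\int[leb2]_x f x = \int[leb]_y \int[leb]_x f (x, y))%E.
Proof. by move=> mf f0; exact: (@fubini_tonelli2 _ _ _ _ R leb leb f mf f0). Qed.

Lemma measurable_leb3_inner (f : R3 R -> \bar R) : measurable_fun setT f -> (forall x, 0 <= f x)%E ->
  measurable_fun setT (fun z => \int[leb2]_p f (p, z))%E.
Proof. by move=> mf f0; exact: (@measurable_fun_fubini_tonelli_G _ _ _ _ R leb2 f mf f0). Qed.

Lemma measurable_leb3_inner_z (f : R3 R -> \bar R) : measurable_fun setT f -> (forall x, 0 <= f x)%E ->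
  measurable_fun setT (fun p => \int[leb]_z f (p, z))%E.
Proof. by move=> mf f0; exact: (@measurable_fun_fubini_tonelli_F _ _ _ _ R leb f mf f0). Qed.

(** The integral of [a] over a horizontal line depends on [y] alone and that of [b] over a vertical
    line on [x] alone, so the integral of their product over the plane factorises. *)
Lemma integral_le_prod2 (h a b : R2 R -> \bar R) :
  measurable_fun setT h -> measurable_fun setT a -> measurable_fun setT b ->
  (forall x, 0 <= h x)%E -> (forall x, 0 <= a x)%E -> (forall x, 0 <= b x)%E ->
  (forall x y, h (x, y) <= (\int[leb]_s a (s, y)) * (\int[leb]_s b (x, s)))%E ->
  (\int[leb2]_p h p <= (\int[leb2]_p a p) * (\int[leb2]_p b p))%E.
Proof.
move=> mh ma mb h0 a0 b0 hab.
have mF : measurable_fun setT (fun y => \int[leb]_s a (s, y))%E.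
  exact: (@measurable_fun_fubini_tonelli_G _ _ _ _ R leb a ma a0).
have mG : measurable_fun setT (fun x => \int[leb]_s b (x, s))%E.
  exact: (@measurable_fun_fubini_tonelli_F _ _ _ _ R leb b mb b0).
have F0 y : (0 <= \int[leb]_s a (s, y))%E by exact: integral_ge0.
have G0 x : (0 <= \int[leb]_s b (x, s))%E by exact: integral_ge0.
rewrite (tonelli_leb2_12 mh)// (tonelli_leb2_21 ma)// (tonelli_leb2_12 mb)//.
rewrite -ge0_integralZl//; last by apply: integral_ge0 => y _.
apply: ge0_le_integral => //.
- by move=> x _; exact: integral_ge0.
- exact: (@measurable_fun_fubini_tonelli_F _ _ _ _ R leb h mh h0).
- exact: measurable_funeM.
- move=> x _; rewrite -ge0_integralZr//; apply: ge0_le_integral => //.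
  + exact: measurable_fun_pair2.
  + apply: emeasurable_funM => //.
Qed.

Variable Omega : bounded_domain R.

(** In the plane at height [z], [sqr_le_integral] in the first two directions and
    [integral_le_prod2] bound the integral of [eta ^+ 4] by [A 0 z * A 1 z]. Cauchy-Schwarz gives
    [A k z ^+ 2 <= 4 * S z * d k z], hence a bound [2 * S z * (d 0 z + d 1 z)]. The third direction
    bounds [S z] by [K] uniformly in [z], and what remains is integrated in [z]. *)
Lemma ladyzhenskaya_test (eta : R3 R -> R) : Ccinfty Omega eta ->
  (\int[leb3 R]_x (eta x ^+ 4)%:E <=
    2%:E * (\int[leb3 R]_x (2 * `|eta x * 'D_(e3 R 2%R) eta x|)%:E) *
    (\int[leb3 R]_x ('D_(e3 R 0%R) eta x ^+ 2)%:E + \int[leb3 R]_x ('D_(e3 R 1%R) eta x ^+ 2)%:E))%E.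
Proof.
move=> ceta.
pose D j := (\int[leb3 R]_x ('D_(e3 R j) eta x ^+ 2)%:E)%E.
pose K := (\int[leb3 R]_x (2 * `|eta x * 'D_(e3 R 2) eta x|)%:E)%E.
change (\int[leb3 R]_x (eta x ^+ 4)%:E <= 2%:E * K * (D 0%R + D 1%R))%E.
have [M M0 [s0 s1 s2]] := slice_supp ceta.
have cd k := Ccinfty_deriv k ceta.
have cont k := slice_continuous (Ccinfty_continuous (cd k)).
have meta := Ccinfty_measurable ceta.
have md k := Ccinfty_measurable (cd k).
pose a k (p : R3 R) := (2 * `|eta p * 'D_(e3 R k) eta p|)%:E.
have ma k : measurable_fun setT (a k).
  apply/measurable_EFinP; apply: measurable_funM => //; apply: measurableT_comp => //.
  exact: measurable_funM.
have a0 k p : (0 <= a k p)%E by rewrite lee_fin.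
have S0 x y z : ((eta ((x, y), z) ^+ 2)%:E <= \int[leb]_s a 0%R ((s, y), z))%E.
  have [c _ _] := cont 0.
  exact: (sqr_le_integral (slice0_derive y z ceta) (c y z) M0 (s0 y z)).
have S1 x y z : ((eta ((x, y), z) ^+ 2)%:E <= \int[leb]_s a 1%R ((x, s), z))%E.
  have [_ c _] := cont 1.
  exact: (sqr_le_integral (slice1_derive x z ceta) (c x z) M0 (s1 x z)).
have S2 x y z : ((eta ((x, y), z) ^+ 2)%:E <= \int[leb]_s a 2%R ((x, y), s))%E.
  have [_ _ c] := cont 2.
  exact: (sqr_le_integral (slice2_derive x y ceta) (c x y) M0 (s2 x y)).
pose S z := (\int[leb2]_p (eta (p, z) ^+ 2)%:E)%E.
pose A k z := (\int[leb2]_p a k (p, z))%E.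
pose d k z := (\int[leb2]_p ('D_(e3 R k) eta (p, z) ^+ 2)%:E)%E.
have m2 (g : R3 R -> R) z : measurable_fun setT g -> measurable_fun setT (fun p => g (p, z)).
  by move=> mg; exact: measurable_fun_pair1.
have I4 z : (\int[leb2]_p (eta (p, z) ^+ 4)%:E <= A 0%R z * A 1%R z)%E.
  apply: integral_le_prod2.
  - by apply/measurable_EFinP; apply: measurable_funX; exact: m2.
  - exact: measurable_fun_pair1.
  - exact: measurable_fun_pair1.
  - by move=> p; rewrite lee_fin exprn_even_ge0.
  - by move=> p; exact: a0.
  - by move=> p; exact: a0.
  - move=> x y; have -> : (eta ((x, y), z) ^+ 4)%:E = ((eta ((x, y), z) ^+ 2)%:E * (eta ((x, y), z) ^+ 2)%:E)%E.
      by rewrite -EFinM -exprD.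
    have sq0 : (0 <= (eta ((x, y), z) ^+ 2)%:E)%E by rewrite lee_fin sqr_ge0.
    exact: (lee_pmul sq0 sq0 (S0 x y z) (S1 x y z)).
have fin (g : R3 R -> R) z : Ccinfty Omega g -> (\int[leb2]_p (g (p, z) ^+ 2)%:E)%E \is a fin_num.
  move=> cg; apply: integrable_fin_num => //.
  exact: (Ccinfty_integrable2 z (CcinftyM cg cg)).
have CS k z : ((A k z) ^+ 2 <= 4%:E * (S z * d k z))%E.
  have := @integral_cauchy_schwarz _ _ R leb2 (fun p => eta (p, z)) (fun p => 2 * 'D_(e3 R k) eta (p, z))
    (m2 _ z meta) (measurable_funM (measurable_cst _) (m2 _ z (md k))).
  rewrite (_ : (\int[_]_x `|eta (x, z) * _|%:E)%E = A k z); last first.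
    by apply: eq_integral => p _; rewrite /a mulrCA normrM [`|2|]ger0_norm.
  move=> /le_trans; apply; rewrite muleCA; apply: lee_pmul => //.
  - by apply: integral_ge0 => p _; rewrite lee_fin sqr_ge0.
  - by apply: integral_ge0 => p _; rewrite lee_fin sqr_ge0.
  - rewrite -ge0_integralZl//; last 2 first.
    + by apply/measurable_EFinP; apply: measurable_funX; exact: (m2 _ z (md k)).
    + by move=> p _; rewrite lee_fin sqr_ge0.
    by rewrite le_eqVlt; apply/orP; left; apply/eqP; apply: eq_integral => p _; rewrite -EFinM exprMn -natrX.
have AA z : (A 0%R z * A 1%R z <= 2%:E * S z * (d 0%R z + d 1%R z))%E.
  have A0 k : (0 <= A k z)%E by apply: integral_ge0 => p _; exact: a0.
  have := CS 1 z; have := CS 0 z; have := A0 0; have := A0 1.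
  have : S z \is a fin_num by exact: fin.
  have : d 0 z \is a fin_num by exact: (fin _ z (cd 0)).
  have : d 1 z \is a fin_num by exact: (fin _ z (cd 1)).
  move: (A 0%R z) (A 1%R z) (S z) (d 0%R z) (d 1%R z) => [x| |] [y| |] [s| |] [d0| |] [d1| |] //=.
  rewrite -!EFinM !lee_fin => _ _ _ y0 x0 h1 h2.
  by have := sqr_ge0 (x - y); nra.
have SK z : (S z <= K)%E.
  rewrite /K (tonelli_leb3_12 (ma 2) (a0 2)); apply: ge0_le_integral => //.
  - by move=> p _; rewrite lee_fin sqr_ge0.
  - by apply/measurable_EFinP; apply: measurable_funX; exact: (m2 _ z meta).
  - exact: measurable_leb3_inner_z.
  - by move=> [x y] _; exact: S2.
have m4 : measurable_fun setT (fun x : R3 R => (eta x ^+ 4)%:E).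
  by apply/measurable_EFinP; exact: measurable_funX.
have md2 k : measurable_fun setT (fun x : R3 R => ('D_(e3 R k) eta x ^+ 2)%:E).
  by apply/measurable_EFinP; exact: measurable_funX.
have d0 k x : (0 <= ('D_(e3 R k) eta x ^+ 2)%:E)%E by rewrite lee_fin sqr_ge0.
have e4 x : (0 <= (eta x ^+ 4)%:E)%E by rewrite lee_fin exprn_even_ge0.
have K0 : (0 <= K)%E by apply: integral_ge0 => x _; exact: (a0 2).
have DE k : D k = (\int[leb]_z d k z)%E by exact: (tonelli_leb3_21 (md2 k) (d0 k)).
rewrite (tonelli_leb3_21 m4 e4) !DE.
have dz0 k z : (0 <= d k z)%E by apply: integral_ge0 => p _; exact: d0.
have mdz k : measurable_fun setT (d k) by exact: (measurable_leb3_inner (md2 k) (d0 k)).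
have K20 : (0 <= 2%:E * K)%E by rewrite mule_ge0.
have mdd : measurable_fun setT (fun z => d 0%R z + d 1%R z)%E by exact: (emeasurable_funD (mdz 0) (mdz 1)).
have dd0 z : (0 <= d 0%R z + d 1%R z)%E by rewrite adde_ge0.
have S00 z : (0 <= S z)%E by apply: integral_ge0 => p _; rewrite lee_fin sqr_ge0.
apply: (@le_trans _ _ (\int[leb]_z (2%:E * K * (d 0%R z + d 1%R z)))%E); last first.
  rewrite (ge0_integralZl leb measurableT mdd (fun z _ => dd0 z) K20).
  have E := ge0_integralD leb measurableT (fun z _ => dz0 0 z) (mdz 0) (fun z _ => dz0 1 z) (mdz 1).
  by rewrite le_eqVlt; apply/orP; left; apply/eqP; congr (_ * _)%E; exact: E.
have h1 z : (2%:E * S z <= 2%:E * K)%E by apply: lee_wpmul2l; [rewrite lee_fin|exact: SK].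
have h2 z : (\int[leb2]_p (eta (p, z) ^+ 4)%:E <= 2%:E * K * (d 0%R z + d 1%R z))%E.
  exact: le_trans (I4 z) (le_trans (AA z) (lee_wpmul2r (dd0 z) (h1 z))).
have i40 z : (0 <= \int[leb2]_p (eta (p, z) ^+ 4)%:E)%E by apply: integral_ge0 => p _; exact: e4.
apply: (@ge0_le_integral _ _ _ leb setT measurableT _ _ (fun z _ => i40 z)
  (measurable_leb3_inner m4 e4) (measurable_funeM _ mdd) (fun z _ => h2 z)).
Qed.

End ladyzhenskaya.

(** * Friedrichs' inequality *)

Section variance.
Context {R : realType}.

(** For a measure of mass [M] this is [2 M] times the integral of the squared deviation from the
    mean. No mean value appears in it, so it can be split along coordinates. *)
Definition dblvar d (T : measurableType d) (m : {measure set T -> \bar R}) (f : T -> R) : \bar R :=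
  (\int[m]_p \int[m]_q ((f p - f q) ^+ 2)%:E)%E.

Context d1 d2 (T1 : measurableType d1) (T2 : measurableType d2).
Variables (m1 : {finite_measure set T1 -> \bar R}) (m2 : {finite_measure set T2 -> \bar R}).

Lemma dblvar_ge0 d (T : measurableType d) (m : {measure set T -> \bar R}) (f : T -> R) :
  (0 <= dblvar m f)%E.
Proof. by apply: integral_ge0 => p _; apply: integral_ge0 => q _; rewrite lee_fin sqr_ge0. Qed.

Lemma measurable_sqr_diff d (T : measurableType d) (f g : T -> R) :
  measurable_fun setT f -> measurable_fun setT g ->
  measurable_fun setT (fun x => ((f x - g x) ^+ 2)%:E).
Proof.
by move=> mf mg; apply/measurable_EFinP; apply: measurable_funX; exact: measurable_funB.
Qed.

Lemma measurable_inner_int d d' (T : measurableType d) (T' : measurableType d')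
   (m : {sigma_finite_measure set T' -> \bar R}) (k : T * T' -> \bar R) :
  measurable_fun setT k -> (forall x, 0 <= k x)%E ->
  measurable_fun setT (fun x => \int[m]_y k (x, y))%E.
Proof. by move=> mk k0; exact: (@measurable_fun_fubini_tonelli_F _ _ _ _ R m k mk k0). Qed.

Lemma ge0_integral_lin2 d (T : measurableType d) (m : {measure set T -> \bar R})
    (f g : T -> \bar R) (c1 c2 : \bar R) : (0 <= c1)%E -> (0 <= c2)%E ->
  measurable_fun setT f -> (forall x, 0 <= f x)%E ->
  measurable_fun setT g -> (forall x, 0 <= g x)%E ->
  (\int[m]_x (c1 * f x + c2 * g x) = c1 * \int[m]_x f x + c2 * \int[m]_x g x)%E.
Proof.
move=> c10 c20 mf f0 mg g0; rewrite ge0_integralD//; last 4 first.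
- by move=> x _; rewrite mule_ge0.
- exact: measurable_funeM.
- by move=> x _; rewrite mule_ge0.
- exact: measurable_funeM.
by rewrite !ge0_integralZl.
Qed.

(** The restrictions of Lebesgue measure to squares and cubes are not product measures by
    definition; agreement on rectangles suffices, by uniqueness of the product. *)
Lemma tonelli_rect (m12 : {measure set (T1 * T2) -> \bar R}) :
  (forall A B, measurable A -> measurable B -> m12 (A `*` B) = (m1 A * m2 B)%E) ->
  forall k : T1 * T2 -> \bar R, measurable_fun setT k -> (forall x, 0 <= k x)%E ->
  (\int[m12]_p k p = \int[m1]_x \int[m2]_y k (x, y))%E /\
  (\int[m12]_p k p = \int[m2]_y \int[m1]_x k (x, y))%E.
Proof.
move=> H k mk k0.
have -> : (\int[m12]_p k p = \int[(m1 \x m2)%E]_p k p)%E.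
  apply: eq_measure_integral => A mA _; symmetry.
  by apply: product_measure_unique => // *; exact: H.
by rewrite {1}(@fubini_tonelli1 _ _ _ _ R m1 m2 k mk k0) (@fubini_tonelli2 _ _ _ _ R m1 m2 k mk k0).
Qed.

(** Pass from [(x, y)] to [(x', y')] through [(x', y)]: the squared difference is at most twice the
    sum of two squares in each of which a single coordinate moves. Integrating out the coordinate
    that does not occur produces the masses. *)
Lemma dblvar_prod (m12 : {finite_measure set (T1 * T2)%type -> \bar R}) (f : T1 * T2 -> R) :
  (forall A B, measurable A -> measurable B -> m12 (A `*` B) = (m1 A * m2 B)%E) ->
  measurable_fun setT f ->
  (dblvar m12 f <=
   2%:E * m2 setT * (\int[m2]_y dblvar m1 (fun x => f (x, y))) +
   2%:E * m1 setT * (\int[m1]_x dblvar m2 (fun y => f (x, y))))%E.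
Proof.
move=> /tonelli_rect TT mf.
pose A (w : (T1 * T2) * T1) := ((f w.1 - f (w.2, w.1.2)) ^+ 2)%:E.
pose B (w : (T1 * T2) * T2) := ((f w.1 - f (w.1.1, w.2)) ^+ 2)%:E.
pose G (w : (T1 * T2) * (T1 * T2)) := ((f w.1 - f w.2) ^+ 2)%:E.
have mA : measurable_fun setT A.
  apply: measurable_sqr_diff; first exact: measurableT_comp.
  apply: (measurableT_comp mf); apply: measurable_fun_pair => //.
  exact: measurableT_comp.
have mB : measurable_fun setT B.
  apply: measurable_sqr_diff; first exact: measurableT_comp.
  apply: (measurableT_comp mf); apply: measurable_fun_pair => //.
  exact: measurableT_comp.
have mG : measurable_fun setT G.
  by apply: measurable_sqr_diff; exact: measurableT_comp.
have A0 w : (0 <= A w)%E by rewrite lee_fin sqr_ge0.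
have B0 w : (0 <= B w)%E by rewrite lee_fin sqr_ge0.
have G0 w : (0 <= G w)%E by rewrite lee_fin sqr_ge0.
pose a p := (\int[m1]_x' A (p, x'))%E.
pose b p := (\int[m2]_y' B (p, y'))%E.
have ma : measurable_fun setT a by exact: measurable_inner_int mA A0.
have mb : measurable_fun setT b by exact: measurable_inner_int mB B0.
have a0 p : (0 <= a p)%E by exact: integral_ge0.
have b0 p : (0 <= b p)%E by exact: integral_ge0.
have inner x y : (\int[m12]_q G ((x, y), q) <=
    2%:E * m2 setT * a (x, y) + 2%:E * \int[m1]_x' b (x', y))%E.
  have mGq : measurable_fun setT (fun q => G ((x, y), q)) by exact: measurable_fun_pair2.
  rewrite (TT _ mGq (fun q => G0 (x, y, q))).1.
  have mbx : measurable_fun setT (fun x' => b (x', y)) by exact: measurable_fun_pair1.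
  have mAx : measurable_fun setT (fun x' => A ((x, y), x')) by exact: measurable_fun_pair2.
  apply: (@le_trans _ _ (\int[m1]_x' (2%:E * m2 setT * A ((x, y), x') + 2%:E * b (x', y)))%E).
    apply: ge0_le_integral => //.
    - by move=> x' _; apply: integral_ge0 => y' _; exact: G0.
    - exact: (@measurable_fun_fubini_tonelli_F _ _ _ _ R m2 _ mGq (fun q => G0 (x, y, q))).
    - apply: emeasurable_funD; exact: measurable_funeM.
    move=> x' _; rewrite /fubini_F.
    have mBy : measurable_fun setT (fun y' => B ((x', y), y')) by exact: measurable_fun_pair2.
    apply: (@le_trans _ _ (\int[m2]_y' (2%:E * A ((x, y), x') + 2%:E * B ((x', y), y')))%E).
      apply: ge0_le_integral => //.
      + exact: (measurable_fun_pair2 x' mGq).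
      + apply: emeasurable_funD; [exact: measurable_cst|exact: measurable_funeM].
      move=> y' _; rewrite /G /A /B /= -!EFinM -EFinD lee_fin.
      have := sqr_ge0 ((f (x, y) - f (x', y)) - (f (x', y) - f (x', y'))); nra.
    rewrite ge0_integral_lin2// integral_cst//.
    by rewrite (muleC (A _)) muleA.
  by rewrite ge0_integral_lin2// mule_ge0.
have mab : measurable_fun setT (fun y => \int[m1]_x' b (x', y))%E.
  by apply: (@measurable_fun_fubini_tonelli_G _ _ _ _ R m1 b mb b0).
have iab0 y : (0 <= \int[m1]_x' b (x', y))%E by exact: integral_ge0.
have mH : measurable_fun setT (fun p => \int[m12]_q G (p, q))%E by exact: (@measurable_fun_fubini_tonelli_F _ _ _ _ R m12 _ mG G0).
have H0 p : (0 <= \int[m12]_q G (p, q))%E by apply: integral_ge0 => q _; exact: (G0 (p, q)).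
have -> : dblvar m12 f = (\int[m2]_y \int[m1]_x \int[m12]_q G ((x, y), q))%E by exact: (TT _ mH H0).2.
have E1 : (\int[m2]_y dblvar m1 (fun x => f (x, y)) = \int[m2]_y \int[m1]_x a (x, y))%E by [].
have E2 : (\int[m1]_x dblvar m2 (fun y => f (x, y)) = \int[m2]_y \int[m1]_x b (x, y))%E.
  rewrite -(@fubini_tonelli _ _ _ _ R m1 m2 b mb b0).
  by apply: eq_integral.
rewrite E1 E2.
have mia : measurable_fun setT (fun y => \int[m1]_x a (x, y))%E.
  by apply: (@measurable_fun_fubini_tonelli_G _ _ _ _ R m1 a ma a0).
have ia0 y : (0 <= \int[m1]_x a (x, y))%E by exact: integral_ge0.
apply: (@le_trans _ _ (\int[m2]_y (2%:E * m2 setT * (\int[m1]_x a (x, y)) +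
    2%:E * m1 setT * (\int[m1]_x' b (x', y))))%E).
  apply: ge0_le_integral => //.
  - by move=> y _; apply: integral_ge0 => x _; apply: integral_ge0 => q _; exact: (G0 (_, q)).
  - exact: (@measurable_fun_fubini_tonelli_G _ _ _ _ R m1 _ mH H0).
  - apply: emeasurable_funD; exact: measurable_funeM.
  move=> y _.
  have may : measurable_fun setT (fun x => a (x, y)) by exact: measurable_fun_pair1.
  apply: (@le_trans _ _ (\int[m1]_x (2%:E * m2 setT * a (x, y) + 2%:E * \int[m1]_x' b (x', y)))%E).
    apply: ge0_le_integral => //.
    - exact: (measurable_fun_pair1 y mH).
    - apply: emeasurable_funD; [exact: measurable_funeM|exact: measurable_cst].
  rewrite ge0_integral_lin2// ?mule_ge0// integral_cst//.
  by rewrite (muleC (integral _ _ _)) muleA.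
by rewrite ge0_integral_lin2// mule_ge0.
Qed.

Lemma measurable_dblvar_inner d (T : measurableType d) (m : {finite_measure set T -> \bar R}) (f : T -> R) :
  measurable_fun setT f -> measurable_fun setT (fun p => \int[m]_q ((f p - f q) ^+ 2)%:E)%E.
Proof.
move=> mf.
have mG : measurable_fun setT (fun w : T * T => ((f w.1 - f w.2) ^+ 2)%:E).
  by apply: measurable_sqr_diff; exact: measurableT_comp.
apply: (@measurable_fun_fubini_tonelli_F _ _ _ _ R m _ mG) => w.
by rewrite lee_fin sqr_ge0.
Qed.

Lemma dblvar_prod_le (m12 : {finite_measure set (T1 * T2)%type -> \bar R}) (f : T1 * T2 -> R)
    (G1 G2 : T1 * T2 -> \bar R) (M1 M2 c1 c2 : R) :
  (forall A B, measurable A -> measurable B -> m12 (A `*` B) = (m1 A * m2 B)%E) ->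
  measurable_fun setT f -> measurable_fun setT G1 -> measurable_fun setT G2 ->
  (forall p, 0 <= G1 p)%E -> (forall p, 0 <= G2 p)%E ->
  m1 setT = M1%:E -> m2 setT = M2%:E -> 0 <= c1 -> 0 <= c2 ->
  (forall y, dblvar m1 (fun x => f (x, y)) <= c1%:E * \int[m1]_x G1 (x, y))%E ->
  (forall x, dblvar m2 (fun y => f (x, y)) <= c2%:E * \int[m2]_y G2 (x, y))%E ->
  (dblvar m12 f <= (2 * M2 * c1)%:E * (\int[m12]_p G1 p) + (2 * M1 * c2)%:E * (\int[m12]_p G2 p))%E.
Proof.
move=> H mf mG1 mG2 G10 G20 M1E M2E c10 c20 h1 h2.
have TT := tonelli_rect H.
have M10 : 0 <= M1 by rewrite -lee_fin -M1E.
have M20 : 0 <= M2 by rewrite -lee_fin -M2E.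
apply: (le_trans (dblvar_prod H mf)); rewrite M1E M2E.
have sq0 (a b : R) : (0 <= ((a - b) ^+ 2)%:E)%E by rewrite lee_fin sqr_ge0.
apply: leeD; rewrite -EFinM.
- rewrite (EFinM (2 * M2)) -muleA; apply: lee_wpmul2l; first by rewrite lee_fin mulr_ge0.
  rewrite (TT _ mG1 G10).2 -ge0_integralZl//; last 2 first.
  + exact: (@measurable_fun_fubini_tonelli_G _ _ _ _ R m1 _ mG1 G10).
  + by move=> y _; exact: integral_ge0.
  apply: ge0_le_integral => //.
  + by move=> y _; exact: dblvar_ge0.
  + pose A (w : (T1 * T2) * T1) := ((f w.1 - f (w.2, w.1.2)) ^+ 2)%:E.
    have mA : measurable_fun setT A.
      apply: measurable_sqr_diff; first exact: measurableT_comp.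
      apply: (measurableT_comp mf); apply: measurable_fun_pair => //.
      exact: measurableT_comp.
    have A0 w : (0 <= A w)%E by rewrite lee_fin sqr_ge0.
    have ma := measurable_inner_int m1 mA A0.
    by apply: (@measurable_fun_fubini_tonelli_G _ _ _ _ R m1 _ ma) => p; exact: integral_ge0.
  + apply: measurable_funeM.
    exact: (@measurable_fun_fubini_tonelli_G _ _ _ _ R m1 _ mG1 G10).
- rewrite (EFinM (2 * M1)) -muleA; apply: lee_wpmul2l; first by rewrite lee_fin mulr_ge0.
  rewrite (TT _ mG2 G20).1 -ge0_integralZl//; last 2 first.
  + exact: (@measurable_fun_fubini_tonelli_F _ _ _ _ R m2 _ mG2 G20).
  + by move=> y _; exact: integral_ge0.
  apply: ge0_le_integral => //.
  + by move=> y _; exact: dblvar_ge0.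
  + pose A (w : (T1 * T2) * T2) := ((f w.1 - f (w.1.1, w.2)) ^+ 2)%:E.
    have mA : measurable_fun setT A.
      apply: measurable_sqr_diff; first exact: measurableT_comp.
      apply: (measurableT_comp mf); apply: measurable_fun_pair => //.
      exact: measurableT_comp.
    have A0 w : (0 <= A w)%E by rewrite lee_fin sqr_ge0.
    have ma := measurable_inner_int m2 mA A0.
    by apply: (@measurable_fun_fubini_tonelli_F _ _ _ _ R m2 _ ma) => p; exact: integral_ge0.
  + apply: measurable_funeM.
    exact: (@measurable_fun_fubini_tonelli_F _ _ _ _ R m2 _ mG2 G20).
Qed.

Lemma dblvarE d (T : measurableType d) (m : {finite_measure set T -> \bar R}) (f : T -> R) (M : R) :
  m setT = M%:E -> m.-integrable setT (EFin \o f) -> m.-integrable setT (EFin \o (fun x => f x ^+ 2)) ->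
  dblvar m f = (2 * (M * (\int[m]_x f x ^+ 2) - (\int[m]_x f x) ^+ 2))%:E.
Proof.
move=> mE i1 i2.
have ic (c : R) : m.-integrable setT (EFin \o (fun=> c)).
  by apply/integrableP; split; [exact/measurable_EFinP|rewrite integral_cst//= mE -EFinM ltry].
have lin (a b c : R) : m.-integrable setT (EFin \o (fun x => a + b * f x + c * f x ^+ 2)) /\
   \int[m]_x (a + b * f x + c * f x ^+ 2) = a * M + b * (\int[m]_x f x) + c * (\int[m]_x f x ^+ 2).
  have ib : m.-integrable setT (EFin \o (fun x => b * f x)) by exact: (integrableZl _ b i1).
  have ica : m.-integrable setT (EFin \o (fun x => c * f x ^+ 2)) by exact: (integrableZl _ c i2).
  have iab : m.-integrable setT (EFin \o (fun x => a + b * f x)) by exact: (integrableD _ (ic a) ib).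
  split; first exact: (integrableD _ iab ica).
  rewrite RintegralD// RintegralD// RintegralZl// RintegralZl//.
  by rewrite /Rintegral integral_cst//= mE -EFinM.
have inn p : (\int[m]_q ((f p - f q) ^+ 2)%:E =
    (f p ^+ 2 * M + (- (2 * f p)) * (\int[m]_x f x) + 1 * (\int[m]_x f x ^+ 2))%:E)%E.
  have [I <-] := lin (f p ^+ 2) (- (2 * f p)) 1.
  rewrite /Rintegral fineK; last exact: (integrable_fin_num _ I).
  by apply: eq_integral => q _; congr (_%:E); ring.
rewrite /dblvar; under eq_integral do rewrite inn.
set J := \int[m]_x f x; set S := \int[m]_x _.
have [I E] := lin S (- 2 * J) M.
transitivity (\int[m]_x ((S + (- 2 * J) * f x + M * f x ^+ 2)%:E))%E.
  by apply: eq_integral => q _; congr (_%:E); ring.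
rewrite -[LHS]fineK; last exact: (integrable_fin_num _ I).
by congr (_%:E); apply: etrans E _; rewrite -/J -/S; ring.
Qed.

Lemma EFin_Rintegral d (T : measurableType d) (m : {measure set T -> \bar R}) (f : T -> R) :
  m.-integrable setT (EFin \o f) -> ((\int[m]_x f x)%:E = \int[m]_x (f x)%:E)%E.
Proof. by move=> i; rewrite /Rintegral fineK//; exact: (integrable_fin_num _ i). Qed.

End variance.

(** The variance bound divided by [2 h^3]; an infinite [D] makes the conclusion trivial. *)
Lemma poincare_arith (R : realType) (h S I : R) (D : \bar R) : 0 < h -> (0 <= D)%E ->
  ((2 * (h ^+ 3 * S - I ^+ 2))%:E <= (4 * h ^+ 5)%:E * D)%E ->
  (S%:E <= (h ^- 3 * I ^+ 2)%:E + (2 * h ^+ 2)%:E * D)%E.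
Proof.
move=> h0.
have h30 : 0 < h ^+ 3 by exact: exprn_gt0.
have h20 : 0 < h ^+ 2 by exact: exprn_gt0.
case: D => [D| |]// D0; last first.
  by move=> _; rewrite gt0_muley ?lte_fin ?mulr_gt0// addey ?leey.
rewrite -!EFinM -EFinD !lee_fin => H.
rewrite -(ler_pM2l h30) mulrDr mulVKf ?gt_eqF//.
have : 4 * h ^+ 5 * D = 2 * (h ^+ 3 * (2 * h ^+ 2 * D)) by rewrite !exprS expr0; ring.
lra.
Qed.

(** * Poincare's inequality on a cube *)

Section cube.
Context {R : realType}.
Local Notation leb := (@lebesgue_measure R).
Local Notation leb2 := (leb2 R).

Definition frestr d (T : measurableType d) (m : {measure set T -> \bar R})
    (D : set T) (mD : measurable D) (moo : (m D < +oo)%E) : {finite_measure set T -> \bar R} :=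
  mfrestr mD moo.

Lemma ge0_integral_frestr d (T : measurableType d) (m : {measure set T -> \bar R})
    (D : set T) (mD : measurable D) (moo : (m D < +oo)%E) (f : T -> \bar R) :
  measurable_fun setT f -> (forall x, 0 <= f x)%E ->
  (\int[frestr mD moo]_x f x = \int[m]_(x in D) f x)%E.
Proof.
move=> mf f0; rewrite (@ge0_negligible_integral _ _ _ (frestr mD moo) setT (~` D))//; last 2 first.
- exact: measurableC.
- by rewrite /= /mfrestr /mrestr setICl measure0.
rewrite setTD setCK; apply: eq_measure_integral => A mA AD.
by rewrite /= /mfrestr /mrestr setIidl.
Qed.

Lemma segment_co_lty (a b : R) : (leb `[a, b[%classic < +oo)%E.
Proof. by rewrite lebesgue_measure_itv/=; case: ifP => _; rewrite -?EFinB ltry. Qed.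

Definition mitv (a h : R) : {finite_measure set (measurableTypeR R) -> \bar R} :=
  frestr (m := leb) (measurable_itv `[a, a + h[) (segment_co_lty a (a + h)).

Lemma leb_co (a h : R) : 0 < h -> leb `[a, (a + h)%R[%classic = h%:E.
Proof. by move=> h0; rewrite lebesgue_measure_itv/= lte_fin ltrDl h0 -EFinB addrAC subrr add0r. Qed.

Lemma integral_cst_co (a h : R) (c : \bar R) : 0 < h ->
  (\int[leb]_(q in `[a, (a + h)%R[) cst c q = c * h%:E)%E.
Proof.
move=> h0; rewrite integral_cst; last exact: measurable_itv.
by congr (_ * _)%E; exact: leb_co.
Qed.

Lemma mitvT (a h : R) : 0 < h -> mitv a h setT = h%:E.
Proof.
by move=> h0; rewrite /mitv /= /mfrestr /mrestr setTI; exact: leb_co.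
Qed.

(** Each squared difference is at most [h] times the integral of [dg ^+ 2]; two more integrations
    over an interval of length [h] give [h ^+ 3]. *)
Lemma dblvar_mitv (g dg : R -> R) (a h : R) : 0 < h -> (forall x : R, is_derive x 1 g (dg x)) ->
  continuous dg -> (dblvar (mitv a h) g <= (h ^+ 3)%:E * \int[mitv a h]_x (dg x ^+ 2)%:E)%E.
Proof.
move=> h0 gd cdg.
have mdg2 : measurable_fun setT (fun x : measurableTypeR R => (dg x ^+ 2)%:E).
  by apply/measurable_EFinP/measurable_funX; exact: continuous_measurable_R.
have mg : measurable_fun setT (g : measurableTypeR R -> R).
  by apply: continuous_measurable_R; exact: is_derive_continuous gd.
set I := (\int[mitv a h]_x _)%E.
have I0 : (0 <= I)%E by apply: integral_ge0 => x _; rewrite lee_fin sqr_ge0.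
have IE : I = (\int[leb]_(x in `[a, (a + h)%R]) (dg x ^+ 2)%:E)%E.
  rewrite /I ge0_integral_frestr//; last by move=> x; rewrite lee_fin sqr_ge0.
  by apply: (@integral_itv_bndo_bndc _ (BLeft a) (a + h)); exact: measurable_funTS.
have pt s t : `[a, a + h[%classic s -> `[a, a + h[%classic t -> (((g s - g t) ^+ 2)%:E <= h%:E * I)%E.
  have co x : `[a, a + h[%classic x -> x \in `[a, a + h].
    by rewrite /= !in_itv/= => /andP[-> /ltW ->].
  by move=> sI tI; rewrite IE; exact: (sqr_diff_le_integral gd cdg (co _ sI) (co _ tI)).
have mst (s : R) : measurable_fun setT (fun t : measurableTypeR R => ((g s - g t) ^+ 2)%:E).
  by apply: measurable_sqr_diff => //; exact: measurable_cst.
have in1 s : `[a, a + h[%classic s -> (\int[mitv a h]_q ((g s - g q) ^+ 2)%:E <= h%:E * (h%:E * I))%E.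
  move=> sI; rewrite ge0_integral_frestr//; last by move=> q; rewrite lee_fin sqr_ge0.
  have -> : (h%:E * (h%:E * I) = \int[leb]_(q in `[a, (a + h)%R[) (cst (h%:E * I) q))%E.
    by rewrite integral_cst_co// muleC.
  apply: ge0_le_integral => //.
  - by move=> t _; rewrite lee_fin sqr_ge0.
  - exact: measurable_funTS.
  - by move=> t tI; exact: pt.
rewrite /dblvar ge0_integral_frestr//; last 2 first.
- exact: (measurable_dblvar_inner (mitv a h) mg).
- by move=> s; apply: integral_ge0 => t _; rewrite lee_fin sqr_ge0.
apply: (@le_trans _ _ (\int[leb]_(q in `[a, (a + h)%R[) (cst (h%:E * (h%:E * I)) q))%E).
  apply: ge0_le_integral => //.
  - by move=> s _; apply: integral_ge0 => t _; rewrite lee_fin sqr_ge0.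
  - exact: (measurable_funTS (measurable_dblvar_inner (mitv a h) mg)).
rewrite integral_cst_co//.
by rewrite [leLHS]muleC !muleA -!EFinM exprS expr2 mulrA.
Qed.

Variables (a : 'I_3 -> R) (h : R).
Hypothesis h0 : 0 < h.

(** Half-open, so that the cells of a grid form a partition and integrals over them add up
    exactly. *)
Definition hcube : set (R3 R) :=
  (`[a 0, (a 0 + h)%R[%classic `*` `[a 1, (a 1 + h)%R[%classic) `*` `[a 2, (a 2 + h)%R[%classic.

Lemma hcube_measurable : measurable hcube.
Proof. by apply: measurableX; [apply: measurableX|]; exact: measurable_itv. Qed.

Lemma leb3_hcube : leb3 R hcube = (h ^+ 3)%:E.
Proof.
rewrite leb3_prod; try exact: measurable_itv.
by rewrite !leb_co// -!EFinM !exprS expr0 mulr1 mulrA.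
Qed.

Let sq2 : set (R2 R) := `[a 0, (a 0 + h)%R[%classic `*` `[a 1, (a 1 + h)%R[%classic.
Let msq2 : measurable sq2. Proof. by apply: measurableX; exact: measurable_itv. Qed.
Let leb2_sq2 : leb2 sq2 = (h ^+ 2)%:E.
Proof.
apply: etrans (leb2_prod _ _) _; try exact: measurable_itv.
by rewrite !leb_co// -EFinM expr2.
Qed.
Let sq2oo : (leb2 sq2 < +oo)%E. Proof. by rewrite leb2_sq2 ltry. Qed.
Let h3oo : (leb3 R hcube < +oo)%E. Proof. by rewrite leb3_hcube ltry. Qed.

Definition msq : {finite_measure set (R2 R) -> \bar R} := frestr (m := leb2) msq2 sq2oo.
Definition mcube : {finite_measure set (R3 R) -> \bar R} := frestr (m := leb3 R) hcube_measurable h3oo.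

Lemma msq_rect A B : measurable A -> measurable B ->
  msq (A `*` B) = (mitv (a 0%R) h A * mitv (a 1%R) h B)%E.
Proof.
move=> mA mB; rewrite /msq/= /mfrestr /mrestr /sq2 -setXI.
by apply: leb2_prod; apply: measurableI => //; exact: measurable_itv.
Qed.

Lemma mcube_rect A B : measurable A -> measurable B ->
  mcube (A `*` B) = (msq A * mitv (a 2%R) h B)%E.
Proof.
move=> mA mB; rewrite /mcube/= /mfrestr /mrestr /hcube -setXI /leb3.
apply: etrans (product_measure1E _ _ _ _) _ => //.
- exact: measurableI.
- by apply: measurableI => //; exact: measurable_itv.
Qed.

Variable Omega : bounded_domain R.

Definition mcubeD (eta : R3 R -> R) k := (\int[mcube]_x ('D_(e3 R k) eta x ^+ 2)%:E)%E.

(** [dblvar_prod_le] is applied twice. The square gives the constant [2 h * h^3 = 2 h^4]; the cube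
    then gives [2 h * 2 h^4 = 4 h^5] for the first two derivatives and [2 h^2 * h^3 = 2 h^5] for the
    third, which is enlarged to [4 h^5]. *)
Lemma dblvar_cube (eta : R3 R -> R) : Ccinfty Omega eta ->
  (dblvar mcube eta <= (4 * h ^+ 5)%:E * (mcubeD eta 0%R + mcubeD eta 1%R + mcubeD eta 2%R))%E.
Proof.
move=> ceta.
have meta := Ccinfty_measurable ceta.
have cd k := Ccinfty_deriv k ceta.
have cont k := slice_continuous (Ccinfty_continuous (cd k)).
pose G k (x : R3 R) := ('D_(e3 R k) eta x ^+ 2)%:E.
have mG k : measurable_fun setT (G k).
  by apply/measurable_EFinP/measurable_funX; exact: Ccinfty_measurable (cd k).
have G0 k x : (0 <= G k x)%E by rewrite lee_fin sqr_ge0.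
have h3 n : 0 <= h ^+ n by rewrite exprn_ge0// ltW.
have s0 y z : (dblvar (mitv (a 0%R) h) (fun x => eta ((x, y), z)) <=
    (h ^+ 3)%:E * \int[mitv (a 0%R) h]_x G 0%R ((x, y), z))%E.
  by have [c _ _] := cont 0; exact: (dblvar_mitv _ h0 (slice0_derive y z ceta) (c y z)).
have s1 x z : (dblvar (mitv (a 1%R) h) (fun y => eta ((x, y), z)) <=
    (h ^+ 3)%:E * \int[mitv (a 1%R) h]_y G 1%R ((x, y), z))%E.
  by have [_ c _] := cont 1; exact: (dblvar_mitv _ h0 (slice1_derive x z ceta) (c x z)).
have s2 p : (dblvar (mitv (a 2%R) h) (fun z => eta (p, z)) <=
    (h ^+ 3)%:E * \int[mitv (a 2%R) h]_z G 2%R (p, z))%E.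
  by case: p => x y; have [_ _ c] := cont 2; exact: (dblvar_mitv _ h0 (slice2_derive x y ceta) (c x y)).
have sq z : (dblvar msq (fun p => eta (p, z)) <= (2 * h ^+ 4)%:E * \int[msq]_p (G 0%R (p, z) + G 1%R (p, z)))%E.
  have mz k : measurable_fun setT (fun p : R2 R => G k (p, z)) by exact: measurable_fun_pair1.
  have := @dblvar_prod_le _ _ _ _ _ (mitv (a 0) h) (mitv (a 1) h) msq (fun p => eta (p, z))
    (fun p => G 0%R (p, z)) (fun p => G 1%R (p, z)) h h _ _ msq_rect
    (measurable_fun_pair1 z meta) (mz _) (mz _) (fun _ => G0 _ _) (fun _ => G0 _ _)
    (mitvT _ h0) (mitvT _ h0) (h3 3%N) (h3 3%N) (fun y => s0 y z) (fun x => s1 x z).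
  rewrite ge0_integralD// -ge0_muleDr ?integral_ge0// => {}h1.
  by apply: (le_trans h1); rewrite -mulrA -exprS.
have mG01 : measurable_fun setT (fun p => (G 0%R p + G 1%R p)%E) by exact: emeasurable_funD.
have msqT : msq setT = (h ^+ 2)%:E.
  by rewrite -setXTT msq_rect// !mitvT// -EFinM expr2.
have h24 : 0 <= 2 * h ^+ 4 by rewrite mulr_ge0.
have := @dblvar_prod_le _ _ _ _ _ msq (mitv (a 2) h) mcube eta
    (fun p => (G 0%R p + G 1%R p)%E) (G 2%R) (h ^+ 2) h _ _ mcube_rect
    meta mG01 (mG 2%R) (fun _ => adde_ge0 (G0 _ _) (G0 _ _)) (G0 _)
    msqT (mitvT _ h0) h24 (h3 3%N) sq s2.
move=> /le_trans; apply.
rewrite ge0_integralD//.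
have -> : 2 * h * (2 * h ^+ 4) = 4 * h ^+ 5 by rewrite !exprS expr0; ring.
have -> : 2 * h ^+ 2 * h ^+ 3 = 2 * h ^+ 5 by rewrite !exprS expr0; ring.
have fin (A B C : \bar R) : (0 <= A -> 0 <= B -> 0 <= C ->
    (4 * h ^+ 5)%:E * (A + B) + (2 * h ^+ 5)%:E * C <= (4 * h ^+ 5)%:E * (A + B + C))%E.
  move=> A0 B0 C0; rewrite [leRHS]ge0_muleDr ?adde_ge0//; apply: leeD2l.
  by apply: lee_wpmul2r => //; rewrite lee_fin; apply: ler_wpM2r; rewrite ?h3//; lra.
by apply: fin; exact: integral_ge0.
Qed.

Lemma integral_mcube (g : R3 R -> \bar R) : measurable_fun setT g -> (forall x, 0 <= g x)%E ->
  (\int[mcube]_x g x = \int[leb3 R]_(x in hcube) g x)%E.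
Proof. by move=> mg g0; rewrite /mcube ge0_integral_frestr. Qed.

Lemma poincare_cube (eta : R3 R -> R) : Ccinfty Omega eta ->
  (\int[leb3 R]_(x in hcube) (eta x ^+ 2)%:E <=
   (h ^- 3 * (\int[leb3 R]_(x in hcube) eta x) ^+ 2)%:E + (2 * h ^+ 2)%:E *
    (\int[leb3 R]_(x in hcube) ('D_(e3 R 0%R) eta x ^+ 2)%:E +
     \int[leb3 R]_(x in hcube) ('D_(e3 R 1%R) eta x ^+ 2)%:E +
     \int[leb3 R]_(x in hcube) ('D_(e3 R 2%R) eta x ^+ 2)%:E))%E.
Proof.
move=> ceta; have meta := Ccinfty_measurable ceta.
have [M M0 Mb] := Ccinfty_bounded ceta.
have cT : mcube setT = (h ^+ 3)%:E.
  by rewrite /mcube /= /mfrestr /mrestr setTI; exact: leb3_hcube.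
have bint (g : R3 R -> R) : measurable_fun setT g -> (exists M, forall x, `|g x| <= M) ->
    mcube.-integrable setT (EFin \o g).
  move=> mg [K Kb]; apply: (@le_integrable _ _ _ mcube setT measurableT _ (EFin \o (fun=> K))).
  - exact/measurable_EFinP.
  - by move=> x _ /=; rewrite lee_fin (le_trans (Kb x))// ler_norm.
  - apply/integrableP; split; first exact/measurable_EFinP.
    by rewrite integral_cst//= cT -EFinM ltry.
have m2 (g : R3 R -> R) : measurable_fun setT g -> measurable_fun setT (fun x => g x ^+ 2).
  exact: measurable_funX.
have i1 := bint _ meta (ex_intro _ M Mb).
have i2 : mcube.-integrable setT (EFin \o (fun x => eta x ^+ 2)).
  apply: bint; first exact: m2.
  by exists (M ^+ 2) => x; rewrite normrX lerXn2r ?nnegrE// (le_trans _ (Mb x)).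
have mD k : measurable_fun setT (fun x => ('D_(e3 R k) eta x ^+ 2)%:E).
  by apply/measurable_EFinP/measurable_funX; exact: Ccinfty_measurable (Ccinfty_deriv k ceta).
have sqE (g : R3 R -> R) x : (0 <= (g x ^+ 2)%:E)%E by rewrite lee_fin sqr_ge0.
pose D k := (\int[leb3 R]_(x in hcube) ('D_(e3 R k) eta x ^+ 2)%:E)%E.
have DE k : mcubeD eta k = D k.
  by apply: integral_mcube; [exact: mD|move=> x; exact: sqE].
have D0' k : (0 <= D k)%E by apply: integral_ge0.
change ((\int[leb3 R]_(x in hcube) (eta x ^+ 2)%:E <=
   (h ^- 3 * (\int[leb3 R]_(x in hcube) eta x) ^+ 2)%:E + (2 * h ^+ 2)%:E * (D 0%R + D 1%R + D 2%R))%E).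
have := dblvar_cube ceta.
rewrite (DE 0%R) (DE 1%R) (DE 2%R).
have : (0 <= D 0%R + D 1%R + D 2%R)%E by apply: adde_ge0; [apply: adde_ge0|]; exact: D0'.
move: (D 0%R + D 1%R + D 2%R)%E => {DE D0'} {}D D0.
rewrite (dblvarE cT i1 i2).
have EI : (\int[mcube]_x (eta x)%:E = \int[leb3 R]_(x in hcube) (eta x)%:E)%E.
  transitivity (\int[mcube]_(x in hcube) (eta x)%:E)%E; last first.
    apply: eq_measure_integral => A mA AD.
    by rewrite /mcube /= /mfrestr /mrestr setIidl.
  rewrite (negligible_integral _ _ i1 (N := ~` hcube)) ?setTD ?setCK//.
  - by apply: measurableC; exact: hcube_measurable.
  - by rewrite /mcube /= /mfrestr /mrestr setICl measure0.
have -> : \int[mcube]_x eta x = \int[leb3 R]_(x in hcube) eta x by exact: (congr1 fine EI).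
have <- : (\int[mcube]_x (eta x ^+ 2))%:E = (\int[leb3 R]_(x in hcube) (eta x ^+ 2)%:E)%E.
  have mE2 : measurable_fun setT (fun x => (eta x ^+ 2)%:E) by exact/measurable_EFinP/measurable_funX.
  rewrite -(integral_mcube mE2); last by move=> x; exact: sqE.
  exact: EFin_Rintegral i2.
exact: poincare_arith h0 D0.
Qed.

End cube.


Lemma L2ip_sqrt_sqr d (T : measurableType d) (R : realType) (mu : {measure set T -> \bar R})
    (u w : L2 mu) (c I : R) : 0 <= c -> L2ip u w = I -> L2ip u (Num.sqrt c *: w) ^+ 2 = c * I ^+ 2.
Proof. by move=> c0 <-; rewrite L2ipC L2ipZl exprMn sqr_sqrtr// L2ipC. Qed.

(** * Friedrichs' inequality for test functions, on a grid of cubes *)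

Section grid.
Context {R : realType}.
Variable Omega : bounded_domain R.
Local Notation leb3 := (leb3 R).

Lemma cell_unique (a h x : R) (m : nat) : 0 < h -> a <= x < a + h * m%:R ->
  exists i : 'I_m, forall j : 'I_m, (a + h * j%:R <= x < a + h * j%:R + h) = (j == i).
Proof.
move=> h0 /andP[ax xb]; pose y := (x - a) / h.
have y0 : 0 <= y by rewrite divr_ge0 ?subr_ge0// ltW.
have ym : (Num.truncn y < m)%N.
  by rewrite truncn_lt_nat// /y ltr_pdivrMr// ltrBlDl mulrC.
exists (Ordinal ym) => j.
rewrite -val_eqE/= eq_sym truncn_eq// /y ler_pdivlMr// ltr_pdivrMr// lerBrDl ltrBlDl.
by rewrite -[in RHS]natr1 mulrDl mul1r addrA ![_%:R * h]mulrC.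
Qed.

Definition corner (M h : R) n (k : 'I_n * 'I_n * 'I_n) (i : 'I_3) : R :=
  - M + h * (if i == 0 then k.1.1 : nat else if i == 1 then k.1.2 : nat else k.2 : nat)%:R.

Lemma hcube_corner (M h : R) n (x : R3 R) : 0 < h -> h * n%:R = 2 * M ->
  (forall i, - M <= coord3 i x < M) ->
  exists k0 : 'I_n * 'I_n * 'I_n, forall k, hcube (corner M h k) h x <-> k = k0.
Proof.
move=> h0 hn xM.
have c i : exists i0 : 'I_n, forall j : 'I_n, (- M + h * j%:R <= coord3 i x < - M + h * j%:R + h) = (j == i0).
  by apply: cell_unique => //; rewrite hn; have /andP[-> ?] := xM i; lra.
have [i0 h0'] := c 0; have [i1 h1'] := c 1; have [i2 h2'] := c 2.
exists (i0, i1, i2) => -[[k0 k1] k2]; rewrite /hcube /corner/=.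
have e (a b : R) y : `[a, b[%classic y = (a <= y < b) :> Prop by rewrite /= in_itv.
split=> [[[]]|[-> -> ->]].
- by rewrite /= !in_itv/= (h0' k0) (h1' k1) (h2' k2) => /eqP-> /eqP-> /eqP->.
- by split; [split|]; rewrite /= !in_itv/=; [rewrite (h0' i0)|rewrite (h1' i1)|rewrite (h2' i2)].
Qed.

Lemma integral_grid (M h : R) n (g : R3 R -> \bar R) : 0 < h -> h * n%:R = 2 * M ->
  measurable_fun setT g -> (forall x, 0 <= g x)%E ->
  (forall x, ~ (forall i, - M <= coord3 i x < M) -> g x = 0%E) ->
  (\sum_(k : 'I_n * 'I_n * 'I_n) \int[leb3]_(x in hcube (corner M h k) h) g x = \int[leb3]_x g x)%E.
Proof.
move=> h0 hn mg g0 gM.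
under eq_bigr do rewrite integral_mkcond.
rewrite -ge0_integral_sum//; last 2 first.
- by move=> k; apply/(measurable_restrictT _ (hcube_measurable _ _)); exact: measurable_funTS.
- by move=> k x _; rewrite /patch; case: ifP.
apply: eq_integral => x _.
have [xM|/gM gx] := pselect (forall i, - M <= coord3 i x < M); last first.
  by rewrite big1 ?gx// => k _; rewrite /patch gx; case: ifP.
have [k0 hk] := hcube_corner h0 hn xM.
rewrite (bigD1 k0)//= big1 ?adde0 => [|k kk0].
  by rewrite /patch mem_set//; apply/hk.
by rewrite /patch memNset// => /hk /eqP; rewrite (negbTE kk0).
Qed.

Definition cellfun (h : R) (a : 'I_3 -> R) (x : R3 R) : R := \1_(hcube a h) x.

Lemma cellfun_L2 (h : R) a : exists w : L2 (leb_dom Omega), L2_fun w = cellfun h a %[ae leb_dom Omega].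
Proof.
have mc : measurable_fun setT (cellfun h a).
  exact: (@measurable_indic _ (R3 R) R setT _ (hcube_measurable a h)).
apply: Lfun2_L2; apply: measurable_sqr_Lfun2 => //.
apply: (@le_lt_trans _ _ (\int[leb_dom Omega]_x (cst 1%E x))%E).
  apply: ge0_le_integral => //.
  - by move=> x _; rewrite lee_fin sqr_ge0.
  - by apply/measurable_EFinP/measurable_funX.
  move=> x _; rewrite lee_fin /cellfun indicE; case: (_ \in _); rewrite ?expr1n// expr0n/=; exact: ler01.
rewrite integral_cst// mul1e; have := leb_dom_fin Omega.
by rewrite ge0_fin_numE.
Qed.

Lemma L2ip_cellfun (h : R) a eta (u w : L2 (leb_dom Omega)) : Ccinfty Omega eta ->
  L2_fun u = eta %[ae leb_dom Omega] -> L2_fun w = cellfun h a %[ae leb_dom Omega] ->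
  L2ip u w = \int[leb3]_(x in hcube a h) eta x.
Proof.
move=> ceta ueta wE.
have mc : measurable_fun setT (cellfun h a).
  exact: (@measurable_indic _ (R3 R) R setT _ (hcube_measurable a h)).
have E : (\int[leb_dom Omega]_x (eta x * cellfun h a x)%:E = \int[leb3]_(x in hcube a h) (eta x)%:E)%E.
  apply: etrans.
    apply: (@integral_leb_dom _ Omega (fun x => (eta x * cellfun h a x)%:E)) => x xO.
    by rewrite (Ccinfty_out ceta xO) mul0r.
  rewrite [RHS]integral_mkcond; apply: eq_integral => x _.
  by rewrite /patch /cellfun indicE; case: (x \in _); rewrite ?mulr1 ?mulr0.
by apply: etrans (L2ip_fun (Ccinfty_measurable ceta) mc ueta wE) _; exact: (congr1 fine E).
Qed.

Lemma sume_lin3 (K : finType) (s : K -> R) (c : R) (Dk : 'I_3 -> K -> \bar R) (D : 'I_3 -> \bar R) :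
  (forall j k, 0 <= Dk j k)%E -> (forall j, \sum_k Dk j k = D j)%E ->
  (\sum_k ((s k)%:E + c%:E * (Dk 0%R k + Dk 1%R k + Dk 2%R k)) =
   \sum_k (s k)%:E + c%:E * (D 0%R + D 1%R + D 2%R))%E.
Proof.
move=> Dk0 SD; rewrite big_split/= -ge0_sume_distrr; last by move=> k _; apply: adde_ge0 => //; exact: adde_ge0.
by rewrite !big_split/= !SD.
Qed.

Lemma fin_lin3 (K : finType) (s t : K -> R) (c e a : R) (D D' : 'I_3 -> \bar R) :
  c <= e -> (forall j, D j \is a fin_num) -> (forall j, 0 <= D j)%E ->
  (forall k, t k = s k) -> (forall j, D' j = D j) ->
  (a%:E <= \sum_k (s k)%:E + c%:E * (D 0%R + D 1%R + D 2%R))%E ->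
  a <= \sum_k t k + e * \sum_j fine (D' j).
Proof.
move=> ce Df D0 /funext -> /funext ->.
have -> : (c%:E * (D 0%R + D 1%R + D 2%R) = (c * (fine (D 0) + fine (D 1) + fine (D 2)))%:E)%E.
  by rewrite EFinM !EFinD !fineK.
rewrite sumEFin -EFinD lee_fin => main.
rewrite (le_trans main)// lerD2l !big_ord_recl big_ord0 addr0.
have -> : lift ord0 ord0 = 1 :> 'I_3 by apply/val_inj.
have -> : lift ord0 (lift ord0 ord0) = 2 :> 'I_3 by apply/val_inj.
rewrite -addrA; apply: ler_wpM2r => //.
by rewrite !addr_ge0// fine_ge0.
Qed.

(** A cube around the domain is cut into cells of side [h] with [2 h^2 <= e], and Poincare's
    inequality is summed over the cells. The functions [w k] are the indicators of the cells times
    [h^(-3/2)], so that the squared inner products are the mean-value terms [h^-3] times the squared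
    integrals. *)
Lemma friedrichs_test (e : R) : 0 < e ->
  exists (K : finType) (w : K -> L2 (leb_dom Omega)), forall eta, Ccinfty Omega eta ->
  forall u : L2 (leb_dom Omega), L2_fun u = eta %[ae leb_dom Omega] ->
  `|u| ^+ 2 <= \sum_k (L2ip u (w k)) ^+ 2 +
     e * \sum_j fine (\int[leb_dom Omega]_x ('D_(e3 R j) eta x ^+ 2)%:E).
Proof.
move=> e0; have [M0 M00 domM0] := dom_bounded_box Omega.
(* The enlargement makes the closed bounding box fit in the half-open cube that is cut into
   cells. *)
pose M := M0 + 1; have M_gt0 : 0 < M by rewrite /M; lra.
have domM x : dom Omega x -> forall i, - M <= coord3 i x < M.
  by move=> /domM0 xM i; move: (xM i) => /andP[]; rewrite /M; lra.
(* With [h = 2 M / m] one has [2 h^2 = 8 M^2 / m^2], which is at most [e] since [m >= 1] and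
   [m >= 8 M^2 / e]. *)
pose m := (Num.truncn (8 * M ^+ 2 / e + 1)).+1.
have m1 : 8 * M ^+ 2 / e + 1 < m%:R.
  exact: truncnS_gt.
have M2e : 0 <= 8 * M ^+ 2 / e by rewrite divr_ge0 ?mulr_ge0 ?sqr_ge0// ltW.
have m0 : 0 < m%:R :> R by lra.
pose h := 2 * M / m%:R.
have h0 : 0 < h by rewrite divr_gt0// mulr_gt0.
have hn : h * m%:R = 2 * M by rewrite /h mulfVK// gt_eqF.
have he : 2 * h ^+ 2 <= e.
  have : 8 * M ^+ 2 <= e * m%:R ^+ 2.
    rewrite -ler_pdivrMl// [_^-1 * _]mulrC; nra.
  have hm2 : h ^+ 2 * m%:R ^+ 2 = 4 * M ^+ 2 by rewrite -exprMn hn exprMn; ring.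
  by move=> H; rewrite -(ler_pM2r (exprn_gt0 2 m0)) -mulrA hm2; lra.
pose K : finType := ('I_m * 'I_m * 'I_m)%type.
pose W (k : K) := projT1 (cid (cellfun_L2 h (corner M h k))).
have WE k : L2_fun (W k) = cellfun h (corner M h k) %[ae leb_dom Omega] by exact: projT2 (cid (cellfun_L2 h (corner M h k))).
exists K, (fun k => (Num.sqrt (h ^- 3)) *: W k) => eta ceta u ueta.
have h3 : 0 <= h ^- 3 by rewrite invr_ge0 exprn_ge0// ltW.
have meta := Ccinfty_measurable ceta.
have ip k : L2ip u (Num.sqrt (h ^- 3) *: W k) ^+ 2 = h ^- 3 * (\int[leb3]_(x in hcube (corner M h k) h) eta x) ^+ 2.
  suff E : L2ip u (W k) = \int[leb3]_(x in hcube (corner M h k) h) eta x.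
    exact: L2ip_sqrt_sqr h3 E.
  exact: L2ip_cellfun ceta ueta (WE k).
have [mD G0] : (forall j, measurable_fun setT (fun x => ('D_(e3 R j) eta x ^+ 2)%:E)) /\
   (forall j, (0 <= \int[leb3]_x ('D_(e3 R j) eta x ^+ 2)%:E)%E).
  split=> j; last by apply: integral_ge0 => x _; rewrite lee_fin sqr_ge0.
  by apply/measurable_EFinP/measurable_funX; exact: Ccinfty_measurable (Ccinfty_deriv j ceta).
have me : measurable_fun setT (fun x => (eta x ^+ 2)%:E).
  exact/measurable_EFinP/measurable_funX.
pose Q (k : K) := hcube (corner M h k) h.
pose D j := (\int[leb3]_x ('D_(e3 R j) eta x ^+ 2)%:E)%E.
pose Dk j (k : K) := (\int[leb3]_(x in Q k) ('D_(e3 R j) eta x ^+ 2)%:E)%E.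
have Dk0 j k : (0 <= Dk j k)%E by apply: integral_ge0 => x _; rewrite lee_fin sqr_ge0.
have SD j : (\sum_k Dk j k = D j)%E.
  apply: (integral_grid h0 hn (mD j)) => [x|x xM]; first by rewrite lee_fin sqr_ge0.
  by rewrite (Ccinfty_out (Ccinfty_deriv j ceta)) ?expr0n// => /domM.
have Dfin j : D j \is a fin_num.
  have cj := Ccinfty_deriv j ceta.
  by have := integrable_fin_num measurableT (Ccinfty_integrable3 (CcinftyM cj cj)).
have E1 : ((`|u| ^+ 2)%:E = \int[leb3]_x (eta x ^+ 2)%:E)%E.
  rewrite -L2_norm_integral -(@integral_leb_dom _ Omega); last first.
    by move=> x /(Ccinfty_out ceta) ->; rewrite expr0n.
  apply: ae_eq_integral => //.
  - by apply/measurable_EFinP/measurable_funX; exact: L2_fun_measurable.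
  - by apply: filterS ueta => x hx _; rewrite hx.
have E2 j : (\int[leb_dom Omega]_x ('D_(e3 R j) eta x ^+ 2)%:E = D j)%E.
  apply: integral_leb_dom => x /(Ccinfty_out (Ccinfty_deriv j ceta)) ->.
  by rewrite expr0n.
have main : ((`|u| ^+ 2)%:E <= \sum_k (h ^- 3 * (\int[leb3]_(x in Q k) eta x) ^+ 2)%:E +
   (2 * h ^+ 2)%:E * (D 0%R + D 1%R + D 2%R))%E.
  have E3 : (\sum_k \int[leb3]_(x in Q k) (eta x ^+ 2)%:E = \int[leb3]_x (eta x ^+ 2)%:E)%E.
    apply: (integral_grid h0 hn me) => [x|x xM]; first by rewrite lee_fin sqr_ge0.
    by rewrite (Ccinfty_out ceta) ?expr0n// => /domM.
  rewrite E1 -E3.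
  apply: (@le_trans _ _ (\sum_k ((h ^- 3 * (\int[leb3]_(x in Q k) eta x) ^+ 2)%:E +
       (2 * h ^+ 2)%:E * (Dk 0%R k + Dk 1%R k + Dk 2%R k)))%E).
    by apply: lee_sum => k _; exact: (poincare_cube _ h0 ceta).
  by rewrite (sume_lin3 _ _ Dk0 SD).
exact: fin_lin3 he Dfin (fun j => G0 j) ip E2 main.
Qed.
End grid.

(** * Weak derivatives and the spaces H^1_0 and L^4 *)

Lemma sum_I3 (V : nmodType) (F : 'I_3 -> V) : \sum_j F j = F 0 + F 1 + F 2.
Proof.
rewrite !big_ord_recl big_ord0 addr0 addrA.
have -> : lift ord0 ord0 = 1 :> 'I_3 by apply/val_inj.
by have -> : lift ord0 (lift ord0 ord0) = 2 :> 'I_3 by apply/val_inj.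
Qed.

Lemma lt_sqr_sum3 (R : realFieldType) (x e : R) (F : 'I_3 -> R) : 0 <= x -> x < e / 2 ->
  (forall j, 0 <= F j) -> (forall j, F j < e / 2) -> x ^+ 2 + \sum_j F j ^+ 2 < e ^+ 2.
Proof.
move=> x0 xe F0 Fe.
have lt2 (y : R) : 0 <= y -> y < e / 2 -> y ^+ 2 < e ^+ 2 / 4.
  move=> y0 ye; have -> : e ^+ 2 / 4 = (e / 2) ^+ 2 by rewrite !expr2; field.
  by rewrite ltr_sqr ?nnegrE// ltW// (le_lt_trans y0).
rewrite sum_I3; have := lt2 _ x0 xe; have := lt2 _ (F0 0) (Fe 0).
have := lt2 _ (F0 1) (Fe 1); have := lt2 _ (F0 2) (Fe 2); lra.
Qed.

Section real_limits.
Context {R : realType} {T : Type} (F : set_system T) {FF : Filter F}.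

Lemma cvg_sqr (f : T -> R) (l : R) : f x @[x --> F] --> l -> f x ^+ 2 @[x --> F] --> l ^+ 2.
Proof. by move=> h; under eq_fun do rewrite expr2; rewrite expr2; exact: cvgM. Qed.

Lemma cvg_sumR (I : finType) (f : I -> T -> R) (l : I -> R) :
  (forall i, f i x @[x --> F] --> l i) -> \sum_i f i x @[x --> F] --> \sum_i l i.
Proof. by move=> h; apply: cvg_big => // -[x y]; exact: add_continuous. Qed.

End real_limits.

Section L2_more.
Context {d} {T : measurableType d} {R : realType}.
Variable mu : {measure set T -> \bar R}.
Local Notation L2 := (L2 mu).

Lemma L2ipDr (u v w : L2) : L2ip w (u + v) = L2ip w u + L2ip w v.
Proof. by rewrite L2ipC L2ipDl !(L2ipC w). Qed.

Lemma L2ipZr a (u w : L2) : L2ip w (a *: u) = a * L2ip w u.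
Proof. by rewrite L2ipC L2ipZl (L2ipC w). Qed.

Lemma L2ipNl (u w : L2) : L2ip (- u) w = - L2ip u w.
Proof. by rewrite -scaleN1r L2ipZl mulN1r. Qed.

Lemma L2ipBl (u v w : L2) : L2ip (u - v) w = L2ip u w - L2ip v w.
Proof. by rewrite L2ipDl L2ipNl. Qed.

Lemma L2ipBr (u v w : L2) : L2ip w (u - v) = L2ip w u - L2ip w v.
Proof. by rewrite L2ipC L2ipBl !(L2ipC w). Qed.

Lemma L2_norm2B (u v : L2) : `|u - v| ^+ 2 = `|u| ^+ 2 - 2 * L2ip u v + `|v| ^+ 2.
Proof. by rewrite -!L2ip_norm L2ipBl !L2ipBr (L2ipC v u); ring. Qed.

Lemma L2ip_sqr_le (u v : L2) : L2ip u v ^+ 2 <= `|u| ^+ 2 * `|v| ^+ 2.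
Proof.
have [v0|v0] := eqVneq v 0.
  have -> : L2ip u v = 0 by rewrite v0 -(scale0r (0 : L2)) L2ipZr mul0r.
  by rewrite expr0n/= mulr_ge0 ?sqr_ge0.
have nv : 0 < `|v| ^+ 2 by rewrite exprn_gt0// normr_gt0.
have := sqr_ge0 `|u - (L2ip u v / `|v| ^+ 2) *: v|.
rewrite L2_norm2B L2ipZr normrZ exprMn.
set I := L2ip u v; set V := `|v| ^+ 2; set U := `|u| ^+ 2.
have -> : `|I / V| ^+ 2 * V = I ^+ 2 / V.
  by rewrite real_normK ?num_real// expr2; field; rewrite gt_eqF.
have -> : 2 * (I / V * I) = 2 * (I ^+ 2 / V) by rewrite expr2; ring.
rewrite -(pmulr_lge0 _ nv) => H.
have : I ^+ 2 / V * V = I ^+ 2 by rewrite mulfVK// gt_eqF.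
rewrite /V in H *; lra.
Qed.

Lemma L2ip_le (u v : L2) : `|L2ip u v| <= `|u| * `|v|.
Proof.
rewrite -ler_sqr ?nnegrE ?mulr_ge0// exprMn real_normK ?num_real//; exact: L2ip_sqr_le.
Qed.

Definition toL2 (f : T -> R) : L2 := xget 0 [set w | L2_fun w = f %[ae mu]].

Lemma toL2E (f : T -> R) : f \in Lfun mu 2%:E -> L2_fun (toL2 f) = f %[ae mu].
Proof. by move=> /Lfun2_L2[w wf]; rewrite /toL2; case: xgetP => // /(_ w) /(_ wf). Qed.

Lemma toL2_eq (w : L2) (f : T -> R) : L2_fun w = f %[ae mu] -> toL2 f = w.
Proof.
move=> wf; apply: L2_funP; rewrite /toL2; case: xgetP => [u _ /= uf|/(_ w)]; last by [].
by apply: filterS2 uf wf => x h1 h2 _; rewrite h1// h2.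
Qed.

Lemma L2ip_cvg (u_ : nat -> L2) (u w : L2) : u_ n @[n --> \oo] --> u ->
  L2ip (u_ n) w @[n --> \oo] --> L2ip u w.
Proof.
move=> uu; apply/cvgrPdist_lt => e e0.
move/cvgrPdist_lt : uu => /(_ (e / (`|w| + 1))) [|N _ HN].
  by rewrite divr_gt0// ltr_wpDl.
exists N => // n /HN /= h; rewrite -L2ipBl; apply: (le_lt_trans (L2ip_le _ _)).
have w1 : 0 < `|w| + 1 by rewrite ltr_wpDl.
have : `|u - u_ n| * `|w| <= `|u - u_ n| * (`|w| + 1) by rewrite ler_wpM2l// lerDl.
move=> /le_lt_trans; apply; by rewrite -ltr_pdivlMr.
Qed.

End L2_more.

Section weak_derivatives.
Context {R : realType}.
Variable Omega : bounded_domain R.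
Local Notation mu := (leb_dom Omega).
Local Notation L2s := (L2 mu).
Local Notation D j eta := ('D_(e3 R j) eta).
Local Notation toL2 := (toL2 mu).

Lemma Ccinfty_Lfun2 eta : Ccinfty Omega eta -> eta \in Lfun mu 2%:E.
Proof.
move=> ceta; apply: measurable_sqr_Lfun2; first exact: (Ccinfty_measurable ceta).
have /integrableP[_] := Ccinfty_integrable (CcinftyM ceta ceta).
apply: le_lt_trans; apply: ge0_le_integral => //.
- by move=> x _; rewrite lee_fin sqr_ge0.
- by apply/measurable_EFinP/measurable_funX; exact: (Ccinfty_measurable ceta).
- apply: measurableT_comp => //; apply/measurable_EFinP.
  exact: Ccinfty_measurable (CcinftyM ceta ceta).
- by move=> x _ /=; rewrite lee_fin expr2 ler_norm.
Qed.

Lemma toL2_test eta : Ccinfty Omega eta -> L2_fun (toL2 eta) = eta %[ae mu].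
Proof. by move=> /Ccinfty_Lfun2; exact: toL2E. Qed.

Lemma integral_test (u : L2s) eta : Ccinfty Omega eta ->
  \int[mu]_x (L2_fun u x * eta x) = L2ip u (toL2 eta).
Proof.
move=> ceta; rewrite (L2ip_fun (L2_fun_measurable u) (Ccinfty_measurable ceta) _ (toL2_test ceta))//.
exact: nearW.
Qed.

Lemma is_weak_partialE j (u g : L2s) : is_weak_partial j u g <->
  forall eta, Ccinfty Omega eta -> L2ip u (toL2 (D j eta)) = - L2ip g (toL2 eta).
Proof.
split=> h eta ceta; have cD := Ccinfty_deriv j ceta.
- by rewrite -!integral_test//; exact: h.
- by rewrite !integral_test//; exact: h.
Qed.

Lemma L2_test_ip_eq0 (u : L2s) : (forall eta, Ccinfty Omega eta -> L2ip u (toL2 eta) = 0) -> u = 0.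
Proof. by move=> h; apply: L2_test_eq0 => eta ceta; rewrite integral_test// h. Qed.

Lemma weak_partial_unique j (u g g' : L2s) : is_weak_partial j u g -> is_weak_partial j u g' -> g = g'.
Proof.
move=> /is_weak_partialE h /is_weak_partialE h'; apply/eqP; rewrite -subr_eq0; apply/eqP.
apply: L2_test_ip_eq0 => eta ceta; rewrite L2ipBl.
by have := h _ ceta; rewrite h'// => /oppr_inj ->; rewrite subrr.
Qed.

Lemma weak_partial_eq j (u g : L2s) : is_weak_partial j u g -> weak_partial j u = g.
Proof.
move=> ug; rewrite /weak_partial; case: xgetP => [g' _ /= ug'|/(_ g)]; last by [].
exact: weak_partial_unique ug' ug.
Qed.

Lemma weak_partialP j (u : L2s) : H1_space u -> is_weak_partial j u (weak_partial j u).
Proof. by move=> /(_ j)[g ug]; rewrite (weak_partial_eq ug). Qed.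

Lemma is_weak_partialD j (u v g h : L2s) : is_weak_partial j u g -> is_weak_partial j v h ->
  is_weak_partial j (u + v) (g + h).
Proof.
move=> /is_weak_partialE h1 /is_weak_partialE h2; apply/is_weak_partialE => eta ceta.
by rewrite !L2ipDl h1// h2// opprD.
Qed.

Lemma is_weak_partialZ j a (u g : L2s) : is_weak_partial j u g -> is_weak_partial j (a *: u) (a *: g).
Proof.
move=> /is_weak_partialE h1; apply/is_weak_partialE => eta ceta.
by rewrite !L2ipZl h1// mulrN.
Qed.

Lemma is_weak_partialB j (u v g h : L2s) : is_weak_partial j u g -> is_weak_partial j v h ->
  is_weak_partial j (u - v) (g - h).
Proof.
move=> /is_weak_partialE h1 /is_weak_partialE h2; apply/is_weak_partialE => eta ceta.
by rewrite !L2ipBl h1// h2// opprB opprK addrC.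
Qed.

Lemma is_weak_partial_test j eta : Ccinfty Omega eta -> is_weak_partial j (toL2 eta) (toL2 (D j eta)).
Proof.
move=> ceta phi cphi; have cD := Ccinfty_deriv j ceta; have cp := Ccinfty_deriv j cphi.
have e (f g : R3 R -> R) : Ccinfty Omega f -> Ccinfty Omega g ->
    \int[mu]_x (L2_fun (toL2 f) x * g x) = \int[mu]_x (f x * g x).
  move=> cf cg; rewrite integral_test//.
  exact: (L2ip_fun (Ccinfty_measurable cf) (Ccinfty_measurable cg) (toL2_test cf) (toL2_test cg)).
by rewrite !e//; exact: Ccinfty_parts.
Qed.

Lemma weak_partial_test j eta : Ccinfty Omega eta -> weak_partial j (toL2 eta) = toL2 (D j eta).
Proof. by move=> c; apply: weak_partial_eq; exact: is_weak_partial_test. Qed.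

Lemma CcinftyL (a : R) eta phi : Ccinfty Omega eta -> Ccinfty Omega phi ->
  Ccinfty Omega (fun x => a * eta x + phi x).
Proof.
move=> [sm cs sub] [sm' cs' sub'].
have cl : closure [set x | a * eta x + phi x != 0] `<=`
    closure [set x | eta x != 0] `|` closure [set x | phi x != 0].
  rewrite -closureU; apply: closure_subset => x /=.
  by have [->|] := eqVneq (eta x) 0; [rewrite mulr0 add0r; right|left].
split.
- by move=> k; apply: CkD => //; apply: CkM => //; exact: Ck_cst.
- by apply: (subclosed_compact _ (compactU cs cs')) => //; exact: closed_closure.
- by apply: (subset_trans cl) => x [/sub|/sub'].
Qed.

Lemma toL2_lin (a : R) eta phi : Ccinfty Omega eta -> Ccinfty Omega phi ->
  toL2 (fun x => a * eta x + phi x) = a *: toL2 eta + toL2 phi.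
Proof.
move=> c1 c2; apply: toL2_eq.
have e1 := L2_funD (a *: toL2 eta) (toL2 phi); have e2 := L2_funZ a (toL2 eta).
have e3 := toL2_test c1; have e4 := toL2_test c2.
apply: filterS2 e1 (filterI e2 (filterI e3 e4)) => x h1 [h2 [h3 h4]] _.
by rewrite h1//= h2//= h3// h4.
Qed.

Lemma Dlin (a : R) eta phi j : Ccinfty Omega eta -> Ccinfty Omega phi ->
  D j (fun x => a * eta x + phi x) = (fun x => a * D j eta x + D j phi x).
Proof.
move=> c1 c2; apply/funext => x; have d1 : derivable eta x (e3 R j) := Ccinfty_derivable c1; have d2 : derivable phi x (e3 R j) := Ccinfty_derivable c2.
have d3 : derivable (a *: eta) x (e3 R j) by exact: derivableZ.
by have := deriveD d3 d2; rewrite (deriveZ _ d1).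
Qed.

(** The identity defining a weak derivative passes to the limit: both of its sides are continuous in
    L^2, and test functions satisfy it through integration by parts. *)
Lemma H10_intro (u : L2s) (g : 'I_3 -> L2s) : (forall e : R, 0 < e ->
    exists eta, [/\ Ccinfty Omega eta, `|u - toL2 eta| < e & forall j, `|g j - toL2 (D j eta)| < e]) ->
  H10_space u /\ forall j, weak_partial j u = g j.
Proof.
move=> h.
have wg j : is_weak_partial j u (g j).
  apply/is_weak_partialE => phi cphi; apply/eqP; rewrite -subr_eq0 opprK -normr_eq0.
  rewrite eq_le normr_ge0 andbT; apply/ler_addgt0Pl => e e0; rewrite addr0.
  pose C := `|toL2 (D j phi)| + `|toL2 phi| + 1.
  have C0 : 0 < C by rewrite /C ltr_wpDl.
  have [eta [ceta h1 h2]] := h (e / C) (divr_gt0 e0 C0).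
  have /is_weak_partialE/(_ phi cphi) E := is_weak_partial_test j ceta.
  have -> : L2ip u (toL2 (D j phi)) + L2ip (g j) (toL2 phi) =
      L2ip (u - toL2 eta) (toL2 (D j phi)) + L2ip (g j - toL2 (D j eta)) (toL2 phi).
    by rewrite !L2ipBl E; ring.
  apply: (le_trans (ler_normD _ _)).
  apply: (@le_trans _ _ (e / C * `|toL2 (D j phi)| + e / C * `|toL2 phi|)).
    by apply: lerD; apply: (le_trans (L2ip_le _ _)); apply: ler_wpM2r => //; apply: ltW => //; exact: h2.
  rewrite -mulrDr mulrAC ler_pdivrMr//; apply: ler_wpM2l; first exact: ltW.
  by rewrite /C lerDl.
split=> [|j]; last exact: weak_partial_eq (wg j).
split=> [j|e e0]; first by exists (g j).
have e20 : 0 < e / 2 by rewrite divr_gt0.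
have [eta [ceta h1 h2]] := h (e / 2) e20.
exists (toL2 eta); split; first by exists eta => //; exact: toL2_test.
rewrite /H1_norm -ltr_sqr ?nnegrE ?sqrtr_ge0// 1?ltW// sqr_sqrtr; last first.
  by rewrite addr_ge0 ?sqr_ge0// sumr_ge0// => j _; exact: sqr_ge0.
under eq_bigr => j _ do rewrite (weak_partial_eq (is_weak_partialB (wg j) (is_weak_partial_test j ceta))).
by apply: lt_sqr_sum3.
Qed.

Lemma H10_approx (u : L2s) (e : R) : H10_space u -> 0 < e ->
  exists eta, [/\ Ccinfty Omega eta, `|u - toL2 eta| < e &
    forall j, `|weak_partial j u - toL2 (D j eta)| < e].
Proof.
move=> [u1 ua] e0; have [v [[eta ceta veta] hn]] := ua e e0.
have vE := toL2_eq veta; rewrite -vE in hn; exists eta; split=> //.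
  apply: le_lt_trans hn; rewrite -[leLHS]ger0_norm// -sqrtr_sqr ler_sqrt.
    by rewrite lerDl sumr_ge0// => j _; exact: sqr_ge0.
  by rewrite addr_ge0 ?sqr_ge0// sumr_ge0// => j _; exact: sqr_ge0.
move=> j; apply: le_lt_trans hn; rewrite -[leLHS]ger0_norm// -sqrtr_sqr.
rewrite -(weak_partial_eq (is_weak_partialB (weak_partialP j u1) (is_weak_partial_test j ceta))).
rewrite ler_sqrt; first by rewrite (bigD1 j)//= addrCA lerDl addr_ge0 ?sqr_ge0// sumr_ge0// => k _; exact: sqr_ge0.
by rewrite addr_ge0 ?sqr_ge0// sumr_ge0// => k _; exact: sqr_ge0.
Qed.

Lemma H10_closed (u : L2s) (g : 'I_3 -> L2s) : (forall e : R, 0 < e ->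
    exists v, [/\ H10_space v, `|u - v| < e & forall j, `|g j - weak_partial j v| < e]) ->
  H10_space u /\ forall j, weak_partial j u = g j.
Proof.
move=> h; apply: H10_intro => e e0; have e20 : 0 < e / 2 by rewrite divr_gt0.
have [v [v0 h1 h2]] := h _ e20; have [eta [ceta h3 h4]] := H10_approx v0 e20.
have tri (a b c : L2s) : `|a - b| < e / 2 -> `|b - c| < e / 2 -> `|a - c| < e.
  move=> ab bc; have -> : a - c = (a - b) + (b - c) by rewrite addrA subrK.
  by apply: (le_lt_trans (ler_normD _ _)); lra.
exists eta; split=> // [|j]; first exact: tri h1 h3.
exact: tri (h2 j) (h4 j).
Qed.

Lemma H10_seq (u : L2s) : H10_space u -> exists eta_ : nat -> R3 R -> R,
  [/\ forall n, Ccinfty Omega (eta_ n), toL2 (eta_ n) @[n --> \oo] --> u &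
    forall j, toL2 (D j (eta_ n)) @[n --> \oo] --> weak_partial j u].
Proof.
move=> u0; have n0 n : 0 < (n.+1%:R^-1 : R) by rewrite invr_gt0.
have a n := cid (H10_approx u0 (n0 n)).
exists (fun n => projT1 (a n)).
have cv (w_ : nat -> L2s) (w : L2s) : (forall n, `|w - w_ n| < n.+1%:R^-1) -> w_ n @[n --> \oo] --> w.
  move=> h; apply/cvgrPdist_lt => e e0.
  have := near_infty_natSinv_lt (PosNum e0); apply: filterS => n /= hn.
  exact: lt_trans (h n) hn.
split=> [n|| j].
- by have [] := projT2 (a n).
- by apply: cv => n; have [] := projT2 (a n).
- by apply: cv => n; have [_ _ /(_ j)] := projT2 (a n).
Qed.

Lemma H10_lin (a : R) (u v : L2s) : H10_space u -> H10_space v ->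
  H10_space (a *: u + v) /\ forall j, weak_partial j (a *: u + v) = a *: weak_partial j u + weak_partial j v.
Proof.
move=> u0 v0.
have H1 : H1_space (a *: u + v).
  move=> j; exists (a *: weak_partial j u + weak_partial j v).
  by apply: is_weak_partialD; [apply: is_weak_partialZ|]; apply: weak_partialP; [case: u0|case: v0].
split; last first.
  move=> j; apply: weak_partial_eq.
  by apply: is_weak_partialD; [apply: is_weak_partialZ|]; apply: weak_partialP; [case: u0|case: v0].
pose g j := a *: weak_partial j u + weak_partial j v.
suff [] : H10_space (a *: u + v) /\ forall j, weak_partial j (a *: u + v) = g j by [].
apply: H10_intro => e e0.
have C0 : 0 < `|a| + 1 by rewrite ltr_wpDl.
have ea0 : 0 < e / 2 / (`|a| + 1) by rewrite !divr_gt0.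
have e20 : 0 < e / 2 by rewrite divr_gt0.
have [eta [ceta h1 h2]] := H10_approx u0 ea0.
have [phi [cphi h3 h4]] := H10_approx v0 e20.
pose z x := a * eta x + phi x.
have est (p q p' q' : L2s) : `|p - p'| < e / 2 / (`|a| + 1) -> `|q - q'| < e / 2 ->
    `|(a *: p + q) - (a *: p' + q')| < e.
  move=> pp qq; have -> : (a *: p + q) - (a *: p' + q') = a *: (p - p') + (q - q').
    by rewrite scalerBr opprD addrACA.
  apply: (le_lt_trans (ler_normD _ _)); rewrite normrZ.
  have : `|a| * `|p - p'| <= (`|a| + 1) * `|p - p'| by rewrite ler_wpM2r// lerDl.
  move: pp; rewrite ltr_pdivlMr// mulrC; lra.
exists (fun x => a * eta x + phi x); split; first exact: CcinftyL.
  by rewrite toL2_lin//; exact: est.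
move=> j; rewrite Dlin// toL2_lin//; try exact: Ccinfty_deriv.
exact: est (h2 j) (h4 j).
Qed.

Lemma friedrichs (e : R) : 0 < e ->
  exists (K : finType) (w : K -> L2s), forall u, H10_space u ->
  `|u| ^+ 2 <= \sum_k (L2ip u (w k)) ^+ 2 + e * \sum_j `|weak_partial j u| ^+ 2.
Proof.
move=> /(friedrichs_test Omega)[K [w h]]; exists K, w => u /H10_seq[eta_ [ceta cu cD]].
have hn n : `|toL2 (eta_ n)| ^+ 2 <= \sum_k (L2ip (toL2 (eta_ n)) (w k)) ^+ 2 +
    e * \sum_j `|toL2 (D j (eta_ n))| ^+ 2.
  apply: le_trans (h _ (ceta n) _ (toL2_test (ceta n))) _.
  rewrite lerD2l le_eqVlt; apply/orP; left; apply/eqP; congr (_ * _).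
  apply: eq_bigr => j _; have cj := Ccinfty_deriv j (ceta n).
  rewrite -[RHS]/(fine (`|toL2 (D j (eta_ n))| ^+ 2)%:E) -L2_norm_integral; congr fine.
  apply: ae_eq_integral => //.
  - by apply/measurable_EFinP/measurable_funX; exact: Ccinfty_measurable cj.
  - by apply/measurable_EFinP/measurable_funX; exact: L2_fun_measurable.
  - by apply: filterS (toL2_test cj) => x hx _; rewrite hx.
have sq (w_ : nat -> L2s) (v : L2s) : w_ n @[n --> \oo] --> v -> `|w_ n| ^+ 2 @[n --> \oo] --> `|v| ^+ 2.
  by move=> c; apply: cvg_sqr; exact: cvg_norm.
apply: (@ler_cvg_to _ \oo _ _ (fun n => `|toL2 (eta_ n)| ^+ 2)
  (fun n => \sum_k (L2ip (toL2 (eta_ n)) (w k)) ^+ 2 + e * \sum_j `|toL2 (D j (eta_ n))| ^+ 2)).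
- exact: sq.
- apply: cvgD; first by apply: cvg_sumR => k; apply: cvg_sqr; exact: L2ip_cvg.
  by apply: cvgM; [exact: cvg_cst|apply: cvg_sumR => j; exact: sq].
- exact: nearW.
Qed.

End weak_derivatives.

(** Truncation at [k] makes the fourth power Lipschitz with constant [4 k^3], and
    [4 k^3 t <= d + 4 k^6 t^2 / d] because [(d - 2 k^3 t) ^+ 2 >= 0]. The difference of [f] and [g]
    thus enters through its square only, which L^2 controls. *)
Lemma trunc4_le (R : realType) (k d f g : R) : 0 <= k -> 0 < d ->
  Num.min `|f| k ^+ 4 <= g ^+ 4 + d + 4 * k ^+ 6 / d * (f - g) ^+ 2.
Proof.
move=> k0 d0; set a := Num.min `|f| k; pose b := Num.min `|g| k.
have a0 : 0 <= a by rewrite le_min normr_ge0.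
have b0 : 0 <= b by rewrite le_min normr_ge0.
have ak : a <= k by rewrite ge_min lexx orbT.
have bk : b <= k by rewrite ge_min lexx orbT.
have bg : b ^+ 4 <= g ^+ 4.
  rewrite -[leRHS]ger0_norm ?exprn_even_ge0// normrX.
  by rewrite lerXn2r ?nnegrE// ge_min lexx.
have ab2 : (a - b) ^+ 2 <= (f - g) ^+ 2.
  have : `|a - b| <= `|f - g|.
    apply: (@le_trans _ _ `| `|f| - `|g| |); last exact: ler_dist_dist.
    rewrite /a /b; move: `|f| `|g| => x y.
    case: (leP x k) => hf; case: (leP y k) => hg //.
    - by rewrite (ler0_norm (_ : x - k <= 0)) ?(ler0_norm (_ : x - y <= 0)); lra.
    - by rewrite (ger0_norm (_ : 0 <= k - y)) ?(ger0_norm (_ : 0 <= x - y)); lra.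
    - by rewrite subrr normr0.
  by move=> h; rewrite -[leLHS]real_normK ?num_real// -[leRHS]real_normK ?num_real// lerXn2r ?nnegrE.
have key : a ^+ 4 - b ^+ 4 <= 4 * k ^+ 3 * `|a - b|.
  have -> : a ^+ 4 - b ^+ 4 = (a ^+ 3 + a ^+ 2 * b + a * b ^+ 2 + b ^+ 3) * (a - b) by ring.
  have k3 : a ^+ 3 + a ^+ 2 * b + a * b ^+ 2 + b ^+ 3 <= 4 * k ^+ 3.
    have m1 i j : (i + j = 3)%N -> a ^+ i * b ^+ j <= k ^+ 3.
      by move=> <-; rewrite exprD ler_pM ?exprn_ge0// lerXn2r ?nnegrE.
    have := m1 3%N 0%N erefl; have := m1 2%N 1%N erefl; have := m1 1%N 2%N erefl.
    have := m1 0%N 3%N erefl; rewrite !expr0 !expr1; lra.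
  apply: (@le_trans _ _ ((a ^+ 3 + a ^+ 2 * b + a * b ^+ 2 + b ^+ 3) * `|a - b|)).
    by rewrite ler_wpM2l ?ler_norm// !addr_ge0 ?mulr_ge0 ?exprn_ge0.
  by rewrite ler_wpM2r.
have yg : 4 * k ^+ 3 * `|a - b| <= d + 4 * k ^+ 6 / d * (a - b) ^+ 2.
  have -> : (a - b) ^+ 2 = `|a - b| ^+ 2 by rewrite real_normK ?num_real.
  have -> : k ^+ 6 = (k ^+ 3) ^+ 2 by rewrite -exprM.
  move: `|a - b| (k ^+ 3) => t K.
  have -> : d + 4 * K ^+ 2 / d * t ^+ 2 = (d ^+ 2 + 4 * K ^+ 2 * t ^+ 2) / d by field; rewrite gt_eqF.
  rewrite ler_pdivlMr//; have := sqr_ge0 (d - 2 * K * t); nra.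
have : 4 * k ^+ 6 / d * (a - b) ^+ 2 <= 4 * k ^+ 6 / d * (f - g) ^+ 2.
  by rewrite ler_wpM2l// divr_ge0 ?mulr_ge0 ?exprn_ge0// ltW.
lra.
Qed.

(** * Products of functions in L^4 *)

Section L4.
Context {d} {T : measurableType d} {R : realType}.
Variable mu : {measure set T -> \bar R}.
Hypothesis mu_fin : mu setT \is a fin_num.
Local Notation L2 := (L2 mu).

Definition int4 (u : L2) : \bar R := (\int[mu]_x (L2_fun u x ^+ 4)%:E)%E.


(** Lower semicontinuity of the L^4 norm under convergence in L^2. [trunc4_le] gives the bound for
    truncations of [u], and monotone convergence removes the truncation; no subsequence converging
    almost everywhere has to be extracted. *)
Lemma int4_closed (u : L2) (K : R) : 0 <= K ->
  (forall e : R, 0 < e -> exists2 v, `|u - v| < e & (int4 v <= (K + e)%:E)%E) -> (int4 u <= K%:E)%E.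
Proof.
move=> K0 h.
have mF := L2_fun_measurable.
have [m mE] : exists m : R, mu setT = m%:E.
  by exists (fine (mu setT)); rewrite fineK.
have m0 : 0 <= m by rewrite -lee_fin -mE.
pose t (n : nat) x := (Num.min `|L2_fun u x| n%:R ^+ 4)%:E.
have mt n : measurable_fun setT (t n).
  apply/measurable_EFinP/measurable_funX; apply: measurable_minr => //.
  by apply: measurableT_comp => //.
have t0 n x : (0 <= t n x)%E by rewrite lee_fin exprn_ge0// le_min normr_ge0/=.
have bound n : (\int[mu]_x t n x <= K%:E)%E.
  apply/lee_addgt0Pr => e e0; rewrite -EFinD.
  (* The error [e] is shared out as [e / 4] for [int4 v], [e / 2] for [del] integrated over a mass
     [m], and [e / 4] for [C] times the squared distance. *)
  pose del := e / (2 * (m + 1)).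
  have del0 : 0 < del by rewrite divr_gt0// mulr_gt0// ltr_wpDl.
  pose C := 4 * n%:R ^+ 6 / del.
  have C0 : 0 <= C by rewrite /C divr_ge0 ?(ltW del0)// mulr_ge0// exprn_ge0.
  pose e' := Num.min (e / 4) (Num.min 1 (e / (4 * (C + 1)))).
  have e'0 : 0 < e' by rewrite !lt_min ltr01 !divr_gt0// mulr_gt0// ltr_wpDl.
  have [v uv v4] := h _ e'0.
  have E : (\int[mu]_x ((L2_fun u x - L2_fun v x) ^+ 2)%:E = (`|u - v| ^+ 2)%:E)%E.
    rewrite -L2_norm_integral; apply: ae_eq_integral => //.
    - by apply/measurable_EFinP/measurable_funX; exact: measurable_funB.
    - by apply/measurable_EFinP/measurable_funX.
    - by apply: filterS (L2_funB u v) => x hx _; rewrite hx.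
  apply: (@le_trans _ _ (\int[mu]_x ((L2_fun v x ^+ 4)%:E + (del%:E + C%:E * ((L2_fun u x - L2_fun v x) ^+ 2)%:E)))%E).
    apply: ge0_le_integral => //.
    - apply: emeasurable_funD; first by apply/measurable_EFinP/measurable_funX.
      apply: emeasurable_funD => //; apply: measurable_funeM.
      by apply/measurable_EFinP/measurable_funX; exact: measurable_funB.
    - move=> x _; rewrite -EFinM -!EFinD lee_fin addrA; exact: trunc4_le.
  have ge4 x : 0 <= L2_fun v x ^+ 4 by rewrite exprn_even_ge0.
  rewrite ge0_integralD//; last 4 first.
  - by move=> x _; rewrite lee_fin.
  - by apply/measurable_EFinP/measurable_funX.
  - by move=> x _; rewrite -EFinM -EFinD lee_fin addr_ge0 ?(ltW del0)// mulr_ge0 ?sqr_ge0.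
  - apply: emeasurable_funD => //; apply: measurable_funeM.
    by apply/measurable_EFinP/measurable_funX; exact: measurable_funB.
  rewrite ge0_integralD//; last 3 first.
  - by move=> x _; rewrite lee_fin ltW.
  - by move=> x _; rewrite -EFinM lee_fin mulr_ge0 ?sqr_ge0.
  - by apply: measurable_funeM; apply/measurable_EFinP/measurable_funX; exact: measurable_funB.
  rewrite integral_cst// mE ge0_integralZl//; last 2 first.
  - by apply/measurable_EFinP/measurable_funX; exact: measurable_funB.
  - by move=> x _; rewrite lee_fin sqr_ge0.
  rewrite E -!EFinM -EFinD; apply: (le_trans (leeD2r _ v4)); rewrite -EFinD lee_fin.
  have a1 : e' <= e / 4 by rewrite /e' ge_min lexx.
  have a2 : del * m <= e / 2.
    rewrite /del mulrAC ler_pdivrMr ?mulr_gt0 ?ltr_wpDl//.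
    have -> : e / 2 * (2 * (m + 1)) = e * (m + 1) by field.
    by rewrite ler_pM2l// lerDl.
  have a3 : C * `|u - v| ^+ 2 <= e / 4.
    have e1 : e' <= 1 by rewrite /e' !ge_min lexx orbT.
    have e2 : e' <= e / (4 * (C + 1)) by rewrite /e' !ge_min lexx !orbT.
    have n2 : `|u - v| ^+ 2 <= e / (4 * (C + 1)).
      apply: le_trans e2; rewrite expr2; apply: (@le_trans _ _ (`|u - v| * 1)).
        by rewrite ler_wpM2l//; apply: le_trans e1; exact: ltW.
      by rewrite mulr1 ltW.
    apply: (@le_trans _ _ ((C + 1) * (e / (4 * (C + 1))))).
      by rewrite ler_pM ?sqr_ge0// lerDl.
    have -> : (C + 1) * (e / (4 * (C + 1))) = e / 4 by field; rewrite gt_eqF// ltr_wpDl.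
    by [].
  lra.
have tnd x : {homo t ^~ x : p q / (p <= q)%N >-> (p <= q)%E}.
  move=> p q pq; rewrite lee_fin lerXn2r ?nnegrE ?le_min ?normr_ge0//=.
  by rewrite ge_min lexx/= ge_min ler_nat pq orbT.
have := @cvg_monotone_convergence _ _ _ mu setT measurableT t (fun n => mt n) (fun n x _ => t0 n x) (fun x _ => tnd x).
have -> : (\int[mu]_x limn (t ^~ x) = int4 u)%E.
  apply: eq_integral => x _; apply/cvg_lim => //.
  apply: (@cvg_trans _ (nbhs (L2_fun u x ^+ 4)%:E)) => //; apply: cvg_near_cst.
  exists (Num.truncn `|L2_fun u x|).+1 => // n /= hn; rewrite /t; congr (_%:E).
  rewrite min_l ?real_normK; last first.
    by apply/ltW; apply: (lt_le_trans (truncnS_gt _)); rewrite ler_nat.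
  by rewrite -normrX ger0_norm// exprn_even_ge0.
move=> c; rewrite -(cvg_lim _ c)//; apply: lime_le; [exact: cvgP c|exact: nearW].
Qed.

Definition L4 (u : L2) : Prop := (int4 u < +oo)%E.
Definition norm4 (u : L2) : R := fine (int4 u).
Definition prod (a c : L2) : L2 := toL2 mu (fun x => L2_fun a x * L2_fun c x).

Let m4 (u : L2) : measurable_fun setT (fun x => (L2_fun u x ^+ 4)%:E).
Proof. by apply/measurable_EFinP/measurable_funX; exact: L2_fun_measurable. Qed.

Let ge4 (y : R) : 0 <= y ^+ 4. Proof. exact: exprn_even_ge0. Qed.

Let ge40 (u : L2) x : (0 <= (L2_fun u x ^+ 4)%:E)%E. Proof. by rewrite lee_fin ge4. Qed.

Let mM (a c : L2) : measurable_fun setT (fun x => L2_fun a x * L2_fun c x).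
Proof. by apply: measurable_funM; exact: L2_fun_measurable. Qed.

Lemma norm4_ge0 u : 0 <= norm4 u.
Proof. by apply/fine_ge0/integral_ge0 => x _; rewrite lee_fin ge4. Qed.

Lemma norm4E u : L4 u -> int4 u = (norm4 u)%:E.
Proof.
move=> h; rewrite /norm4 fineK// ge0_fin_numE//.
by apply/integral_ge0 => x _; rewrite lee_fin ge4.
Qed.

Lemma prod_Lfun a c : L4 a -> L4 c -> (fun x => L2_fun a x * L2_fun c x) \in Lfun mu 2%:E.
Proof.
move=> a4 c4; apply: measurable_sqr_Lfun2; first exact: mM.
apply: (@le_lt_trans _ _ (\int[mu]_x ((L2_fun a x ^+ 4)%:E + (L2_fun c x ^+ 4)%:E))%E).
  apply: ge0_le_integral => //.
  - by move=> x _; rewrite lee_fin sqr_ge0.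
  - by apply/measurable_EFinP/measurable_funX; exact: mM.
  - exact: emeasurable_funD.
  - move=> x _; rewrite -EFinD lee_fin; move: (L2_fun a x) (L2_fun c x) => p q.
    have -> : p ^+ 4 = (p ^+ 2) ^+ 2 by rewrite -exprM.
    have -> : q ^+ 4 = (q ^+ 2) ^+ 2 by rewrite -exprM.
    rewrite exprMn; have := sqr_ge0 (p ^+ 2 - q ^+ 2); have := sqr_ge0 p; have := sqr_ge0 q; nra.
rewrite (ge0_integralD mu measurableT (fun x _ => ge40 a x) (m4 a) (fun x _ => ge40 c x) (m4 c)).
exact: lte_add_pinfty.
Qed.

Lemma prodE a c : L4 a -> L4 c -> L2_fun (prod a c) = (fun x => L2_fun a x * L2_fun c x) %[ae mu].
Proof. by move=> a4 c4; apply: toL2E; exact: prod_Lfun. Qed.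

Lemma prodC a c : prod a c = prod c a.
Proof. by congr toL2; apply/funext => x; rewrite mulrC. Qed.

Lemma prod_linl (s : R) a b c : L4 a -> L4 b -> L4 c -> prod (s *: a + b) c = s *: prod a c + prod b c.
Proof.
move=> a4 b4 c4; apply: toL2_eq.
have h1 := L2_funD (s *: prod a c) (prod b c); have h2 := L2_funZ s (prod a c).
have h3 := prodE a4 c4; have h4 := prodE b4 c4.
have h5 := L2_funD (s *: a) b; have h6 := L2_funZ s a.
apply: filterS2 (filterI h1 (filterI h2 h3)) (filterI h4 (filterI h5 h6)) => x [k1 [k2 k3]] [k4 [k5 k6]] _.
by rewrite k1//= k2//= k3// k4// k5//= k6//= mulrDl mulrA.
Qed.

(** The squared norm of [a c] is the inner product of [a^2] and [c^2], to which Cauchy-Schwarz is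
    applied. *)
Lemma prod_norm a c : L4 a -> L4 c -> `|prod a c| ^+ 4 <= norm4 a * norm4 c.
Proof.
move=> a4 c4.
have sq b : L4 b -> `|prod b b| ^+ 2 = norm4 b.
  move=> b4; rewrite -L2ip_norm (L2ip_fun _ _ (prodE b4 b4) (prodE b4 b4)) ?mM//.
  by congr fine; apply: eq_integral => x _; rewrite -!expr2 -exprM.
have E : `|prod a c| ^+ 2 = L2ip (prod a a) (prod c c).
  rewrite -L2ip_norm (L2ip_fun _ _ (prodE a4 c4) (prodE a4 c4)) ?mM//.
  rewrite (L2ip_fun _ _ (prodE a4 a4) (prodE c4 c4)) ?mM//.
  by apply: eq_Rintegral => x _; ring.
have -> : `|prod a c| ^+ 4 = (`|prod a c| ^+ 2) ^+ 2 by rewrite -exprM.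
by rewrite E; apply: (le_trans (L2ip_sqr_le _ _)); rewrite !sq.
Qed.

Lemma tri_integral a g c : L4 a -> L4 c ->
  mu.-integrable setT (EFin \o (fun x => L2_fun a x * L2_fun g x * L2_fun c x)) /\
  \int[mu]_x (L2_fun a x * L2_fun g x * L2_fun c x) = L2ip g (prod a c).
Proof.
move=> a4 c4; split.
  have := Lfun2_mul_integrable (L2_fun_Lfun g) (prod_Lfun a4 c4).
  by apply: eq_integrable => // x _ /=; congr (_%:E); ring.
rewrite (L2ip_fun (L2_fun_measurable g) (mM a c) _ (prodE a4 c4)); last exact: nearW.
by apply: eq_Rintegral => x _; ring.
Qed.

End L4.

Section H10_L4.
Context {R : realType}.
Variable Omega : bounded_domain R.
Local Notation mu := (leb_dom Omega).
Local Notation L2s := (L2 mu).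
Local Notation D j eta := ('D_(e3 R j) eta).
Local Notation toL2 := (toL2 mu).

Lemma L2_norm_test eta : Ccinfty Omega eta -> (\int[mu]_x (eta x ^+ 2)%:E = (`|toL2 eta| ^+ 2)%:E)%E.
Proof.
move=> ceta; rewrite -L2_norm_integral; apply: ae_eq_integral => //.
- by apply/measurable_EFinP/measurable_funX; exact: Ccinfty_measurable ceta.
- by apply/measurable_EFinP/measurable_funX; exact: L2_fun_measurable.
- by apply: filterS (toL2_test ceta) => x hx _; rewrite hx.
Qed.

Lemma sqr_le_EFin (x : \bar R) (c : R) : (0 <= x)%E -> 0 <= c -> (x ^+ 2 <= (c ^+ 2)%:E)%E -> (x <= c%:E)%E.
Proof.
case: x => [r| |] x0 c0.
- by rewrite expe2 -EFinM !lee_fin in x0 *; rewrite -expr2 ler_sqr ?nnegrE.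
- by rewrite -[(+oo ^+ 2)%E]/(+oo * +oo)%E mulyy leye_eq.
- by rewrite leNye.
Qed.

Lemma int4_combine (X D0 D1 : \bar R) (p d0 d1 : R) : D0 = d0%:E -> D1 = d1%:E -> 0 <= d0 -> 0 <= d1 ->
  (X <= (2 * p)%:E)%E -> (2%:E * X * (D0 + D1) <= (4 * p * (d0 + d1))%:E)%E.
Proof.
move=> -> -> d00 d10 h; rewrite -EFinD EFinM; apply: lee_wpmul2r; first by rewrite lee_fin addr_ge0.
have -> : 4 * p = 2 * (2 * p) by ring.
by rewrite (EFinM 2); apply: lee_wpmul2l.
Qed.

Lemma dist_lt_le (K x e : R) : `|K - x| < e -> x <= K + e.
Proof. by rewrite ltr_norml => /andP[]; lra. Qed.

Lemma int4_test eta : Ccinfty Omega eta ->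
  (int4 (toL2 eta) <= (4 * (`|toL2 eta| * `|toL2 (D 2 eta)|) *
     (`|toL2 (D 0 eta)| ^+ 2 + `|toL2 (D 1 eta)| ^+ 2))%:E)%E.
Proof.
move=> ceta; have cj j := Ccinfty_deriv j ceta.
have meta := Ccinfty_measurable ceta.
have mj j := Ccinfty_measurable (cj j).
have -> : (int4 (toL2 eta) = \int[leb3 R]_x (eta x ^+ 4)%:E)%E.
  rewrite -(@integral_leb_dom _ Omega); last by move=> x /(Ccinfty_out ceta) ->; rewrite expr0n.
  apply: ae_eq_integral => //.
  - by apply/measurable_EFinP/measurable_funX; exact: L2_fun_measurable.
  - by apply/measurable_EFinP/measurable_funX.
  - by apply: filterS (toL2_test ceta) => x hx _; rewrite hx.
apply: (le_trans (ladyzhenskaya_test ceta)).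
have Dj j : (\int[leb3 R]_x (D j eta x ^+ 2)%:E = (`|toL2 (D j eta)| ^+ 2)%:E)%E.
  rewrite -(L2_norm_test (cj j)); symmetry; apply: integral_leb_dom => x /(Ccinfty_out (cj j)) ->.
  by rewrite expr0n.
apply: (int4_combine (Dj 0) (Dj 1)); [exact: sqr_ge0|exact: sqr_ge0|].
have abs0 x : (0 <= `|eta x * D 2 eta x|%:E)%E by rewrite lee_fin.
have mabs : measurable_fun setT (fun x => `|eta x * D 2 eta x|%:E).
  by apply/measurable_EFinP; apply: measurableT_comp => //; exact: measurable_funM.
have h : (\int[mu]_x `|eta x * D 2 eta x|%:E <= (`|toL2 eta| * `|toL2 (D 2 eta)|)%:E)%E.
  apply: sqr_le_EFin; [exact: integral_ge0|by rewrite mulr_ge0|].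
  apply: (le_trans (integral_cauchy_schwarz mu meta (mj 2))).
  by rewrite (L2_norm_test ceta) (L2_norm_test (cj 2)) -EFinM exprMn.
have -> : (\int[leb3 R]_x (2 * `|eta x * D 2 eta x|)%:E = 2%:E * \int[mu]_x `|eta x * D 2 eta x|%:E)%E.
  rewrite -(@integral_leb_dom _ Omega); last by move=> x /(Ccinfty_out ceta) ->; rewrite mul0r normr0 mulr0.
  by rewrite -ge0_integralZl.
by rewrite EFinM; apply: lee_wpmul2l.
Qed.

Lemma int4_H10 (u : L2s) : H10_space u ->
  (int4 u <= (4 * (`|u| * `|weak_partial 2 u|) *
     (`|weak_partial 0 u| ^+ 2 + `|weak_partial 1 u| ^+ 2))%:E)%E.
Proof.
move=> u0; have [eta_ [ceta cu cD]] := H10_seq u0.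
apply: (int4_closed (leb_dom_fin Omega)).
  by rewrite mulr_ge0 ?mulr_ge0 ?addr_ge0 ?sqr_ge0.
move=> e e0.
have nm (w_ : nat -> L2s) (v : L2s) : w_ n @[n --> \oo] --> v -> `|w_ n| @[n --> \oo] --> `|v|.
  by exact: cvg_norm.
set K := 4 * _ * _.
have cK : 4 * (`|toL2 (eta_ n)| * `|toL2 (D 2 (eta_ n))|) *
     (`|toL2 (D 0 (eta_ n))| ^+ 2 + `|toL2 (D 1 (eta_ n))| ^+ 2) @[n --> \oo] --> K.
  apply: cvgM; first by apply: cvgM; [exact: cvg_cst|apply: cvgM; exact: nm].
  by apply: cvgD; apply: cvg_sqr; exact: nm.
move/cvgrPdist_lt : cu => /(_ e e0) cu.
move/cvgrPdist_lt : cK => /(_ e e0) cK.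
have [n [h1 h2]] := @filter_ex _ _ _ _ (filterI cu cK).
exists (toL2 (eta_ n)) => //; apply: (le_trans (int4_test (ceta n))).
by rewrite lee_fin; exact: dist_lt_le h2.
Qed.

Lemma H10_L4 (u : L2s) : H10_space u -> L4 u.
Proof. by move=> /int4_H10 h; apply: (le_lt_trans h); exact: ltry. Qed.

End H10_L4.

(** * The space V and the trilinear form *)

Section inner.
Context {R : realType} {W : normedModType R}.

(** One set of axioms serves the fields and their gradients, which live in families over different
    index types. *)
Record is_inner (ip : W -> W -> R) : Prop := IsInner {
  ipC : forall u v, ip u v = ip v u ;
  ipDl : forall u v w, ip (u + v) w = ip u w + ip v w ;
  ipZl : forall a u w, ip (a *: u) w = a * ip u w ;
  ip_norm : forall u, ip u u = `|u| ^+ 2 }.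

Variables (ip : W -> W -> R) (ipP : is_inner ip).
Implicit Types u v w : W.

Lemma ipDr u v w : ip w (u + v) = ip w u + ip w v.
Proof. by rewrite (ipC ipP) (ipDl ipP) !(ipC ipP w). Qed.

Lemma ipZr (a : R) u w : ip w (a *: u) = a * ip w u.
Proof. by rewrite (ipC ipP) (ipZl ipP) (ipC ipP w). Qed.

Lemma ipBl u v w : ip (u - v) w = ip u w - ip v w.
Proof. by rewrite (ipDl ipP) -scaleN1r (ipZl ipP) mulN1r. Qed.

Lemma ipBr u v w : ip w (u - v) = ip w u - ip w v.
Proof. by rewrite (ipC ipP) ipBl !(ipC ipP w). Qed.

Lemma norm2D u v : `|u + v| ^+ 2 = `|u| ^+ 2 + 2 * ip u v + `|v| ^+ 2.
Proof. by rewrite -!(ip_norm ipP) (ipDl ipP) !ipDr (ipC ipP v u); ring. Qed.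

Lemma norm2B u v : `|u - v| ^+ 2 = `|u| ^+ 2 - 2 * ip u v + `|v| ^+ 2.
Proof. by rewrite -!(ip_norm ipP) ipBl !ipBr (ipC ipP v u); ring. Qed.

Lemma ip_le u v : `|ip u v| <= `|u| * `|v|.
Proof.
rewrite -ler_sqr ?nnegrE ?mulr_ge0// exprMn real_normK ?num_real//.
have [v0|v0] := eqVneq v 0.
  have -> : ip u v = 0 by rewrite v0 -(scale0r (0 : W)) ipZr mul0r.
  by rewrite expr0n/= mulr_ge0 ?sqr_ge0.
have nv : 0 < `|v| ^+ 2 by rewrite exprn_gt0// normr_gt0.
have := sqr_ge0 `|u - (ip u v / `|v| ^+ 2) *: v|.
rewrite norm2B ipZr normrZ exprMn.
move: (ip u v) (`|v| ^+ 2) (`|u| ^+ 2) nv => J V U nv.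
have -> : `|J / V| ^+ 2 * V = J ^+ 2 / V.
  by rewrite real_normK ?num_real// expr2; field; rewrite gt_eqF.
have -> : 2 * (J / V * J) = 2 * (J ^+ 2 / V) by rewrite expr2; ring.
rewrite -(pmulr_lge0 _ nv) => H.
have : J ^+ 2 / V * V = J ^+ 2 by rewrite mulfVK// gt_eqF.
lra.
Qed.

Lemma parallelogram u v :
  `|u - v| ^+ 2 = 2 * `|u| ^+ 2 + 2 * `|v| ^+ 2 - 4 * `|2^-1 *: (u + v)| ^+ 2.
Proof.
rewrite normrZ exprMn norm2B norm2D (@ger0_norm _ 2^-1) ?invr_ge0//.
by rewrite exprVn; field.
Qed.

Lemma lin_subE (a : R) u v s t : (a *: u + v) - (a *: s + t) = a *: (u - s) + (v - t).
Proof. by rewrite scalerBr opprD addrACA. Qed.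

Lemma norm_lin_lt (a e : R) u v : `|u| < e / 2 / (`|a| + 1) -> `|v| < e / 2 -> `|a *: u + v| < e.
Proof.
have C0 : 0 < `|a| + 1 by rewrite ltr_wpDl.
move=> h1 h2; apply: (le_lt_trans (ler_normD _ _)); rewrite normrZ.
have : `|a| * `|u| <= (`|a| + 1) * `|u| by rewrite ler_wpM2r// lerDl.
move: h1; rewrite ltr_pdivlMr// mulrC; lra.
Qed.

Lemma norm_sub_lt (e : R) u v w : `|u - v| < e / 2 -> `|v - w| < e / 2 -> `|u - w| < e.
Proof.
move=> h1 h2; have -> : u - w = (u - v) + (v - w) by rewrite addrA subrK.
by apply: (le_lt_trans (ler_normD _ _)); lra.
Qed.

End inner.

Section l2fam_inner.
Context {R : realType}.
Variable Omega : bounded_domain R.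
Local Notation mu := (leb_dom Omega).
Local Notation L2s := (L2 mu).
Variable I : finType.
Local Notation W := (l2fam I L2s).

Lemma L2inner_is_inner : is_inner (fun u v : W => L2inner u v).
Proof.
split=> [u v|u v w|a u w|u].
- by apply: eq_bigr => i _; exact: L2ipC.
- by rewrite /L2inner -big_split; apply: eq_bigr => i _; rewrite l2famD; exact: L2ipDl.
- by rewrite /L2inner mulr_sumr; apply: eq_bigr => i _; rewrite l2famZ; exact: L2ipZl.
- rewrite l2fam_norm sqr_sqrtr; last by apply: sumr_ge0 => i _; exact: sqr_ge0.
  by apply: eq_bigr => i _; exact: L2ip_norm.
Qed.

End l2fam_inner.

Lemma Rintegral_sum3 d (T : measurableType d) (R : realType) (m : {measure set T -> \bar R})
    (h : 'I_3 -> T -> R) : (forall j, m.-integrable setT (EFin \o h j)) ->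
  m.-integrable setT (EFin \o (fun x => \sum_j h j x)) /\
  \int[m]_x (\sum_j h j x) = \sum_j \int[m]_x h j x.
Proof.
move=> hi; split.
  have -> : EFin \o (fun x => \sum_j h j x) = (fun x => \sum_j (h j x)%:E)%E.
    by apply/funext => x /=; rewrite sumEFin.
  by apply: integrable_sum => // j _; exact: hi.
rewrite sum_I3 -RintegralD// -RintegralD//; last exact: (integrableD measurableT (hi 0) (hi 1)).
by apply: eq_Rintegral => x _; rewrite sum_I3.
Qed.

Lemma root4_le (R : realFieldType) (p L M a b x y : R) : 0 <= p -> 0 <= L -> 0 <= M ->
  p ^+ 4 <= a * b -> 0 <= a -> 0 <= b -> a <= x -> b <= y -> L ^+ 4 = x -> M ^+ 4 = y -> p <= L * M.
Proof.
move=> p0 L0 M0 pab a0 b0 ax bY Lx My.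
rewrite -(@ler_pXn2r _ 4%N) ?nnegrE ?mulr_ge0// exprMn Lx My.
by apply: (le_trans pab); exact: ler_pM.
Qed.

Section gradient.
Context {R : realType}.
Variable Omega : bounded_domain R.
Local Notation mu := (leb_dom Omega).
Local Notation L2s := (L2 mu).
Local Notation W := (L2vec Omega).
Local Notation D j eta := ('D_(e3 R j) eta).
Local Notation toL2 := (toL2 mu).
Implicit Types u v w : W.

Definition H10f u : Prop := forall i, H10_space (u i).

Lemma gradE u i j : grad u (i, j) = weak_partial j (u i).
Proof. by rewrite /grad /l2fam_fun ffunE. Qed.

Lemma l2famP (I : finType) (V : normedModType R) (u v : l2fam I V) : (forall i, u i = v i) -> u = v.
Proof. by move=> h; apply/ffunP. Qed.

Lemma grad_lin (a : R) u v : H10f u -> H10f v ->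
  H10f (a *: u + v) /\ grad (a *: u + v) = a *: grad u + grad v.
Proof.
move=> u0 v0; split=> [i|].
  by rewrite l2famD l2famZ; have [] := H10_lin a (u0 i) (v0 i).
apply: l2famP => -[i j]; rewrite l2famD l2famZ !gradE l2famD l2famZ.
by have [_ ->] := H10_lin a (u0 i) (v0 i).
Qed.

Definition test_vec (phi : 'I_3 -> R3 R -> R) : W := [ffun i => toL2 (phi i)].

Lemma test_vecE phi i : test_vec phi i = toL2 (phi i).
Proof. by rewrite /test_vec /l2fam_fun ffunE. Qed.

Lemma solenoidal_testsE u : solenoidal_tests u -> exists phi : 'I_3 -> R3 R -> R,
  [/\ forall i, Ccinfty Omega (phi i), forall x, \sum_i D i (phi i) x = 0 & u = test_vec phi].
Proof.
move=> [phi [c d e]]; exists phi; split=> //; apply: l2famP => i; rewrite test_vecE.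
by symmetry; apply: toL2_eq; exact: e.
Qed.

Lemma solenoidal_H10f u : solenoidal_tests u -> H10f u.
Proof.
move=> /solenoidal_testsE[phi [c _ ->]] i; rewrite test_vecE.
suff h : H10_space (toL2 (phi i)) /\ forall j, weak_partial j (toL2 (phi i)) = toL2 (D j (phi i)) by case: h.
apply: H10_intro => e e0; by exists (phi i); split => // [|j]; rewrite subrr normr0.
Qed.

Lemma solenoidal_lin (a : R) u v : solenoidal_tests u -> solenoidal_tests v -> solenoidal_tests (a *: u + v).
Proof.
move=> /solenoidal_testsE[phi [c1 d1 ->]] /solenoidal_testsE[psi [c2 d2 ->]].
exists (fun i x => a * phi i x + psi i x); split=> [i|x|i].
- exact: CcinftyL.
- rewrite (eq_bigr (fun i => a * D i (phi i) x + D i (psi i) x)); last first.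
    by move=> i _; exact: (congr1 (@^~ x) (Dlin a i (c1 i) (c2 i))).
  by rewrite big_split/= -mulr_sumr d1 d2 mulr0 addr0.
- rewrite l2famD l2famZ !test_vecE -toL2_lin//; apply: toL2_test; exact: CcinftyL.
Qed.

Lemma VspaceH10 u : Vspace u -> H10f u. Proof. by case. Qed.

Lemma solenoidal0 : solenoidal_tests (0 : W).
Proof.
(* The box with lower corner 1 and upper corner 0 is empty, so its bump is a test function on any
   domain. *)
pose b : R3 R -> R := bump 0 (fun=> 1) (fun=> 0).
have cb : Ccinfty Omega b.
  by apply: bump_Ccinfty => x /(_ 0) /andP[h1 /(le_trans h1)]; rewrite ler10.
have c0 : Ccinfty Omega (fun=> 0).
  have -> : (fun=> 0) = (fun x : R3 R => -1 * b x + b x) by apply/funext => x; rewrite mulN1r addNr.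
  exact: CcinftyL.
exists (fun _ _ => 0); split=> // [x|i].
- by rewrite big1// => i _; exact: derive_cst.
- have -> : (0 : W) i = 0 by rewrite /l2fam_fun ffunE.
  exact: L2_fun0.
Qed.

Lemma solenoidal_V u : solenoidal_tests u -> Vspace u.
Proof.
move=> h; split=> [|e e0]; first exact: solenoidal_H10f.
exists u => //; have [_] := grad_lin (-1) (solenoidal_H10f h) (solenoidal_H10f h).
by rewrite !scaleN1r !addNr subrr => ->; rewrite normr0.
Qed.

Lemma grad_sub u v : H10f u -> H10f v -> grad (u - v) = grad u - grad v.
Proof. by move=> u0 v0; rewrite addrC -scaleN1r (grad_lin _ v0 u0).2 scaleN1r addrC. Qed.

Lemma H10f_sub u v : H10f u -> H10f v -> H10f (u - v).
Proof. by move=> u0 v0; have := (grad_lin (-1) v0 u0).1; rewrite scaleN1r addrC. Qed.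

Lemma V_lin (a : R) u v : Vspace u -> Vspace v -> Vspace (a *: u + v).
Proof.
move=> [u0 ua] [v0 va]; split; first exact: (grad_lin a u0 v0).1.
move=> e e0.
have C0 : 0 < `|a| + 1 by rewrite ltr_wpDl.
have ea0 : 0 < e / 2 / (`|a| + 1) by rewrite !divr_gt0.
have e20 : 0 < e / 2 by rewrite divr_gt0.
have [s s0 hs] := ua _ ea0; have [t t0 ht] := va _ e20.
exists (a *: s + t); first exact: solenoidal_lin.
have s1 := solenoidal_H10f s0; have t1 := solenoidal_H10f t0.
have [_ E] := grad_lin a (H10f_sub u0 s1) (H10f_sub v0 t1).
rewrite (lin_subE a u v s t) E; exact: norm_lin_lt.
Qed.

Lemma grad_linV (a : R) u v : Vspace u -> Vspace v -> grad (a *: u + v) = a *: grad u + grad v.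
Proof. by move=> /VspaceH10 h1 /VspaceH10 h2; exact: (grad_lin a h1 h2).2. Qed.

Lemma V0 : Vspace (0 : W). Proof. exact/solenoidal_V/solenoidal0. Qed.

(** Closedness of the graph of [grad]: the components are handled by [H10_closed], and the
    approximation by solenoidal test fields is inherited from nearby elements of V. *)
Lemma V_closed u (g : l2fam ('I_3 * 'I_3)%type L2s) : (forall e : R, 0 < e ->
    exists v, [/\ Vspace v, `|u - v| < e & `|g - grad v| < e]) -> Vspace u /\ grad u = g.
Proof.
move=> h.
have hi i : H10_space (u i) /\ forall j, weak_partial j (u i) = g (i, j).
  apply: (H10_closed (g := fun j => g (i, j))) => e e0; have [v [vV h1 h2]] := h e e0.
  exists (v i); split=> [||j]; first exact: vV.1.
    by rewrite -l2famB; apply: le_lt_trans h1; exact: l2fam_le.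
  rewrite -gradE -l2famB; apply: le_lt_trans h2; exact: l2fam_le.
have ug : grad u = g by apply: l2famP => -[i j]; rewrite gradE; exact: (hi i).2.
split=> //; split=> [i|e e0]; first exact: (hi i).1.
have u0 : H10f u by move=> i; exact: (hi i).1.
have e20 : 0 < e / 2 by rewrite divr_gt0.
have [v [vV _ h2]] := h _ e20; have [s s0 hs] := vV.2 _ e20.
exists s => //; have s1 := solenoidal_H10f s0.
rewrite (grad_sub vV.1 s1) -ug in hs h2.
rewrite (grad_sub u0 s1); exact: norm_sub_lt h2 hs.
Qed.

Lemma fam_norm2 (I : finType) (u : l2fam I L2s) : `|u| ^+ 2 = \sum_i `|u i| ^+ 2.
Proof. by rewrite l2fam_norm sqr_sqrtr// sumr_ge0// => i _; exact: sqr_ge0. Qed.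

Lemma grad_norm2 u : `|grad u| ^+ 2 = \sum_i \sum_j `|weak_partial j (u i)| ^+ 2.
Proof.
rewrite fam_norm2 pair_big; apply: eq_bigr => -[i j] _.
by rewrite gradE.
Qed.

Lemma sum33 (c : R) : \sum_(i < 3) \sum_(j < 3) c = c * 9.
Proof. by rewrite !sumr_const !card_ord -mulrnA mulr_natr. Qed.

Definition unit_fam (i : 'I_3) (x : L2s) : W := [ffun i' => if i' == i then x else 0].

Lemma L2inner_unit_fam u i x : L2inner u (unit_fam i x) = L2ip (u i) x.
Proof.
rewrite /L2inner (bigD1 i)//= big1 ?addr0 => [|k ki].
  by rewrite /l2fam_fun /unit_fam !ffunE eqxx.
have -> : unit_fam i x k = 0 by rewrite /l2fam_fun /unit_fam ffunE (negbTE ki).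
by have := L2ipZr 0 (0 : L2s) (u k); rewrite scale0r mul0r.
Qed.

Lemma friedrichs_vec (e : R) : 0 < e ->
  exists (K : finType) (w : K -> W), forall u, H10f u ->
  `|u| ^+ 2 <= \sum_k (L2inner u (w k)) ^+ 2 + e * `|grad u| ^+ 2.
Proof.
move=> /(friedrichs Omega)[K [w h]].
exists ('I_3 * K)%type, (fun k => unit_fam k.1 (w k.2)) => u u0.
rewrite fam_norm2 grad_norm2 mulr_sumr -(pair_big xpredT xpredT (fun i k => L2inner u (unit_fam i (w k)) ^+ 2))/= -big_split/=.
apply: ler_sum => i _; apply: (le_trans (h _ (u0 i))); rewrite lerD2r.
by apply: ler_sum => k _; rewrite L2inner_unit_fam.
Qed.

(** Integration by parts moves both derivatives onto the smooth field, so the functional is bounded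
    in the norm of L^2. This provides the dense set of functionals recorded in [es_dense]. *)
Lemma grad_test_bound s : solenoidal_tests s -> exists2 C : R, 0 <= C &
  forall v, H10f v -> `|L2inner (grad s) (grad v)| <= C * `|v|.
Proof.
move=> /solenoidal_testsE[phi [c _ sE]].
exists (\sum_ij `|toL2 (D ij.2 (D ij.2 (phi ij.1)))|); first exact: sumr_ge0.
move=> v v0; rewrite mulr_suml; apply: (le_trans (ler_norm_sum _ _ _)).
apply: ler_sum => -[i j] _ /=.
rewrite -/(L2ip _ _) !gradE sE test_vecE (weak_partial_test j (c i)) L2ipC.
have /is_weak_partialE/(_ _ (Ccinfty_deriv j (c i))) E := weak_partialP j (v0 i).1.
rewrite -normrN -E; apply: (le_trans (L2ip_le _ _)); rewrite mulrC.
by apply: ler_wpM2l => //; exact: l2fam_le.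
Qed.

Lemma V_L4 u i : Vspace u -> L4 (u i).
Proof. by move=> [h _]; exact: H10_L4. Qed.

Lemma grad_le u i j : `|weak_partial j (u i)| <= `|grad u|.
Proof. by rewrite -gradE; exact: l2fam_le. Qed.

Lemma V_norm4 u i : Vspace u -> norm4 (u i) <= 8 * `|u| * `|grad u| ^+ 3.
Proof.
move=> uV; have := int4_H10 (uV.1 i); rewrite (norm4E (V_L4 i uV)) lee_fin => /le_trans; apply.
have g2 j : `|weak_partial j (u i)| ^+ 2 <= `|grad u| ^+ 2.
  by rewrite lerXn2r ?nnegrE//; exact: grad_le.
have h1 : `|u i| * `|weak_partial 2 (u i)| <= `|u| * `|grad u|.
  by apply: ler_pM => //; [exact: l2fam_le|exact: grad_le].
have h2 := lerD (g2 0) (g2 1).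
have -> : 8 * `|u| * `|grad u| ^+ 3 = 4 * (`|u| * `|grad u|) * (`|grad u| ^+ 2 + `|grad u| ^+ 2) by ring.
apply: ler_pM => //; by rewrite ler_pM2l.
Qed.

(* A bound for the [L^4] norm of the components of [u]. *)
Definition L4bound u : R := Num.sqrt (Num.sqrt (8 * `|u| * `|grad u| ^+ 3)).

Lemma L4bound_ge0 u : 0 <= L4bound u. Proof. exact: sqrtr_ge0. Qed.

Lemma prod_norm_V u w i j : Vspace u -> Vspace w ->
  `|prod (u i) (w j)| <= L4bound u * L4bound w.
Proof.
move=> uV wV; have := prod_norm (V_L4 i uV) (V_L4 j wV) => h.
have pw v : L4bound v ^+ 4 = 8 * `|v| * `|grad v| ^+ 3.
  rewrite -[4%N]/(2 * 2)%N exprM /L4bound sqr_sqrtr ?sqrtr_ge0// sqr_sqrtr//.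
exact: (root4_le (normr_ge0 _) (L4bound_ge0 u) (L4bound_ge0 w) h (norm4_ge0 _) (norm4_ge0 _)
  (V_norm4 i uV) (V_norm4 j wV) (pw u) (pw w)).
Qed.

(** Each term pairs a derivative in L^2 with a product of two functions of L^4, so the integral of
    the sum splits. Trilinearity and the bounds are read off this form. *)
Lemma convectionE u v w : Vspace u -> Vspace w ->
  convection u v w = \sum_i \sum_j L2ip (weak_partial j (v i)) (prod (u j) (w i)).
Proof.
move=> uV wV; pose h i j x := L2_fun (u j) x * L2_fun (grad v (i, j)) x * L2_fun (w i) x.
have tri i j := tri_integral (grad v (i, j)) (V_L4 j uV) (V_L4 i wV).
transitivity (\int[mu]_x \sum_i \sum_j h i j x).
  by apply: eq_Rintegral => x _; apply: eq_bigr => i _; rewrite mulr_suml.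
rewrite (Rintegral_sum3 (fun i => (Rintegral_sum3 (fun j => (tri i j).1)).1)).2.
apply: eq_bigr => i _; rewrite (Rintegral_sum3 (fun j => (tri i j).1)).2.
by apply: eq_bigr => j _; rewrite -gradE; exact: (tri i j).2.
Qed.

Lemma convection_le u v w : Vspace u -> Vspace w ->
  `|convection u v w| <= 9 * (L4bound u * L4bound w) * `|grad v|.
Proof.
move=> uV wV; rewrite convectionE//; apply: (le_trans (ler_norm_sum _ _ _)).
apply: (@le_trans _ _ (\sum_(i < 3) \sum_(j < 3) `|grad v| * (L4bound u * L4bound w))).
  apply: ler_sum => i _; apply: (le_trans (ler_norm_sum _ _ _)); apply: ler_sum => j _.
  apply: (le_trans (L2ip_le _ _)); apply: ler_pM => //; [exact: grad_le|exact: prod_norm_V].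
have ar (g l : R) : g * l * 9 = 9 * l * g by ring.
by rewrite sum33 ar.
Qed.

Lemma convection_lin1 (a : R) u u' v w : Vspace u -> Vspace u' -> Vspace w ->
  convection (a *: u + u') v w = a * convection u v w + convection u' v w.
Proof.
move=> uV uV' wV; rewrite (convectionE v (V_lin a uV uV') wV) (convectionE v uV wV) (convectionE v uV' wV).
rewrite mulr_sumr -big_split; apply: eq_bigr => i _.
rewrite mulr_sumr -big_split; apply: eq_bigr => j _ /=.
rewrite l2famD l2famZ (prod_linl _ (V_L4 j uV) (V_L4 j uV') (V_L4 i wV)).
by rewrite L2ipDr L2ipZr.
Qed.

Lemma convection_lin2 (a : R) u v v' w : Vspace u -> Vspace v -> Vspace v' -> Vspace w ->
  convection u (a *: v + v') w = a * convection u v w + convection u v' w.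
Proof.
move=> uV vV vV' wV; rewrite (convectionE (a *: v + v') uV wV) (convectionE v uV wV) (convectionE v' uV wV).
rewrite mulr_sumr -big_split; apply: eq_bigr => i _.
rewrite mulr_sumr -big_split; apply: eq_bigr => j _ /=.
rewrite l2famD l2famZ (H10_lin a (vV.1 i) (vV'.1 i)).2.
by rewrite L2ipDl L2ipZl.
Qed.

Lemma convection_lin3 (a : R) u v w w' : Vspace u -> Vspace w -> Vspace w' ->
  convection u v (a *: w + w') = a * convection u v w + convection u v w'.
Proof.
move=> uV wV wV'; rewrite (convectionE v uV (V_lin a wV wV')) (convectionE v uV wV) (convectionE v uV wV').
rewrite mulr_sumr -big_split; apply: eq_bigr => i _.
rewrite mulr_sumr -big_split; apply: eq_bigr => j _ /=.
rewrite l2famD l2famZ prodC (prod_linl _ (V_L4 i wV) (V_L4 i wV') (V_L4 j uV)).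
by rewrite L2ipDr L2ipZr !(prodC (u j)).
Qed.

End gradient.

(** * Weak topology and compactness in energy spaces *)

Lemma near_min (R : realType) (A : set R) (e : R) : A !=set0 -> (exists m, lbound A m) -> 0 < e ->
  exists2 a, A a & forall b, A b -> a <= b + e.
Proof.
move=> A0 Alb e0; have [a Aa ha] := inf_adherent e0 (conj A0 Alb).
exists a => // b Ab; apply/ltW/(lt_le_trans ha); rewrite lerD2r.
by apply: ge_inf.
Qed.

Definition seq_complete (R : realType) (W : normedModType R) : Prop := forall u_ : nat -> W,
  (forall e : R, 0 < e -> exists N, forall m n, (N <= m)%N -> (N <= n)%N -> `|u_ m - u_ n| <= e) ->
  exists u : W, u_ n @[n --> \oo] --> u.

(* A Hilbert space W with a subspace V that is complete for the norm of its gradient. *)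
Record energy_space (R : realType) := EnergySpace {
  es_W : normedModType R ;
  es_G : normedModType R ;
  es_ip : es_W -> es_W -> R ;
  es_ipG : es_G -> es_G -> R ;
  es_V : es_W -> Prop ;
  es_grad : es_W -> es_G ;
  es_ipP : is_inner es_ip ;
  es_ipGP : is_inner es_ipG ;
  es_complete : seq_complete es_W ;
  es_completeG : seq_complete es_G ;
  es_V0 : es_V 0 ;
  es_V_lin : forall (a : R) u v, es_V u -> es_V v -> es_V (a *: u + v) ;
  es_grad_lin : forall (a : R) u v, es_V u -> es_V v ->
    es_grad (a *: u + v) = a *: es_grad u + es_grad v ;
  es_V_closed : forall u g, (forall e : R, 0 < e ->
    exists v, [/\ es_V v, `|u - v| < e & `|g - es_grad v| < e]) -> es_V u /\ es_grad u = g ;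
  es_dense : forall u (e : R), es_V u -> 0 < e -> exists s, [/\ es_V s, `|es_grad (u - s)| < e &
    exists2 C : R, 0 <= C & forall v, es_V v -> `|es_ipG (es_grad s) (es_grad v)| <= C * `|v|] ;
  es_friedrichs : forall e : R, 0 < e -> exists (K : finType) (w : K -> es_W), forall u, es_V u ->
    `|u| ^+ 2 <= \sum_k (es_ip u (w k)) ^+ 2 + e * `|es_grad u| ^+ 2 }.

Section energy_space.
Context {R : realType} (E : energy_space R).
Local Notation W := (es_W E).
Local Notation V := (@es_V _ E).
Local Notation gr := (@es_grad _ E).
Local Notation ipG := (@es_ipG _ E).
Implicit Types u v w : W.

Lemma es_VZ a u : V u -> V (a *: u).
Proof. by move=> h; rewrite -[_ *: _]addr0; apply: es_V_lin => //; exact: es_V0. Qed.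

Lemma es_VD u v : V u -> V v -> V (u + v).
Proof. by move=> h1 h2; rewrite -[u]scale1r; exact: es_V_lin. Qed.

Lemma es_VB u v : V u -> V v -> V (u - v).
Proof. by move=> h1 h2; rewrite addrC -scaleN1r; exact: es_V_lin. Qed.

Lemma es_grad0 : gr 0 = 0.
Proof. by have := es_grad_lin (-1) (es_V0 E) (es_V0 E); rewrite !scaleN1r !addNr. Qed.

Lemma es_gradZ a u : V u -> gr (a *: u) = a *: gr u.
Proof. by move=> h; rewrite -[_ *: _]addr0 es_grad_lin//; [rewrite es_grad0 addr0|exact: es_V0]. Qed.

Lemma es_gradD u v : V u -> V v -> gr (u + v) = gr u + gr v.
Proof. by move=> h1 h2; have := es_grad_lin 1 h1 h2; rewrite !scale1r. Qed.

Lemma es_gradB u v : V u -> V v -> gr (u - v) = gr u - gr v.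
Proof. by move=> h1 h2; rewrite addrC -scaleN1r es_grad_lin// scaleN1r addrC. Qed.

Lemma half_double u : 2^-1 *: (u + u) = u.
Proof. have e : 2^-1 + 2^-1 = 1 :> R by field.
by rewrite scalerDr -scalerDl e scale1r. Qed.

Lemma natSinv_lt (e : R) : 0 < e -> exists N, forall n, (N <= n)%N -> n.+1%:R^-1 < e.
Proof. by move=> e0; have [N _ h] := near_infty_natSinv_lt (PosNum e0); exists N => n /h. Qed.

Lemma natSinv_gt0 n : 0 < n.+1%:R^-1 :> R.
Proof. by rewrite invr_gt0. Qed.

(* Weak compactness of the balls of V by Mazur's argument: elements of almost
   minimal gradient in the convex sets of points of the ball near the limit form a
   Cauchy sequence by the parallelogram identity. *)
Lemma es_weak_closed u (r : R) :
  (forall e : R, 0 < e -> exists v, [/\ V v, `|gr v| <= r & `|u - v| <= e]) -> V u /\ `|gr u| <= r.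
Proof.
move=> h.
have r0 : 0 <= r by have [v [_ hv _]] := h _ ltr01; exact: le_trans hv.
pose C (e : R) := [set v | [/\ V v, `|gr v| <= r & `|u - v| <= e]].
have near n : exists2 v, C n.+1%:R^-1 v &
    forall w, C n.+1%:R^-1 w -> `|gr v| ^+ 2 <= `|gr w| ^+ 2 + n.+1%:R^-1.
  have [||_ [v Cv <-] hv] := @near_min R [set `|gr v| ^+ 2 | v in C n.+1%:R^-1] n.+1%:R^-1 _ _ (natSinv_gt0 n).
  - by have [v hv] := h _ (natSinv_gt0 n); exists (`|gr v| ^+ 2); exists v.
  - by exists 0 => _ [v _ <-]; exact: sqr_ge0.
  by exists v => // w Cw; apply: hv; exists w.
pose v_ n := s2val (cid2 (near n)).
have Cv n : C n.+1%:R^-1 (v_ n) by exact: s2valP (cid2 (near n)).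
have hv n w : C n.+1%:R^-1 w -> `|gr (v_ n)| ^+ 2 <= `|gr w| ^+ 2 + n.+1%:R^-1.
  exact: (s2valP' (cid2 (near n))).
have Cm m n : (n <= m)%N -> C n.+1%:R^-1 (v_ m).
  move=> nm; have [a b c] := Cv m; split=> //; apply: (le_trans c).
  by rewrite lef_pV2 ?posrE ?ltr0n// ler_nat.
have Vv n : V (v_ n) by have [] := Cv n.
have gap m n : (n <= m)%N -> `|gr (v_ m) - gr (v_ n)| ^+ 2 <=
    2 * (`|gr (v_ m)| ^+ 2 - `|gr (v_ n)| ^+ 2) + 4 * n.+1%:R^-1.
  move=> nm; have Cmid : C n.+1%:R^-1 (2^-1 *: (v_ m + v_ n)).
    have [a b c] := Cm _ _ nm; have [a' b' c'] := Cv n; split.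
    - by apply: es_VZ; exact: es_VD.
    - rewrite es_gradZ ?es_gradD//; last exact: es_VD.
      rewrite normrZ ger0_norm ?invr_ge0//; have := ler_normD (gr (v_ m)) (gr (v_ n)); lra.
    - have -> : u - 2^-1 *: (v_ m + v_ n) = 2^-1 *: ((u - v_ m) + (u - v_ n)).
        by rewrite addrACA -opprD scalerBr half_double.
      rewrite normrZ ger0_norm ?invr_ge0//.
      have := ler_normD (u - v_ m) (u - v_ n); move: c c'; move: (n.+1%:R^-1) => q; lra.
  have := hv _ _ Cmid; rewrite es_gradZ ?es_gradD//; last exact: es_VD.
  rewrite (parallelogram (es_ipGP E)); move: (n.+1%:R^-1) => q; lra.
pose a n := `|gr (v_ n)| ^+ 2.
(* The values [a n] need not be monotone, but [b n <= a m] whenever [n <= m]; the supremum of [b]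
   plays the role of their limit. *)
pose b n := a n - n.+1%:R^-1.
have ba m n : (n <= m)%N -> b n <= a m by move=> nm; rewrite lerBlDr; apply: hv; exact: Cm.
have bb : ubound [set b n | n in setT] (r ^+ 2).
  move=> _ [n _ <-]; apply: (le_trans (ba _ _ (leqnn n))).
  by rewrite lerXn2r ?nnegrE//; have [] := Cv n.
have bsup : has_sup [set b n | n in setT] by split; [exists (b 0%N); exists 0%N|exists (r ^+ 2)].
set S := sup [set b n | n in setT].
have bS n : b n <= S by apply: sup_upper_bound => //; exists n.
have cauchy : forall e : R, 0 < e -> exists N, forall m n, (N <= m)%N -> (N <= n)%N ->
    `|gr (v_ m) - gr (v_ n)| <= e.
  (* For large [n <= m], [a m < S + eta] and [a n > S - eta], so the bound in [gap] is at most
     [2 * (2 eta) + 4 eta = e ^+ 2]. *)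
  move=> e e0; pose eta := e ^+ 2 / 8.
  have eta0 : 0 < eta by rewrite divr_gt0// exprn_gt0.
  have [_ [N1 _ <-] hN1] := sup_adherent eta0 bsup.
  have [N2 hN2] := natSinv_lt eta0.
  pose N := maxn N1 N2; exists N.
  have main m n : (n <= m)%N -> (N <= n)%N -> `|gr (v_ m) - gr (v_ n)| <= e.
    move=> nm Nn; rewrite -ler_sqr ?nnegrE// ?(ltW e0)//; apply: (le_trans (gap _ _ nm)).
    have h1 k : (n <= k)%N -> k.+1%:R^-1 < eta.
      by move=> nk; apply: hN2; apply: leq_trans (leq_trans Nn nk); rewrite leq_maxr.
    have h2 := bS m; have h3 := h1 _ (leqnn n); have h4 := h1 _ nm.
    have h5 : b N1 <= a n by apply: ba; apply: leq_trans Nn; rewrite leq_maxl.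
    change (2 * (a m - a n) + 4 * n.+1%:R^-1 <= e ^+ 2).
    have -> : e ^+ 2 = 8 * eta by rewrite /eta; field.
    move: h2 h3 h4 h5 hN1; rewrite {1}/b -/S; move: (m.+1%:R^-1) (n.+1%:R^-1) => q q'; lra.
  move=> m n Nm Nn; case: (leqP n m) => [nm|/ltnW nm]; first exact: main.
  by rewrite distrC; exact: main.
have [g gg] := es_completeG cauchy.
have gN e : 0 < e -> exists N, forall n, (N <= n)%N -> `|g - gr (v_ n)| < e.
  by move=> e0; move/cvgrPdist_lt : gg => /(_ e e0)[N _ hN]; exists N => n /hN.
have [Vu ug] : V u /\ gr u = g.
  apply: es_V_closed => e e0; have [N1 h1] := gN _ e0; have [N2 h2] := natSinv_lt e0.
  exists (v_ (maxn N1 N2)); split=> //; last by apply: h1; exact: leq_maxl.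
  have [_ _ c] := Cv (maxn N1 N2); apply: (le_lt_trans c).
  by apply: h2; exact: leq_maxr.
split=> //; rewrite ug; apply/ler_addgt0Pl => e e0; have [N hN] := gN _ e0.
have [_ c _] := Cv N; have := hN N (leqnn N).
have := ler_normD (g - gr (v_ N)) (gr (v_ N)); rewrite subrK; lra.
Qed.

Definition es_dual (l : W -> R) : Prop :=
  (forall a u v, V u -> V v -> l (a *: u + v) = a * l u + l v) /\
  exists C : R, forall u, V u -> `|l u| <= C * `|gr u|.

Lemma es_dualB (l : W -> R) u v : es_dual l -> V u -> V v -> l (u - v) = l u - l v.
Proof. by move=> [lin _] h1 h2; rewrite addrC -scaleN1r lin// mulN1r addrC. Qed.

(** Functionals bounded in H are dense in V'. An almost minimiser [w] of the Dirichlet energy [J]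
    represents [l] up to a small multiple of the gradient, as in Riesz' theorem, and [w] is then
    replaced by an element [s] whose functional is bounded in H. *)
Lemma es_dual_small (l : W -> R) (e : R) : es_dual l -> 0 < e ->
  exists2 C : R, 0 <= C & forall v, V v -> `|l v| <= e * `|gr v| + C * `|v|.
Proof.
move=> [lin [C0 hC0]] e0; have e40 : 0 < e / 4 by rewrite divr_gt0.
(* Chosen so that [2 * d = (e / 2) ^+ 2]; the replacement of [w] by [s] costs [e / 4] more. *)
pose d := e ^+ 2 / 8; have d0 : 0 < d by rewrite divr_gt0// exprn_gt0.
pose J v := 2^-1 * `|gr v| ^+ 2 - l v.
have [||_ [w Vw <-] hw] := @near_min R [set J v | v in V] d _ _ d0.
- by exists (J 0); exists 0 => //; exact: es_V0.
- exists (- (C0 ^+ 2)) => _ [v Vv <-]; rewrite /J.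
  have := hC0 v Vv; rewrite ler_norml => /andP[_]; move: (l v) `|gr v| => y x.
  have := sqr_ge0 (x - C0); have := sqr_ge0 C0; have := sqr_ge0 x; rewrite !expr2; nra.
have quad v : V v -> (ipG (gr w) (gr v) - l v) ^+ 2 <= 2 * d * `|gr v| ^+ 2.
  move=> Vv; set a := _ - l v; set b := `|gr v| ^+ 2.
  (* Compare [J] at [w] and at [t *: v + w]. As [t] is arbitrary, the discriminant gives the bound
     [a ^+ 2 <= 2 * d * b]. *)
  have key t : - d <= t * a + 2^-1 * t ^+ 2 * b.
    have Vtv : V (t *: v + w) by exact: es_V_lin.
    have : J w <= J (t *: v + w) + d by apply: hw; exists (t *: v + w).
    rewrite /J es_grad_lin// lin// (norm2D (es_ipGP E)) (ipZl (es_ipGP E)) normrZ exprMn real_normK ?num_real//.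
    rewrite (ipC (es_ipGP E) (gr v)) -/b /a; nra.
  have b0 : 0 <= b by exact: sqr_ge0.
  have [b00|bn0] := eqVneq b 0.
    rewrite b00 mulr0; have [->|a0] := eqVneq a 0; first by rewrite expr0n.
    have := key (- (d + 1) / a); rewrite b00 mulr0 addr0 mulfVK//; lra.
  have bp : 0 < b by rewrite lt_neqAle eq_sym bn0.
  have := key (- a / b).
  have -> : - a / b * a + 2^-1 * (- a / b) ^+ 2 * b = - (a ^+ 2 / (2 * b)) by field.
  move=> h; have : a ^+ 2 / (2 * b) <= d by lra.
  have b2 : 0 < 2 * b by lra.
  by rewrite ler_pdivrMr// => /le_trans; apply; rewrite mulrA [d * 2]mulrC.
have [s [Vs hs [C C00 hC]]] := es_dense Vw e40.
exists C => // v Vv.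
have h1 : `|ipG (gr w) (gr v) - l v| <= e / 2 * `|gr v|.
  rewrite -ler_sqr ?nnegrE ?mulr_ge0 ?divr_ge0 ?(ltW e0)// real_normK ?num_real//.
  apply: (le_trans (quad v Vv)); rewrite exprMn.
  by apply: ler_wpM2r; [exact: sqr_ge0|rewrite /d expr_div_n; lra].
have h2 : `|ipG (gr w) (gr v) - ipG (gr s) (gr v)| <= e / 4 * `|gr v|.
  rewrite -(ipBl (es_ipGP E)) -es_gradB//; apply: (le_trans (ip_le (es_ipGP E) _ _)).
  by apply: ler_wpM2r => //; exact: ltW.
have h3 := hC v Vv; have g0 : 0 <= e / 4 * `|gr v| by rewrite mulr_ge0// ltW.
have -> : l v = - (ipG (gr w) (gr v) - l v) + (ipG (gr w) (gr v) - ipG (gr s) (gr v)) + ipG (gr s) (gr v) by ring.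
apply: (le_trans (ler_normD _ _)); apply: (le_trans (lerD (ler_normD _ _) (lexx _))).
rewrite normrN; lra.
Qed.

(** Weak convergence in V of a sequence that is bounded in V and converges in H: in [es_dual_small]
    the gradient term is uniformly small and the other one tends to 0. *)
Lemma es_dual_cvg (l : W -> R) (u_ : nat -> W) u (r : R) : es_dual l -> (forall n, V (u_ n)) ->
  (forall n, `|gr (u_ n)| <= r) -> V u -> u_ n @[n --> \oo] --> u -> l (u_ n) @[n --> \oo] --> l u.
Proof.
move=> ld Vn gn Vu cu; have [lin _] := ld; apply/cvgrPdist_lt => e e0.
have r0 : 0 <= r by apply: le_trans (gn 0%N).
pose r1 := r + `|gr u| + 1; have r10 : 0 < r1 by rewrite /r1 ltr_wpDl// addr_ge0.
have d0 : 0 < e / 2 / r1 by rewrite !divr_gt0.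
have [C C0 hC] := es_dual_small ld d0.
have d1 : 0 < e / 2 / (C + 1) by rewrite !divr_gt0// ltr_wpDl.
move/cvgrPdist_lt : cu => /(_ _ d1); apply: filterS => n hn.
have -> : l u - l (u_ n) = l (u - u_ n) by rewrite (es_dualB ld).
apply: (le_lt_trans (hC _ (es_VB Vu (Vn n)))).
have g1 : `|gr (u - u_ n)| <= r1.
  by rewrite es_gradB//; apply: (le_trans (ler_normB _ _)); have := gn n; rewrite /r1; lra.
have h1 : e / 2 / r1 * `|gr (u - u_ n)| <= e / 2.
  by apply: (le_trans (ler_wpM2l (ltW d0) g1)); rewrite mulfVK ?gt_eqF.
have h2 : C * `|u - u_ n| < e / 2.
  have := ler_wpM2r (normr_ge0 (u - u_ n)) (_ : C <= C + 1); rewrite lerDl => /(_ ler01).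
  move=> /le_lt_trans; apply; rewrite mulrC -ltr_pdivlMr// ltr_wpDl//.
lra.
Qed.

End energy_space.

(** The limit is the supremum of the [t] such that [t <= f] on a member of [F]; an ultrafilter
    decides the question for each [t]. *)
Lemma ultra_lim (R : realType) (T : Type) (F : set_system T) (f : T -> R) (M : R) : UltraFilter F ->
  F [set x | `|f x| <= M] -> exists2 l : R, `|l| <= M & forall d : R, 0 < d -> F [set x | `|f x - l| < d].
Proof.
move=> FU FM; have FP := @ultra_proper _ F FU.
pose A := [set t : R | F [set x | t <= f x]].
have A1 : A (- M) by apply: filterS FM => x /=; rewrite ler_norml => /andP[].
have Aub : ubound A M.
  move=> t At; have [x [/= h1 h2]] := @filter_ex _ _ _ _ (filterI At FM).
  by move: h2; rewrite ler_norml => /andP[_]; exact: le_trans.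
have sA : has_sup A by split; [exists (- M)|exists M].
exists (sup A).
  rewrite ler_norml; apply/andP; split; first exact: sup_upper_bound.
  by apply: sup_le_ub => //; exists (- M).
move=> d d0.
have [t At ht] := sup_adherent d0 sA.
have : ~ A (sup A + d / 2).
  by move=> /(sup_upper_bound sA); rewrite gerDl leNgt divr_gt0.
have [//|h] := @in_ultra_setVsetC _ _ [set x | sup A + d / 2 <= f x] FU => _.
apply: filterS2 At h => x /= h1 /negP; rewrite -ltNge => h2.
by rewrite ltr_distl; lra.
Qed.

Lemma sum_cst (R : realType) (K : finType) (c : R) : \sum_(k : K) c = #|K|%:R * c.
Proof. by rewrite sumr_const mulr_natl. Qed.

(** * The compact embedding of V in H *)

Section compactness.
Context {R : realType} (E : energy_space R).
Local Notation W := (es_W E).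
Local Notation V := (@es_V _ E).
Local Notation gr := (@es_grad _ E).
Local Notation ip := (@es_ip _ E).
Variables (T : topologicalType) (val : T -> W).
Hypothesis nbhs_val : forall (x : T) (A : set T),
  nbhs x A <-> exists2 e : R, 0 < e & forall y, `|val y - val x| < e -> A y.

Lemma within_seq_continuous (A : set T) (f : T -> R) :
  (forall (u_ : nat -> T) u, (forall n, A (u_ n)) -> A u -> val (u_ n) @[n --> \oo] --> val u ->
    f (u_ n) @[n --> \oo] --> f u) -> {within A, continuous f}.
Proof.
move=> h; apply/subspace_continuousP => x Ax; apply/cvgrPdist_lt => e e0; apply: contrapT => nh.
have bad n : exists y, [/\ A y, `|val y - val x| < n.+1%:R^-1 & e <= `|f x - f y|].
  apply: contrapT => nex; apply: nh; rewrite /within/=; apply/nbhs_val.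
  exists n.+1%:R^-1; first by rewrite invr_gt0.
  move=> y yx Ay; rewrite ltNge; apply/negP => fe; apply: nex; by exists y.
pose u_ n := projT1 (cid (bad n)).
have uP n : [/\ A (u_ n), `|val (u_ n) - val x| < n.+1%:R^-1 & e <= `|f x - f (u_ n)|] by exact: projT2 (cid (bad n)).
have : f (u_ n) @[n --> \oo] --> f x.
  apply: h => // [n|]; first by have [] := uP n.
  apply/cvgrPdist_lt => d d0; have [N hN] := @natSinv_lt R _ d0; exists N => // n /= /hN.
  by rewrite distrC; apply: lt_trans; have [] := uP n.
move=> /cvgrPdist_lt/(_ e e0)[N _ /(_ N (leqnn N))] /=.
by rewrite ltNge; have [_ _ ->] := uP N.
Qed.

(** Rellich's theorem. By Friedrichs' inequality the distance of two points of [A] is small as soon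
    as finitely many linear functionals nearly agree on them. These functionals converge along the
    ultrafilter, which therefore contains sets of arbitrarily small diameter; completeness gives the
    limit. *)
Lemma es_compact (A : set T) (r b : R) :
  (forall x, A x -> [/\ V (val x), `|gr (val x)| <= r & `|val x| <= b]) ->
  (forall (u_ : nat -> T) w, (forall n, A (u_ n)) -> val (u_ n) @[n --> \oo] --> w ->
    exists2 x, A x & val x = w) -> compact A.
Proof.
move=> hA clA; rewrite compact_ultra => F FU FA.
have FP := @ultra_proper _ F FU.
have small e : 0 < e -> exists S : set T, [/\ F S, S `<=` A & forall x y, S x -> S y -> `|val x - val y| <= e].
  (* The gradient of a difference is at most [2 * r], so the term with [e'] is at most
     [e' * 4 * (r ^+ 2 + 1) = e ^+ 2 / 2]; the choice of [d] leaves the other half for the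
     functionals. *)
  move=> e0; pose e' := e ^+ 2 / (8 * (r ^+ 2 + 1)).
  have r20 : 0 < r ^+ 2 + 1 by rewrite ltr_wpDl ?sqr_ge0.
  have e'0 : 0 < e' by rewrite divr_gt0 ?exprn_gt0// mulr_gt0.
  have [K [w fr]] := @es_friedrichs _ E e' e'0.
  pose d := e / (4 * (#|K|%:R + 1)).
  have d0 : 0 < d by rewrite divr_gt0// mulr_gt0// ltr_wpDl.
  have lims k : exists l : R, F [set x | `|ip (val x) (w k) - l| < d].
    have [|l _ hl] := @ultra_lim _ _ F (fun x => ip (val x) (w k)) (b * `|w k|) FU.
      apply: filterS FA => x /hA[_ _ xb] /=; apply: (le_trans (ip_le (es_ipP E) _ _)).
      by apply: ler_wpM2r.
    by exists l; exact: hl.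
  pose l k := projT1 (cid (lims k)).
  have hl k : F [set x | `|ip (val x) (w k) - l k| < d] by exact: projT2 (cid (lims k)).
  exists (A `&` [set x | forall k, `|ip (val x) (w k) - l k| < d]); split.
  - by apply: filterI => //; exact: filter_forall.
  - by move=> x [].
  move=> x y [Ax hx] [Ay hy]; have [Vx gx bx] := hA _ Ax; have [Vy gy by_] := hA _ Ay.
  rewrite -ler_sqr ?nnegrE ?(ltW e0)//; apply: (le_trans (fr _ (es_VB Vx Vy))).
  have h1 : e' * `|gr (val x - val y)| ^+ 2 <= e ^+ 2 / 2.
    have : `|gr (val x - val y)| <= 2 * r.
      by rewrite es_gradB//; apply: (le_trans (ler_normB _ _)); lra.
    move=> g2; have : `|gr (val x - val y)| ^+ 2 <= 4 * (r ^+ 2 + 1).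
      have := ler_pM (normr_ge0 _) (normr_ge0 _) g2 g2; rewrite -!expr2 !exprMn; nra.
    move=> /(ler_wpM2l (ltW e'0)) /le_trans; apply.
    have -> : e' * (4 * (r ^+ 2 + 1)) = e ^+ 2 / 2 by rewrite /e'; field; rewrite gt_eqF.
    by [].
  have h2 : \sum_k ip (val x - val y) (w k) ^+ 2 <= e ^+ 2 / 2.
    apply: (@le_trans _ _ (\sum_(k : K) (2 * d) ^+ 2)).
      apply: ler_sum => k _; rewrite -[leLHS]real_normK ?num_real// lerXn2r ?nnegrE//; first by have := ltW d0; lra.
      rewrite (ipBl (es_ipP E)).
      have -> : ip (val x) (w k) - ip (val y) (w k) = (ip (val x) (w k) - l k) - (ip (val y) (w k) - l k) by ring.
      apply: (le_trans (ler_normB _ _)); have := hx k; have := hy k; lra.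
    rewrite sum_cst.
    have -> : (2 * d) ^+ 2 = (e ^+ 2 / 4) * ((#|K|%:R + 1)^-1 ^+ 2).
      by rewrite /d; field; rewrite gt_eqF// ltr_wpDl.
    have : #|K|%:R * ((#|K|%:R + 1)^-1 ^+ 2) <= 1 :> R.
      have c0 : 0 <= #|K|%:R :> R by [].
      rewrite exprVn ler_pdivrMr ?exprn_gt0 ?ltr_wpDl// mul1r; nra.
    move=> q1; rewrite [leLHS]mulrCA.
    have e24 : 0 <= e ^+ 2 / 4 by rewrite divr_ge0 ?sqr_ge0.
    have := ler_wpM2l e24 q1; rewrite mulr1; have := sqr_ge0 e; lra.
  lra.
pose S n := projT1 (cid (small n.+1%:R^-1 (natSinv_gt0 n))).
have SP n : [/\ F (S n), S n `<=` A & forall x y, S n x -> S n y -> `|val x - val y| <= n.+1%:R^-1].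
  exact: projT2 (cid (small n.+1%:R^-1 (natSinv_gt0 n))).
(* Finitely many members of [F] have a common point; taking one in [S 0], ..., [S n] for each [n]
   gives a Cauchy sequence. *)
have ex n : exists x, forall i : 'I_n.+1, S i x.
  by apply: (@filter_ex _ F); apply: filter_forall => i; have [] := SP i.
pose u_ n := projT1 (cid (ex n)).
have uS n i : (i <= n)%N -> S i (u_ n).
  by move=> ni; exact: (projT2 (cid (ex n)) (Ordinal (ni : (i < n.+1)%N))).
have [] := @es_complete _ E (fun n => val (u_ n)).
  move=> e e0; have [N hN] := @natSinv_lt R _ e0; exists N => m n Nm Nn.
  have [_ _ hS] := SP N; apply: (le_trans (hS _ _ (uS _ _ Nm) (uS _ _ Nn))).
  by apply/ltW/hN.
move=> w cw.
have [x Ax xw] : exists2 x, A x & val x = w.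
  by apply: (clA u_) => // n; have [_ SA _] := SP 0%N; apply: SA; exact: uS.
exists x; split=> // N /nbhs_val[e e0 hN].
have e20 : 0 < e / 2 by rewrite divr_gt0.
have [n hn] := @natSinv_lt R _ e20.
have [FS _ hS] := SP n; apply: filterS FS => y Sy; apply: hN; rewrite xw.
move/cvgrPdist_lt : cw => /(_ _ e20)[m _ hm].
apply: (@norm_sub_lt _ _ e _ (val (u_ (maxn m n)))).
  apply: (le_lt_trans (hS _ _ Sy (uS _ _ (leq_maxr _ _)))); exact: hn.
by rewrite distrC; apply: hm => /=; exact: leq_maxl.
Qed.

End compactness.

(* Sokal's gliding hump proof of the uniform boundedness principle. *)
Lemma weakly_bounded_bounded (R : realType) (W : normedModType R) (ip : W -> W -> R) (ipP : is_inner ip)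
    (Wc : seq_complete W) (Hs : W -> Prop) (C : set W) :
  Hs 0 -> (forall a u v, Hs u -> Hs v -> Hs (a *: u + v)) ->
  (forall (u_ : nat -> W) u, (forall n, Hs (u_ n)) -> u_ n @[n --> \oo] --> u -> Hs u) ->
  (forall u, C u -> Hs u) -> (forall x, Hs x -> exists M, forall u, C u -> `|ip x u| <= M) ->
  exists M, forall u, C u -> `|u| <= M.
Proof.
move=> Hs0 Hlin Hcl CH wb; apply: contrapT => nb.
have big n : exists2 u, C u & 4 ^+ n < `|u|.
  apply: contrapT => h; apply: nb; exists (4 ^+ n) => u Cu; rewrite leNgt; apply/negP => un.
  by apply: h; exists u.
pose a n := s2val (cid2 (big n)).
have aC n : C (a n) by exact: s2valP (cid2 (big n)).
have an n : 4 ^+ n < `|a n| by exact: (s2valP' (cid2 (big n))).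
have a0 n : 0 < `|a n| by apply: (le_lt_trans _ (an n)); rewrite exprn_ge0.
(* The humps have length [3^-n]. All the later ones together have length at most [3^-n / 2] and can
   destroy half of the gain [3^-n * |a n|], which exceeds [(4/3)^n]. *)
pose q : R := 3^-1.
have q0 : 0 < q by rewrite invr_gt0.
(* The hump takes the sign of [ip x (a n)], so that adding it cannot cancel what is already
   there. *)
pose stp n x := if 0 <= ip x (a n) then (q ^+ n / `|a n|) *: a n + x
  else - 1 *: ((q ^+ n / `|a n|) *: a n) + x.
pose x_ := fix x_ n := if n is n'.+1 then stp n' (x_ n') else 0.
have stpd n x : `|stp n x - x| = q ^+ n.
  have ny : `|(q ^+ n / `|a n|) *: a n| = q ^+ n.
    rewrite normrZ ger0_norm ?divr_ge0 ?exprn_ge0 ?(ltW q0)//.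
    by rewrite mulfVK// gt_eqF.
  by rewrite /stp; case: ifP => _; rewrite addrK// scaleN1r normrN.
have stpi n x : q ^+ n * `|a n| <= `|ip (stp n x) (a n)|.
  rewrite /stp; set y := _ *: a n.
  have yi : ip y (a n) = q ^+ n * `|a n|.
    by rewrite (ipZl ipP) (ip_norm ipP) expr2 mulrA mulfVK// gt_eqF.
  have z0 : 0 <= q ^+ n * `|a n| by rewrite mulr_ge0// exprn_ge0// ltW.
  case: ifPn => h; rewrite (ipDl ipP) ?(ipZl ipP (-1)) yi.
  - by rewrite ger0_norm ?addr_ge0// lerDl.
  - by rewrite -ltNge in h; rewrite ler0_norm; lra.
have stpH n x : Hs x -> Hs (stp n x).
  have Hy : Hs ((q ^+ n / `|a n|) *: a n) by rewrite -[_ *: _]addr0; apply: Hlin => //; exact: CH.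
  by move=> Hx; rewrite /stp; case: ifP => _; [rewrite -[_ *: a n]scale1r|]; exact: Hlin.
have xH n : Hs (x_ n) by elim: n => //= n IH; exact: stpH.
have xd m n : (n <= m)%N -> `|x_ m - x_ n| <= q ^+ n * (3 / 2) - q ^+ m * (3 / 2).
  move=> /subnKC <-; elim: (m - n)%N => [|k IH]; first by rewrite addn0 !subrr normr0.
  rewrite addnS /=; set z := x_ (n + k)%N; have -> : stp (n + k)%N z - x_ n = (stp (n + k)%N z - z) + (z - x_ n).
    by rewrite addrA subrK.
  apply: (le_trans (ler_normD _ _)); rewrite stpd exprS; move: IH; rewrite -/z.
  have -> : q * q ^+ (n + k) * (3 / 2) = q ^+ (n + k) / 2 by rewrite /q; field.
  lra.
have [x xx] : exists x : W, x_ n @[n --> \oo] --> x.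
  apply: Wc => e e0.
  have : (q ^+ n : R) @[n --> \oo] --> 0 by apply: cvg_expr; rewrite ger0_norm ?(ltW q0)// invf_lt1//; lra.
  move=> /cvgrPdist_lt/(_ (e / 2)) [|N _ hN]; first by rewrite divr_gt0.
  exists N => m n Nm Nn.
  have main m' n' : (n' <= m')%N -> (N <= n')%N -> `|x_ m' - x_ n'| <= e.
    move=> nm /hN /=; rewrite sub0r normrN ger0_norm ?exprn_ge0 ?(ltW q0)// => qe.
    apply: (le_trans (xd _ _ nm)).
    have : 0 <= q ^+ m' by rewrite exprn_ge0// ltW.
    lra.
  case: (leqP n m) => [nm|/ltnW nm]; first exact: main.
  by rewrite distrC; exact: main.
have Hx := Hcl _ _ xH xx.
have [M hM] := wb x Hx.
have lim n : `|x - x_ n.+1| <= q ^+ n / 2.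
  apply/ler_addgt0Pl => e e0; move/cvgrPdist_lt : xx => /(_ e e0)[N _ hN].
  have h1 := hN (maxn N n.+1) (leq_maxl _ _).
  have h2 := xd _ _ (leq_maxr N n.+1).
  have -> : x - x_ n.+1 = (x - x_ (maxn N n.+1)) + (x_ (maxn N n.+1) - x_ n.+1) by rewrite addrA subrK.
  apply: (le_trans (ler_normD _ _)); move: h1 h2 => /=; rewrite exprS.
  have -> : q * q ^+ n * (3 / 2) = q ^+ n / 2 by rewrite /q; field.
  have : 0 <= q ^+ (maxn N n.+1) by rewrite exprn_ge0// ltW.
  lra.
have low n : (4 / 3) ^+ n / 2 <= M.
  apply: le_trans (hM _ (aC n)).
  have -> : x = x_ n.+1 - (x_ n.+1 - x) by rewrite opprB addrC subrK.
  rewrite (ipBl ipP); apply: (le_trans _ (lerB_dist _ _)).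
  have h1 := stpi n (x_ n); have h2 := ip_le ipP (x_ n.+1 - x) (a n).
  have h3 : `|x_ n.+1 - x| * `|a n| <= q ^+ n / 2 * `|a n| by rewrite distrC ler_wpM2r.
  have h4 : (4 / 3) ^+ n <= q ^+ n * `|a n|.
    rewrite expr_div_n mulrC -exprVn -/q; apply: ler_wpM2l; first by rewrite exprn_ge0// ltW.
    exact: ltW.
  move: h1 h2 h3 h4; rewrite -[stp n (x_ n)]/(x_ n.+1).
  have -> : q ^+ n / 2 * `|a n| = q ^+ n * `|a n| / 2 by rewrite mulrAC.
  lra.
(* Bernoulli's inequality gives [(4/3)^k >= 1 + k / 3 > 2 M], against [low k]. *)
pose k := (Num.truncn (6 * (M + 1))).+1.
have kM : 6 * (M + 1) < k%:R by exact: truncnS_gt.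
have bern : 1 + k%:R / 3 <= (4 / 3) ^+ k :> R.
  elim: k {kM} => [|k IH]; first by rewrite mul0r addr0.
  rewrite exprS -natr1; have k0 : 0 <= k%:R :> R by []; nra.
have := low k; lra.
Qed.

(** * Coercive functions and the set B_f *)

Section ultrafilters.
Context {R : realType}.

Lemma ultra_map (I T : Type) (U : set_system I) (f : I -> T) : UltraFilter U -> UltraFilter (f @ U).
Proof.
move=> UU; have UP := @ultra_proper _ U UU; apply: Build_UltraFilter => G GP FG.
apply/seteqP; split=> // A GA.
have [//|h] := @in_ultra_setVsetC _ _ (f @^-1` A) UU.
have GcA : G (~` A) by apply: FG; rewrite /nbhs/=.
by have [x [? []]] := @filter_ex _ G _ _ (filterI GA GcA).
Qed.

Lemma ultra_compact_cvg (I : Type) (T : topologicalType) (U : set_system I) (f : I -> T) (A : set T) :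
  UltraFilter U -> compact A -> U [set i | A (f i)] -> exists2 x, A x & f i @[i --> U] --> x.
Proof.
move=> UU; rewrite compact_ultra => /(_ (f @ U) (ultra_map f UU)) h /h[x [Ax fx]].
by exists x.
Qed.

Lemma ultra_cvgR (I : Type) (U : set_system I) (f : I -> R) (M : R) : UltraFilter U ->
  U [set i | `|f i| <= M] -> exists2 l : R, `|l| <= M & f i @[i --> U] --> l.
Proof.
move=> UU /(ultra_lim UU)[l lM hl]; have UP := @ultra_proper _ U UU; exists l => //.
by apply/cvgrPdist_lt => e e0; apply: filterS (hl _ e0) => i /=; rewrite distrC.
Qed.

Lemma le_cvg_filter (I : Type) (U : set_system I) {UP : ProperFilter U} (f g : I -> R) (l l' : R) :
  f i @[i --> U] --> l -> g i @[i --> U] --> l' -> U [set i | f i <= g i] -> l <= l'.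
Proof.
move=> cf cg Uh; apply/ler_addgt0Pl => e e0; have e20 : 0 < e / 2 by rewrite divr_gt0.
move/cvgrPdist_lt : cf => /(_ _ e20) cf; move/cvgrPdist_lt : cg => /(_ _ e20) cg.
have [i [/= h [h1 h2]]] := @filter_ex _ U UP _ (filterI Uh (filterI cf cg)).
by move: h1 h2; rewrite !ltr_distl => /andP[] ? ? /andP[]; lra.
Qed.

(** Limits along a free ultrafilter replace the extraction of subsequences: all bounded quantities
    converge at once. *)
Lemma nat_ultra : exists U : set_system nat, UltraFilter U /\ \oo `<=` U.
Proof. exact: ultraFilterLemma. Qed.

End ultrafilters.

Section coercive.
Context {R : realType} (T : topologicalType) (T2 : hausdorff_space T).
Variables (X : set T) (N : T -> R).
Hypothesis N0 : forall x, X x -> 0 <= N x.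
Definition sublevel (r : R) : set T := [set x | X x /\ N x <= r].
Hypothesis Kc : forall r, compact (sublevel r).

(* With [N] the square of the norm of V, these are the functions that are weakly
   continuous on V and of subquadratic growth. *)
Definition subq (g : T -> R) : Prop := (forall r, {within sublevel r, continuous g}) /\
  forall e : R, 0 < e -> exists2 C : R, 0 <= C & forall x, X x -> `|g x| <= e * N x + C.

Lemma subq_cst (c : R) : subq (fun=> c).
Proof.
split=> [r|e e0]; first by apply: continuous_subspaceT => x; exact: cvg_cst.
by exists `|c| => // x /N0 Nx; rewrite ler_wpDl// mulr_ge0// ltW.
Qed.

Lemma within_cvgP (A : set T) (g : T -> R) : {within A, continuous g} <->
  forall x, A x -> g y @[y --> within A (nbhs x)] --> g x.
Proof. exact: subspace_continuousP. Qed.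

Lemma subqD f g : subq f -> subq g -> subq (fun x => f x + g x).
Proof.
move=> [cf bf] [cg bg]; split=> [r|e e0].
  apply/within_cvgP => x Kx; apply: cvgD; [exact: ((within_cvgP _ _).1 (cf r))|exact: ((within_cvgP _ _).1 (cg r))].
have e20 : 0 < e / 2 by rewrite divr_gt0.
have [C1 C10 h1] := bf _ e20; have [C2 C20 h2] := bg _ e20.
exists (C1 + C2) => [|x Xx]; first exact: addr_ge0.
by apply: (le_trans (ler_normD _ _)); have := h1 x Xx; have := h2 x Xx; lra.
Qed.

Lemma subqZ (c : R) f : subq f -> subq (fun x => c * f x).
Proof.
move=> [cf bf]; split=> [r|e e0].
  by apply/within_cvgP => x Kx; apply: cvgM; [exact: cvg_cst|exact: ((within_cvgP _ _).1 (cf r))].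
have c1 : 0 < `|c| + 1 by rewrite ltr_wpDl.
have [C C0 h] := bf _ (divr_gt0 e0 c1).
exists ((`|c| + 1) * C) => [|x Xx]; first by rewrite mulr_ge0// ltW.
rewrite normrM; apply: (@le_trans _ _ ((`|c| + 1) * `|f x|)); first by rewrite ler_wpM2r// lerDl.
apply: (le_trans (ler_wpM2l (ltW c1) (h x Xx))); rewrite mulrDr mulrA [_ * (e / _)]mulrC mulfVK ?gt_eqF//.
Qed.

Lemma subq_bound (w f : T -> R) (M : R) : (forall r, {within sublevel r, continuous w}) ->
  (forall x, X x -> `|w x| <= M) -> subq f -> subq (fun x => w x * f x).
Proof.
move=> cw bw [cf bf]; split=> [r|e e0].
  by apply/within_cvgP => x Kx; apply: cvgM; [exact: ((within_cvgP _ _).1 (cw r))|exact: ((within_cvgP _ _).1 (cf r))].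
have c1 : 0 < `|M| + 1 by rewrite ltr_wpDl.
have [C C0 h] := bf _ (divr_gt0 e0 c1).
exists ((`|M| + 1) * C) => [|x Xx]; first by rewrite mulr_ge0// ltW.
rewrite normrM; apply: (@le_trans _ _ ((`|M| + 1) * `|f x|)).
  by rewrite ler_wpM2r// (le_trans (bw x Xx))// (le_trans (ler_norm M))// lerDl.
apply: (le_trans (ler_wpM2l (ltW c1) (h x Xx))); rewrite mulrDr mulrA [_ * (e / _)]mulrC mulfVK ?gt_eqF//.
Qed.

Section ultra.
Variables (I : Type) (U : set_system I) (UU : UltraFilter U) (x_ : I -> T).

Let UP : ProperFilter U := @ultra_proper _ U UU.

(** The limit [a] of [N (x_ i)] may exceed [N x], as [N] is only lower semicontinuous. The bound
    [N x <= a] holds because the points lie eventually in the compact sublevel set of level [a + e],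
    which then contains their limit. *)
Lemma ultra_sublevel (r : R) : U [set i | sublevel r (x_ i)] ->
  exists (x : T) (a : R), [/\ X x, N x <= a, x_ i @[i --> U] --> x, N (x_ i) @[i --> U] --> a &
    forall g : T -> R, (forall s, {within sublevel s, continuous g}) -> g (x_ i) @[i --> U] --> g x].
Proof.
move=> Ur; have [x [Xx Nx] cx] := ultra_compact_cvg UU (@Kc r) Ur.
have [|a _ ca] := @ultra_cvgR R I U (fun i => N (x_ i)) r UU.
  by apply: filterS Ur => i [Xi Ni] /=; rewrite ger0_norm// N0.
exists x, a; split=> //.
  apply/ler_addgt0Pl => e e0; rewrite addrC.
  have Ue : U [set i | sublevel (a + e) (x_ i)].
    move/cvgrPdist_lt : ca => /(_ e e0) h; apply: filterS2 Ur h => i [Xi _] h; split=> //.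
    by rewrite ltW//; move: h; rewrite ltr_distlC => /andP[_]; rewrite addrC.
  have [y [_ Ny] cy] := ultra_compact_cvg UU (@Kc (a + e)) Ue.
  by have -> : x = y by apply: (cvg_unique T2 cx cy).
move=> g gc; have /within_cvgP/(_ x (conj Xx Nx)) h := gc r.
move=> A /h hA; rewrite /nbhs /=; have := cx _ hA; rewrite /nbhs/=.
by apply: filterS2 Ur => i Ki; apply.
Qed.

(** Either [N (x_ i)] is bounded along the ultrafilter and [ultra_sublevel] applies, or it is
    unbounded. The weights then tend to 0 because [t_ i * N (x_ i)] is bounded, and subquadratic
    growth gives [t_ i * g (x_ i)] the limit 0: the escaping atom leaves no trace except in [N]. *)
Lemma ultra_weight (t_ : I -> R) (r : R) :
  U [set i | [/\ 0 <= t_ i <= 1, X (x_ i) & t_ i * N (x_ i) <= r]] ->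
  exists (t : R) (x : T) (a : R), [/\ 0 <= t <= 1 /\ t_ i @[i --> U] --> t, X x, t * N x <= a,
    t_ i * N (x_ i) @[i --> U] --> a &
    (forall g : T -> R, subq g -> t_ i * g (x_ i) @[i --> U] --> t * g x) /\
    (0 < t -> forall g : T -> R, subq g -> g (x_ i) @[i --> U] --> g x)].
Proof.
move=> Uw.
have [|t _ ct] := @ultra_cvgR R I U t_ 1 UU.
  by apply: filterS Uw => i [/andP[t0 t1] _ _] /=; rewrite ger0_norm.
have t01 : 0 <= t <= 1.
  apply/andP; split.
  - by apply: (@le_cvg_filter _ _ U UP (fun=> 0) _ 0 t (cvg_cst _) ct); apply: filterS Uw => i [/andP[]].
  - by apply: (@le_cvg_filter _ _ U UP _ (fun=> 1) t 1 ct (cvg_cst _)); apply: filterS Uw => i [/andP[]].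
have [|a _ ca] := @ultra_cvgR R I U (fun i => t_ i * N (x_ i)) r UU.
  by apply: filterS Uw => i [/andP[t0 t1] Xi h] /=; rewrite ger0_norm// mulr_ge0// N0.
have [[s Us]|unb] := pselect (exists s, U [set i | N (x_ i) <= s]).
  have [|x [b [Xx Nb cx cb hg]]] := ultra_sublevel (r := s).
    by apply: filterS2 Uw Us => i [_ Xi _] /= Ni.
  have ab : a = t * b by apply: (cvg_unique _ ca); [exact: norm_hausdorff|exact: cvgM].
  exists t, x, a; split=> //.
  - by rewrite ab ler_wpM2l//; case/andP: t01.
  - by split=> [g [gc _]|_ g [gc _]]; [apply: cvgM => //|]; exact: hg.
have big s : U [set i | s < N (x_ i)].
  have [h|] := @in_ultra_setVsetC _ _ [set i | N (x_ i) <= s] UU; first by exfalso; apply: unb; exists s.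
  by apply: filterS => i /negP; rewrite -ltNge.
have tlim : t_ i @[i --> U] --> 0.
  apply/cvgrPdist_lt => e e0; apply: filterS2 Uw (big ((`|r| + 1) / e)) => i [/andP[t0 t1] Xi h] /= Ni.
  rewrite sub0r normrN ger0_norm//; rewrite ltr_pdivrMr// in Ni.
  have h1 : t_ i * (`|r| + 1) <= t_ i * (N (x_ i) * e) by rewrite ler_wpM2l// ltW.
  rewrite ltNge; apply/negP => et.
  have h2 : e * (`|r| + 1) <= t_ i * (`|r| + 1) by rewrite ler_wpM2r// addr_ge0.
  have h3 : t_ i * (N (x_ i) * e) <= r * e by rewrite mulrA ler_wpM2r// ltW.
  have h4 : r * e <= `|r| * e by rewrite ler_wpM2r ?ler_norm// ltW.
  have : e * (`|r| + 1) <= `|r| * e by lra.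
  by rewrite mulrDr mulr1 mulrC gerDl leNgt e0.
have t0 : t = 0 by apply: (cvg_unique _ ct tlim); exact: norm_hausdorff.
(* The limit weight is 0, so any point of [X] can stand for the atom that has escaped. *)
have [i0 [_ Xi0 _]] := @filter_ex _ U UP _ Uw.
exists t, (x_ i0), a; split=> //.
- rewrite t0 mul0r; apply: (@le_cvg_filter _ _ U UP (fun=> 0) _ 0 a (cvg_cst _) ca).
  by apply: filterS Uw => i [/andP[ti0 _] Xi _]; exact: mulr_ge0 ti0 (N0 Xi).
- rewrite t0 ltxx; split=> // g [_ bg]; rewrite mul0r; apply/cvgrPdist_lt => e e0.
  have r0 : 0 < `|r| + 1 by rewrite ltr_wpDl.
  have er : 0 < e / 2 / (`|r| + 1) by rewrite !divr_gt0.
  have [C C0 hC] := bg _ er.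
  have C1 : 0 < C + 1 by rewrite ltr_wpDl.
  have eC : 0 < e / 2 / (C + 1) by rewrite !divr_gt0.
  move/cvgrPdist_lt : tlim => /(_ _ eC) tl; apply: filterS2 Uw tl => i [/andP[ti0 _] Xi h].
  rewrite !sub0r !normrN ger0_norm// ltr_pdivlMr// => h1.
  rewrite normrM ger0_norm//; apply: (le_lt_trans (ler_wpM2l ti0 (hC _ Xi))).
  rewrite mulrDr; have h2 : t_ i * (e / 2 / (`|r| + 1) * N (x_ i)) <= e / 2.
    rewrite mulrCA; apply: (le_trans (ler_wpM2l (ltW er) h)).
    have rr : r <= `|r| + 1 by rewrite (le_trans (ler_norm r))// lerDl.
    by apply: (le_trans (ler_wpM2l (ltW er) rr)); rewrite mulfVK// gt_eqF.
  lra.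
Qed.

End ultra.

Lemma coercive_bound (w G : T -> R) (k c : R) : 0 < k -> (forall x, X x -> k <= w x) -> subq G ->
  exists r : R, forall x, X x -> w x * N x + G x <= c -> N x <= r.
Proof.
move=> k0 kw [_ bG]; have k20 : 0 < k / 2 by rewrite divr_gt0.
have [C C0 hC] := bG _ k20; exists (2 * (c + C) / k) => x Xx h.
rewrite ler_pdivlMr//; have := hC x Xx; rewrite ler_norml => /andP[h1 _].
have := ler_wpM2r (N0 Xx) (kw x Xx); lra.
Qed.

(** Coercivity confines the set to a sublevel set of [N]. In the limit [N] can only drop and [w] is
    positive, so the inequality is kept. *)
Lemma sublevel_compact (w G : T -> R) (k c : R) : 0 < k -> (forall r, {within sublevel r, continuous w}) ->
  (forall x, X x -> k <= w x) -> subq G -> compact [set x | X x /\ w x * N x + G x <= c].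
Proof.
move=> k0 cw kw sG; have [r hr] := coercive_bound c k0 kw sG.
rewrite compact_ultra => F FU FA; have FP := @ultra_proper _ F FU.
have Fr : F [set i | sublevel r i] by apply: filterS FA => x [Xx h]; split=> //; exact: hr.
have [x [a [Xx Na cx ca hg]]] := @ultra_sublevel _ F FU id r Fr.
exists x; split=> //; split=> //.
have lim : w y * N y + G y @[y --> F] --> w x * a + G x.
  by apply: cvgD; [apply: cvgM; [exact: (hg _ cw)|]|exact: (hg _ sG.1)].
have : w x * a + G x <= c.
  by apply: (@le_cvg_filter _ _ F FP _ (fun=> c) _ c lim (cvg_cst _)); apply: filterS FA => y [].
have := ler_wpM2l (le_trans (ltW k0) (kw x Xx)) Na; lra.
Qed.

End coercive.

(** * Minimisation over B_f *)

Section pairs.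
Context {R : realType} (T : topologicalType) (T2 : hausdorff_space T).
Variables (X : set T) (N : T -> R).
Hypothesis N0 : forall x, X x -> 0 <= N x.
Hypothesis Kc : forall r, compact (sublevel X N r).
Local Notation subq := (subq X N).
Variables (e F : T -> R) (se : subq e) (sF : subq F).

Definition ellN (x : T) : R := N x - F x.

(* The set B_f of the paper, with theta_2 = 1 - theta_1 left out. *)
Definition bf : set (R * T * T) := [set b | let: (t, x, y) := b in
  [/\ X x, ellN x <= 0, t = 1 & y = x] \/
  [/\ 0 < t < 1, X x /\ X y, e x = e y, ellN x < 0 < ellN y & t * ellN x + (1 - t) * ellN y = 0] ].

(* Relaxation of [bf] that is stable under limits. *)
Definition br : set (R * T * T) := [set b | let: (t, x, y) := b in
  [/\ 0 <= t <= 1, X x, X y, 0 < t -> 0 < 1 - t -> e x = e y & t * ellN x + (1 - t) * ellN y <= 0] ].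

Definition bval (G : T -> R) (b : R * T * T) : R := let: (t, x, y) := b in t * G x + (1 - t) * G y.

Lemma bf_br : bf `<=` br.
Proof.
move=> [[t x] y] [[Xx lx -> ->]|[/andP[t0 t1] [Xx Xy] exy _ l0]]; split=> //.
- by rewrite ler01 lexx.
- by rewrite subrr mul0r addr0 mul1r.
- by rewrite !ltW.
- by rewrite l0.
Qed.

Lemma bvalD G G' b : bval (fun x => G x + G' x) b = bval G b + bval G' b.
Proof. by case: b => [[t x] y] /=; ring. Qed.

Lemma bvalZ c G b : bval (fun x => c * G x) b = c * bval G b.
Proof. by case: b => [[t x] y] /=; ring. Qed.

Lemma bval_cst c b : bval (fun=> c) b = c.
Proof. by case: b => [[t x] y] /=; ring. Qed.

Lemma bval_le G G' b : br b -> (forall x, X x -> G x <= G' x) -> bval G b <= bval G' b.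
Proof.
case: b => [[t x] y] [/andP[t0 t1] Xx Xy _ _] h /=.
by apply: lerD; apply: ler_wpM2l; rewrite ?subr_ge0//; exact: h.
Qed.

Lemma bval_ell b : br b -> bval ellN b <= 0.
Proof. by case: b => [[t x] y] []. Qed.

(** Coercivity comes from the constraint: [N / 2 <= ellN + C] since [F] is subquadratic, and the
    average of [ellN] is at most 0. *)
Lemma br_N : exists2 r0 : R, 0 <= r0 & forall b, br b -> bval N b <= r0.
Proof.
have h2 : 0 < (2^-1 : R) by rewrite invr_gt0.
have [C C0 hC] := sF.2 _ h2; exists (2 * C) => [|b bb]; first by rewrite mulr_ge0.
have h := bval_ell bb.
have := @bval_le (fun x => 2^-1 * N x) (fun x => ellN x + C) b bb.
rewrite bvalZ bvalD bval_cst => H.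
have : 2^-1 * bval N b <= bval ellN b + C.
  by apply: H => x Xx; have := hC x Xx; rewrite ler_norml /ellN => /andP[_]; lra.
lra.
Qed.

Lemma bval_bound G : subq G -> exists2 C : R, 0 <= C & forall b, br b -> `|bval G b| <= C.
Proof.
move=> sG; have [r0 r00 hr] := br_N; have [C C0 hC] := sG.2 _ ltr01.
exists (r0 + C) => [|b bb]; first exact: addr_ge0.
have := hr b bb => h; rewrite ler_norml; apply/andP; split.
- have := @bval_le (fun x => - 1 * N x + - C) G b bb; rewrite bvalD bvalZ bval_cst => H.
  suff : -1 * bval N b + - C <= bval G b by lra.
  by apply: H => x Xx; have := hC x Xx; rewrite ler_norml => /andP[+ _]; lra.
- have := @bval_le G (fun x => 1 * N x + C) b bb; rewrite bvalD bvalZ bval_cst => H.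
  suff : bval G b <= 1 * bval N b + C by lra.
  by apply: H => x Xx; have := hC x Xx; rewrite ler_norml => /andP[_]; lra.
Qed.

(** If [ellN] is at most 0 at both points, the one with the smaller value of [G] does alone.
    Otherwise let [u] be the point with [ellN u < 0]: when [G u <= G v], [u] does alone; when
    [G u > G v], the weight of [u] is lowered to [w], at which the average of [ellN] is 0, and this
    lowers the average of [G]. *)
Lemma br_bf G b : br b -> exists2 b', bf b' & bval G b' <= bval G b.
Proof.
case: b => [[t x] y] [/andP[t0 t1] Xx Xy exy l0].
have one z : X z -> ellN z <= 0 -> bf (1, z, z) by move=> Xz lz; left.
have oneE z : bval G (1, z, z) = G z by rewrite /= mul1r subrr mul0r addr0.
have t1' : 0 <= 1 - t by rewrite subr_ge0.
have [tz|tn0] := eqVneq t 0.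
  by exists (1, y, y); [apply: one => //; move: l0; rewrite tz; lra|rewrite oneE /= tz; lra].
have [tz|tn1] := eqVneq t 1.
  by exists (1, x, x); [apply: one => //; move: l0; rewrite tz; lra|rewrite oneE /= tz; lra].
have tp : 0 < t by rewrite lt_neqAle eq_sym tn0.
have tq : 0 < 1 - t by rewrite subr_gt0 lt_neqAle tn1.
have {}exy := exy tp tq.
have key (s : R) (u v : T) : 0 < s -> 0 < 1 - s -> X u -> X v -> e u = e v ->
    ellN u <= 0 -> s * ellN u + (1 - s) * ellN v <= 0 ->
    exists2 b', bf b' & bval G b' <= s * G u + (1 - s) * G v.
  move=> s0 s1 Xu Xv euv lu ls.
  have [lv|lv] := leP (ellN v) 0.
    have [Guv|/ltW Gvu] := leP (G u) (G v).
      exists (1, u, u); [exact: one|rewrite oneE].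
      by have := ler_wpM2l (ltW s1) Guv; lra.
    exists (1, v, v); [exact: one|rewrite oneE].
    by have := ler_wpM2l (ltW s0) Gvu; lra.
  have lu' : ellN u < 0.
    rewrite lt_neqAle lu andbT; apply/eqP => z; have := mulr_gt0 s1 lv.
    by move: ls; rewrite z mulr0 add0r; lra.
  have d0 : 0 < ellN v - ellN u by lra.
  pose w := ellN v / (ellN v - ellN u).
  have w0 : 0 < w by rewrite divr_gt0.
  have w1 : 1 - w = - ellN u / (ellN v - ellN u) by rewrite /w; field; rewrite gt_eqF.
  have w1p : 0 < 1 - w by rewrite w1 divr_gt0// oppr_gt0.
  have ws : w <= s by rewrite /w ler_pdivrMr//; lra.
  have [Guv|/ltW Gvu] := leP (G u) (G v).
    exists (1, u, u); [exact: one|rewrite oneE].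
    by have := ler_wpM2l (ltW s1) Guv; lra.
  exists (w, u, v).
    right; split=> //; [by rewrite w0 -subr_gt0 w1p|by rewrite lu'|].
    by rewrite w1 /w; field; rewrite gt_eqF.
  have : 0 <= (s - w) * (G u - G v) by apply: mulr_ge0; rewrite subr_ge0.
  rewrite /=; lra.
have [lx|lx] := leP (ellN x) 0; first exact: (key t x y).
have ly : ellN y <= 0.
  have := mulr_gt0 tp lx => h; have : (1 - t) * ellN y <= 0 by lra.
  by rewrite pmulr_rle0.
have := key (1 - t) y x tq; rewrite subKr => kk.
have l0' : (1 - t) * ellN y + t * ellN x <= 0 by lra.
have [b' bb' hb'] := kk tp Xy Xx (esym exy) ly l0'.
by exists b' => //; move: hb'; rewrite /= addrC.
Qed.

(** The direct method. It needs the relaxed set: in the limit [N] may drop, so that equality becomes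
    an inequality, strict inequalities become weak, and a point may escape with vanishing weight. *)
Lemma br_min G : subq G -> br !=set0 -> exists2 b, br b & forall b', br b' -> bval G b <= bval G b'.
Proof.
move=> sG [b0 bb0]; have [C C0 hC] := bval_bound sG.
have lb : exists m, lbound [set bval G b | b in br] m.
  by exists (- C) => _ [b bb <-]; have := hC b bb; rewrite ler_norml => /andP[].
have ne : [set bval G b | b in br] !=set0 by exists (bval G b0); exists b0.
have [r0 r00 hr] := br_N.
have sel n : exists2 b, br b & forall b', br b' -> bval G b <= bval G b' + n.+1%:R^-1.
  have [_ [b bb <-] hb] := near_min ne lb (@natSinv_gt0 R n).
  by exists b => // b' bb'; apply: hb; exists b'.
pose b_ n := s2val (cid2 (sel n)).
have bb n : br (b_ n) by exact: s2valP (cid2 (sel n)).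
have hb n b' : br b' -> bval G (b_ n) <= bval G b' + n.+1%:R^-1 by exact: (s2valP' (cid2 (sel n))).
pose t_ n := (b_ n).1.1; pose x_ n := (b_ n).1.2; pose y_ n := (b_ n).2.
have bE n : [/\ 0 <= t_ n <= 1, X (x_ n), X (y_ n), 0 < t_ n -> 0 < 1 - t_ n -> e (x_ n) = e (y_ n) &
    t_ n * ellN (x_ n) + (1 - t_ n) * ellN (y_ n) <= 0].
  by have := bb n; rewrite /t_ /x_ /y_; case: (b_ n) => [[]].
have vE H n : bval H (b_ n) = t_ n * H (x_ n) + (1 - t_ n) * H (y_ n).
  by rewrite /t_ /x_ /y_; case: (b_ n) => [[]].
have [U [UU oU]] := nat_ultra; have UP := @ultra_proper _ U UU.
have UT (P : nat -> Prop) : (forall n, P n) -> U [set n | P n].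
  by move=> h; apply: filterS (@filterT _ U _) => n _; exact: h.
have N0' n : 0 <= t_ n * N (x_ n) /\ 0 <= (1 - t_ n) * N (y_ n).
  by have [/andP[t0 t1] Xx Xy _ _] := bE n; rewrite !mulr_ge0 ?N0// subr_ge0.
have [|t [x [a [[t01 ct] Xx tNa ca [hg hgt]]]]] := @ultra_weight R T T2 X N N0 Kc nat U UU x_ t_ r0.
  apply: UT => n; have [t01 Xx _ _ _] := bE n; split=> //.
  by have := hr _ (bb n); rewrite vE; have [] := N0' n; lra.
have [|s [y [c [[s01 cs] Xy sNc cc [kg kgt]]]]] := @ultra_weight R T T2 X N N0 Kc nat U UU y_ (fun n => 1 - t_ n) r0.
  apply: UT => n; have [/andP[t0 t1] _ Xyn _ _] := bE n; split=> //.
    by rewrite subr_ge0 t1 gerBl.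
  by have := hr _ (bb n); rewrite vE; have [] := N0' n; lra.
have st : s = 1 - t.
  apply: (cvg_unique _ cs); first exact: norm_hausdorff.
  by apply: cvgB => //; exact: cvg_cst.
have cv H : subq H -> bval H (b_ n) @[n --> U] --> t * H x + (1 - t) * H y.
  by move=> sH; under eq_fun do rewrite vE; rewrite -st; apply: cvgD; [exact: hg|exact: kg].
exists (t, x, y); [split=> //|move=> b' bb'].
(* Equality of the values of [e] passes to the limit when both limit weights are positive, which is
   all that [br] asks. *)
- move=> tp sp; apply: (cvg_unique _ (hgt tp e se)); first exact: norm_hausdorff.
  have ky : e (y_ n) @[n --> U] --> e y by apply: kgt => //; rewrite st.
  apply: cvg_trans ky; apply: near_eq_cvg.
  move/cvgrPdist_lt : ct => /(_ _ tp) h1; move/cvgrPdist_lt : cs; rewrite st => /(_ _ sp) h2.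
  apply: filterS2 h1 h2 => n; rewrite !ltr_distl => /andP[_ h3] /andP[_ h4].
  by have [_ _ _ -> //] := bE n; lra.
- rewrite /ellN.
  have h1 : t * F x + (1 - t) * F y >= a + c.
    apply: (@le_cvg_filter _ _ U UP (fun n => t_ n * N (x_ n) + (1 - t_ n) * N (y_ n)) (fun n => bval F (b_ n))).
    + exact: cvgD.
    + exact: cv.
    + apply: UT => n; have [_ _ _ _] := bE n; rewrite vE /ellN; lra.
  move: sNc; rewrite st; lra.
- apply: (@le_cvg_filter _ _ U UP (fun n => bval G (b_ n)) (fun n => bval G b' + n.+1%:R^-1)).
  + exact: cv.
  + rewrite -[X in _ --> X]addr0; apply: cvgD; first exact: cvg_cst.
    by apply: (cvg_trans _ (@cvg_harmonic R)); apply: cvg_app.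
  + by apply: UT => n; exact: hb.
Qed.

Lemma bf_min G : subq G -> bf !=set0 -> exists2 b, bf b & forall b', bf b' -> bval G b <= bval G b'.
Proof.
move=> sG [b0 bb0]; have [|b bb hb] := br_min sG; first by exists b0; exact: bf_br.
have [b1 bb1 h1] := br_bf G bb; exists b1 => // b' /bf_br /hb; exact: le_trans.
Qed.

End pairs.

(** * The dual functional *)

Section hahn_banach.
Context {R : realType} (W : lmodType R) (D : W -> Prop).
Hypothesis D0 : D 0.
Hypothesis Dlin : forall a u v, D u -> D v -> D (a *: u + v).

Lemma inf_add (A B C : set R) : A !=set0 -> B !=set0 -> (exists m, lbound A m) -> (exists m, lbound B m) ->
  (exists m, lbound C m) -> (forall a b, A a -> B b -> exists2 c, C c & c <= a + b) ->
  inf C <= inf A + inf B.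
Proof.
move=> A0 B0 Al Bl Cl h; apply/ler_addgt0Pl => e e0; have e20 : 0 < e / 2 by rewrite divr_gt0.
have [a Aa ha] := inf_adherent e20 (conj A0 Al); have [b Bb hb] := inf_adherent e20 (conj B0 Bl).
have [c Cc hc] := h a b Aa Bb; apply: (le_trans (ge_inf Cl Cc)); lra.
Qed.

Definition sublinear (q : W -> R) : Prop := (forall u v, D u -> D v -> q (u + v) <= q u + q v) /\
  forall a u, 0 <= a -> D u -> q (a *: u) = a * q u.

Lemma hbDZ a u : D u -> D (a *: u).
Proof. by move=> Du; rewrite -[_ *: _]addr0; exact: Dlin. Qed.

Lemma hbDD u v : D u -> D v -> D (u + v).
Proof. by move=> Du Dv; rewrite -[u]scale1r; exact: Dlin. Qed.

Lemma hbDN u : D u -> D (- u).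
Proof. by rewrite -scaleN1r; exact: hbDZ. Qed.

Lemma sublinear0 q : sublinear q -> q 0 = 0.
Proof. by move=> [_ h]; have := h 0 0 (lexx 0) D0; rewrite scaler0 mul0r. Qed.

Lemma sublinear_opp q u : sublinear q -> D u -> - q (- u) <= q u.
Proof.
move=> sq Du; have := sq.1 u (- u) Du (hbDN Du); rewrite subrr sublinear0//; lra.
Qed.

(** The inequality for [a^-1] is the converse of the inequality for [a]. *)
Lemma sublinear_intro (q : W -> R) : (forall u v, D u -> D v -> q (u + v) <= q u + q v) ->
  (forall a u, 0 < a -> D u -> q (a *: u) <= a * q u) -> q 0 = 0 -> sublinear q.
Proof.
move=> qD qZ q0; split=> // a u a0 Du.
have [->|an0] := eqVneq a 0; first by rewrite scale0r mul0r.
have ap : 0 < a by rewrite lt_neqAle eq_sym an0.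
apply/eqP; rewrite eq_le qZ//=.
have := qZ a^-1 (a *: u); rewrite invr_gt0 => /(_ ap (hbDZ a Du)).
by rewrite scalerA mulVf// scale1r => h; rewrite mulrC -ler_pdivlMr// mulrC.
Qed.

Variable p : W -> R.
Hypothesis sp : sublinear p.

(** A minimal sublinear functional below [p] exists by Zorn's lemma, and minimality forces it to be
    linear. *)
Theorem hahn_banach : exists E : W -> R,
  (forall a u v, D u -> D v -> E (a *: u + v) = a * E u + E v) /\ forall u, D u -> E u <= p u.
Proof.
pose S := {q : W -> R | sublinear q /\ forall u, D u -> q u <= p u}.
(* The order is reversed: maximal elements are minimal functionals, and chains are bounded by their
   infimum. *)
pose le (q r : S) := `[< forall u, D u -> sval r u <= sval q u >].
have sS (q : S) : sublinear (sval q) by case: (svalP q).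
have pS (q : S) u : D u -> sval q u <= p u by case: (svalP q) => _; apply.
have p0 : S by exists p; split.
have low (q : S) u : D u -> - p (- u) <= sval q u.
  move=> Du; apply: le_trans (sublinear_opp (sS q) Du); rewrite lerN2; apply: pS; exact: hbDN.
have [||A tA|t ht] := @ZL_preorder S p0 (fun q r => le q r).
- by move=> q; apply/asboolP.
- by move=> r s t /asboolP h1 /asboolP h2; apply/asboolP => u Du; exact: le_trans (h2 u Du) (h1 u Du).
- have [[r0 Ar0]|Ae] := pselect (A !=set0); last first.
    by exists p0 => s As; exfalso; apply: Ae; exists s.
  pose C u := [set sval r u | r in A].
  have C0 u : C u !=set0 by exists (sval r0 u); exists r0.
  have Cl u : D u -> exists m, lbound (C u) m.
    by move=> Du; exists (- p (- u)) => _ [r _ <-]; exact: low.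
  have sq : sublinear (fun u => inf (C u)).
    apply: sublinear_intro => [u v Du Dv|a u a0 Du|].
    + apply: inf_add => //; try exact: Cl; first exact/Cl/hbDD.
      move=> _ _ [r1 A1 <-] [r2 A2 <-].
      have [/asboolP h|/asboolP h] := tA r1 r2 A1 A2.
      * exists (sval r2 (u + v)); first by exists r2.
        by apply: (le_trans ((sS r2).1 u v Du Dv)); rewrite lerD2r; exact: h.
      * exists (sval r1 (u + v)); first by exists r1.
        by apply: (le_trans ((sS r1).1 u v Du Dv)); rewrite lerD2l; exact: h.
    + rewrite mulrC -ler_pdivrMr//; apply: lb_le_inf => // _ [r Ar <-].
      rewrite ler_pdivrMr// mulrC -((sS r).2 a u (ltW a0) Du); apply: ge_inf; first exact/Cl/hbDZ.
      by exists r.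
    + apply/eqP; rewrite eq_le; apply/andP; split.
        by apply: ge_inf; [exact: Cl|exists r0 => //; exact: sublinear0].
      by apply: lb_le_inf => // _ [r Ar <-]; rewrite sublinear0.
  have sqp u : D u -> inf (C u) <= p u.
    by move=> Du; apply: le_trans (pS r0 u Du); apply: ge_inf; [exact: Cl|exists r0].
  exists (exist (fun q => sublinear q /\ forall u, D u -> q u <= p u) _ (conj sq sqp)) => s As; apply/asboolP => u Du /=.
  by apply: ge_inf; [exact: Cl|exists s].
pose q := sval t; have sq : sublinear q := sS t.
have add x y : D x -> D y -> q (x + y) = q x + q y.
  move=> Dx Dy; apply/eqP; rewrite eq_le sq.1//=.
  (* [u |-> inf (C u)] is sublinear and at most [q], hence equal to [q] by minimality; [s = 1] then
     gives [q x <= q (x + y) - q y]. *)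
  pose C u := [set q (u + s *: y) - s * q y | s in [set s : R | 0 <= s]].
  have C0 u : C u !=set0 by exists (q (u + 0 *: y) - 0 * q y); exists 0 => /=.
  have Clb u : D u -> lbound (C u) (- q (- u)).
    move=> Du _ [s /= s0 <-].
    have := sq.1 (u + s *: y) (- u) (hbDD Du (hbDZ s Dy)) (hbDN Du).
    rewrite addrAC subrr add0r sq.2//; lra.
  have Cl u : D u -> exists m, lbound (C u) m by move=> /Clb h; exists (- q (- u)).
  have sC : sublinear (fun u => inf (C u)).
    apply: sublinear_intro => [u v Du Dv|a u a0 Du|].
    + apply: inf_add => //; try exact: Cl; first exact/Cl/hbDD.
      move=> _ _ [s1 /= s10 <-] [s2 /= s20 <-].
      exists (q (u + v + (s1 + s2) *: y) - (s1 + s2) * q y); first by exists (s1 + s2) => //=; exact: addr_ge0.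
      have := sq.1 (u + s1 *: y) (v + s2 *: y) (hbDD Du (hbDZ s1 Dy)) (hbDD Dv (hbDZ s2 Dy)).
      by rewrite addrACA -scalerDl mulrDl; lra.
    + rewrite mulrC -ler_pdivrMr//; apply: lb_le_inf => // _ [s /= s0 <-].
      rewrite ler_pdivrMr// mulrBl mulrC -(sq.2 a _ (ltW a0) (hbDD Du (hbDZ s Dy))).
      have -> : s * q y * a = a * s * q y by ring.
      rewrite scalerDr scalerA; apply: ge_inf; first exact/Cl/hbDZ.
      by exists (a * s) => //=; rewrite mulr_ge0// ltW.
    + apply/eqP; rewrite eq_le; apply/andP; split.
        apply: ge_inf; [exact: Cl|exists 0 => //=].
        by rewrite scale0r addr0 mul0r subr0 sublinear0.
      by apply: lb_le_inf => //; have := Clb 0 D0; rewrite oppr0 (sublinear0 sq) oppr0.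
  have Cq u : D u -> inf (C u) <= q u.
    move=> Du; apply: ge_inf; [exact: Cl|exists 0 => //=].
    by rewrite scale0r addr0 mul0r subr0.
  pose r : S := exist (fun q => sublinear q /\ forall u, D u -> q u <= p u) _ (conj sC (fun u Du => le_trans (Cq u Du) (pS t u Du))).
  have /asboolP/(_ x Dx) /= h : le r t by apply: ht; apply/asboolP; exact: Cq.
  have : inf (C x) <= q (x + y) - q y.
    apply: ge_inf; [exact: Cl|exists 1 => //=].
    by rewrite scale1r mul1r.
  rewrite -/q in h; lra.
exists q; split=> [a u v Du Dv|u Du]; last exact: pS.
rewrite add//; last exact: hbDZ.
congr (_ + _); have [a0|a0] := leP 0 a; first exact: sq.2.
have := add (a *: u) (- a *: u) (hbDZ a Du) (hbDZ (- a) Du).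
rewrite -scalerDl subrr scale0r (sublinear0 sq) (sq.2 (- a)) ?oppr_ge0 ?ltW//; lra.
Qed.

End hahn_banach.

(** * The positive functional dominated by the supremum over B_f *)

Section dual_functional.
Context {R : realType} (T : topologicalType) (T2 : hausdorff_space T).
Variables (X : set T) (N : T -> R).
Hypothesis N0 : forall x, X x -> 0 <= N x.
Local Notation subq := (subq X N).
Variables (e F : T -> R) (sF : subq F).
Local Notation bf := (bf X N e F).

(** The growth of [N] is allowed and no continuity is asked: the domain of the functional must
    contain [N] and all indicators. *)
Definition subquad (h : T -> R) : Prop := exists C : R, forall x, X x -> `|h x| <= C * (1 + N x).

Lemma subq_subquad h : subq h -> subquad h.
Proof.
move=> [_ /(_ 1 ltr01)[C C0 hC]]; exists (1 + C) => x Xx; apply: (le_trans (hC x Xx)).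
have := N0 Xx; nra.
Qed.

Lemma subquad_lin (a : R) (h k : T -> R) : subquad h -> subquad k -> subquad (fun x => a * h x + k x).
Proof.
move=> [C hC] [C' hC']; exists (`|a| * C + C') => x Xx; apply: (le_trans (ler_normD _ _)).
by rewrite normrM mulrDl; apply: lerD; [rewrite -mulrA; apply: ler_wpM2l => //; exact: hC|exact: hC'].
Qed.

Lemma subquad_cst (c : R) : subquad (fun=> c).
Proof. by exists `|c| => x /N0 Nx; rewrite ler_peMr// lerDl. Qed.

Lemma subquadN : subquad N.
Proof. by exists 1 => x /[dup] /N0 Nx _; rewrite mul1r ger0_norm// lerDr. Qed.

Lemma bval_ext h k b : bf b -> (forall x, X x -> h x = k x) -> bval h b = bval k b.
Proof.
move=> /bf_br bb hk; apply/eqP; rewrite eq_le; apply/andP.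
by split; apply: (bval_le bb) => x /hk ->.
Qed.

Lemma bval_subquad h : subquad h -> exists C : R, forall b, bf b -> `|bval h b| <= C.
Proof.
move=> [C hC]; have [r0 r00 hr] := br_N e sF.
exists (`|C| * (1 + r0)) => b /bf_br bb.
have hC' x : X x -> `|h x| <= `|C| * (1 + N x).
  by move=> Xx; apply: (le_trans (hC x Xx)); rewrite ler_wpM2r ?ler_norm// addr_ge0// N0.
have B : `|C| * (1 + bval N b) <= `|C| * (1 + r0) by rewrite ler_wpM2l// lerD2l; exact: hr.
rewrite ler_norml; apply/andP; split.
- apply: (@le_trans _ _ (bval (fun x => (- `|C|) * (1 + N x)) b)).
    by rewrite bvalZ (bvalD (fun=> 1)) bval_cst mulNr lerN2.
  by apply: (bval_le bb) => x /hC'; rewrite ler_norml mulNr => /andP[].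
- apply: (@le_trans _ _ (bval (fun x => `|C| * (1 + N x)) b)).
    by apply: (bval_le bb) => x /hC'; rewrite ler_norml => /andP[].
  by rewrite bvalZ (bvalD (fun=> 1)) bval_cst.
Qed.

Variables (Gs : set (T -> R)) (phi : T -> R) (lam : R).
Hypothesis Gs_subq : forall g, Gs g -> subq g.
Hypothesis Gs_ne : Gs !=set0.
Hypothesis Gs_lin : forall g1 g2 (c : R), Gs g1 -> Gs g2 -> exists2 g, Gs g & forall x, X x -> g x = g1 x + c * g2 x.
Hypothesis sphi : subq phi.
Hypothesis lamP : forall g, Gs g -> exists2 b, bf b & bval (fun x => phi x + g x) b <= lam.

Let Gs_scale (c : R) g : Gs g -> exists2 g', Gs g' & forall x, X x -> g' x = c * g x.
Proof.
move=> Gg; have [g' Gg' hg'] := Gs_lin (c - 1) Gg Gg; exists g' => // x Xx.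
by rewrite hg'//; ring.
Qed.

Let bfne : bf !=set0.
Proof. by have [g Gg] := Gs_ne; have [b bb _] := lamP Gg; exists b. Qed.

Let p0 (h : T -> R) : R := sup [set bval h b | b in bf].

Let p0_ub h c : (forall b, bf b -> bval h b <= c) -> p0 h <= c.
Proof.
move=> hc; apply: sup_le_ub; last by move=> _ [b bb <-]; exact: hc.
by have [b bb] := bfne; exists (bval h b); exists b.
Qed.

Let p0_ge h b : subquad h -> bf b -> bval h b <= p0 h.
Proof.
move=> /bval_subquad[C hC] bb; apply: sup_upper_bound; last by exists b.
split; first by exists (bval h b); exists b.
by exists C => _ [b' bb' <-]; have := hC _ bb'; rewrite ler_norml => /andP[].
Qed.

(** Admitting these functions in the infimum forces [lam - phi] to have a nonnegative value and
    every [g] the value 0. *)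
Let zf (s : R) (g : T -> R) x := s * (lam - phi x) + g x.

Let zf_subquad s g : Gs g -> subquad (zf s g).
Proof.
move=> Gg; rewrite /zf; apply: subquad_lin; last exact/subq_subquad/Gs_subq.
have := subquad_lin (- 1) (subq_subquad sphi) (subquad_cst lam).
by have -> : (fun x => -1 * phi x + lam) = (fun x => lam - phi x) by apply/funext => x; ring.
Qed.

Let bval_zf s g b : bval (zf s g) b = s * (lam - bval phi b) + bval g b.
Proof. by case: b => [[t x] y]; rewrite /zf /=; ring. Qed.

Let bval_hz h s g b : bval (fun x => h x + zf s g x) b = bval h b + (s * (lam - bval phi b) + bval g b).
Proof. by case: b => [[t x] y]; rewrite /zf /=; ring. Qed.

(** This keeps the infimum over [s] and [g] finite. For [s > 0] it is [lamP] for [- s^-1 * g]. For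
    [s = 0], a [g] whose supremum over [bf] is negative would violate [lamP] after multiplication by
    a large negative constant. *)
Let p0_zf s g : 0 <= s -> Gs g -> 0 <= p0 (zf s g).
Proof.
move=> s0 Gg; have [sz|sn0] := eqVneq s 0; last first.
  have sp : 0 < s by rewrite lt_neqAle eq_sym sn0.
  have [g' Gg' hg'] := Gs_scale (- s^-1) Gg; have [b bb hb] := lamP Gg'.
  apply: le_trans (p0_ge (zf_subquad s Gg) bb); rewrite bval_zf.
  move: hb; rewrite bvalD (bval_ext bb hg') bvalZ => hb.
  have -> : bval g b = s * (s^-1 * bval g b) by rewrite mulrA mulfV ?mul1r.
  by rewrite -mulrDr; apply: mulr_ge0; [exact: ltW|lra].
rewrite leNgt; apply/negP => neg.
have [C hC] := bval_subquad (subq_subquad sphi).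
(* A nonpositive factor for which [c * g] averages to at least [|lam| + C + 1] on [bf], more than
   [lam - phi] can reach. *)
pose c := (`|lam| + C + 1) / p0 (zf s g).
have [g' Gg' hg'] := Gs_scale c Gg; have [b bb hb] := lamP Gg'.
move: hb; rewrite bvalD (bval_ext bb hg') bvalZ => hb.
have h1 : bval g b <= p0 (zf s g).
  by apply: le_trans (p0_ge (zf_subquad s Gg) bb); rewrite bval_zf sz mul0r add0r.
have C0 : 0 <= C by exact: le_trans (hC b bb).
have c0 : c <= 0 by rewrite /c pmulr_rle0 ?invr_le0 ?(ltW neg)// ltr_wpDl// addr_ge0.
have h2 : c * p0 (zf s g) <= c * bval g b by exact: ler_wnM2l.
have h3 : c * p0 (zf s g) = `|lam| + C + 1 by rewrite /c mulfVK// lt_eqF.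
have := hC b bb; rewrite ler_norml => /andP[h4 _].
have := ler_norm lam; lra.
Qed.

Let W := (T -> R^o)%type.

(* Hahn-Banach for the sublinear functional
   h |-> inf_(s >= 0, g) sup_bf (h + s (lam - phi) + g). *)
Lemma dual_functional : exists E : (T -> R) -> R,
  [/\ forall (a : R) h k, subquad h -> subquad k -> E (fun x => a * h x + k x) = a * E h + E k,
    forall h c, subquad h -> (forall b, bf b -> bval h b <= c) -> E h <= c,
    forall g, Gs g -> E g = 0 & E phi <= lam].
Proof.
have [g1 Gg1] := Gs_ne.
have [g0 Gg0 hg0] : exists2 g0, Gs g0 & forall x, X x -> g0 x = 0.
  by have [g Gg hg] := Gs_scale 0 Gg1; exists g => // x /hg ->; rewrite mul0r.
pose S h := [set r | exists s g, [/\ 0 <= s, Gs g & r = p0 (fun x => h x + zf s g x)]].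
have Sne h : S h !=set0 by exists (p0 (fun x => h x + zf 0 g1 x)); exists 0, g1.
have hz h s g : subquad h -> Gs g -> subquad (fun x => h x + zf s g x).
  by move=> sh /(zf_subquad s); move=> /(subquad_lin 1 sh); under eq_fun do rewrite mul1r.
have Slb h : subquad h -> lbound (S h) (- p0 (fun x => - 1 * h x)).
  move=> sh _ [s [g [s0 Gg ->]]].
  have h1 : subquad (fun x => -1 * h x).
    by have := subquad_lin (-1) sh (subquad_cst 0); under eq_fun do rewrite addr0.
  have := p0_zf s0 Gg.
  have : p0 (zf s g) <= p0 (fun x => h x + zf s g x) + p0 (fun x => -1 * h x).
    apply: p0_ub => b bb; have := p0_ge (hz h s g sh Gg) bb; have := p0_ge h1 bb.
    rewrite bval_hz bvalZ bval_zf; lra.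
  lra.
have Sl h : subquad h -> exists m, lbound (S h) m by move=> /Slb ?; eexists; eassumption.
pose p (h : T -> R) := inf (S h).
have ple h s g : subquad h -> 0 <= s -> Gs g -> p h <= p0 (fun x => h x + zf s g x).
  by move=> sh s0 Gg; apply: ge_inf; [exact: Sl|exists s, g].
have [|||E [Elin Ep]] := @hahn_banach R W subquad _ _ p.
- exact: (subquad_cst 0).
- by move=> a u v su sv; exact: subquad_lin.
- have DD (u v : T -> R) : subquad u -> subquad v -> subquad (fun x => u x + v x).
    by move=> su /(subquad_lin 1 su); under eq_fun do rewrite mul1r.
  have DZ a (u : T -> R) : subquad u -> subquad (fun x => a * u x).
    by move=> su; have := subquad_lin a su (subquad_cst 0); under eq_fun do rewrite addr0.
  apply: (@sublinear_intro R W subquad).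
  + exact: (subquad_cst 0).
  + by move=> a u v su sv; exact: subquad_lin.
  + move=> u v su sv; apply: inf_add => //; try exact: Sl; first exact/Sl/DD.
    move=> _ _ [s [g [s0 Gg ->]]] [s' [g' [s0' Gg' ->]]].
    have [g2 Gg2 hg2] := Gs_lin 1 Gg Gg'.
    exists (p0 (fun x => (u x + v x) + zf (s + s') g2 x)).
      by exists (s + s'), g2; split=> //; exact: addr_ge0.
    apply: p0_ub => b bb; have h1 := p0_ge (hz u s g su Gg) bb; have h2 := p0_ge (hz v s' g' sv Gg') bb.
    move: h1 h2; rewrite !bval_hz (bvalD u v) (bval_ext bb hg2) bvalD bvalZ; lra.
  + move=> a u a0 su; rewrite mulrC -ler_pdivrMr//; apply: lb_le_inf => // _ [s [g [s0 Gg ->]]].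
    rewrite ler_pdivrMr// mulrC.
    have [g2 Gg2 hg2] := Gs_scale a Gg.
    have as0 : 0 <= a * s by rewrite mulr_ge0// ltW.
    apply: (le_trans (ple (fun x => a * u x) (a * s) g2 (DZ a u su) as0 Gg2)).
    apply: p0_ub => b bb; have := ler_wpM2l (ltW a0) (p0_ge (hz u s g su Gg) bb).
    rewrite !bval_hz (bval_ext bb hg2) !bvalZ; lra.
  + apply/eqP; rewrite eq_le; apply/andP; split.
      apply: (le_trans (ple (fun=> 0) 0 g0 (subquad_cst 0) (lexx 0) Gg0)).
      by apply: p0_ub => b bb; rewrite bval_hz bval_cst (bval_ext bb hg0) bval_cst; lra.
    apply: lb_le_inf => // _ [s [g [s0 Gg ->]]].
    have -> : (fun x => 0 + zf s g x) = zf s g by apply/funext => x; rewrite add0r.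
    exact: p0_zf.
have Ele h s g c : subquad h -> 0 <= s -> Gs g ->
    (forall b, bf b -> bval (fun x => h x + zf s g x) b <= c) -> E h <= c.
  by move=> sh s0 Gg hc; apply: (le_trans (Ep h sh)); apply: (le_trans (ple h s g sh s0 Gg)); exact: p0_ub.
have Ebf h c : subquad h -> (forall b, bf b -> bval h b <= c) -> E h <= c.
  move=> sh hc; apply: (Ele h 0 g0 c sh (lexx 0) Gg0) => b bb.
  by rewrite bval_hz (bval_ext bb hg0) bval_cst mul0r !addr0; exact: hc.
have ElinT (a : R) h k : subquad h -> subquad k -> E (fun x => a * h x + k x) = a * E h + E k.
  by move=> sh sk; exact: (Elin a h k sh sk).
have E0 h : subquad h -> (forall x, X x -> h x = 0) -> E h <= 0.
  by move=> sh h0; apply: Ebf => // b bb; rewrite (bval_ext bb h0) bval_cst.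
have EN h : subquad h -> E (fun x => -1 * h x + 0) = - E h.
  move=> sh; rewrite (ElinT (-1) h (fun=> 0) sh (subquad_cst 0)).
  have : E (fun=> 0) = 0.
    have := ElinT 1 (fun=> 0) (fun=> 0) (subquad_cst 0) (subquad_cst 0).
    have -> : (fun x : T => 1 * 0 + 0) = (fun=> 0) :> (T -> R) by apply/funext => x; ring.
    lra.
  move=> ->; lra.
have sN h : subquad h -> subquad (fun x => -1 * h x + 0).
  by move=> sh; exact: subquad_lin (subquad_cst 0).
(* [- g] is cancelled by [g] itself in the infimum. The reverse inequality comes from the negative
   of [g], which also belongs to [Gs] up to values off [X]. *)
have Eg g : Gs g -> 0 <= E g.
  move=> Gg; have sg := subq_subquad (Gs_subq Gg).
  have : E (fun x => -1 * g x + 0) <= 0.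
    apply: (Ele _ 0 g 0 (sN _ sg) (lexx 0) Gg) => b bb.
    by rewrite bval_hz (bvalD (fun x => -1 * g x)) bvalZ bval_cst; lra.
  rewrite EN//; lra.
exists E; split=> // [g Gg|].
- apply/eqP; rewrite eq_le Eg// andbT.
  have [g' Gg' hg'] := Gs_scale (-1) Gg.
  have sg := subq_subquad (Gs_subq Gg); have sg' := subq_subquad (Gs_subq Gg').
  have : E (fun x => 1 * g x + g' x) <= 0.
    by apply: E0 => [|x Xx]; [exact: subquad_lin|rewrite hg'//; ring].
  rewrite ElinT//; have := Eg _ Gg'; lra.
- have sp := subq_subquad sphi.
  have sl : subquad (fun x => 1 * phi x + - lam) by exact: subquad_lin (subquad_cst _).
  have : E (fun x => 1 * phi x + - lam) <= 0.
    apply: (Ele _ 1 g0 0 sl ler01 Gg0) => b bb.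
    by rewrite bval_hz (bvalD (fun x => 1 * phi x)) bvalZ bval_cst (bval_ext bb hg0) bval_cst; lra.
  rewrite ElinT//; last exact: subquad_cst.
  have : E (fun=> - lam) >= - lam.
    have : E (fun x => -1 * (- lam) + 0) <= lam.
      by apply: Ebf => [|b bb]; [exact: subquad_cst|rewrite (bval_ext bb (k := fun=> lam)) ?bval_cst// => x _; ring].
    rewrite (EN (fun=> - lam)); last exact: subquad_cst.
    lra.
  lra.
Qed.

End dual_functional.

(** * From inner contents to Borel probabilities *)

Definition compacts_separated (T : topologicalType) : Prop := forall K1 K2 : set T,
  compact K1 -> compact K2 -> K1 `&` K2 = set0 ->
  exists U1 U2 : set T, [/\ open U1, open U2, K1 `<=` U1, K2 `<=` U2 & U1 `&` U2 = set0].

Section inner_content.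
Context {R : realType} (T : ptopologicalType) (T2 : hausdorff_space T).
Hypothesis Tsep : compacts_separated T.
Variable L : set T -> R.
Hypothesis L0 : forall A, 0 <= L A.
Hypothesis Lmono : forall A B, A `<=` B -> L A <= L B.
Hypothesis Ladd : forall A B, A `&` B = set0 -> L (A `|` B) = L A + L B.

Lemma contentU A B : L (A `|` B) <= L A + L B.
Proof.
have -> : A `|` B = A `|` (B `\` A) by rewrite setUDr setDv setD0.
rewrite Ladd; first by rewrite lerD2l; apply: Lmono => x [].
by rewrite setDE setICA setICr setI0.
Qed.

(** [L] is only finitely additive. Its inner regularisation by compact sets is countably subadditive
    on open sets, because a compact set needs only finitely many members of an open cover. *)
Definition lamO (O : set T) : R := sup [set L K | K in [set K | compact K /\ K `<=` O]].

Lemma content0 : L set0 = 0.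
Proof. have := Ladd (setI0 set0); rewrite setU0; lra. Qed.

Lemma lamO_sup O : has_sup [set L K | K in [set K | compact K /\ K `<=` O]].
Proof.
split; first by exists (L set0); exists set0 => //; split=> //; exact: compact0.
by exists (L setT) => _ [K _ <-]; exact: Lmono.
Qed.

Lemma lamO_ge O K : compact K -> K `<=` O -> L K <= lamO O.
Proof. by move=> cK KO; apply: sup_upper_bound; [exact: lamO_sup|exists K]. Qed.

Lemma lamO_le O c : (forall K, compact K -> K `<=` O -> L K <= c) -> lamO O <= c.
Proof.
move=> h; apply: sup_le_ub; first by have [] := lamO_sup O.
by move=> _ [K [cK KO] <-]; exact: h.
Qed.

Lemma lamO_near O (e : R) : 0 < e -> exists K, [/\ compact K, K `<=` O & lamO O <= L K + e].
Proof.
move=> e0; have [_ [K [cK KO] <-] h] := sup_adherent e0 (lamO_sup O).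
by exists K; split=> //; move: h; rewrite -/(lamO O); lra.
Qed.

Lemma lamO_mono O O' : O `<=` O' -> lamO O <= lamO O'.
Proof. by move=> OO; apply: lamO_le => K cK KO; apply: lamO_ge => // x /KO/OO. Qed.

Lemma lamO_ge0 O : 0 <= lamO O.
Proof. by apply: le_trans (L0 set0) _; apply: lamO_ge => //; exact: compact0. Qed.

Lemma lamO_L O : lamO O <= L O.
Proof. by apply: lamO_le => K _; exact: Lmono. Qed.

Lemma compactD (K U : set T) : compact K -> open U -> compact (K `\` U).
Proof.
move=> cK oU; apply: (subclosed_compact _ cK) => [|x []//].
by rewrite setDE; apply: closedI; [exact: compact_closed|exact: open_closedC].
Qed.

(** The compact sets [K] minus [O1] and [K] minus [O2] are disjoint. Disjoint open sets [U1] and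
    [U2] around them cut [K] into the compact pieces [K] minus [U1], inside [O1], and [K] minus
    [U2], inside [O2]. *)
Lemma lamOU O1 O2 : open O1 -> open O2 -> lamO (O1 `|` O2) <= lamO O1 + lamO O2.
Proof.
move=> o1 o2; apply: lamO_le => K cK KO.
have [|U1 [U2 [oU1 oU2 KU1 KU2 U12]]] := Tsep (compactD cK o1) (compactD cK o2).
  by apply/seteqP; split=> // x [[Kx n1] [_ n2]]; case: (KO x Kx).
apply: (@le_trans _ _ (L (K `\` U1) + L (K `\` U2))).
  apply: le_trans (contentU _ _); apply: Lmono => x Kx.
  have [U1x|nU1] := pselect (U1 x); last by left.
  right; split=> // U2x; suff : (U1 `&` U2) x by rewrite U12.
  by split.
apply: lerD; apply: lamO_ge; try exact: compactD.
- by move=> x [Kx nU1]; apply: contrapT => nO; apply: nU1; apply: KU1.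
- by move=> x [Kx nU2]; apply: contrapT => nO; apply: nU2; apply: KU2.
Qed.

Lemma lamO_bigsetU (O : nat -> set T) n : (forall i, open (O i)) ->
  lamO (\big[setU/set0]_(i < n) O i) <= \sum_(i < n) lamO (O i).
Proof.
move=> oO; elim: n => [|n IH].
  by rewrite !big_ord0; apply: (le_trans (lamO_L _)); rewrite content0.
rewrite !big_ord_recr/=; apply: (le_trans (lamOU _ _)) => //; last by rewrite lerD2r.
by elim/big_ind : _ => //; [exact: open0|exact: openU].
Qed.

Lemma compact_bigsetU (K : set T) (O : nat -> set T) : compact K -> (forall i, open (O i)) ->
  K `<=` \bigcup_i O i -> exists n, K `<=` \big[setU/set0]_(i < n) O i.
Proof.
move=> cK oO KO; apply: contrapT => nex.
have bad n : exists2 x, K x & ~ (\big[setU/set0]_(i < n) O i) x.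
  apply: contrapT => h; apply: nex; exists n => x Kx; apply: contrapT => nx.
  by apply: h; exists x.
pose x_ n := s2val (cid2 (bad n)).
have Kx n : K (x_ n) by exact: s2valP (cid2 (bad n)).
have nx n : ~ (\big[setU/set0]_(i < n) O i) (x_ n) by exact: (s2valP' (cid2 (bad n))).
have [U [UU oU]] := nat_ultra; have UP := @ultra_proper _ U UU.
have [|x Kxx cx] := @ultra_compact_cvg nat T U x_ K UU cK.
  by apply: filterS (@filterT _ U _) => n _; exact: Kx.
have [m _ Om] := KO x Kxx.
have h1 : U [set n | O m (x_ n)] by apply: cx; exact: open_nbhs_nbhs.
have h2 : U [set n | (m < n)%N] by apply: oU; exists m.+1.
have [n [/= a b]] := @filter_ex _ U UP _ (filterI h1 h2).
by apply: (nx n); rewrite -bigcup_mkord; exists m.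
Qed.

Definition muout_set (A : set T) : set R := [set lamO O | O in [set O | open O /\ A `<=` O]].
Definition muout (A : set T) : R := inf (muout_set A).

Lemma muout_set_ne A : muout_set A !=set0.
Proof. by exists (lamO setT); exists setT => //; split=> //; exact: openT. Qed.

Lemma muout_set_lb A : lbound (muout_set A) 0.
Proof. by move=> _ [Q _ <-]; exact: lamO_ge0. Qed.

Lemma muout_le A O : open O -> A `<=` O -> muout A <= lamO O.
Proof. by move=> oO AO; apply: ge_inf; [exists 0; exact: muout_set_lb|exists O]. Qed.

Lemma muout_ge0 A : 0 <= muout A.
Proof. by apply: lb_le_inf; [exact: muout_set_ne|exact: muout_set_lb]. Qed.

Lemma muout_near A (e : R) : 0 < e -> exists O, [/\ open O, A `<=` O & lamO O <= muout A + e].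
Proof.
move=> e0; have hi : has_inf (muout_set A) by split; [exact: muout_set_ne|exists 0; exact: muout_set_lb].
have [_ [Q [oQ AQ] <-] h] := inf_adherent e0 hi.
by exists Q; split=> //; exact: ltW.
Qed.

Lemma muout_open O : open O -> muout O = lamO O.
Proof.
move=> oO; apply/eqP; rewrite eq_le muout_le//=; apply: lb_le_inf; first exact: muout_set_ne.
by move=> _ [Q' [_ OO] <-]; exact: lamO_mono.
Qed.

Definition muoutE (A : set T) : \bar R := (muout A)%:E.

Lemma muoutE0 : muoutE set0 = 0%E.
Proof.
rewrite /muoutE muout_open; last exact: open0.
by congr (_%:E); apply/eqP; rewrite eq_le lamO_ge0 andbT -content0 lamO_L.
Qed.

Lemma muoutE_ge0 A : (0 <= muoutE A)%E. Proof. by rewrite lee_fin muout_ge0. Qed.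

Lemma muoutE_mono : {homo muoutE : A B / A `<=` B >-> (A <= B)%E}.
Proof.
move=> A B AB; rewrite lee_fin; apply: lb_le_inf; first exact: muout_set_ne.
by move=> _ [Q [oQ BQ] <-]; apply: muout_le => // x /AB/BQ.
Qed.

Lemma muoutE_sigma_subadditive : sigma_subadditive muoutE.
Proof.
move=> A; apply/lee_addgt0Pr => e e0.
apply: le_trans (epsilon_trick _ (fun n => muoutE_ge0 (A n)) (ltW e0)).
have en n : 0 < e / (2 ^ n.+1)%:R by rewrite divr_gt0// ltr0n expn_gt0.
pose O n := projT1 (cid (muout_near (A n) (en n))).
have OP n : [/\ open (O n), A n `<=` O n & lamO (O n) <= muout (A n) + e / (2 ^ n.+1)%:R].
  exact: projT2 (cid (muout_near (A n) (en n))).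
have oO n : open (O n) by have [] := OP n.
apply: (@le_trans _ _ (lamO (\bigcup_n O n))%:E).
  rewrite lee_fin; apply: muout_le; first exact: bigcup_open.
  by apply: subset_bigcup => n _; have [] := OP n.
apply/lee_addgt0Pr => d d0; have [K' [cK' KO' h]] := lamO_near (\bigcup_n O n) d0.
have [n Kn] := compact_bigsetU cK' oO KO'.
apply: (@le_trans _ _ ((\sum_(i < n) (muout (A i) + e / (2 ^ i.+1)%:R))%:E + d%:E)%E).
  rewrite -EFinD lee_fin; apply: (le_trans h); rewrite lerD2r.
  apply: (@le_trans _ _ (lamO (\big[setU/set0]_(i < n) O i))); first exact: lamO_ge.
  apply: (le_trans (lamO_bigsetU n oO)); apply: ler_sum => i _.
  by have [] := OP i.
rewrite leeD2rE// -sumEFin.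
rewrite -(big_mkord xpredT (fun i => (muout (A i) + e / (2 ^ i.+1)%:R)%:E)).
apply: nneseries_lim_ge => i _ _; rewrite lee_fin addr_ge0 ?muout_ge0//.
by rewrite divr_ge0// ltW.
Qed.

HB.instance Definition _ := isOuterMeasure.Build R T muoutE
  muoutE0 muoutE_ge0 muoutE_mono muoutE_sigma_subadditive.

(** Exhaust the intersection of [Q] and [U] by a compact [K], then the open set [Q] minus [K] by a
    compact [K']. The two are disjoint subsets of [Q], so additivity of [L] gives the inequality up
    to [e]. *)
Lemma open_caratheodory U : open U -> muoutE.-caratheodory U.
Proof.
move=> oU; apply: le_caratheodory_measurable => A.
rewrite -EFinD lee_fin; apply/ler_addgt0Pl => e e0; have e30 : 0 < e / 3 by rewrite divr_gt0.
have [Q [oQ AQ hQ]] := muout_near A e30.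
have oQU : open (Q `&` U) by exact: openI.
have [K [cK KO hK]] := lamO_near (Q `&` U) e30.
have oQK : open (Q `\` K).
  by rewrite setDE; apply: openI => //; apply: closed_openC; exact: compact_closed.
have [K' [cK' KO' hK']] := lamO_near (Q `\` K) e30.
have h1 : muout (A `&` U) <= lamO (Q `&` U) by apply: muout_le => // x [/AQ].
have h2 : muout (A `&` ~` U) <= lamO (Q `\` K).
  by apply: muout_le => // x [/AQ Qx nU]; split=> // /KO[].
have h3 : L K + L K' <= lamO Q.
  rewrite -Ladd; last by apply/seteqP; split=> // x [Kx /KO'[]].
  apply: lamO_ge; first exact: compactU.
  by move=> x [/KO[]//|/KO'[]].
lra.
Qed.

Definition borelT : measurableType _ := g_sigma_algebraType (@open T).

Lemma borel_caratheodory (A : set borelT) : measurable A -> muoutE.-caratheodory A.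
Proof.
move: A; apply: smallest_sub; last by move=> U; exact: open_caratheodory.
split.
- exact: caratheodory_measurable_set0.
- by move=> A mA; rewrite setTD; exact: caratheodory_measurable_setC.
- exact: caratheodory_measurable_bigcup.
Qed.

Definition borel_measure (A : set borelT) : \bar R := muoutE A.

Lemma borel_measure_sigma_additive : semi_sigma_additive borel_measure.
Proof.
move=> A mA tA mU; apply: (@caratheodory_measure_sigma_additive R T muoutE A) => //.
- by move=> i; exact: borel_caratheodory.
- exact: borel_caratheodory.
Qed.

HB.instance Definition _ := isMeasure.Build _ borelT R borel_measure
  muoutE0 muoutE_ge0 borel_measure_sigma_additive.

Hypothesis LT : L setT = 1.
Hypothesis Ltight : forall e : R, 0 < e -> exists2 K, compact K & 1 - e <= L K.

(** Tightness enters here: without it compact sets could miss a part of the mass of [L]. *)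
Lemma borel_measureT : borel_measure setT = 1%E.
Proof.
rewrite /borel_measure /muoutE muout_open; last exact: openT.
congr (_%:E); apply/eqP; rewrite eq_le; apply/andP; split; first by rewrite -LT lamO_L.
apply/ler_addgt0Pl => e e0; have [K cK hK] := Ltight e0.
by have := lamO_ge cK (@subsetT _ K); lra.
Qed.

HB.instance Definition _ := Measure_isProbability.Build _ borelT R borel_measure borel_measureT.

Theorem content_probability : exists mu : probability borelT R,
  forall O : set T, open O -> (mu O <= (L O)%:E)%E.
Proof.
exists borel_measure => O oO.
by rewrite -[leLHS]/(muoutE O) lee_fin muout_open// lamO_L.
Qed.

End inner_content.

(** The sum counts the levels [d], [2 d], ..., [m d] lying strictly below [h], so it is [h] rounded
    down to the grid as long as [h] does not exceed the next level [m.+1 * d]. *)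
Lemma staircase (R : realType) (d h : R) (m : nat) : 0 < d -> 0 <= h ->
  let s := \sum_(j < m) d * (j.+1%:R * d < h)%R%:R in
  s <= h /\ (h <= m.+1%:R * d -> h <= s + d).
Proof.
(* The induction also needs that the sum never exceeds [m * d], and that all [m] steps are present
   once [h] is above the next level. *)
move=> d0 h0; have [] : let s := \sum_(j < m) d * (j.+1%:R * d < h)%R%:R in
    (s <= h /\ s <= m%:R * d) /\ ((h <= m.+1%:R * d -> h <= s + d) /\ (m.+1%:R * d < h -> m%:R * d <= s)).
  elim: m => [|m /=]; first by rewrite big_ord0 mul0r; split=> //; split; lra.
  rewrite big_ord_recr/=; move: (\sum_(_ < _) _) => s [[a1 a2] [b1 b2]].
  have E2 : m.+2%:R * d = m.+1%:R * d + d by rewrite mulrSr; ring.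
  have E1 : m.+1%:R * d = m%:R * d + d by rewrite mulrSr; ring.
  rewrite E2; move: (m.+1%:R * d) (m%:R * d) E1 a2 b1 b2 => p q E1 a2 b1 b2.
  have [hm|hm] := ltP p h; rewrite ?mulr1 ?mulr0.
    by have := b2 hm; split; split; lra.
  by have := b1 hm; split; split; lra.
by case=> ? _ [? _]; split.
Qed.

(** * Comparison of the measure with the functional *)

Section positive_functional.
Context {R : realType} (T : ptopologicalType) (T2 : hausdorff_space T).
Hypothesis Tsep : compacts_separated T.
Variables (X : set T) (N : T -> R).
Hypothesis N0 : forall x, X x -> 0 <= N x.
Hypothesis Kc : forall r, compact (sublevel X N r).
Local Notation subq := (subq X N).
Local Notation subquad := (subquad X N).
Variable E : (T -> R) -> R.
Hypothesis Elin : forall (a : R) h k, subquad h -> subquad k -> E (fun x => a * h x + k x) = a * E h + E k.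
Hypothesis Emono : forall h k, subquad h -> subquad k -> (forall x, X x -> h x <= k x) -> E h <= E k.
Hypothesis E1 : E (fun=> 1) = 1.

Lemma subquad_indic A : subquad (\1_A : T -> R).
Proof.
exists 1 => x /N0 Nx; rewrite indicE mul1r; case: (_ \in _); rewrite ?normr1 ?normr0 ?lerDl//.
by rewrite addr_ge0.
Qed.

Let sc := subquad_cst N0.

Lemma func_cst c : E (fun=> c) = c.
Proof.
have E0 : E (fun=> 0) = 0.
  have := Elin 1 (sc 0) (sc 0).
  have -> : (fun x : T => 1 * 0 + 0) = (fun=> 0) :> (T -> R) by apply/funext => x; ring.
  lra.
have := Elin c (sc 1) (sc 0); rewrite E1 E0.
have -> : (fun x : T => c * 1 + 0) = (fun=> c) :> (T -> R) by apply/funext => x; ring.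
lra.
Qed.

Lemma funcZ a h : subquad h -> E (fun x => a * h x) = a * E h.
Proof. by move=> sh; have := Elin a sh (sc 0); rewrite func_cst addr0; under eq_fun do rewrite addr0. Qed.

Let L (A : set T) : R := E (\1_A).

Lemma indic_content_ge0 A : 0 <= L A.
Proof.
rewrite -(func_cst 0); apply: Emono; [exact: sc|exact: subquad_indic|].
by move=> x _; rewrite indicE; case: (_ \in _).
Qed.

Lemma indic_content_mono A B : A `<=` B -> L A <= L B.
Proof.
move=> AB; apply: Emono; [exact: subquad_indic|exact: subquad_indic|].
move=> x _; rewrite !indicE ler_nat; have [Ax|] := boolP (x \in A) => //.
by rewrite (mem_set (AB x (set_mem Ax))).
Qed.

Lemma indic_content_add A B : A `&` B = set0 -> L (A `|` B) = L A + L B.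
Proof.
move=> AB; have := Elin 1 (subquad_indic A) (subquad_indic B); rewrite mul1r => <-.
congr E; apply/funext => x; rewrite !indicE mul1r in_setU -natrD; congr (_%:R).
have : ~ (A `&` B) x by rewrite AB.
case: (boolP (x \in A)) => [/set_mem Ax|_]; case: (boolP (x \in B)) => [/set_mem Bx|_] //= h.
by exfalso; apply: h.
Qed.

Lemma indic_contentT : L setT = 1.
Proof. by rewrite /L -E1; congr E; apply/funext => x; rewrite indicE in_setT. Qed.

Lemma indic_contentC A : L (~` A) = 1 - L A.
Proof. by have := indic_content_add (setICr A); rewrite setUCr indic_contentT => ->; lra. Qed.

(** Chebyshev's inequality for [E]; it yields tightness. *)
Lemma indic_content_sublevel r : 0 < r -> 1 - E N / r <= L (sublevel X N r).
Proof.
move=> r0; have : L (~` sublevel X N r) <= E (fun x => r^-1 * N x).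
  apply: Emono; [exact: subquad_indic| |].
    have := subquad_lin r^-1 (subquadN N0) (sc 0); by under eq_fun do rewrite addr0.
  move=> x Xx; rewrite indicE; case: (boolP (_ \in _)) => [/set_mem h|_].
    rewrite mulrC ler_pdivlMr// mul1r leNgt; apply/negP => /ltW Nr; exact: h.
  by rewrite mulr_ge0 ?N0// invr_ge0 ltW.
rewrite indic_contentC funcZ; last exact: subquadN.
rewrite mulrC; lra.
Qed.

Lemma indic_content_tight (e : R) : 0 < e -> exists2 K, compact K & 1 - e <= L K.
Proof.
move=> e0; pose r := (`|E N| + 1) / e; have r0 : 0 < r by rewrite divr_gt0// ltr_wpDl.
exists (sublevel X N r) => //; apply: le_trans (indic_content_sublevel r0).
rewrite lerD2l lerN2 ler_pdivrMr// /r mulrC mulfVK ?gt_eqF//.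
by rewrite (le_trans (ler_norm _))// lerDl.
Qed.

Lemma func_measure : exists mu : probability (borelT T) R,
  forall C : set T, closed C -> ((L C)%:E <= mu C)%E.
Proof.
have [mu hmu] := content_probability T2 Tsep indic_content_ge0 indic_content_mono
  indic_content_add indic_contentT indic_content_tight.
exists mu => C cC; have oC : open (~` C) by exact: closed_openC.
have mC : measurable (C : set (borelT T)).
  by rewrite -[C]setCK; apply: measurableC; exact: sub_sigma_algebra.
have := hmu _ oC; rewrite indic_contentC.
have -> : (mu (~` C) = 1 - mu C)%E by exact: probability_setC.
have : (mu C \is a fin_num)%E by exact: fin_num_measure.
move/fineK => <-; rewrite -EFinB !lee_fin; lra.
Qed.

Variable mu : probability (borelT T) R.
Hypothesis muL : forall C : set T, closed C -> ((L C)%:E <= mu C)%E.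

Lemma closed_measurable_borel (C : set T) : closed C -> measurable (C : set (borelT T)).
Proof.
move=> cC; rewrite -[C]setCK; apply: measurableC; apply: sub_sigma_algebra.
exact: closed_openC.
Qed.

Lemma sublevel_closed r : closed (sublevel X N r).
Proof. exact: compact_closed. Qed.

Lemma coercive_measurable : measurable (X : set (borelT T)).
Proof.
have -> : X = \bigcup_n sublevel X N n%:R.
  apply/seteqP; split=> [x Xx|x [n _ []//]].
  exists (Num.truncn (N x)).+1 => //; split=> //.
  by rewrite ltW// truncnS_gt.
by apply: bigcup_measurable => n _; apply: closed_measurable_borel; exact: sublevel_closed.
Qed.

Lemma func_measureX : mu X = 1%E.
Proof.
apply/eqP; rewrite eq_le probability_le1//=; last exact: coercive_measurable.
apply/lee_addgt0Pr => e e0; pose r := (`|E N| + 1) / e.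
have r0 : 0 < r by rewrite divr_gt0// ltr_wpDl.
apply: (@le_trans _ _ ((L (sublevel X N r))%:E + e%:E)%E).
  rewrite -EFinD lee_fin; have := indic_content_sublevel r0.
  have : E N / r <= e.
    rewrite ler_pdivrMr// /r mulrC mulfVK ?gt_eqF//.
    by rewrite (le_trans (ler_norm _))// lerDl.
  lra.
apply: leeD => //; have h1 : (mu (sublevel X N r) <= mu X)%E; last exact: le_trans (muL (@sublevel_closed r)) h1.
apply: le_measure; rewrite ?inE; [|exact: coercive_measurable|by move=> x []].
by apply: closed_measurable_borel; exact: sublevel_closed.
Qed.

Lemma content_open O : open O -> (mu O <= (L O)%:E)%E.
Proof.
move=> oO; have cC := open_closedC oO.
have mC := closed_measurable_borel cC.
have mO : measurable (O : set (borelT T)) by exact: sub_sigma_algebra.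
have := muL cC; rewrite indic_contentC.
have -> : (mu (~` O) = 1 - mu O)%E by exact: probability_setC.
have : (mu O \is a fin_num)%E by exact: fin_num_measure.
move/fineK => <-; rewrite -EFinB !lee_fin; lra.
Qed.

Section layer_cake.
Variables (h : T -> R).
Hypothesis h0 : forall x, X x -> 0 <= h x.
Hypothesis sh : subquad h.
Hypothesis hc : forall c, closed [set x | X x /\ h x <= c].

Lemma layer_measurable : measurable_fun (X : set (borelT T)) (h : borelT T -> R).
Proof.
apply: (measurability _ (RGenOInfty.measurableE R)) => _ [_ [c ->] <-].
have -> : X `&` h @^-1` `]c, +oo[ = X `\` [set x | X x /\ h x <= c].
  apply/seteqP; split=> x [Xx] /=; rewrite in_itv/= andbT.
    by move=> ch; split=> // -[_]; rewrite leNgt ch.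
  by move=> nh; split=> //; rewrite ltNge; apply/negP => hx; apply: nh.
apply: measurableD; first exact: coercive_measurable.
by apply: closed_measurable_borel; exact: hc.
Qed.

(** The mesh is [1 / (n+1)] and there are [n * (n+1)] steps, so heights up to [n] are resolved. *)
Let st n (x : T) : R := \sum_(j < n * n.+1) n.+1%:R^-1 * (j.+1%:R * n.+1%:R^-1 < h x)%R%:R.

Let A n (j : nat) : set T := [set x | X x /\ h x <= j.+1%:R * n.+1%:R^-1].

Let stE n x : X x -> st n x = \sum_(j < n * n.+1) n.+1%:R^-1 * \1_(~` A n j) x.
Proof.
move=> Xx; apply: eq_bigr => j _; congr (_ * _); rewrite indicE; congr (_%:R); congr nat_of_bool.
apply/idP/idP => [hj|/set_mem nA].
  by rewrite inE => -[_]; rewrite leNgt hj.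
by rewrite ltNge; apply/negP => hx; apply: nA.
Qed.

Lemma func_sum (I : Type) (r : seq I) (c : R) (k : I -> T -> R) : (forall i, subquad (k i)) ->
  subquad (fun x => \sum_(i <- r) c * k i x) /\ E (fun x => \sum_(i <- r) c * k i x) = \sum_(i <- r) c * E (k i).
Proof.
move=> sk; elim: r => [|i r [s1 IH]].
  by under eq_fun do rewrite big_nil; rewrite big_nil func_cst; split=> //; exact: sc.
under eq_fun do rewrite big_cons; rewrite big_cons -IH Elin//; split=> //.
exact: subquad_lin.
Qed.

(* Layer cake: the sets where [h] is large are open, and [mu] is at most [E] on
   open sets. *)
Lemma layer_integral : (\int[mu]_(x in (X : set (borelT T))) (h x)%:E <= (E h)%:E)%E.
Proof.
have mX := coercive_measurable.
have mA n j : measurable (~` A n j : set (borelT T)).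
  by apply: measurableC; by apply: closed_measurable_borel; exact: hc.
have d0 n : 0 < (n.+1%:R^-1 : R) by rewrite invr_gt0.
have stle n x : X x -> st n x <= h x.
  by move=> Xx; have [] := @staircase R n.+1%:R^-1 (h x) (n * n.+1) (d0 n) (h0 Xx).
have stge n x : X x -> h x <= n%:R -> h x <= st n x + n.+1%:R^-1.
  move=> Xx hn; have [_ H] := @staircase R n.+1%:R^-1 (h x) (n * n.+1) (d0 n) (h0 Xx); apply: H.
  rewrite ler_pdivlMr// (le_trans (ler_wpM2r _ hn))//.
  by rewrite -natrM ler_nat.
have st0 n (x : borelT T) : X x -> (0%R <= (st n x)%:E)%E.
  move=> Xx; rewrite lee_fin sumr_ge0// => j _; rewrite mulr_ge0 ?(ltW (d0 n))//.
have stcvg x : X x -> (st n x)%:E @[n --> \oo] --> (h x)%:E.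
  move=> Xx; apply: cvg_EFin; first by near=> n.
  apply/cvgrPdist_lt => e e0; near=> n => /=; rewrite ger0_norm ?subr_ge0 ?stle//.
  have h1 : h x <= st n x + n.+1%:R^-1.
    apply: stge => //; near: n; exact: nbhs_infty_ger.
  have : n.+1%:R^-1 < e by near: n; exact: near_infty_natSinv_lt (PosNum e0).
  by move: h1; move: (n.+1%:R^-1) => q; lra.
have mst n : measurable_fun (X : set (borelT T)) (fun x : borelT T => (st n x)%:E).
  apply/measurable_EFinP.
  have eqst : {in X, (fun x : borelT T => \sum_(j < n * n.+1) n.+1%:R^-1 * \1_(~` A n j) x) =1 st n}.
    by move=> x /set_mem Xx; rewrite stE.
  apply: (@eq_measurable_fun _ _ (borelT T) _ X _ _ eqst).
  by apply: measurable_sum => j; apply: measurable_funM.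
have st_int n : (\int[mu]_(x in (X : set (borelT T))) (st n x)%:E <= (E h)%:E)%E.
  have [ss sE] := @func_sum 'I_(n * n.+1) (index_enum _) n.+1%:R^-1 (fun j => \1_(~` A n j)) (fun j => subquad_indic _).
  apply: (@le_trans _ _ (E (fun x => \sum_(j < n * n.+1) n.+1%:R^-1 * \1_(~` A n j) x))%:E); last first.
    by rewrite lee_fin; apply: Emono => // x Xx; rewrite -stE// stle.
  rewrite sE; under eq_integral => x /set_mem Xx do rewrite stE// -sumEFin.
  rewrite ge0_integral_sum//; last first.
    move=> j; apply/measurable_EFinP; apply: measurable_funM => //.
  rewrite -sumEFin; apply: lee_sum => j _.
  under eq_integral do rewrite EFinM.
  rewrite ge0_integralZl_EFin//; last exact/measurable_EFinP.
  rewrite EFinM; apply: lee_wpmul2l; first by rewrite lee_fin ltW.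
  rewrite integral_indic//.
  have oA : open (~` A n j) by apply: closed_openC; exact: hc.
  apply: le_trans (content_open oA); apply: le_measure; rewrite ?inE //.
  exact: measurableI.
have := @fatou _ _ _ mu _ mX (fun n x => (st n x)%:E) mst st0.
under eq_integral => x /set_mem Xx do rewrite (cvg_limn_einf_sup (stcvg x Xx)).1.
move=> /le_trans; apply.
rewrite limn_einf_lim; apply: lime_le; first exact: is_cvg_einfs.
apply: nearW => n; apply: le_trans (st_int n); apply: ereal_inf_lbound.
by exists n => /=.
Unshelve. all: by end_near.
Qed.

End layer_cake.

Lemma coercive_integrable (h : T -> R) : (forall x, X x -> 0 <= h x) -> subquad h ->
  (forall c, closed [set x | X x /\ h x <= c]) ->
  mu.-integrable (X : set (borelT T)) (EFin \o h) /\ \int[mu]_(x in (X : set (borelT T))) h x <= E h.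
Proof.
move=> h0 sh hc; have mX := coercive_measurable.
have hi := layer_integral h0 sh hc.
have int : mu.-integrable (X : set (borelT T)) (EFin \o h).
  apply/integrableP; split; first by apply/measurable_EFinP; exact: layer_measurable.
  under eq_integral => x /set_mem Xx do rewrite /= ger0_norm ?h0//.
  by apply: le_lt_trans hi _; rewrite ltry.
split=> //; rewrite -lee_fin /Rintegral fineK//.
by have := integrable_fin_num mX int.
Qed.

(** [w N + G] may be negative, and may lack compact sublevel sets where [w] vanishes. Adding
    [k N + C] repairs both. The constant cancels, as [E] and [mu] have mass 1, and what remains of
    the correction is [k * (E N - int N) <= k * E N], which vanishes with [k]. *)
Lemma weighted_integral (w G : T -> R) (M : R) : (forall r, {within sublevel X N r, continuous w}) ->
  (forall x, X x -> 0 <= w x <= M) -> subq G ->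
  mu.-integrable (X : set (borelT T)) (EFin \o (fun x => w x * N x + G x)) /\
  \int[mu]_(x in (X : set (borelT T))) (w x * N x + G x) <= E (fun x => w x * N x + G x).
Proof.
move=> cw bw sG; have mX := coercive_measurable.
have sN := subquadN N0.
have swN : subquad (fun x => w x * N x).
  exists `|M| => x Xx; have /andP[w0 w1] := bw x Xx; have Nx := N0 Xx.
  rewrite ger0_norm ?mulr_ge0// ler_pM ?lerDr//.
  by rewrite (le_trans w1)// ler_norm.
have sGq := subq_subquad N0 sG.
have swNG : subquad (fun x => w x * N x + G x).
  by have := subquad_lin 1 swN sGq; under eq_fun do rewrite mul1r.
have cN c : closed [set x | X x /\ N x <= c] by exact: sublevel_closed.
have [iN hN] := coercive_integrable N0 sN cN.
have key (k : R) : 0 < k -> mu.-integrable (X : set (borelT T)) (EFin \o (fun x => w x * N x + G x)) /\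
    \int[mu]_(x in (X : set (borelT T))) (w x * N x + G x) <= E (fun x => w x * N x + G x) + k * E N.
  move=> k0; have [C C0 hC] := sG.2 _ k0.
  pose H x := k * N x + (1 * (w x * N x + G x) + C).
  have sH0 : subquad (fun x => 1 * (w x * N x + G x) + C) by exact: subquad_lin (sc C).
  have sH : subquad H by exact: subquad_lin.
  have H0 x : X x -> 0 <= H x.
    move=> Xx; have := hC x Xx; rewrite ler_norml => /andP[h _].
    have /andP[w0 _] := bw x Xx; have := mulr_ge0 w0 (N0 Xx); rewrite /H; lra.
  have Hc c : closed [set x | X x /\ H x <= c].
    have -> : [set x | X x /\ H x <= c] = [set x | X x /\ (w x + k) * N x + G x <= c - C].
      by apply/seteqP; split=> x [Xx h]; split=> //; move: h; rewrite /H; lra.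
    apply: compact_closed => //; apply: (@sublevel_compact R T T2 X N N0 Kc _ G k) => //.
    - by move=> r; apply/within_cvgP => x Kx; apply: cvgD; [exact: ((within_cvgP _ _).1 (cw r))|exact: cvg_cst].
    - by move=> x Xx; have /andP[w0 _] := bw x Xx; rewrite lerDr.
  have [iH hH] := coercive_integrable H0 sH Hc.
  have EH : E H = k * E N + (E (fun x => w x * N x + G x) + C).
    by rewrite /H Elin// Elin// ?func_cst ?mul1r//; exact: sc.
  have iC : mu.-integrable (X : set (borelT T)) (EFin \o (fun=> C : R)) by exact: finite_measure_integrable_cst.
  have ikN : mu.-integrable (X : set (borelT T)) (EFin \o (fun x => k * N x)) by exact: (integrableZl mX k iN).
  have iNC : mu.-integrable (X : set (borelT T)) (EFin \o (fun x => k * N x + C)) by exact: (integrableD mX ikN iC).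
  have e1 : (fun x => w x * N x + G x) = (fun x => H x - (k * N x + C)).
    by apply/funext => x; rewrite /H; ring.
  have iwNG : mu.-integrable (X : set (borelT T)) (EFin \o (fun x => w x * N x + G x)).
    by rewrite e1; exact: (integrableB mX iH iNC).
  split=> //.
  have N_ge0 : 0 <= \int[mu]_(x in (X : set (borelT T))) N x by apply: Rintegral_ge0.
  have : \int[mu]_(x in (X : set (borelT T))) (w x * N x + G x) =
      \int[mu]_(x in (X : set (borelT T))) H x - (k * \int[mu]_(x in (X : set (borelT T))) N x + C).
    rewrite {1}e1 (RintegralB mX iH iNC) (RintegralD mX ikN iC) (RintegralZl k mX iN) Rintegral_cst//.
    have -> : fine (mu X) = 1 by have /(congr1 fine) := func_measureX.
    by rewrite mulr1.
  move=> ->; have := mulr_ge0 (ltW k0) N_ge0; move: hH; rewrite EH; lra.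
split; first by have [] := key 1 ltr01.
apply/ler_addgt0Pl => e e0; have EN1 : 0 < `|E N| + 1 by rewrite ltr_wpDl.
have ek : 0 < e / (`|E N| + 1) by rewrite divr_gt0.
have [_ h] := key _ ek; apply: (le_trans h); rewrite addrC lerD2r.
have : e / (`|E N| + 1) * E N <= e / (`|E N| + 1) * (`|E N| + 1).
  by rewrite ler_wpM2l ?(ltW ek)// (le_trans (ler_norm _))// lerDl.
by rewrite mulfVK// gt_eqF.
Qed.

(** [weighted_integral] with weight 0, for [G] and for [- G]. *)
Lemma subq_integral (G : T -> R) : subq G ->
  mu.-integrable (X : set (borelT T)) (EFin \o G) /\ \int[mu]_(x in (X : set (borelT T))) G x = E G.
Proof.
move=> sG; have mX := coercive_measurable.
have le G' : subq G' -> mu.-integrable (X : set (borelT T)) (EFin \o G') /\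
    \int[mu]_(x in (X : set (borelT T))) G' x <= E G'.
  move=> sG'; have [||] := @weighted_integral (fun=> 0) G' 0 _ _ sG'.
  - by move=> r; apply/within_cvgP => x Kx; exact: cvg_cst.
  - by move=> x _; rewrite lexx.
  - by have -> : (fun x => 0 * N x + G' x) = G' by apply/funext => x; ring.
have [iG hG] := le G sG; split=> //; apply/eqP; rewrite eq_le hG/=.
have [_] := le _ (subqZ (-1) sG); rewrite RintegralZl// funcZ; last exact: subq_subquad.
lra.
Qed.


End positive_functional.

(** * Lagrange multipliers and the minimax theorem *)

(* By a partition of unity, the condition being convex in the constant. *)
Lemma glue_segment (R : realType) (a b m M : R) (P : R -> R -> Prop) : m <= M ->
  (forall s (I : Type) (r : seq I) (c h : I -> R), (forall i, 0 <= c i) -> 0 < \sum_(i <- r) c i ->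
     (forall i, 0 < c i -> P s (h i)) -> P s ((\sum_(i <- r) c i * h i) / \sum_(i <- r) c i)) ->
  (forall r, a <= r <= b -> exists h d : R, [/\ m <= h <= M, 0 < d &
     forall s, a <= s <= b -> `|s - r| < d -> P s h]) ->
  exists k : R -> R, [/\ continuous k, forall s, m <= k s <= M & forall s, a <= s <= b -> P s (k s)].
Proof.
move=> mM Pconv loc; have [ab|ba] := leP a b; last first.
  exists (fun=> m); split; [by move=> x; exact: cvg_cst|by move=> _; rewrite lexx|].
  by move=> s /andP[as_ sb]; move: ba; rewrite ltNge (le_trans as_ sb).
have loc' r : exists hd : R * R, a <= r <= b -> [/\ m <= hd.1 <= M, 0 < hd.2 &
     forall s, a <= s <= b -> `|s - r| < hd.2 -> P s hd.1].
  have [/loc[h [d H]]|/negP nr] := boolP (a <= r <= b); first by exists (h, d).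
  by exists (0, 0).
pose hd r := projT1 (cid (loc' r)).
have hdP r : a <= r <= b -> [/\ m <= (hd r).1 <= M, 0 < (hd r).2 &
     forall s, a <= s <= b -> `|s - r| < (hd r).2 -> P s (hd r).1] by exact: projT2 (cid (loc' r)).
have cK := @segment_compact R a b; rewrite compact_cover in cK.
have [|x xab|D' DD cov] := cK R `[a, b]%classic (fun r => ball r (hd r).2).
- by move=> i _; exact: ball_open.
- exists x => //; apply: ballxx; move: xab; rewrite /= in_itv/= => xab.
  by have [] := hdP x xab.
pose D : seq R := finmap.enum_fset D'.
(* Tent functions, positive exactly on the balls of the finite cover. *)
pose bmp r s : R := Num.max 0 ((hd r).2 - `|s - r|).
pose S s := \sum_(r <- D) bmp r s.
have D'ab r : r \in D -> a <= r <= b by move=> /DD/set_mem; rewrite /= in_itv.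
have bmp0 r s : 0 <= bmp r s by rewrite /bmp le_max lexx.
have S_gt0 s : a <= s <= b -> 0 < S s.
  move=> sab; have [|r /= rD] := cov s; first by rewrite /= in_itv.
  rewrite /ball/= distrC => rs.
  rewrite /S (perm_big _ (perm_to_rem rD)) big_cons ltr_wpDr ?sumr_ge0//.
  by rewrite /bmp lt_max subr_gt0 rs orbT.
(* Clamping to the segment extends the glued function continuously, with the same bounds, to the
   whole line. *)
pose cl s := Num.max a (Num.min b s).
have clab s : a <= cl s <= b by rewrite /cl le_max lexx/= ge_max ab/= ge_min lexx.
have cle s : a <= s <= b -> cl s = s.
  by move=> /andP[as_ sb]; rewrite /cl (min_idPr sb) (max_idPr as_).
pose k0 s := (\sum_(r <- D) bmp r s * (hd r).1) / S s.
have cbmp r : continuous (bmp r).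
  move=> s; apply: (@continuous_max _ _ (fun=> 0) (fun s => (hd r).2 - `|s - r|)); first exact: cvg_cst.
  apply: cvgB; first exact: cvg_cst.
  by apply: cvg_norm; apply: cvgB; [exact: cvg_id|exact: cvg_cst].
have csum (c : R -> R) : continuous (fun s => \sum_(r <- D) bmp r s * c r).
  move=> s; elim: {1}D => [|r s' IH].
    by rewrite (_ : (fun _ => _) = fun=> 0); [exact: cst_continuous|apply/funext => t; rewrite big_nil].
  rewrite (_ : (fun _ => _) = fun s => bmp r s * c r + \sum_(r <- s') bmp r s * c r); last first.
    by apply/funext => t; rewrite big_cons.
  by apply: cvgD => //; apply: cvgM; [exact: cbmp|exact: cvg_cst].
have cS : continuous S.
  by have := csum (fun=> 1); under eq_fun do under eq_bigr do rewrite mulr1.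
have ccl : continuous cl.
  move=> s; apply: (@continuous_max _ _ (fun=> a) (fun s => Num.min b s)); first exact: cvg_cst.
  by apply: (@continuous_min _ _ (fun=> b) id); [exact: cvg_cst|exact: cvg_id].
exists (k0 \o cl); split.
- move=> s; apply: continuous_comp; first exact: ccl.
  apply: cvgM; first exact: csum.
  by apply: cvgV; [rewrite gt_eqF// S_gt0|exact: cS].
- move=> s; rewrite /=; move: (cl s) (clab s) => t tab; rewrite /k0.
  rewrite ler_pdivlMr ?ler_pdivrMr ?S_gt0// /S !mulr_sumr; apply/andP; split.
    rewrite big_seq [leRHS]big_seq; apply: ler_sum => r /D'ab/hdP[/andP[h1 _] _ _].
    by rewrite mulrC ler_wpM2l.
  rewrite big_seq [leRHS]big_seq; apply: ler_sum => r /D'ab/hdP[/andP[_ h1] _ _].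
  by rewrite [leRHS]mulrC ler_wpM2l.
- move=> s sab; rewrite /= cle// /k0 /S.
  (* The indices are restricted to points of the segment, because the local constants satisfy [P]
     only there and the convexity hypothesis quantifies over the whole index type. *)
  have := @Pconv s {r : R | a <= r <= b} (pmap insub D) (fun r => bmp (val r) s) (fun r => (hd (val r)).1).
  have e2 (c : R -> R) : \sum_(r <- pmap insub D : seq {r : R | a <= r <= b}) c (val r) = \sum_(r <- D) c r.
    rewrite -(big_map val xpredT c) pmap_filter; last exact: insubK.
    rewrite big_filter big_seq_cond [RHS]big_seq_cond; apply: eq_bigl => r; rewrite andbT.
    by case: (boolP (r \in D)) => //= /D'ab h; rewrite isSome_insub.
  rewrite (e2 (fun r => bmp r s)) (e2 (fun r => bmp r s * (hd r).1)); apply => //; first exact: S_gt0.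
  move=> [r rab] /=; rewrite /bmp lt_max ltxx/= subr_gt0 => rs.
  by have [_ _] := hdP r rab; apply.
Qed.

(** * Weak duality by multipliers *)

Section weak_duality.
Context {R : realType} (T : ptopologicalType) (T2 : hausdorff_space T).
Variables (X : set T) (N : T -> R).
Hypothesis N0 : forall x, X x -> 0 <= N x.
Hypothesis Kc : forall r, compact (sublevel X N r).
Local Notation subq := (subq X N).
Variables (e F : T -> R) (ce : continuous e) (E0 : R).
Hypothesis eE : forall x, X x -> 0 <= e x <= E0.
Hypothesis sF : subq F.
Local Notation bf := (bf X N e F).
Local Notation ell := (ellN N F).

Lemma ell_below : exists2 C : R, 0 <= C & forall x, X x -> N x <= 2 * ell x + C.
Proof.
have h2 : 0 < (2^-1 : R) by rewrite invr_gt0.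
have [C C0 hC] := sF.2 _ h2; exists (2 * C) => [|x Xx]; first by rewrite mulr_ge0.
by have := hC x Xx; rewrite ler_norml /ellN => /andP[_]; lra.
Qed.

Lemma continuous_sublevel r : {within sublevel X N r, continuous e}.
Proof. exact: continuous_subspaceT. Qed.

Variables (G : T -> R) (q : R).
Hypothesis sG : subq G.
Hypothesis Gq : forall b, bf b -> q <= bval G b.

Lemma bf_below1 x : X x -> ell x <= 0 -> q <= G x.
Proof.
move=> Xx lx; have : q <= bval G (1, x, x) by apply: Gq; left.
by rewrite /= mul1r subrr mul0r addr0.
Qed.

(** The weight [w] makes the average of [ell] equal to 0, so the two points form an element of [bf];
    the bound is multiplied by [ell y - ell x]. *)
Lemma bf_below2 x y : X x -> X y -> e x = e y -> ell x < 0 -> 0 < ell y ->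
  0 <= ell y * (G x - q) - ell x * (G y - q).
Proof.
move=> Xx Xy exy lx ly; have d0 : 0 < ell y - ell x by lra.
pose w := ell y / (ell y - ell x).
have w0 : 0 < w by rewrite divr_gt0.
have w1 : 1 - w = - ell x / (ell y - ell x) by rewrite /w; field; rewrite gt_eqF.
have w1p : 0 < 1 - w by rewrite w1 divr_gt0// oppr_gt0.
have : q <= bval G (w, x, y).
  apply: Gq; right; split=> //; [by rewrite w0 -subr_gt0 w1p|by rewrite lx|].
  by rewrite w1 /w; field; rewrite gt_eqF.
rewrite /= w1 /w [ell y / _ * _]mulrAC [- _ / _ * _]mulrAC -mulrDl ler_pdivlMr//; lra.
Qed.

(** The slack [eta] keeps the multipliers from blowing up where [ell] tends to 0 from above.
    Otherwise points with ratios tending to infinity would, by compactness, have a limit [y] with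
    [ell y <= 0] and [G y <= q - eta], against [bf_below1]. *)
Lemma multiplier_bound (eta : R) : 0 < eta -> exists2 M : R, 0 <= M & forall y, X y ->
  G y - q + eta < 0 -> - (G y - q + eta) <= M * ell y.
Proof.
move=> eta0; apply: contrapT => nM.
have bad (n : nat) : exists2 y, X y & G y - q + eta < 0 /\ n.+1%:R * ell y < - (G y - q + eta).
  apply: contrapT => h; apply: nM; exists n.+1%:R => // y Xy Gy.
  by rewrite leNgt; apply/negP => lt; apply: h; exists y.
pose y_ n := s2val (cid2 (bad n)).
have Xy n : X (y_ n) by exact: s2valP (cid2 (bad n)).
have yP n : G (y_ n) - q + eta < 0 /\ n.+1%:R * ell (y_ n) < - (G (y_ n) - q + eta) by exact: (s2valP' (cid2 (bad n))).
have lp n : 0 < ell (y_ n).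
  rewrite ltNge; apply/negP => l0; have := bf_below1 (Xy n) l0; have [] := yP n; lra.
have [C1 C10 h1] := ell_below.
(* With this constant [2 * ell] is bounded by [N / 2] plus a constant, which is absorbed in
   [N <= 2 * ell + C1]. *)
have q0 : 0 < (4^-1 : R) by rewrite invr_gt0.
have [C2 C20 h2] := sG.2 _ q0.
have n1 n : 1 <= n.+1%:R :> R by rewrite ler1n.
have Ny n : sublevel X N (2 * (C1 + 2 * (C2 + `|q|))) (y_ n).
  split=> //; have := h1 _ (Xy n); have := h2 _ (Xy n); rewrite ler_norml => /andP[a1 a2].
  have [b1 b2] := yP n; have := ler_norm q; have := ler_wpM2r (ltW (lp n)) (n1 n); lra.
have [U [UU oU]] := nat_ultra; have UP := @ultra_proper _ U UU.
have UT (P : nat -> Prop) : (forall n, P n) -> U [set n | P n].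
  by move=> h; apply: filterS (@filterT _ U _) => n _; exact: h.
have [y [a [Xy' Na cy ca hg]]] := @ultra_sublevel R T T2 X N N0 Kc nat U UU y_ _ (UT _ Ny).
have cG := hg G sG.1; have cF := hg F sF.1.
have cl : ell (y_ n) @[n --> U] --> a - F y by apply: cvgB.
have l0 : a - F y <= 0.
  (* A bound for [- (G - q + eta)] on the sublevel set that contains the points, so that
     [ell (y_ n) <= K / (n+1)]. *)
  pose K := C1 + 2 * (C2 + `|q|) + C2 + `|q|.
  have := @le_cvg_filter R _ U UP (fun n => ell (y_ n)) (fun n => K * n.+1%:R^-1) (a - F y) (K * 0) cl.
  rewrite mulr0; apply.
    rewrite -[X in _ --> X](mulr0 K); apply: cvgM; first exact: cvg_cst.
    by apply: (cvg_trans _ (@cvg_harmonic R)); apply: cvg_app.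
  apply: UT => n; rewrite ler_pdivlMr// mulrC; have [_ b2] := yP n; apply: ltW (lt_le_trans b2 _).
  have [_ Nn] := Ny n; have := h2 _ (Xy n); rewrite ler_norml => /andP[a1 a2].
  by have := ler_norm q; have := normr_ge0 q; rewrite /K; lra.
have := @bf_below1 y Xy'; rewrite /ellN => h; have {}h : q <= G y by apply: h; lra.
have : G y <= q - eta.
  apply: (@le_cvg_filter R _ U UP (fun n => G (y_ n)) (fun=> q - eta) _ _ cG (cvg_cst _)).
  by apply: UT => n; have [] := yP n; lra.
lra.
Qed.

(* The values of [k] at [r] are the Lagrange multipliers of the constraint on
   [ell] in the slice [e = r]. *)
Lemma multiplier (eta : R) : 0 < eta -> exists (k : R -> R) (M : R),
  [/\ continuous k, forall s, 0 <= k s <= M & forall x, X x -> q - eta <= G x + k (e x) * ell x].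
Proof.
move=> eta0; have eta2 : 0 < eta / 2 by rewrite divr_gt0.
have [M M0 hM] := multiplier_bound eta2.
have [C C0 hC] := ell_below.
(* The multiplier of a slice may be 0, which would leave no coercivity. Raising it by [kap] restores
   it and lowers the value by at most [kap * C <= eta / 2]. *)
pose kap := eta / 2 / (C + 1).
have C1 : 0 < C + 1 by rewrite ltr_wpDl.
have kap0 : 0 < kap by rewrite divr_gt0.
have kapC : kap * C <= eta / 2.
  by rewrite /kap mulrAC ler_pdivrMr// ler_wpM2l// ?(ltW eta2)// lerDl.
pose P (s h : R) := forall x, X x -> e x = s -> q - eta <= G x + h * ell x.
have [||r rE|k [ck k0M kP]] := @glue_segment R 0 E0 0 (M + kap) P.
- by rewrite addr_ge0// ltW.
- move=> s I r c h c0 cS ch x Xx xs.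
  have e1 : G x = (\sum_(i <- r) c i * G x) / (\sum_(i <- r) c i).
    by rewrite -mulr_suml mulrAC mulfV ?mul1r// gt_eqF.
  rewrite {1}e1 mulrAC -mulrDl ler_pdivlMr// mulr_sumr mulr_suml -big_split/=.
  apply: ler_sum => i _; have [ci0|cip] := eqVneq (c i) 0; first by rewrite ci0 !(mul0r, mulr0) addr0.
  have ci : 0 < c i by rewrite lt_neqAle eq_sym cip c0.
  by have := ler_wpM2l (c0 i) (ch i ci x Xx xs); rewrite mulrC; lra.
(* Points of the slice with [ell > 0] bound the multiplier from below and those with [ell < 0] from
   above; [bf_below2] makes the two families of bounds compatible, so the supremum of the lower ones
   works. *)
- pose S := [set z : R | z = 0 \/ exists y, [/\ X y, e y = r, 0 < ell y & z = - (G y - q + eta / 2) / ell y]].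
  have S0 : S 0 by left.
  have SM z : S z -> z <= M.
    case=> [->//|[y [Xy ey ly ->]]]; rewrite ler_pdivrMr//.
    have [/hM h|h] := ltP (G y - q + eta / 2) 0; first exact: h.
    by apply: (@le_trans _ _ 0); [rewrite oppr_le0|rewrite mulr_ge0// ltW].
  have hS : has_sup S by split; [exists 0|exists M].
  pose h := sup S.
  have h0 : 0 <= h by exact: sup_upper_bound.
  have hM' : h <= M by apply: sup_le_ub; [exists 0|].
  have slice x : X x -> e x = r -> 0 <= G x - q + eta / 2 + h * ell x.
    move=> Xx ex; have [l0|l0|l0] := ltgtP (ell x) 0.
    - suff : h <= (G x - q + eta / 2) / - ell x by rewrite ler_pdivlMr ?oppr_gt0//; lra.
      have Gx := bf_below1 Xx (ltW l0).
      apply: sup_le_ub; first by exists 0.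
      move=> _ [->|[y [Xy ey ly ->]]]; first by rewrite divr_ge0//; lra.
      rewrite ler_pdivrMr// mulrAC ler_pdivlMr ?oppr_gt0//.
      have := bf_below2 Xx Xy _ l0 ly; rewrite ex ey => /(_ erefl).
      have := mulr_gt0 eta2 ly; have : 0 < eta / 2 * - ell x by rewrite mulr_gt0// oppr_gt0.
      lra.
    - have : - (G x - q + eta / 2) / ell x <= h by apply: sup_upper_bound => //; right; exists x.
      rewrite ler_pdivrMr//; lra.
    - by have := bf_below1 Xx; rewrite l0 mulr0 => /(_ (lexx _)); lra.
  have bC : compact [set x | X x /\ (h + kap) * N x + (G x + - (h + kap) * F x) <= q - eta].
    apply: (@sublevel_compact R T T2 X N N0 Kc (fun=> h + kap) _ kap) => //.
    - by move=> s; apply/within_cvgP => x _; exact: cvg_cst.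
    - by move=> x _; rewrite lerDr.
    - by apply: subqD => //; exact: subqZ.
  have bE x : (h + kap) * N x + (G x + - (h + kap) * F x) = G x + (h + kap) * ell x by rewrite /ellN; ring.
  (* The points that violate the inequality form a compact set. Its image under [e] is closed and
     misses [r], so the same multiplier serves all nearby slices. *)
  have eC : closed (e @` [set x | X x /\ (h + kap) * N x + (G x + - (h + kap) * F x) <= q - eta]).
    apply: compact_closed; first exact: norm_hausdorff.
    by apply: continuous_compact => //; exact: continuous_subspaceT.
  have nr : (~` (e @` [set x | X x /\ (h + kap) * N x + (G x + - (h + kap) * F x) <= q - eta])) r.
    move=> [x [Xx]]; rewrite bE => bx ex; have := slice x Xx ex; have := hC x Xx.
    have := N0 Xx; have h1 := mulr_gt0 kap0; move: (ell x) bx => l bx n1 n2 n3.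
    have : kap * (- C) <= kap * (2 * l) by rewrite ler_wpM2l ?(ltW kap0)//; lra.
    lra.
  have /nbhs_ballP[d /= d0 dP] : nbhs r (~` (e @` [set x | X x /\ (h + kap) * N x + (G x + - (h + kap) * F x) <= q - eta])).
    by apply: open_nbhs_nbhs; split=> //; exact: closed_openC.
  exists (h + kap), d; split=> //.
    by rewrite addr_ge0 ?(ltW kap0)//= lerD2r.
  move=> s _ sr x Xx xs; rewrite leNgt; apply/negP => lt.
  have : (~` (e @` [set x | X x /\ (h + kap) * N x + (G x + - (h + kap) * F x) <= q - eta])) s.
    by apply: dP; rewrite /ball/= distrC.
  by apply; exists x => //; split=> //; rewrite bE ltW.
- exists k, (M + kap); split=> // x Xx; apply: (kP (e x)) => //; exact: eE.
Qed.

(** A difference of two functions with closed sublevel sets, [N + g] and [N]. *)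
Lemma subq_measurable (g : T -> R) : subq g -> measurable_fun (X : set (borelT T)) (g : borelT T -> R).
Proof.
move=> sg; have cl (c : R) h : subq h -> closed [set x | X x /\ 1 * N x + h x <= c].
  move=> sh; apply: compact_closed => //; apply: (@sublevel_compact R T T2 X N N0 Kc (fun=> 1) _ 1) => //.
  by move=> s; apply/within_cvgP => x _; exact: cvg_cst.
have m1 := layer_measurable T2 Kc (fun c => @cl c _ sg).
have m2 := layer_measurable T2 Kc (fun c => @cl c _ (subq_cst N0 0)).
have -> : g = (fun x => (1 * N x + g x) - (1 * N x + 0)) by apply/funext => x; ring.
exact: measurable_funB.
Qed.

Lemma subq_integrable (mu : probability (borelT T) R) (g : T -> R) :
  mu.-integrable (X : set (borelT T)) (EFin \o N) -> subq g ->
  mu.-integrable (X : set (borelT T)) (EFin \o g).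
Proof.
move=> iN sg; have mX := coercive_measurable T2 Kc.
have [C C0 hC] := sg.2 _ ltr01.
have iC : mu.-integrable (X : set (borelT T)) (EFin \o (fun=> C : R)) by exact: finite_measure_integrable_cst.
apply: (le_integrable mX _ _ (integrableD mX iN iC)).
  by apply/measurable_EFinP; exact: subq_measurable.
move=> x Xx /=; rewrite lee_fin [leRHS]ger0_norm ?addr_ge0 ?N0//.
by have := hC x Xx; rewrite mul1r.
Qed.

Lemma ell_integrable (mu : probability (borelT T) R) (k : R -> R) (M : R) :
  mu.-integrable (X : set (borelT T)) (EFin \o N) -> continuous k -> (forall s, 0 <= k s <= M) ->
  mu.-integrable (X : set (borelT T)) (EFin \o (fun x => k (e x) * ell x)).
Proof.
move=> iN ck kM; have mX := coercive_measurable T2 Kc.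
have cke r : {within sublevel X N r, continuous (k \o e)}.
  by apply: continuous_subspaceT => x; apply: continuous_comp; [exact: ce|exact: ck].
have iF : mu.-integrable (X : set (borelT T)) (EFin \o F) by exact: subq_integrable.
have il := integrableB mX iN iF.
apply: (le_integrable mX _ _ (integrableZl mX M il)).
  apply/measurable_EFinP; apply: measurable_funM.
    apply: (@subq_measurable (k \o e)); split=> // d d0; exists `|M| => // x Xx.
    rewrite ler_wpDl ?mulr_ge0 ?N0 ?(ltW d0)// ger0_norm; last by have /andP[] := kM (e x).
    by rewrite (le_trans _ (ler_norm _))//; have /andP[] := kM (e x).
  by apply: measurable_funB; [have /measurable_int/measurable_EFinP := iN|have /measurable_int/measurable_EFinP := iF].
move=> x Xx /=; have /andP[k0 k1] := kM (e x); rewrite lee_fin !normrM -/(ellN N F x).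
by rewrite ler_wpM2r// !ger0_norm// (le_trans k0).
Qed.

End weak_duality.

(** * The abstract minimax theorem *)

Section minimax.
Context {R : realType} (T : ptopologicalType) (T2 : hausdorff_space T).
Hypothesis Tsep : compacts_separated T.
Variables (X : set T) (N : T -> R).
Hypothesis N0 : forall x, X x -> 0 <= N x.
Hypothesis Kc : forall r, compact (sublevel X N r).
Local Notation subq := (subq X N).
Variables (e F : T -> R) (ce : continuous e) (E0 : R).
Hypothesis eE : forall x, X x -> 0 <= e x <= E0.
Hypothesis sF : subq F.
Local Notation bf := (bf X N e F).
Local Notation ell := (ellN N F).
Variables (I : Type) (g : I -> T -> R).
Hypothesis sg : forall i, subq (g i).
Hypothesis g_lin : forall i j (c : R), exists l, forall x, X x -> g l x = g i x + c * g j x.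
Hypothesis Ine : exists i : I, True.
Variable phi : T -> R.
Hypothesis sphi : subq phi.

(* Here [k] stands for the derivative of the function psi of the energy inequality. *)
Definition admissible (mu : probability (borelT T) R) : Prop :=
  [/\ mu X = 1%E, mu.-integrable (X : set (borelT T)) (EFin \o N),
    forall (k : R -> R) M, continuous k -> (forall s, 0 <= k s <= M) ->
      \int[mu]_(x in (X : set (borelT T))) (k (e x) * ell x) <= 0 &
    forall i, \int[mu]_(x in (X : set (borelT T))) g i x = 0].

Lemma weak_duality mu i q : admissible mu ->
  (forall b, bf b -> q <= bval (fun x => phi x + g i x) b) -> q <= \int[mu]_(x in (X : set (borelT T))) phi x.
Proof.
move=> [muX iN hk hg] Gq; have mX := coercive_measurable T2 Kc.
apply/ler_addgt0Pl => eta eta0.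
have sG : subq (fun x => phi x + g i x) by exact: subqD.
have [k [M [ck kM hkM]]] := multiplier T2 N0 Kc ce eE sF sG Gq eta0.
have ip := subq_integrable T2 N0 Kc iN sphi; have ig := subq_integrable T2 N0 Kc iN (sg i).
have il := ell_integrable T2 N0 Kc ce sF iN ck kM.
have iq : mu.-integrable (X : set (borelT T)) (EFin \o (fun=> q - eta)) by exact: finite_measure_integrable_cst.
have iG := integrableD mX ip ig.
have := le_Rintegral mX iq (integrableD mX iG il) hkM.
rewrite Rintegral_cst// (RintegralD mX iG il) (RintegralD mX ip ig) hg.
have -> : fine (mu X) = 1 by rewrite muX.
have := hk k M ck kM; lra.
Qed.

(** On an empty [bf] the hypothesis of weak duality would hold for every [q], even above the
    integral of [phi]. *)
Lemma bf_nonempty mu : admissible mu -> bf !=set0.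
Proof.
move=> am; apply: contrapT => ne; have [i _] := Ine.
have := @weak_duality mu i (\int[mu]_(x in (X : set (borelT T))) phi x + 1) am.
rewrite gerDl ler10 => H; suff : false by []; apply: H => b bb.
by exfalso; apply: ne; exists b.
Qed.

Lemma dual_measure lam : (forall i, exists2 b, bf b & bval (fun x => phi x + g i x) b <= lam) ->
  exists2 mu, admissible mu & \int[mu]_(x in (X : set (borelT T))) phi x <= lam.
Proof.
move=> lamP.
have [||||E [Elin Ebf Eg Ephi]] := @dual_functional R T X N N0 e F sF (range g) phi lam _ _ _ sphi.
- by move=> _ [i _ <-].
- by have [i _] := Ine; exists (g i); exists i.
- move=> _ _ c [i _ <-] [j _ <-]; have [l hl] := g_lin i j c.
  by exists (g l) => //; exists l.
- by move=> _ [i _ <-].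
have sc := subquad_cst N0.
have E1 : E (fun=> 1) = 1.
  have h1 : E (fun=> 1) <= 1 by apply: Ebf => // b _; rewrite bval_cst.
  have E00 : E (fun=> 0) = 0.
    have := Elin 1 _ _ (sc 0) (sc 0).
    have -> : (fun x : T => 1 * 0 + 0) = (fun=> 0) :> (T -> R) by apply/funext => x; ring.
    lra.
  have h2 : E (fun=> -1 * 1 + 0) <= -1 by apply: Ebf => // b _; rewrite bval_cst; lra.
  have := Elin (-1) _ _ (sc 1) (sc 0); rewrite E00; lra.
have Emono h k : subquad X N h -> subquad X N k -> (forall x, X x -> h x <= k x) -> E h <= E k.
  move=> sh sk hk; have s1 := subquad_lin (-1) sk sh.
  have : E (fun x => -1 * k x + h x) <= 0.
    apply: Ebf => // b bb; rewrite -(bval_cst 0 b); apply: (bval_le (bf_br bb)) => x Xx.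
    by have := hk x Xx; lra.
  rewrite Elin//; lra.
have [mu muL] := func_measure T2 Tsep N0 Kc Elin Emono E1.
have subI := subq_integral T2 N0 Kc Elin Emono E1 muL.
exists mu; last by have [_ ->] := subI _ sphi.
split.
- exact: (func_measureX T2 N0 Kc Elin Emono E1 muL).
- have [||] := @weighted_integral R T T2 X N N0 Kc E Elin Emono E1 mu muL (fun=> 1) (fun=> 0) 1 _ _ (subq_cst N0 0).
  + by move=> r; apply/within_cvgP => x _; exact: cvg_cst.
  + by move=> x _; rewrite ler01 lexx.
  + by under eq_fun do rewrite mul1r addr0.
- move=> k M ck kM.
  have cke r : {within sublevel X N r, continuous (k \o e)}.
    by apply: continuous_subspaceT => x; apply: continuous_comp; [exact: ce|exact: ck].
  have sk : subq (fun x => -1 * (k (e x) * F x)).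
    apply: subqZ; apply: (@subq_bound R T X N (k \o e) F M) => // x _ /=.
    by have /andP[k0 k1] := kM (e x); rewrite ger0_norm.
  have [||_] := @weighted_integral R T T2 X N N0 Kc E Elin Emono E1 mu muL (k \o e) _ M _ _ sk.
  - exact: cke.
  - by move=> x _; exact: kM.
  have -> : (fun x => (k \o e) x * N x + -1 * (k (e x) * F x)) = (fun x => k (e x) * ell x).
    by apply/funext => x; rewrite /= /ellN; ring.
  move=> /le_trans; apply; apply: Ebf.
    have [C hC] := subq_subquad N0 sF.
    exists (`|M| * (1 + `|C|)) => x Xx; have Nx := N0 Xx; have /andP[k0 k1] := kM (e x).
    rewrite normrM -mulrA ger0_norm//; apply: ler_pM => //.
      by rewrite (le_trans k1)// ler_norm.
    rewrite /ellN (le_trans (ler_normB _ _))// ger0_norm// mulrDl mul1r lerD ?lerDr//.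
    by rewrite (le_trans (hC x Xx))// ler_wpM2r ?ler_norm// addr_ge0.
  (* The two atoms have the same value of [e], so [k] factors out of the average of [ell]. *)
  move=> [[t x] y] [[Xx lx -> ->]|[_ _ exy _ tl]] /=.
    rewrite subrr mul0r addr0 mul1r; have /andP[k0 _] := kM (e x).
    by rewrite mulr_ge0_le0.
  by rewrite -exy mulrCA [(1 - t) * _]mulrCA -mulrDr tl mulr0.
- by move=> i; have [_ ->] := subI _ (sg i); apply: Eg; exists i.
Qed.

Theorem minimax mu0 : admissible mu0 -> exists (p : R) (q : I -> R),
  [/\ minimum [set \int[mu]_(x in (X : set (borelT T))) phi x | mu in admissible] p,
      forall i, minimum [set bval (fun x => phi x + g i x) b | b in bf] (q i),
      has_sup (range q) & p = sup (range q)].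
Proof.
move=> am0; have bne := bf_nonempty am0.
have ex i : exists qi, minimum [set bval (fun x => phi x + g i x) b | b in bf] qi.
  have sG : subq (fun x => phi x + g i x) by exact: subqD.
  have se : subq e.
    split=> [r|d d0]; first exact: continuous_sublevel.
    exists `|E0| => // x Xx; have /andP[e0 e1] := eE Xx.
    by rewrite ger0_norm// ler_wpDl ?mulr_ge0 ?N0 ?(ltW d0)// (le_trans e1)// ler_norm.
  have [b bb hb] := bf_min T2 N0 Kc se sF sG bne.
  by exists (bval (fun x => phi x + g i x) b); split; [exists b|move=> _ [b' bb' <-]; exact: hb].
pose q i := projT1 (cid (ex i)).
have qP i : minimum [set bval (fun x => phi x + g i x) b | b in bf] (q i) by exact: projT2 (cid (ex i)).
have qle mu i : admissible mu -> q i <= \int[mu]_(x in (X : set (borelT T))) phi x.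
  by move=> am; apply: (weak_duality (i := i)) => // b bb; have [_] := qP i; apply; exists b.
have hs : has_sup (range q).
  have [i _] := Ine; split; first by exists (q i); exists i.
  by exists (\int[mu0]_(x in (X : set (borelT T))) phi x) => _ [j _ <-]; exact: qle.
have supq i : q i <= sup (range q) by apply: sup_upper_bound => //; exists i.
have [|mu am hmu] := @dual_measure (sup (range q)).
  by move=> i; have [[b bb hb] _] := qP i; exists b => //; rewrite hb.
exists (sup (range q)), q; split=> //; split.
  exists mu => //; apply/eqP; rewrite eq_le hmu/=; apply: sup_le_ub; first by case: hs.
  by move=> _ [i _ <-]; exact: qle.
move=> _ [nu an <-]; apply: sup_le_ub; first by case: hs.
by move=> _ [i _ <-]; exact: qle.
Qed.

End minimax.

(** * The spaces H and V of a bounded domain *)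

Section metrized.
Context {R : realType} (W : normedModType R).
Variables (T : topologicalType) (val : T -> W).
Hypothesis nbhs_val : forall (x : T) (A : set T),
  nbhs x A <-> exists2 e : R, 0 < e & forall y, `|val y - val x| < e -> A y.
Hypothesis val_inj : injective val.

Lemma val_ultra_cvg (I : Type) (U : set_system I) (UP : ProperFilter U) (x_ : I -> T) x :
  x_ i @[i --> U] --> x -> val (x_ i) @[i --> U] --> val x.
Proof.
move=> h; apply/cvgrPdist_lt => e e0.
have : nbhs x [set y | `|val y - val x| < e] by apply/nbhs_val; exists e.
by move=> /h hh; apply: (@filterS _ U _ _ _ _ hh) => n /=; rewrite distrC.
Qed.

Lemma val_hausdorff : hausdorff_space T.
Proof.
move=> x y cxy; apply: val_inj; apply/eqP; rewrite -subr_eq0 -normr_eq0 eq_le normr_ge0 andbT.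
apply/ler_addgt0Pl => e e0; rewrite addr0; have e20 : 0 < e / 2 by rewrite divr_gt0.
have h1 : nbhs x [set z | `|val z - val x| < e / 2] by apply/nbhs_val; exists (e / 2).
have h2 : nbhs y [set z | `|val z - val y| < e / 2] by apply/nbhs_val; exists (e / 2).
have [z [/= zx zy]] := cxy _ _ h1 h2.
by apply: ltW; apply: (@norm_sub_lt R W e (val x) (val z) (val y)) => //; rewrite distrC.
Qed.

Lemma val_compacts_separated : compacts_separated T.
Proof.
move=> K1 K2 c1 c2 K12.
have [d d0 dP] : exists2 d : R, 0 < d & forall x y, K1 x -> K2 y -> d <= `|val x - val y|.
  apply: contrapT => nd.
  have bad n : exists p : T * T, [/\ K1 p.1, K2 p.2 & `|val p.1 - val p.2| < n.+1%:R^-1].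
    apply: contrapT => h; apply: nd; exists n.+1%:R^-1 => // x y Kx Ky.
    by rewrite leNgt; apply/negP => lt; apply: h; exists (x, y).
  pose p_ n := projT1 (cid (bad n)).
  have pP n : [/\ K1 (p_ n).1, K2 (p_ n).2 & `|val (p_ n).1 - val (p_ n).2| < n.+1%:R^-1].
    exact: projT2 (cid (bad n)).
  have [U [UU oU]] := nat_ultra; have UP := @ultra_proper _ U UU.
  have UT (P : nat -> Prop) : (forall n, P n) -> U [set n | P n].
    by move=> h; apply: filterS (@filterT _ U _) => n _; exact: h.
  have [|x Kx cx] := @ultra_compact_cvg nat T U (fun n => (p_ n).1) K1 UU c1.
    by apply: UT => n; have [] := pP n.
  have [|y Ky cy] := @ultra_compact_cvg nat T U (fun n => (p_ n).2) K2 UU c2.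
    by apply: UT => n; have [] := pP n.
  suff xy : x = y by have : (K1 `&` K2) x by [split=> //; rewrite xy]; rewrite K12.
  have vx := val_ultra_cvg UP cx; have vy := val_ultra_cvg UP cy.
  have cn : `|val (p_ n).1 - val (p_ n).2| @[n --> U] --> `|val x - val y|.
    by apply: cvg_norm; apply: cvgB.
  apply: val_inj; apply/eqP; rewrite -subr_eq0 -normr_eq0 eq_le normr_ge0 andbT.
  apply: (@le_cvg_filter R _ U UP _ (fun n => n.+1%:R^-1) _ 0 cn).
    by apply: (cvg_trans _ (@cvg_harmonic R)); apply: cvg_app.
  by apply: UT => n; have [_ _ /ltW] := pP n.
have op (K : set T) : open [set z | exists2 x, K x & `|val z - val x| < d / 2].
  rewrite openE => z [x Kx zx]; rewrite /interior; apply/nbhs_val.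
  exists (d / 2 - `|val z - val x|); first by rewrite subr_gt0.
  move=> y yz; exists x => //; apply: (@le_lt_trans _ _ (`|val y - val z| + `|val z - val x|)).
    exact: ler_distD.
  lra.
exists [set z | exists2 x, K1 x & `|val z - val x| < d / 2], [set z | exists2 x, K2 x & `|val z - val x| < d / 2].
have d20 : 0 < d / 2 by rewrite divr_gt0.
split=> //.
- by move=> x Kx; exists x => //; rewrite subrr normr0.
- by move=> x Kx; exists x => //; rewrite subrr normr0.
- apply/seteqP; split=> // z [[x Kx zx] [y Ky zy]].
  have := dP x y Kx Ky; rewrite leNgt => /negP; apply.
  by apply: (@norm_sub_lt R W d (val x) (val z) (val y)) => //; rewrite distrC.
Qed.

End metrized.

Section concrete.
Context {R : realType}.
Variable Omega : bounded_domain R.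
Local Notation L2s := (L2 (leb_dom Omega)).
Local Notation W := (L2vec Omega).
Local Notation HH := (Hspace Omega).

(** Transparent, so that its projections reduce to the concrete spaces. *)
Definition dirichlet_space : energy_space R.
Proof.
refine (@EnergySpace R W (l2fam ('I_3 * 'I_3)%type L2s) _ _ (@Vspace R Omega) (@grad R Omega)
  (@L2inner_is_inner R Omega 'I_3) (@L2inner_is_inner R Omega ('I_3 * 'I_3)%type)
  _ _ (V0 Omega) (@V_lin R Omega) (@grad_linV R Omega) (@V_closed R Omega) _ _).
- by move=> u_; exact: l2fam_L2_complete.
- by move=> u_; exact: l2fam_L2_complete.
- move=> u e Vu e0; have [s ss hs] := Vu.2 e e0; exists s; split; [exact: solenoidal_V|exact: hs|].
  have [C C0 hC] := grad_test_bound ss; exists C; [exact: C0|move=> v Vv; apply: hC; exact: VspaceH10].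
- move=> e e0; have [K [w hw]] := @friedrichs_vec R Omega e e0.
  by exists K, w => u Vu; apply: hw; exact: VspaceH10.
Defined.

Lemma H_nbhs (x : HH) (A : set HH) :
  nbhs x A <-> exists2 e : R, 0 < e & forall y, `|H_val y - H_val x| < e -> A y.
Proof.
split=> [|[e e0 eA]].
  rewrite /nbhs/= => -[_ [[Q oQ <-] Qx] QA].
  have /nbhs_ballP[e /= e0 eQ] : nbhs (H_val x) Q by apply: open_nbhs_nbhs; split.
  by exists e => // y yx; apply: QA; apply: eQ; rewrite -ball_normE/= distrC.
rewrite /nbhs/=; exists (@H_val R Omega @^-1` ball (H_val x) e).
split; [exists (ball (H_val x) e) => //; exact: ball_open|exact: ballxx|].
by move=> y; rewrite /= -ball_normE/= distrC => /eA.
Qed.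

Lemma H_val_inj : injective (@H_val R Omega).
Proof. by move=> x y; exact: val_inj. Qed.

Lemma H_closed (w : W) : (forall e : R, 0 < e -> exists u : HH, `|w - H_val u| < e) -> exists u : HH, H_val u = w.
Proof.
move=> h; have cw : closure (@solenoidal_tests R Omega) w.
  rewrite closureE/=; move=> C [cC sC]; apply: cC => U /nbhs_ballP[e /= e0 eU].
  have [u uw] := h e e0.
  have /set_mem uC : H_val u \in closure (@solenoidal_tests R Omega) by exact: valP.
  have [|v [sv uv]] := uC (ball w e).
    by apply: open_nbhs_nbhs; split; [exact: ball_open|rewrite -ball_normE].
  by exists v; split; [exact: sC|exact: eU].
by exists (exist _ w (mem_set cw)).
Qed.

Lemma H_hausdorff : hausdorff_space HH.
Proof. exact: (val_hausdorff H_nbhs H_val_inj). Qed.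

Lemma H_separated : compacts_separated HH.
Proof. exact: (val_compacts_separated H_nbhs H_val_inj). Qed.

Lemma H_norm_continuous : continuous (fun u : HH => `|H_val u| ^+ 2).
Proof.
move=> x; have FF : Filter (nbhs (x : HH)) by exact: nbhs_filter.
have cv : H_val y @[y --> (x : HH)] --> H_val x.
  apply/cvgrPdist_lt => e e0; apply/H_nbhs; exists e => // y /=.
  by rewrite distrC.
by apply: cvg_sqr; exact: cvg_norm.
Qed.

Lemma weakH_continuous (w : HH) : continuous (fun u : weakH Omega => L2inner (H_val u) (H_val w)).
Proof.
pose F (u : HH) : prod_topology (fun _ : HH => R) := fun w => L2inner (H_val u) (H_val w).
have c1 : continuous (F : initial_topology F -> prod_topology (fun _ : HH => R)) by exact: initial_continuous.
have c2 := @proj_continuous HH (fun=> R) w.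
by move=> u; exact: (cvg_comp F (proj w) (c1 u) (c2 (F u))).
Qed.

Local Notation ipP := (@L2inner_is_inner R Omega 'I_3).

Lemma H_lin (a : R) (u v : HH) : exists w : HH, H_val w = a *: H_val u + H_val v.
Proof.
have appr (x : HH) (e : R) : 0 < e -> exists2 s, solenoidal_tests s & `|H_val x - s| < e.
  move=> e0; have /set_mem xC : H_val x \in closure (@solenoidal_tests R Omega) by exact: valP.
  have [|s [ss xs]] := xC (ball (H_val x) e); first exact: nbhsx_ballx.
  by exists s => //; move: xs; rewrite -ball_normE.
apply: H_closed => e e0.
have a1 : 0 < `|a| + 1 by rewrite ltr_wpDl.
have [s ss hs] := appr u (e / 2 / (`|a| + 1)) (divr_gt0 (divr_gt0 e0 (ltr0Sn _ _)) a1).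
have [t st ht] := appr v (e / 2) (divr_gt0 e0 (ltr0Sn _ _)).
have cs : closure (@solenoidal_tests R Omega) (a *: s + t).
  by apply: subset_closure; exact: solenoidal_lin.
exists (exist _ (a *: s + t) (mem_set cs)).
rewrite -[H_val (exist _ _ _)]/(a *: s + t) lin_subE.
exact: norm_lin_lt.
Qed.

Lemma H_zero : exists z : HH, H_val z = 0.
Proof.
apply: H_closed => e e0; exists point; rewrite -[H_val point]/(0 : W) subrr normr0.
exact: e0.
Qed.

Lemma H_limit (u_ : nat -> HH) (w : W) : H_val (u_ n) @[n --> \oo] --> w -> exists u : HH, H_val u = w.
Proof.
move=> cu; apply: H_closed => e e0; move/cvgrPdist_lt : cu => /(_ e e0)[n _ h].
by exists (u_ n); apply: h => /=.
Qed.

Section weakly_compact.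
Variables (B : set HH).
Hypothesis Bc : @compact (weakH Omega) B.

(** Uniform boundedness with test vectors in H alone, since the weak topology of H controls no
    others; this is why [weakly_bounded_bounded] is stated relative to a closed subspace. *)
Lemma weakly_compact_bounded : exists M : R, forall u, B u -> `|H_val u| <= M.
Proof.
have Wc : seq_complete W by move=> u_; exact: l2fam_L2_complete.
have [|||||M hM] := @weakly_bounded_bounded R W (fun u v => L2inner u v) ipP Wc
    (fun w => exists u : HH, H_val u = w) [set H_val u | u in B].
- exact: H_zero.
- by move=> a _ _ [u <-] [v <-]; exact: H_lin.
- move=> u_ u hu cu; apply: (@H_limit (fun n => projT1 (cid (hu n)))).
  have -> : (fun n => H_val (projT1 (cid (hu n)))) = u_ by apply/funext => n; exact: (projT2 (cid (hu n))).
  exact: cu.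
- by move=> _ [u _ <-]; exists u.
- move=> _ [w <-].
  have cI : compact ((fun u : weakH Omega => L2inner (H_val u) (H_val w)) @` B).
    apply: (@continuous_compact (weakH Omega) R _ B _ Bc).
    exact: (@continuous_subspaceT (weakH Omega) R B _ (@weakH_continuous w)).
  have [M [_ hM]] := compact_bounded cI; exists (M + 1) => _ [u Bu <-].
  rewrite (ipC ipP); apply: (hM (M + 1)); first by rewrite ltrDl.
  by exists u.
- by exists M => u Bu; apply: hM; exists u.
Qed.

(** The strong limit [u] and a weak limit [b] in [B] have the same inner products with H, and
    [u - b] itself lies in H. *)
Lemma weakly_compact_closed (u_ : nat -> HH) (u : HH) : (forall n, B (u_ n)) ->
  H_val (u_ n) @[n --> \oo] --> H_val u -> B u.
Proof.
move=> Bu cu.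
have [U [UU oU]] := nat_ultra; have UP := @ultra_proper _ U UU.
have [|b Bb cb] := @ultra_compact_cvg nat (weakH Omega) U u_ B UU Bc.
  by apply: filterS (@filterT _ U _) => n _; exact: Bu.
suff -> : u = b by [].
have key (w : HH) : L2inner (H_val u) (H_val w) = L2inner (H_val b) (H_val w).
  have c1 : L2inner (H_val (u_ n)) (H_val w) @[n --> U] --> L2inner (H_val b) (H_val w).
    by apply: cvg_trans (@weakH_continuous w b); exact: (cvg_app (fun u => L2inner (H_val u) (H_val w)) cb).
  have c2 : L2inner (H_val (u_ n)) (H_val w) @[n --> U] --> L2inner (H_val u) (H_val w).
    apply/cvgrPdist_lt => e e0; have w0 : 0 < `|H_val w| + 1 by rewrite ltr_wpDl.
    have d0 := divr_gt0 e0 w0.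
    move/cvgrPdist_lt : cu => /(_ _ d0)/oU; apply: filterS => n hn.
    rewrite -(ipBl ipP); apply: (le_lt_trans (ip_le ipP _ _)).
    apply: (@le_lt_trans _ _ (`|H_val u - H_val (u_ n)| * (`|H_val w| + 1))).
      by rewrite ler_wpM2l// lerDl.
    by rewrite -ltr_pdivlMr.
  exact: (cvg_unique _ c2 c1).
have [w hw] := H_lin (-1) b u.
apply: H_val_inj; apply/eqP; rewrite -subr_eq0 -normr_eq0 -sqrf_eq0 -(ip_norm ipP) (ipBl ipP).
have e1 : H_val u - H_val b = H_val w by rewrite hw scaleN1r addrC.
by rewrite e1 key subrr.
Qed.

End weakly_compact.

End concrete.

(** Beyond the threshold [K] one has [t^delta >= C1 / e], so the quadratic term dominates; below it
    the left-hand side is bounded. *)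
Lemma powR_subquadratic (R : realType) (C1 delta e : R) : 0 <= C1 -> 0 < delta <= 2 -> 0 < e ->
  exists2 C : R, 0 <= C & forall t, 0 <= t -> C1 * t `^ (2 - delta) <= e * t ^+ 2 + C.
Proof.
move=> C10 /andP[d0 d2] e0; have dd : 0 <= 2 - delta by rewrite subr_ge0.
pose L := C1 / e + 1; have L0 : 0 < L by rewrite ltr_wpDl// divr_ge0// ltW.
pose K := L `^ delta^-1; have K0 : 0 <= K by exact: powR_ge0.
exists (C1 * K `^ (2 - delta)) => [|t t0]; first by rewrite mulr_ge0// powR_ge0.
have [tK|Kt] := leP t K.
  apply: (@le_trans _ _ (C1 * K `^ (2 - delta))); last by rewrite lerDr mulr_ge0 ?sqr_ge0// ltW.
  by rewrite ler_wpM2l// ge0_ler_powR ?nnegrE.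
apply: (@le_trans _ _ (e * t ^+ 2)); last by rewrite lerDl mulr_ge0// powR_ge0.
have t1 : 0 < t by exact: le_lt_trans Kt.
have KL : L <= t `^ delta.
  have -> : L = K `^ delta by rewrite /K -powRrM mulVf ?powRr1 ?(ltW L0)// gt_eqF.
  by rewrite ge0_ler_powR ?nnegrE// ltW.
have tE : t ^+ 2 = t `^ (2 - delta) * t `^ delta.
  by rewrite -powRD ?subrK ?powR_mulrn//; apply/implyP => _; rewrite gt_eqF.
rewrite tE mulrCA mulrC; apply: ler_wpM2l; first exact: powR_ge0.
apply: (@le_trans _ _ (e * L)); last by rewrite ler_wpM2l// ltW.
by rewrite /L mulrDr mulr1 mulrCA mulfV ?gt_eqF// mulr1 lerDl ltW.
Qed.

(** The hypothesis bounds [L * t] by a multiple of [t^(7/4)]. Beyond [K] one has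
    [C^4 * M <= e^4 * t], hence [(C L)^4 <= (e t)^4]. *)
Lemma quartic_subquadratic (R : realType) (C M e : R) : 0 <= C -> 0 <= M -> 0 < e ->
  exists2 C' : R, 0 <= C' & forall t L, 0 <= t -> 0 <= L -> L ^+ 4 <= M * t ^+ 3 ->
    C * L * t <= e * t ^+ 2 + C'.
Proof.
move=> C0 M0 e0; have e4 : 0 < e ^+ 4 by rewrite exprn_gt0.
pose K := C ^+ 4 * M / e ^+ 4; have K0 : 0 <= K by rewrite !mulr_ge0 ?exprn_ge0// invr_ge0 ltW.
have D0 : 0 <= 1 + M * K ^+ 3 by rewrite addr_ge0// mulr_ge0// exprn_ge0.
have D1 : 0 <= C * (1 + M * K ^+ 3) * K := mulr_ge0 (mulr_ge0 C0 D0) K0.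
exists (C * (1 + M * K ^+ 3) * K) => [//|t L t0 L0 hL].
have [tK|/ltW Kt] := leP t K.
  apply: (@le_trans _ _ (C * (1 + M * K ^+ 3) * K)); last by rewrite lerDr mulr_ge0 ?sqr_ge0// ltW.
  have L1 : L <= 1 + M * K ^+ 3.
    have h1 : L ^+ 4 <= M * K ^+ 3.
      by apply: (le_trans hL); rewrite ler_wpM2l// lerXn2r.
    have [l1|l1] := leP L 1; first by rewrite (le_trans l1)// lerDl mulr_ge0// exprn_ge0.
    apply: (@le_trans _ _ (L ^+ 4)); first by rewrite ler_eXnr// ltW.
    by rewrite (le_trans h1)// lerDr.
  apply: ler_pM => //; [by rewrite mulr_ge0|by rewrite ler_wpM2l].
apply: (@le_trans _ _ (e * t ^+ 2)); last by rewrite lerDl.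
rewrite expr2 mulrA ler_wpM2r//.
have et0 : 0 <= e * t by rewrite mulr_ge0// ltW.
rewrite -(@ler_pXn2r _ 4)// ?nnegrE ?mulr_ge0// !exprMn.
apply: (le_trans (ler_wpM2l (exprn_ge0 4 C0) hL)).
have h : C ^+ 4 * M <= e ^+ 4 * t by rewrite [e ^+ 4 * t]mulrC -ler_pdivrMr.
by rewrite mulrA [t ^+ 4]exprS [leRHS]mulrA ler_wpM2r ?exprn_ge0.
Qed.

Lemma root4_small (R : realType) (a g s e L : R) : 0 <= a -> 0 <= g -> g <= s -> 0 < e -> 0 <= L ->
  L ^+ 4 = 8 * a * g ^+ 3 -> a < e ^+ 4 / (8 * s ^+ 3 + 1) -> L < e.
Proof.
move=> a0 g0 gs e0 L0 LE ae; have s0 : 0 <= s by exact: le_trans gs.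
have d0 : 0 < 8 * s ^+ 3 + 1 by rewrite ltr_wpDl// mulr_ge0// exprn_ge0.
rewrite -(@ltr_pXn2r _ 4)// ?nnegrE ?(ltW e0)// LE.
apply: (@le_lt_trans _ _ (a * (8 * s ^+ 3 + 1))); last by rewrite -ltr_pdivlMr.
rewrite -mulrA mulrCA ler_wpM2l// (@le_trans _ _ (8 * s ^+ 3))//; last by rewrite lerDl.
by rewrite ler_wpM2l// lerXn2r.
Qed.

Section concrete.
Context {R : realType}.
Variable Omega : bounded_domain R.
Local Notation W := (L2vec Omega).
Local Notation HH := (Hspace Omega).
Local Notation DS := (dirichlet_space Omega).
Variables (nu : R) (nu_gt0 : 0 < nu).
Variables (B : set HH) (Bc : @compact (weakH Omega) B).
Local Notation X := (VinH Omega `&` B).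
Definition dissipation (u : HH) : R := nu * `|grad (H_val u)| ^+ 2.
Local Notation N := dissipation.

Lemma dissipation_ge0 u : 0 <= N u.
Proof. by rewrite mulr_ge0 ?sqr_ge0// ltW. Qed.

Lemma dissipation_le r u : 0 <= r -> (N u <= r) = (`|grad (H_val u)| <= Num.sqrt (r / nu)).
Proof.
move=> r0; rewrite /N mulrC -ler_pdivlMr//.
have h : 0 <= r / nu by rewrite divr_ge0// ltW.
by rewrite -{1}(sqr_sqrtr h) ler_sqr ?nnegrE ?sqrtr_ge0.
Qed.

Lemma sublevel_compactH r : compact (sublevel X N r).
Proof.
have [M hM] := weakly_compact_bounded Bc.
have r0 u : sublevel X N r u -> 0 <= r by move=> [_]; exact: le_trans (dissipation_ge0 u).
apply: (@es_compact R DS HH (@H_val R Omega) (@H_nbhs R Omega) _ (Num.sqrt (r / nu)) M).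
  move=> u su; have [[Vu Bu] Nu] := su; split; [exact: Vu| |exact: hM].
  by rewrite -dissipation_le// (r0 u).
move=> u_ w su cu; have [u uw] := H_limit cu; rewrite -uw in cu *.
have rr := r0 _ (su 0%N).
have [Vu gu] : Vspace (H_val u) /\ `|grad (H_val u)| <= Num.sqrt (r / nu).
  apply: (@es_weak_closed R DS) => e e0; move/cvgrPdist_lt : cu => /(_ e e0)[n _ /(_ n (leqnn n)) hn].
  exists (H_val (u_ n)); have [[Vn Bn] Nn] := su n; split; [exact: Vn| |exact: ltW].
  by rewrite -dissipation_le.
exists u => //; split; last by rewrite dissipation_le.
split; first exact: Vu.
by apply: (weakly_compact_closed Bc (u_ := u_)) => // n; have [[]] := su n.
Qed.

(* Sequences that are bounded in [V] and converge in [H]. *)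
Definition seqcts (h : HH -> R) : Prop := forall (u_ : nat -> HH) u r, (forall n, X (u_ n)) ->
  (forall n, `|grad (H_val (u_ n))| <= r) -> X u -> H_val (u_ n) @[n --> \oo] --> H_val u ->
  h (u_ n) @[n --> \oo] --> h u.

Lemma seqcts_subq h : seqcts h -> (forall e : R, 0 < e -> exists2 C : R, 0 <= C &
    forall u, X u -> `|h u| <= e * `|grad (H_val u)| ^+ 2 + C) -> subq X N h.
Proof.
move=> ch bh; split=> [r|e e0].
  apply: (@within_seq_continuous R DS HH (@H_val R Omega) (@H_nbhs R Omega)).
  move=> u_ u su [Xu Nu] cu.
  have r0 : 0 <= r by exact: le_trans (dissipation_ge0 u) Nu.
  apply: (ch u_ u (Num.sqrt (r / nu)) _ _ Xu cu) => n; first exact: (su n).1.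
  by rewrite -(dissipation_le _ r0); exact: (su n).2.
have en : 0 < e * nu by rewrite mulr_gt0.
by have [C C0 hC] := bh _ en; exists C => // u Xu; rewrite /N mulrA; exact: hC.
Qed.

Lemma Vdual_seqcts l : Vdual l -> seqcts (fun u => l (H_val u)).
Proof.
move=> dl u_ u r Xn gn [Vu _] cu; have Vn n : Vspace (H_val (u_ n)) := (Xn n).1.
exact: (@es_dual_cvg R DS l (fun n => H_val (u_ n)) (H_val u) r dl Vn gn Vu cu).
Qed.

Lemma linear_growth (h : HH -> R) (C : R) : 0 <= C -> (forall u, X u -> `|h u| <= C * `|grad (H_val u)|) ->
  forall e : R, 0 < e -> exists2 C : R, 0 <= C & forall u, X u -> `|h u| <= e * `|grad (H_val u)| ^+ 2 + C.
Proof.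
move=> C0 hC e e0; exists (C ^+ 2 / e) => [|u Xu]; first by rewrite divr_ge0 ?sqr_ge0// ltW.
apply: (le_trans (hC u Xu)); move: `|grad _| => t.
have ee : e != 0 by rewrite gt_eqF.
have -> : e * t ^+ 2 + C ^+ 2 / e = C * t + ((e * t - C / 2) ^+ 2 + 3 / 4 * C ^+ 2) / e by field.
by rewrite lerDl divr_ge0 ?(ltW e0)// addr_ge0 ?sqr_ge0// mulr_ge0 ?sqr_ge0.
Qed.

Lemma Vdual_subq l : Vdual l -> subq X N (fun u => l (H_val u)).
Proof.
move=> dl; apply: seqcts_subq; first exact: Vdual_seqcts.
have [_ [C hC]] := dl; apply: (@linear_growth _ `|C|) => // u [Vu _].
by apply: (le_trans (hC _ Vu)); rewrite ler_wpM2r// ler_norm.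
Qed.

Lemma weakV_subq phi : weakV_seq_continuous X phi ->
  (exists C0 C1 delta : R, [/\ 0 <= C0, 0 <= C1, 0 < delta <= 2 &
     forall u : HH, X u -> `|phi u| <= C0 + C1 * `|grad (H_val u)| `^ (2 - delta)]) ->
  subq X N phi.
Proof.
move=> cphi [C0 [C1 [delta [C00 C10 dd hphi]]]]; apply: seqcts_subq.
  by move=> u_ u r Xn gn Xu cu; apply: cphi => // l dl; exact: (@Vdual_seqcts l dl u_ u r).
move=> e e0; have [C C'0 hC] := powR_subquadratic C10 dd e0.
exists (C + C0) => [|u Xu]; first exact: addr_ge0.
by apply: (le_trans (hphi u Xu)); rewrite addrC addrA lerD2r; exact: hC.
Qed.

Lemma grad_Vdual w : Vspace w -> Vdual (fun u : W => L2inner (grad u) (grad w)).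
Proof.
have ipG := @L2inner_is_inner R Omega ('I_3 * 'I_3)%type.
move=> Vw; split=> [a u v Vu Vv|].
  by rewrite (grad_linV a Vu Vv) (ipDl ipG) (ipZl ipG).
by exists `|grad w| => u Vu; rewrite mulrC; exact: (ip_le ipG).
Qed.

Lemma L4bound4 (u : W) : L4bound u ^+ 4 = 8 * `|u| * `|grad u| ^+ 3.
Proof.
have h : 0 <= 8 * `|u| * `|grad u| ^+ 3 by rewrite !mulr_ge0// exprn_ge0.
by rewrite /L4bound (exprM _ 2 2) !sqr_sqrtr// sqrtr_ge0.
Qed.

(** For continuity, the first argument is split as [(u_ n - u) + u]. The first part tends to 0
    because [u_ n - u] does so in L^4, by interpolation between L^2 and the bounded gradients; the
    second is a fixed element of V' applied to [u_ n]. Growth is of order 7/4 in the gradient, as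
    [B] is bounded in H. *)
Lemma convection_subq w : Vspace w -> subq X N (fun u => convection (H_val u) (H_val u) w).
Proof.
move=> Vw; have [M hM] := weakly_compact_bounded Bc; apply: seqcts_subq.
  move=> u_ u r Xn gn Xu cu.
  have Vn n : Vspace (H_val (u_ n)) := (Xn n).1.
  have Vu : Vspace (H_val u) := Xu.1.
  have Vd n : Vspace (H_val (u_ n) - H_val u) by exact: (@es_VB R DS _ _ (Vn n) Vu).
  have split n : convection (H_val (u_ n)) (H_val (u_ n)) w =
      convection (H_val (u_ n) - H_val u) (H_val (u_ n)) w + convection (H_val u) (H_val (u_ n)) w.
    have := convection_lin1 1 (H_val (u_ n)) (Vd n) Vu Vw.
    by rewrite scale1r subrK mul1r.
  have h2 : convection (H_val u) (H_val (u_ n)) w @[n --> \oo] --> convection (H_val u) (H_val u) w.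
    apply: (@Vdual_seqcts (fun v => convection (H_val u) v w) _ u_ u r) => //.
    split=> [a v v' Vv Vv'|]; first exact: convection_lin2.
    by exists (9 * (L4bound (H_val u) * L4bound w)) => v Vv; exact: convection_le.
  have h1 : convection (H_val (u_ n) - H_val u) (H_val (u_ n)) w @[n --> \oo] --> (0 : R).
    apply/cvgrPdist_lt => e e0.
    have L0 := L4bound_ge0 w; have r0 : 0 <= r := le_trans (normr_ge0 _) (gn 0%N).
    pose c := 9 * L4bound w * r + 1.
    have c0 : 0 < c by rewrite ltr_wpDl// !mulr_ge0.
    have ec0 : 0 < e / c by rewrite divr_gt0.
    pose s := r + `|grad (H_val u)|.
    have s0 : 0 <= s by rewrite addr_ge0.
    have d0 : 0 < 8 * s ^+ 3 + 1 by rewrite ltr_wpDl// mulr_ge0// exprn_ge0.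
    have q0 : 0 < (e / c) ^+ 4 / (8 * s ^+ 3 + 1) by rewrite divr_gt0// exprn_gt0.
    move/cvgrPdist_lt : cu => /(_ _ q0); apply: filterS => n hn.
    have gs : `|grad (H_val (u_ n) - H_val u)| <= s.
      have -> : grad (H_val (u_ n) - H_val u) = grad (H_val (u_ n)) - grad (H_val u).
        exact: (@es_gradB R DS _ _ (Vn n) Vu).
      by apply: (le_trans (ler_normB _ _)); rewrite lerD2r; exact: gn.
    have Lb := L4bound4 (H_val (u_ n) - H_val u).
    rewrite distrC in hn.
    have Ls := root4_small (normr_ge0 _) (normr_ge0 _) gs ec0 (L4bound_ge0 _) Lb hn.
    rewrite sub0r normrN; apply: (le_lt_trans (convection_le _ (Vd n) Vw)).
    move: Ls (L4bound_ge0 (H_val (u_ n) - H_val u)) (gn n) (normr_ge0 (grad (H_val (u_ n)))).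
    move: (L4bound (H_val (u_ n) - H_val u)) `|grad (H_val (u_ n))| => x y xe x0 yr y0.
    have h3 : 9 * (x * L4bound w) * y <= x * c.
      have -> : 9 * (x * L4bound w) * y = x * (9 * L4bound w * y) by ring.
      rewrite ler_wpM2l// (@le_trans _ _ (9 * L4bound w * r))//; last by rewrite lerDl.
      by rewrite ler_wpM2l// mulr_ge0.
    by apply: (le_lt_trans h3); rewrite -ltr_pdivlMr.
  have -> : (fun n => convection (H_val (u_ n)) (H_val (u_ n)) w) = (fun n =>
    convection (H_val (u_ n) - H_val u) (H_val (u_ n)) w + convection (H_val u) (H_val (u_ n)) w).
    by apply/funext => n; exact: split.
  have h3 := cvgD h1 h2; rewrite add0r in h3; exact: h3.
move=> e e0.
have L0 := L4bound_ge0 w.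
have [C' C'0 hC'] := @quartic_subquadratic R (9 * L4bound w) (8 * `|M|) e (mulr_ge0 (ler0n _ 9) L0) (mulr_ge0 (ler0n _ 8) (normr_ge0 M)) e0.
exists C' => // u Xu; have [Vu Bu] := Xu.
apply: (le_trans (convection_le _ Vu Vw)).
have := hC' `|grad (H_val u)| (L4bound (H_val u)) (normr_ge0 _) (L4bound_ge0 _).
rewrite L4bound4 [9 * (_ * _)]mulrCA [L4bound (H_val u) * _]mulrC => h; apply: h.
by rewrite ler_wpM2r ?exprn_ge0// ler_wpM2l// (le_trans (hM u Bu))// ler_norm.
Qed.

Variables (f : W -> R) (f_dual : Vdual f).

Lemma NSop_subq w : Vspace w -> subq X N (fun u => NSop nu f (H_val u) w).
Proof.
move=> Vw; have X0 u : X u -> 0 <= N u by move=> _; exact: dissipation_ge0.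
have s1 := subqD (subqZ (- nu) (Vdual_subq (grad_Vdual Vw))) (subqZ (-1) (convection_subq Vw)).
have := subqD (subq_cst X0 (f w)) s1.
have -> // : (fun u : HH => f w + (- nu * L2inner (grad (H_val u)) (grad w) +
    -1 * convection (H_val u) (H_val u) w)) = (fun u => NSop nu f (H_val u) w).
by apply/funext => u; rewrite /NSop mulN1r mulNr addrA.
Qed.

Lemma NSop_lin (a : R) (u w w' : W) : Vspace u -> Vspace w -> Vspace w' ->
  NSop nu f u (a *: w + w') = a * NSop nu f u w + NSop nu f u w'.
Proof.
move=> Vu Vw Vw'; rewrite /NSop f_dual.1// (convection_lin3 a u Vu Vw Vw') (grad_linV a Vw Vw').
have ipG := @L2inner_is_inner R Omega ('I_3 * 'I_3)%type.
rewrite (ipDr ipG) (ipZr ipG).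
move: (L2inner (grad u) (grad w)) (L2inner (grad u) (grad w')) (convection u u w) (convection u u w') (f w) (f w').
by move=> p p' q q' s s'; ring.
Qed.

Lemma NSop_sum (I : Type) (r : seq I) (c : I -> R) (w : I -> W) (u : W) : Vspace u ->
  (forall i, Vspace (w i)) -> Vspace (\sum_(i <- r) c i *: w i) /\
  NSop nu f u (\sum_(i <- r) c i *: w i) = \sum_(i <- r) c i * NSop nu f u (w i).
Proof.
move=> Vu Vw; elim: r => [|i r [V1 IH]].
  rewrite !big_nil; split; first exact: V0.
  have := NSop_lin 1 Vu (V0 Omega) (V0 Omega); rewrite scaler0 addr0; lra.
rewrite !big_cons (NSop_lin _ Vu (Vw i) V1) IH; split; [exact: V_lin (Vw i) V1|reflexivity].
Qed.

Definition cyl_test (Psi : Tcyl Omega) (u : HH) : R :=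
  NSop nu f (H_val u) (cyl_diff Psi (H_to_Vdual u)).

Lemma cyl_testE Psi u : X u -> cyl_test Psi u =
  \sum_j 'D_(delta_mx 0 j) (@cyl_psi _ _ Psi) (cyl_proj Psi (H_to_Vdual u)) * NSop nu f (H_val u) (@cyl_w _ _ Psi j).
Proof. by move=> [Vu _]; rewrite /cyl_test /cyl_diff; exact: (NSop_sum _ _ Vu (@cyl_w_V R Omega Psi)).2. Qed.

End concrete.

(** * Cylindrical functionals *)

Section row_calculus.
Context {R : realType}.

Lemma row_norm_le (m : nat) (x : 'rV[R]_m) (e : R) : 0 <= e -> (forall j, `|x 0 j| <= e) -> `|x| <= e.
Proof.
move=> e0 h; rewrite -[`|x|]/(mx_norm x) mx_normrE; apply: bigmax_le => // -[i j] _ /=.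
by rewrite (ord1 i); exact: h.
Qed.

Lemma row_cvg (m : nat) (I : Type) (F : set_system I) {FF : Filter F} (f : I -> 'rV[R]_m) (l : 'rV[R]_m) :
  (forall j, f i 0 j @[i --> F] --> l 0 j) -> f i @[i --> F] --> l.
Proof.
move=> h; apply/cvgrPdist_le => e e0.
have H : F (fun i => forall j, `|l 0 j - f i 0 j| <= e).
  by apply: filter_forall => j; move/cvgrPdist_le : (h j) => /(_ e e0).
by apply: (@filterS _ F _ _ _ _ H) => i hi; apply: row_norm_le => [|j]; [exact: ltW|rewrite !mxE; exact: hi].
Qed.

Definition C1 (m : nat) (psi : 'rV[R]_m -> R) : Prop := continuous psi /\
  forall j, (forall x, derivable psi x (delta_mx 0 j)) /\ continuous ('D_(delta_mx 0 j) psi).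

Lemma C1_cst m (c : R) : C1 (fun _ : 'rV[R]_m => c).
Proof.
have cc (a : R) : continuous (fun _ : 'rV[R]_m => a) by exact: cst_continuous.
split=> [|j]; first exact: cc.
split=> [x|]; first exact: derivable_cst.
rewrite (_ : 'D__ _ = fun=> 0); first exact: cc.
by apply/funext => x; rewrite derive_cst.
Qed.

Lemma C1M m (f g : 'rV[R]_m -> R) : C1 f -> C1 g -> C1 (fun x => f x * g x).
Proof.
move=> [cf df] [cg dg].
have cc : continuous (fun x => f x * g x).
  by move=> x; have FF : Filter (nbhs x) by [exact: nbhs_filter]; exact: (cvgM (cf x) (cg x)).
split=> [|j]; first exact: cc.
have [df1 df2] := df j; have [dg1 dg2] := dg j; split=> [x|].
  exact: (@derivableM _ _ f g).
have cc' : continuous (fun x => f x * 'D_(delta_mx 0 j) g x + g x * 'D_(delta_mx 0 j) f x).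
  move=> x; have FF : Filter (nbhs x) by exact: nbhs_filter.
  exact: (cvgD (cvgM (cf x) (dg2 x)) (cvgM (cg x) (df2 x))).
rewrite (_ : 'D__ _ = fun x => f x * 'D_(delta_mx 0 j) g x + g x * 'D_(delta_mx 0 j) f x); first exact: cc'.
by apply/funext => x; exact: (@deriveM _ _ f g).
Qed.

Lemma C1D m (f g : 'rV[R]_m -> R) : C1 f -> C1 g -> C1 (fun x => f x + g x).
Proof.
move=> [cf df] [cg dg].
have cc : continuous (fun x => f x + g x).
  by move=> x; have FF : Filter (nbhs x) by [exact: nbhs_filter]; exact: (cvgD (cf x) (cg x)).
split=> [|j]; first exact: cc.
have [df1 df2] := df j; have [dg1 dg2] := dg j; split=> [x|].
  exact: (@derivableD _ _ _ f g).
have cc' : continuous (fun x => 'D_(delta_mx 0 j) f x + 'D_(delta_mx 0 j) g x).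
  by move=> x; have FF : Filter (nbhs x) by [exact: nbhs_filter]; exact: (cvgD (df2 x) (dg2 x)).
rewrite (_ : 'D__ _ = fun x => 'D_(delta_mx 0 j) f x + 'D_(delta_mx 0 j) g x); first exact: cc'.
by apply/funext => x; exact: (@deriveD _ _ _ f g).
Qed.

Lemma C1_prod m (I : Type) (r : seq I) (f : I -> 'rV[R]_m -> R) : (forall i, C1 (f i)) ->
  C1 (fun x => \prod_(i <- r) f i x).
Proof.
move=> Cf; elim: r => [|i r IH].
  by under eq_fun do rewrite big_nil; exact: C1_cst.
by under eq_fun do rewrite big_cons; exact: C1M.
Qed.

Lemma is_derive_prod1 m (I : Type) (r : seq I) (f : I -> 'rV[R]_m -> R) x v :
  (forall i, is_derive x v (f i) 0 /\ f i x = 1) ->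
  is_derive x v (fun x => \prod_(i <- r) f i x) 0 /\ \prod_(i <- r) f i x = 1.
Proof.
move=> h; elim: r => [|i r [IH1 IH2]].
  by rewrite big_nil; under eq_fun do rewrite big_nil; split=> //; exact: is_derive_cst.
rewrite big_cons; under eq_fun do rewrite big_cons; have [h1 h2] := h i.
split; last by rewrite h2 IH2 mulr1.
by have := @is_deriveM _ _ _ _ x v _ _ h1 IH1; rewrite !scaler0 addr0.
Qed.

(** A directional derivative sees a function only along a line, so it transfers between functions on
    different spaces that agree along corresponding lines. *)
Lemma is_derive_eq_quot (V V' : normedModType R) (f : V -> R) (g : V' -> R) x v y w (d : R) :
  (forall h : R, f (h *: v + x) = g (h *: w + y)) -> is_derive y w g d -> is_derive x v f d.
Proof.
move=> fg [dg1 dg2].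
have E : (fun h : R => h^-1 *: (f (h *: v + x) - f x)) = (fun h => h^-1 *: (g (h *: w + y) - g y)).
  by apply/funext => h; rewrite fg; have := fg 0; rewrite !scale0r !add0r => ->.
have E' : (fun h : R => h^-1 *: ((f \o shift x) (h *: v) - f x)) =
    (fun h => h^-1 *: ((g \o shift y) (h *: w) - g y)) by exact: E.
split; first by rewrite /derivable E'.
by rewrite /derive E'.
Qed.

Lemma C1_coord m (k : 'I_m) (g dg : R -> R) : (forall t, is_derive t (1 : R) g (dg t)) -> continuous dg ->
  C1 (fun x : 'rV[R]_m => g (x 0 k)) /\
  forall j x, is_derive x (delta_mx 0 j) (fun x : 'rV[R]_m => g (x 0 k)) ((k == j)%:R * dg (x 0 k)).
Proof.
move=> hg cdg.
have D j x : is_derive x (delta_mx 0 j) (fun x : 'rV[R]_m => g (x 0 k)) ((k == j)%:R * dg (x 0 k)).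
  have [<-|kj] := eqVneq k j.
    rewrite mul1r; apply: (is_derive_eq_quot _ (hg (x 0 k))) => h.
    by rewrite !mxE !eqxx.
  rewrite mul0r; apply: (is_derive_eq_quot (g := fun _ : R => g (x 0 k)) (y := 0) (w := 1)).
    by move=> h; rewrite !mxE eqxx (negbTE kj) mulr0 add0r.
have cg : continuous g by move=> t; apply/differentiable_continuous/derivable1_diffP; have [] := hg t.
have cc (G : R -> R) : continuous G -> continuous (fun x : 'rV[R]_m => G (x 0 k)).
  by move=> cG x; apply: (continuous_comp (@coord_continuous R 1 m 0 k x)); exact: cG.
split=> //; split=> [|j]; first exact: cc.
split=> [x|]; first by have [] := D j x.
rewrite (_ : 'D__ _ = fun x : 'rV[R]_m => (k == j)%:R * dg (x 0 k)).
  move=> x; have FF : Filter (nbhs x) by exact: nbhs_filter.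
  exact: (cvgM (cvg_cst _) (cc _ cdg x)).
by apply/funext => x; have [_ ->] := D j x.
Qed.

(** Composition with the projection of a row onto one of its blocks. Coordinate directions must go
    to 0 or to coordinate directions because [C1] speaks only of coordinate derivatives. *)
Lemma C1_linear m n (p : 'rV[R]_n -> 'rV[R]_m) (psi : 'rV[R]_m -> R) : C1 psi ->
  (forall (h : R) x y, p (h *: x + y) = h *: p x + p y) -> (forall x, `|p x| <= `|x|) ->
  (forall j, p (delta_mx 0 j) = 0 \/ exists j', p (delta_mx 0 j) = delta_mx 0 j') ->
  C1 (psi \o p) /\ forall j x, 'D_(delta_mx 0 j) (psi \o p) x = 'D_(p (delta_mx 0 j)) psi (p x).
Proof.
move=> [cpsi dpsi] plin pn pj.
have cp : continuous p.
  move=> x; have FF : Filter (nbhs (x : 'rV[R]_n)) by exact: nbhs_filter.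
  apply/cvgrPdist_lt => e e0; 
  have := (cvgrPdist_lt _ _).1 (cvg_id : y @[y --> x] --> x) e e0.
  move=> /(_ FF) h; apply: (@filterS _ _ FF _ _ _ h) => y xy; apply: le_lt_trans xy.
  have -> : p x - p y = p (-1 *: y + x) by rewrite plin scaleN1r addrC.
  by apply: le_trans (pn _) _; rewrite scaleN1r addrC.
have D0 (x : 'rV[R]_m) : is_derive x (0 : 'rV[R]_m) psi 0.
  apply: (is_derive_eq_quot (g := fun _ : R => psi x) (y := 0) (w := 1)).
    by move=> h; rewrite scaler0 add0r.
have dp j (x : 'rV[R]_m) : derivable psi x (p (delta_mx 0 j)).
  by have [->|[j' ->]] := pj j; [have [] := D0 x|have [] := dpsi j'].
have D j x : is_derive x (delta_mx 0 j) (psi \o p) ('D_(p (delta_mx 0 j)) psi (p x)).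
  apply: (is_derive_eq_quot (g := psi) (y := p x) (w := p (delta_mx 0 j))).
    by move=> h; rewrite /= plin.
  by split=> //; exact: dp.
split=> [|j x]; last by have [_ ->] := D j x.
split=> [x|j]; first by apply: continuous_comp; [exact: cp|exact: cpsi].
split=> [x|]; first by have [] := D j x.
rewrite (_ : 'D__ _ = fun x => 'D_(p (delta_mx 0 j)) psi (p x)); last first.
  by apply/funext => x; have [_ ->] := D j x.
move=> x; have [->|[j' ->]] := pj j.
  rewrite (_ : (fun _ => _) = fun=> 0); first exact: cst_continuous.
  by apply/funext => y; have [_ ->] := D0 (p y).
by apply: (@continuous_comp _ _ _ p ('D_(delta_mx 0 j') psi)); [exact: cp|have [_] := dpsi j'; exact].
Qed.

(** The squared positive part is continuously differentiable, which suffices for cut-offs of class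
    C^1. *)
Definition sqp (t : R) : R := Num.max 0 t ^+ 2.

Lemma sqp_taylor (t h : R) : `|sqp (t + h) - sqp t - 2 * Num.max 0 t * h| <= h ^+ 2.
Proof.
have key (a b : R) : `|b ^+ 2 - a ^+ 2 - 2 * a * (b - a)| = (b - a) ^+ 2.
  by rewrite -[RHS]ger0_norm ?sqr_ge0//; congr (`|_|); ring.
rewrite /sqp; have [t0|t0] := leP 0 t; have [th|th] := leP 0 (t + h).
- by have := key t (t + h); rewrite [t + h - t]addrC addKr => ->.
- rewrite expr0n/= ler_norml; apply/andP; split; nra.
- rewrite expr0n/= mulr0 mul0r !subr0 ger0_norm ?sqr_ge0//.
  by rewrite lerXn2r ?nnegrE//; nra.
- by rewrite mulr0 mul0r !subrr normr0 sqr_ge0.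
Qed.

Lemma is_derive_sqp (t : R) : is_derive t (1 : R) sqp (2 * Num.max 0 t).
Proof.
have lim : (h^-1 *: (sqp (h *: 1 + t) - sqp t)) @[h --> (0 : R)^'] --> 2 * Num.max 0 t.
  apply/cvgrPdist_lt => e e0; apply/nbhs_ballP; exists e => // h /=.
  rewrite /ball/= sub0r normrN => he h0.
  have hn : 0 < `|h| by rewrite normr_gt0.
  rewrite distrC -(ltr_pM2l hn) -normrM.
  have -> : h * (h^-1 *: (sqp (h *: 1 + t) - sqp t) - 2 * Num.max 0 t) =
      sqp (t + h) - sqp t - 2 * Num.max 0 t * h.
    by rewrite -![_ *: _]/(_ * _) mulr1 [h + t]addrC; field.
  apply: (le_lt_trans (sqp_taylor _ _)).
  by rewrite -real_normK ?num_real// expr2 ltr_pM2l.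
by split; [apply/cvg_ex; exists (2 * Num.max 0 t)|exact: cvg_lim lim].
Qed.

Lemma sqp_eq1 (t r : R) : t <= r -> Num.max 0 (t - r) = 0.
Proof. by move=> h; rewrite max_l// subr_le0. Qed.

(** Equal to 1 for [t ^+ 2 <= r] and to 0 for [t ^+ 2 >= r + 1]. *)
Definition cutoff1 (r t : R) : R := sqp (1 - sqp (t ^+ 2 - r)).

Definition dcutoff1 (r t : R) : R :=
  2 * Num.max 0 (1 - sqp (t ^+ 2 - r)) * (- (2 * Num.max 0 (t ^+ 2 - r) * (2 * t))).

Lemma is_derive_cutoff1 r t : is_derive t (1 : R) (cutoff1 r) (dcutoff1 r t).
Proof.
have d1 : is_derive t (1 : R) (fun s : R => s ^+ 2 - r) (2 * t).
  have := @is_deriveB _ _ _ _ _ t 1 _ _ (@is_deriveX _ _ id 2 t 1 1 (is_derive_id _ _)) (is_derive_cst r t 1).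
  have -> : (2%:R * id t ^+ 2.-1) *: (1 : R) - 0 = 2 * t by rewrite subr0 expr1 -[_ *: _]/(_ * _) mulr1.
  exact.
have d2 : is_derive t (1 : R) (fun s => sqp (s ^+ 2 - r)) (2 * Num.max 0 (t ^+ 2 - r) * (2 * t)).
  exact: (is_derive1_comp (is_derive_sqp _) d1).
have d3 : is_derive t (1 : R) (fun s => 1 - sqp (s ^+ 2 - r)) (- (2 * Num.max 0 (t ^+ 2 - r) * (2 * t))).
  by have := @is_deriveB _ _ _ _ _ t 1 _ _ (is_derive_cst (1 : R) t 1) d2; rewrite sub0r.
exact: (is_derive1_comp (is_derive_sqp _) d3).
Qed.

Lemma cont_max0 : continuous (fun t : R => Num.max 0 t).
Proof. by move=> t; apply: (@continuous_max _ _ (fun=> 0) id); [exact: cvg_cst|exact: cvg_id]. Qed.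

Lemma dcutoff1_continuous r : continuous (dcutoff1 r).
Proof.
have c1 : continuous (fun t : R => t ^+ 2 - r).
  by move=> t; apply: cvgB; [exact: cvg_sqr cvg_id|exact: cvg_cst].
have c2 : continuous (fun t : R => Num.max 0 (t ^+ 2 - r)).
  by move=> t; apply: (continuous_comp (c1 t)); exact: cont_max0.
have c3 : continuous (fun t : R => 1 - sqp (t ^+ 2 - r)).
  by move=> t; apply: cvgB; [exact: cvg_cst|apply: cvg_sqr; exact: c2].
have c4 : continuous (fun t : R => Num.max 0 (1 - sqp (t ^+ 2 - r))).
  by move=> t; apply: (continuous_comp (c3 t)); exact: cont_max0.
move=> t; apply: cvgM; first by apply: cvgM; [exact: cvg_cst|exact: c4].
apply: cvgN; apply: cvgM; first by apply: cvgM; [exact: cvg_cst|exact: c2].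
by apply: cvgM; [exact: cvg_cst|exact: cvg_id].
Qed.

Lemma cutoff1_in r t : t ^+ 2 <= r -> cutoff1 r t = 1 /\ dcutoff1 r t = 0.
Proof.
move=> tr; rewrite /cutoff1 /dcutoff1 /sqp (sqp_eq1 tr) expr0n/= subr0 max_r// expr1n.
by split=> //; ring.
Qed.

Lemma cutoff1_out r t : 0 <= r -> cutoff1 r t != 0 -> `|t| <= r + 1.
Proof.
move=> r0; apply: contraNT; rewrite -ltNge => ht; rewrite /cutoff1 /sqp.
have h : 1 <= Num.max 0 (t ^+ 2 - r) ^+ 2.
  have h1 : 1 <= t ^+ 2 - r.
    have : (r + 1) ^+ 2 <= `|t| ^+ 2 by rewrite lerXn2r ?nnegrE ?addr_ge0// ltW.
    by rewrite real_normK ?num_real//; nra.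
  by rewrite max_r ?(le_trans ler01)// -(expr1n _ 2) lerXn2r ?nnegrE// (le_trans ler01).
by rewrite max_l ?expr0n// subr_le0.
Qed.

Definition cutoff (m : nat) (r : R) (x : 'rV[R]_m) : R := \prod_k cutoff1 r (x 0 k).

Lemma C1_cutoff m r : C1 (@cutoff m r).
Proof. by apply: C1_prod => k; have [] := C1_coord k (is_derive_cutoff1 r) (@dcutoff1_continuous r). Qed.

Lemma cutoff_in m r (x : 'rV[R]_m) j : (forall k, x 0 k ^+ 2 <= r) ->
  is_derive x (delta_mx 0 j) (@cutoff m r) 0 /\ cutoff r x = 1.
Proof.
move=> xr; apply: is_derive_prod1 => k; have [h1 h2] := cutoff1_in (xr k); split=> //.
have [_ /(_ j x)] := C1_coord k (is_derive_cutoff1 r) (@dcutoff1_continuous r).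
by rewrite h2 mulr0.
Qed.

Lemma rV_box_compact m (r : R) : compact [set x : 'rV[R]_m | forall k, `[-r, r]%classic (x 0 k)].
Proof. by apply: (@rV_compact R m (fun=> `[-r, r]%classic)) => _; exact: segment_compact. Qed.

Lemma cutoff_C1c m r (psi : 'rV[R]_m -> R) : 0 <= r -> C1 psi -> C1c (fun x => cutoff r x * psi x).
Proof.
move=> r0 Cpsi; have [c d] := C1M (C1_cutoff m r) Cpsi; split=> //.
have cb := @rV_box_compact m (r + 1).
apply: (subclosed_compact (@closed_closure _ _) cb).
have clb : closed [set x : 'rV[R]_m | forall k, `[-(r + 1), r + 1]%classic (x 0 k)].
  by apply: compact_closed => //; exact: norm_hausdorff.
rewrite [X in _ `<=` X]((closure_id _).1 clb); apply: closureS => x /= nz k.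
rewrite in_itv/= -ler_norml; apply: cutoff1_out => //.
apply: contraNneq nz => h; apply/eqP; rewrite /cutoff (bigD1 k)//= h; ring.
Qed.

Lemma cutoff_derive m r (psi : 'rV[R]_m -> R) (x : 'rV[R]_m) j : C1 psi -> (forall k, x 0 k ^+ 2 <= r) ->
  'D_(delta_mx 0 j) (fun x => cutoff r x * psi x) x = 'D_(delta_mx 0 j) psi x.
Proof.
move=> [_ /(_ j)[dpsi _]] xr; have [[h1 h2] h3] := cutoff_in j xr.
rewrite (@deriveM _ _ (@cutoff m r) psi)// h2 h3 scaler0 addr0; exact: mul1r.
Qed.

End row_calculus.

Section cylinders.
Context {R : realType}.
Variable Omega : bounded_domain R.
Local Notation W := (L2vec Omega).
Local Notation HH := (Hspace Omega).
Variables (nu : R) (nu_gt0 : 0 < nu).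
Variables (B : set HH) (Bc : @compact (weakH Omega) B).
Local Notation X := (VinH Omega `&` B).
Variables (f : W -> R) (f_dual : Vdual f).
Local Notation N := (dissipation nu).

Lemma Tcyl_nonempty : exists Psi : Tcyl Omega, True.
Proof.
have C0 : C1c (fun _ : 'rV[R]_0 => 0 : R).
  have [c d] := @C1_cst R 0 0; split=> //.
  rewrite (_ : closure _ = set0); first exact: compact0.
  by rewrite -closure0; congr closure; apply/seteqP; split=> x //=; rewrite eqxx.
have w0 (j : 'I_0) : Vspace (0 : W) by exact: V0.
by exists (Cylindrical C0 w0).
Qed.

Lemma cyl_proj_continuous (Psi : Tcyl Omega) : continuous (fun u : HH => cyl_proj Psi (H_to_Vdual u)).
Proof.
have ipP := @L2inner_is_inner R Omega 'I_3.
move=> u; have FF : Filter (nbhs (u : HH)) by exact: nbhs_filter.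
apply: row_cvg => j; rewrite /cyl_proj; under eq_fun do rewrite mxE; rewrite mxE.
apply/cvgrPdist_lt => e e0; pose w := cyl_w j.
have w1 : 0 < `|w| + 1 by rewrite ltr_wpDl.
apply/H_nbhs; exists (e / (`|w| + 1)); first by rewrite divr_gt0.
move=> v; rewrite ltr_pdivlMr// => uv; rewrite /H_to_Vdual -(ipBl ipP).
apply: le_lt_trans uv; apply: (le_trans (ip_le ipP _ _)); rewrite distrC.
by rewrite ler_wpM2l// lerDl.
Qed.

(** On [B] the projections stay in a fixed box, on which the derivatives of psi are bounded and a
    cut-off can be made equal to 1. *)
Lemma cyl_proj_bounded (Psi : Tcyl Omega) : exists2 r : R, 0 <= r & forall u, B u ->
  forall k, `|cyl_proj Psi (H_to_Vdual u) 0 k| <= r.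
Proof.
have [M hM] := weakly_compact_bounded Bc.
have ipP := @L2inner_is_inner R Omega 'I_3.
exists (`|M| * \sum_k `|@cyl_w R Omega Psi k|) => [|u Bu k].
  by rewrite mulr_ge0// sumr_ge0.
rewrite mxE; apply: (le_trans (ip_le ipP _ _)); apply: ler_pM => //.
  by rewrite (le_trans (hM u Bu))// ler_norm.
by rewrite (bigD1 k)//= lerDl sumr_ge0.
Qed.

Lemma cyl_test_subq (Psi : Tcyl Omega) : subq X N (cyl_test nu f Psi).
Proof.
have X0 u : X u -> 0 <= N u by move=> _; exact: dissipation_ge0.
have [r r0 hr] := cyl_proj_bounded Psi.
have [_ dpsi _] := cyl_psi_C1c Psi.
pose c j (u : HH) := 'D_(delta_mx 0 j) (@cyl_psi _ _ Psi) (cyl_proj Psi (H_to_Vdual u)).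
have cc j : continuous (c j).
  move=> u; apply: (@continuous_comp _ _ _ (fun u : HH => cyl_proj Psi (H_to_Vdual u)) ('D_(delta_mx 0 j) (@cyl_psi _ _ Psi))).
    exact: cyl_proj_continuous.
  by have [_] := dpsi j; exact.
have bc j : exists M : R, forall u, X u -> `|c j u| <= M.
  pose D (x : 'rV[R]_(cyl_dim Psi)) := 'D_(delta_mx 0 j) (@cyl_psi _ _ Psi) x.
  have cI : compact (D @` [set x : 'rV[R]_(cyl_dim Psi) | forall k, `[-r, r]%classic (x 0 k)]).
    apply: continuous_compact; last exact: rV_box_compact.
    by apply: continuous_subspaceT; have [_] := dpsi j.
  have [M [_ hM]] := compact_bounded cI; exists (M + 1) => u [_ Bu].
  apply: (hM (M + 1)); first by rewrite ltrDl.
  by exists (cyl_proj Psi (H_to_Vdual u)) => // k; rewrite /= in_itv/= -ler_norml; exact: hr.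
have st j : subq X N (fun u => c j u * NSop nu f (H_val u) (@cyl_w _ _ Psi j)).
  have [M hM] := bc j; apply: (subq_bound (M := M)) => //.
    by move=> s; exact: continuous_subspaceT.
  by apply: NSop_subq => //; exact: cyl_w_V.
have ss (r' : seq 'I_(cyl_dim Psi)) : subq X N (fun u => \sum_(j <- r') c j u * NSop nu f (H_val u) (@cyl_w _ _ Psi j)).
  elim: r' => [|j r' IH]; first by under eq_fun do rewrite big_nil; exact: subq_cst.
  by under eq_fun do rewrite big_cons; exact: subqD.
have [s1 s2] := ss (index_enum _).
have E u : X u -> \sum_j c j u * NSop nu f (H_val u) (@cyl_w _ _ Psi j) = cyl_test nu f Psi u.
  by move=> Xu; rewrite (cyl_testE nu f_dual _ Xu).
split=> [s|e e0].
  apply: subspace_eq_continuous (s1 s).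
  by move=> u /set_mem [Xu _]; exact: E.
by have [C C0 hC] := s2 e e0; exists C => // u Xu; rewrite -E//; exact: hC.
Qed.

Lemma lin_submx m1 m2 : [/\ forall (h : R) (x y : 'rV[R]_(m1 + m2)), lsubmx (h *: x + y) = h *: lsubmx x + lsubmx y,
    forall (h : R) (x y : 'rV[R]_(m1 + m2)), rsubmx (h *: x + y) = h *: rsubmx x + rsubmx y,
    forall x : 'rV[R]_(m1 + m2), `|lsubmx x| <= `|x| & forall x : 'rV[R]_(m1 + m2), `|rsubmx x| <= `|x| ].
Proof.
have le (x : 'rV[R]_(m1 + m2)) k : `|x 0 k| <= `|x|.
  rewrite -[`|x|]/(mx_norm x) mx_normrE.
  exact: (@le_bigmax _ _ _ 0 (fun ij : 'I_1 * 'I_(m1 + m2) => `|x ij.1 ij.2|) (0, k)).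
split.
- by move=> h x y; apply/rowP => k; rewrite !mxE.
- by move=> h x y; apply/rowP => k; rewrite !mxE.
- by move=> x; apply: row_norm_le => // k; rewrite mxE.
- by move=> x; apply: row_norm_le => // k; rewrite mxE.
Qed.

Lemma delta_submx m1 m2 :
  [/\ forall j, lsubmx (delta_mx 0 (lshift m2 j) : 'rV[R]_(m1 + m2)) = delta_mx 0 j,
      forall j, lsubmx (delta_mx 0 (rshift m1 j) : 'rV[R]_(m1 + m2)) = 0,
      forall j, rsubmx (delta_mx 0 (lshift m2 j) : 'rV[R]_(m1 + m2)) = 0 &
      forall j, rsubmx (delta_mx 0 (rshift m1 j) : 'rV[R]_(m1 + m2)) = delta_mx 0 j].
Proof.
split=> j; apply/rowP => k; rewrite !mxE ?eqxx//=.
- by rewrite eq_lrshift.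
- by rewrite eq_rlshift.
- by rewrite eq_rshift.
Qed.

Lemma derive0 m (psi : 'rV[R]_m -> R) x : 'D_(0 : 'rV[R]_m) psi x = 0.
Proof.
have [|_ //] := is_derive_eq_quot (f := psi) (x := x) (v := 0) (g := fun _ : R => psi x) (y := 0) (w := 1) _ (is_derive_cst (psi x) (0 : R) 1).
by move=> h; rewrite scaler0 add0r.
Qed.

(** The natural candidate [psi1 (x) + c * psi2 (y)] on the product has no compact support.
    Multiplied by a cut-off equal to 1 on all projections of points of [B], it becomes admissible
    and keeps its value and derivatives there; the identity therefore holds on [X] only. *)
Lemma cyl_test_lin (Psi1 Psi2 : Tcyl Omega) (c : R) : exists Psi : Tcyl Omega, forall u, X u ->
  cyl_test nu f Psi u = cyl_test nu f Psi1 u + c * cyl_test nu f Psi2 u.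
Proof.
set m1 := cyl_dim Psi1; set m2 := cyl_dim Psi2.
have C1c1 (Psi : Tcyl Omega) : C1 (@cyl_psi _ _ Psi) by have [a b _] := cyl_psi_C1c Psi.
have [[ll lr nl nr] [dll dlr drl drr]] := (lin_submx m1 m2, delta_submx m1 m2).
have [|Cl Dl] := C1_linear (C1c1 Psi1) ll nl.
  move=> j; case: (split_ordP j) => j' ->; last by left.
  by right; exists j'.
have [|Cr Dr] := C1_linear (C1c1 Psi2) lr nr.
  move=> j; case: (split_ordP j) => j' ->; first by left.
  by right; exists j'.
pose psi0 (x : 'rV[R]_(m1 + m2)) := (@cyl_psi _ _ Psi1 \o lsubmx) x + c * (@cyl_psi _ _ Psi2 \o rsubmx) x.
have Cc : C1 (fun x : 'rV[R]_(m1 + m2) => c * (@cyl_psi _ _ Psi2 \o rsubmx) x) by apply: C1M => //; exact: C1_cst.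
have C0 : C1 psi0 by exact: C1D.
have D0 j x : 'D_(delta_mx 0 j) psi0 x = 'D_(lsubmx (delta_mx 0 j)) (@cyl_psi _ _ Psi1) (lsubmx x) +
    c * 'D_(rsubmx (delta_mx 0 j)) (@cyl_psi _ _ Psi2) (rsubmx x).
  rewrite -Dl -Dr /psi0 deriveD; [|by have [_ /(_ j)[]] := Cl|by have [_ /(_ j)[]] := Cc].
  by rewrite deriveZ//; have [_ /(_ j)[]] := Cr.
have [r1 r10 hr1] := cyl_proj_bounded Psi1; have [r2 r20 hr2] := cyl_proj_bounded Psi2.
pose r := r1 ^+ 2 + r2 ^+ 2; have r0 : 0 <= r by rewrite addr_ge0 ?sqr_ge0.
pose w (j : 'I_(m1 + m2)) : W := match fintype.split j with inl j1 => @cyl_w _ _ Psi1 j1 | inr j2 => @cyl_w _ _ Psi2 j2 end.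
have Vw j : Vspace (w j) by rewrite /w; case: fintype.split => k; exact: cyl_w_V.
pose Psi := @Cylindrical R Omega (m1 + m2) _ (cutoff_C1c r0 C0) w Vw.
have wl j : w (lshift m2 j) = @cyl_w _ _ Psi1 j by rewrite /w (unsplitK (inl j)).
have wr j : w (rshift m1 j) = @cyl_w _ _ Psi2 j by rewrite /w (unsplitK (inr j)).
exists Psi => u Xu; have [_ Bu] := Xu.
rewrite !(cyl_testE nu f_dual _ Xu).
have pl : lsubmx (cyl_proj Psi (H_to_Vdual u)) = cyl_proj Psi1 (H_to_Vdual u).
  by apply/rowP => k; rewrite !mxE /= wl.
have pr : rsubmx (cyl_proj Psi (H_to_Vdual u)) = cyl_proj Psi2 (H_to_Vdual u).
  by apply/rowP => k; rewrite !mxE /= wr.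
have pb k : cyl_proj Psi (H_to_Vdual u) 0 k ^+ 2 <= r.
  have sq (x y : R) : 0 <= y -> `|x| <= y -> x ^+ 2 <= y ^+ 2.
    by move=> y0 xy; rewrite -real_normK ?num_real// lerXn2r ?nnegrE.
  case: (split_ordP k) => j ->.
    have -> : cyl_proj Psi (H_to_Vdual u) 0 (lshift m2 j) = cyl_proj Psi1 (H_to_Vdual u) 0 j.
      by rewrite !mxE /= wl.
    by rewrite (le_trans (sq _ _ r10 (hr1 u Bu j)))// lerDl sqr_ge0.
  have -> : cyl_proj Psi (H_to_Vdual u) 0 (rshift m1 j) = cyl_proj Psi2 (H_to_Vdual u) 0 j.
    by rewrite !mxE /= wr.
  by rewrite (le_trans (sq _ _ r20 (hr2 u Bu j)))// lerDr sqr_ge0.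
have DE j : 'D_(delta_mx 0 j) (@cyl_psi _ _ Psi) (cyl_proj Psi (H_to_Vdual u)) =
    'D_(delta_mx 0 j) psi0 (cyl_proj Psi (H_to_Vdual u)) by exact: cutoff_derive.
rewrite (eq_bigr (fun j => 'D_(delta_mx 0 j) psi0 (cyl_proj Psi (H_to_Vdual u)) * NSop nu f (H_val u) (w j))).
  rewrite big_split_ord/= mulr_sumr; congr (_ + _); apply: eq_bigr => j _.
    by rewrite D0 dll drl derive0 mulr0 addr0 pl wl.
  by rewrite D0 dlr drr derive0 add0r pr wr mulrA.
by move=> j _; rewrite DE.
Qed.

End cylinders.

(** * Stationary statistical solutions *)

Import HBNNSimple.

Section integral_nonmeasurable.
Context {d} {T : measurableType d} {R : realType}.
Variable mu : {measure set T -> \bar R}.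
Local Open Scope ereal_scope.
Implicit Types f g : T -> \bar R.

(** The integral of a nonnegative function is a supremum over simple functions below it, so
    monotonicity asks for no measurability. [Pfpsss] integrates over [VinH], of which only the part
    inside [B] is shown to be measurable. *)
Lemma integralT_mono f g : (forall x, 0 <= f x) -> (forall x, f x <= g x) ->
  \int[mu]_x f x <= \int[mu]_x g x.
Proof.
move=> f0 fg; have g0 x : 0 <= g x by exact: le_trans (fg x).
rewrite !ge0_integralTE//; apply: le_ereal_sup => _ [h hf <-]; exists h => // x.
exact: le_trans (hf x) (fg x).
Qed.

Variable N : set T.
Hypothesis mN : measurable N.
Hypothesis N0 : mu N = 0.

(** A simple function below [f'], set to 0 on the null set, keeps its integral and lies below
    [g']. *)
Lemma integralT_eq_off_null f g : (forall x, ~ N x -> f x = g x) -> \int[mu]_x f x = \int[mu]_x g x.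
Proof.
have le (f' g' : T -> \bar R) : (forall x, 0 <= f' x) -> (forall x, 0 <= g' x) ->
    (forall x, ~ N x -> f' x = g' x) -> \int[mu]_x f' x <= \int[mu]_x g' x.
  move=> f0 g0 fg; rewrite ge0_integralTE//; apply: ge_ereal_sup => _ [h hf <-].
  have mNC := measurableC mN.
  have -> : sintegral mu h = \int[mu]_x (proj_nnsfun h mNC x)%:E.
    rewrite -integralT_nnsfun; apply: ae_eq_integral => //.
    - by apply/measurable_EFinP.
    - by apply/measurable_EFinP.
    - exists N; split=> // x /= nx; apply: contrapT => nN; apply: nx => _.
      by rewrite mindicE mem_set// mulr1.
  apply: integralT_mono => x; first by rewrite lee_fin.
  rewrite -mrestrict patchE; case: ifPn => [/set_mem nN|_]; last exact: g0.
  by rewrite -fg//; exact: hf.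
have eq (f' g' : T -> \bar R) : (forall x, 0 <= f' x) -> (forall x, 0 <= g' x) ->
    (forall x, ~ N x -> f' x = g' x) -> \int[mu]_x f' x = \int[mu]_x g' x.
  by move=> f0 g0 fg; apply/eqP; rewrite eq_le !le// => x /fg.
move=> fg; rewrite [LHS]integralE [RHS]integralE; congr (_ - _).
- by apply: eq => [x|x|x nN]; [exact: funepos_ge0|exact: funepos_ge0|rewrite !funeposE fg].
- by apply: eq => [x|x|x nN]; [exact: funeneg_ge0|exact: funeneg_ge0|rewrite !funenegE fg].
Qed.

Lemma integral_eq_off_null f (D D' : set T) : (forall x, ~ N x -> D x <-> D' x) ->
  \int[mu]_(x in D) f x = \int[mu]_(x in D') f x.
Proof.
move=> DD; rewrite integral_mkcond [RHS]integral_mkcond; apply: integralT_eq_off_null => x nN.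
rewrite !patchE; case: ifPn => [/set_mem/(DD x nN)h|nD]; first by rewrite mem_set.
by rewrite memNset// => /(DD x nN)/mem_set h; move: nD; rewrite h.
Qed.

End integral_nonmeasurable.

Section primitive.
Context {R : realType}.
Variables (k : R -> R) (M : R).
Hypothesis ck : continuous k.
Hypothesis kM : forall s, 0 <= k s <= M.

(** Starting at -1 makes 0 an interior point, so the one-sided derivative there is a restriction of
    the two-sided one. *)
Let P (x : R) : R := \int[@lebesgue_measure R]_(t in `[-1, x]) k t.

Lemma primitive_halfline : exists psi : R -> R, [/\ C1_halfline psi k,
  forall x, 0 <= x -> 0 <= psi x & forall x y, 0 <= x -> x <= y -> psi x <= psi y].
Proof.
have ik a b : (@lebesgue_measure R).-integrable `[a, b] (EFin \o k).
  apply: continuous_compact_integrable; first exact: segment_compact.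
  exact: continuous_subspaceT.
have P0 x : 0 <= P x by apply: Rintegral_ge0 => t _; have /andP[] := kM t.
exists P; split=> // [|x y x0 xy]; last first.
  rewrite -subr_ge0 /P Rintegral_itvB//.
  - by apply: Rintegral_ge0 => t _; have /andP[] := kM t.
  - by rewrite bnd_simp (le_trans _ x0)// lerN10.
split=> [x x0|]; last exact: continuous_subspaceT.
have xm : -1 < x by rewrite (lt_le_trans _ x0)// ltrN10.
have [||||dP] := @continuous_FTC1 R k (BLeft (-1)) x (x + 1).
- by rewrite ltrDl.
- exact: ik.
- by rewrite /= lte_fin.
- exact: ck.
rewrite derive1E => eP; have cv : h^-1 *: (P (h *: 1 + x) - P x) @[h --> 0^'] --> k x.
  by rewrite -eP; exact: dP.
apply/cvgrPdist_lt => e e0; move/cvgrPdist_lt : cv => /(_ e e0).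
rewrite /within/= => /nbhs_ballP[d /= d0 hd]; apply/nbhs_ballP; exists d => // y xy yx _.
have := hd (y - x); rewrite /ball/= sub0r normrN distrC => /(_ xy).
by rewrite subr_eq0 => /(_ yx); rewrite -![_ *: _]/(_ * _) mulr1 subrK mulrC.
Qed.

Lemma halfline_ge0 (psi dpsi : R -> R) : C1_halfline psi dpsi ->
  (forall x y, 0 <= x -> x <= y -> psi x <= psi y) -> forall x, 0 <= x -> 0 <= dpsi x.
Proof.
move=> [dp _] mono x x0; rewrite leNgt; apply/negP => neg.
have := dp x x0; move/cvgrPdist_lt => /(_ (- dpsi x)); rewrite oppr_gt0 => /(_ neg).
rewrite /within/= => /nbhs_ballP[d /= d0 hd].
have := hd (x + d / 2); rewrite /ball/= opprD addNKr normrN gtr0_norm ?divr_gt0//.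
rewrite ltr_pdivrMr// ltr_pMr// ltr1n => /(_ isT).
have d20 : 0 < d / 2 by rewrite divr_gt0.
have ne : x + d / 2 != x by rewrite gt_eqF// ltrDl.
move=> /(_ ne); rewrite in_itv/= andbT addr_ge0 ?(ltW d20)// => /(_ isT).
have := mono x (x + d / 2) x0; rewrite lerDl (ltW d20) => /(_ isT) hm.
have : 0 <= (psi (x + d / 2) - psi x) / (x + d / 2 - x).
  by rewrite divr_ge0 ?subr_ge0// lerDl ltW.
by move: (_ / _) => z z0; rewrite ltr_distl => /andP[]; lra.
Qed.

(** [admissible] takes multipliers continuous on the whole line; clamping the argument changes
    nothing at squared norms. *)
Lemma halfline_clamp (dpsi : R -> R) : {within `[0, +oo[%classic, continuous dpsi} ->
  continuous (fun y : R => dpsi (Num.max 0 y)).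
Proof.
move=> cd y; have /within_cvgP h := cd.
have cm : Num.max 0 z @[z --> y] --> Num.max 0 y by exact: cont_max0.
have m0 (z : R) : `[0, +oo[%classic (Num.max 0 z).
  have z0 : 0 <= Num.max 0 z by rewrite le_max lexx.
  by rewrite /= in_itv/= andbT.
have FF : Filter (nbhs (y : R)) by exact: nbhs_filter.
move=> A /(h _ (m0 y)) hA; have {}hA := cm _ hA.
by apply: (@filterS _ _ FF _ _ _ hA) => z; apply; exact: m0.
Qed.

End primitive.

Section admissible_measures.
Context {R : realType}.
Variable Omega : bounded_domain R.
Local Notation W := (L2vec Omega).
Local Notation HH := (Hspace Omega).
Variables (nu : R) (nu_gt0 : 0 < nu).
Variables (B : set HH) (Bc : @compact (weakH Omega) B).
Local Notation X := (VinH Omega `&` B).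
Variables (f : W -> R) (f_dual : Vdual f).
Local Notation N := (dissipation nu).
Local Notation e := (fun u : HH => `|H_val u| ^+ 2).
Local Notation F := (fun u : HH => f (H_val u)).
Local Notation adm := (@admissible R HH X N e F (Tcyl Omega) (cyl_test nu f)).
Variable mu : probability (borelH Omega) R.

Let Kc := sublevel_compactH nu_gt0 Bc.
Let X0 u : X u -> 0 <= N u. Proof. by move=> _; exact: dissipation_ge0. Qed.
Let mX : measurable (X : set (borelH Omega)).
Proof. exact: (coercive_measurable (@H_hausdorff R Omega) Kc). Qed.

Lemma weakly_compact_open_compl : open (~` B).
Proof.
rewrite openE => x nBx; rewrite /interior; apply/H_nbhs; apply: contrapT => h; apply: nBx.
have bad n : exists y, `|H_val y - H_val x| < n.+1%:R^-1 /\ B y.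
  apply: contrapT => ne; apply: h; exists n.+1%:R^-1; first by rewrite invr_gt0.
  by move=> y yx By; apply: ne; exists y.
pose y_ n := projT1 (cid (bad n)).
have yP n : `|H_val (y_ n) - H_val x| < n.+1%:R^-1 /\ B (y_ n) by exact: projT2 (cid (bad n)).
apply: (weakly_compact_closed Bc (u_ := y_)) => [n|]; first by have [] := yP n.
apply/cvgrPdist_lt => d d0; have [n0 hn] := natSinv_lt d0.
exists n0 => // n /= n0n; rewrite distrC; have [h1 _] := yP n.
exact: (lt_trans h1 (hn n n0n)).
Qed.

Let mB : measurable (~` B : set (borelH Omega)).
Proof. by apply: sub_sigma_algebra; exact: weakly_compact_open_compl. Qed.

Let mNX : measurable (~` X : set (borelH Omega)).
Proof. exact: measurableC. Qed.

Lemma compl_null : mu X = 1%E -> mu (~` X) = 0%E.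
Proof.
move=> h; have -> : (mu (~` X) = 1 - mu X)%E by exact: probability_setC.
by rewrite h subee.
Qed.

Lemma integral_VinH (h : HH -> \bar R) : mu (~` B) = 0%E ->
  (\int[mu]_(u in (VinH Omega : set (borelH Omega))) h u = \int[mu]_(u in (X : set (borelH Omega))) h u)%E.
Proof.
move=> B0; apply: (integral_eq_off_null mB B0) => x nB.
by split=> [Vx|[]//]; split=> //; apply: contrapT.
Qed.

Lemma enstrophy_integral : mu (~` X) = 0%E ->
  (\int[mu]_(u in [set: borelH Omega]) enstrophy (H_val u) =
   \int[mu]_(u in (X : set (borelH Omega))) (`|grad (H_val u)| ^+ 2)%:E)%E.
Proof.
move=> N0; rewrite [RHS]integral_mkcond; apply: (integralT_eq_off_null mNX N0) => x nX.
have Xx : X x by exact: contrapT.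
by rewrite patchE mem_set//; rewrite /enstrophy; case: asboolP => // nV; have [] := Xx.
Qed.

Lemma admissible_compl : adm mu -> mu (~` X) = 0%E /\ mu (~` B) = 0%E.
Proof.
move=> [muX _ _ _]; have X1 := compl_null muX; split=> //; apply/eqP.
rewrite eq_le measure_ge0 andbT -X1; apply: le_measure; rewrite ?inE//.
by move=> x nB [_ Bx]; exact: nB.
Qed.

(** [A] is the part of [B] outside V. [enstrophy] is infinite on it, so a positive measure of [A]
    would contradict the first condition of [Pfpsss]. *)
Lemma Pfpsss_compl : Pfpsss_on nu f B mu -> mu (~` X) = 0%E.
Proof.
move=> [[fin _ _] B0]; pose A : set (borelH Omega) := ~` X `\` ~` B.
have mA : measurable A by exact: measurableD.
have A0 : mu A = 0%E.
  apply: contrapT => /eqP nz.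
  have : (\int[mu]_(u in A) cst +oo%E u <= \int[mu]_(u in [set: borelH Omega]) enstrophy (H_val u))%E.
    rewrite integral_mkcond; apply: integralT_mono => x; rewrite patchE.
      by case: ifPn => // _; exact: leey.
    have en0 : (0 <= enstrophy (H_val x))%E.
      by rewrite /enstrophy; case: asboolP => // _; rewrite lee_fin sqr_ge0.
    case: ifPn => [/set_mem [nX nnB]|_]; last exact: en0.
    rewrite /enstrophy; case: asboolP => [Vx|_]; last exact: leey.
    by exfalso; apply: nX; split=> //; exact: contrapT.
  rewrite integral_cst// gt0_mulye; last by rewrite lt0e nz measure_ge0.
  by rewrite leye_eq => /eqP h; move: fin; rewrite h ltxx.
apply/eqP; rewrite eq_le measure_ge0 andbT.
apply: (@le_trans _ _ (mu (A `|` ~` B))).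
  apply: le_measure; rewrite ?inE//; first exact: measurableU.
  by move=> x nX; have [Bx|nB] := pselect (B x); [left; split=> // -[]|right].
have e1 : (mu A + mu (~` B) = 0)%E by rewrite A0 B0 adde0.
by rewrite -[leRHS]e1; exact: (@measureU2 _ _ _ mu _ _ mA mB).
Qed.

Lemma dissipation_grad : (\int[mu]_(u in (X : set (borelH Omega))) (N u)%:E =
  nu%:E * \int[mu]_(u in (X : set (borelH Omega))) (`|grad (H_val u)| ^+ 2)%:E)%E.
Proof.
have mN : measurable_fun (X : set (borelH Omega)) (N : borelH Omega -> R).
  apply: (layer_measurable (@H_hausdorff R Omega) Kc) => c.
  by apply: compact_closed; [exact: H_hausdorff|exact: Kc].
rewrite -ge0_integralZl_EFin//.
- apply/measurable_EFinP.
  have -> : (fun u : HH => `|grad (H_val u)| ^+ 2) = (fun u => nu^-1 * N u).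
    by apply/funext => u; rewrite /dissipation mulKf// gt_eqF.
  exact: measurable_funM.
- exact: ltW.
Qed.

Let sF : subq X N F. Proof. exact: Vdual_subq. Qed.

Lemma coercive_Rintegral (h : HH -> R) : mu.-integrable (X : set (borelH Omega)) (EFin \o h) ->
  (\int[mu]_(u in (X : set (borelH Omega))) (h u)%:E = (\int[mu]_(u in (X : set (borelH Omega))) h u)%:E)%E.
Proof. by move=> ih; rewrite /Rintegral fineK//; exact: (integrable_fin_num mX ih). Qed.

Lemma admissible_Pfpsss : adm mu -> Pfpsss_on nu f B mu.
Proof.
move=> am; have [nX nB] := admissible_compl am; have [muX iN hk hg] := am.
split=> //; split.
- rewrite enstrophy_integral// -(@lte_pmul2l _ nu%:E)// ?lte_fin//.
  rewrite -dissipation_grad gt0_muley ?lte_fin// coercive_Rintegral//; exact: ltry.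
- move=> psi dpsi C1 psi0 mono [M hM]; rewrite integral_VinH//.
  have ck := halfline_clamp C1.2.
  have kM s : 0 <= dpsi (Num.max 0 s) <= M.
    have m0 : 0 <= Num.max 0 s by rewrite le_max lexx.
    rewrite (halfline_ge0 C1 mono m0)/=; apply: le_trans (hM _ m0); exact: ler_norm.
  have := hk _ M ck kM.
  have il := ell_integrable (@H_hausdorff R Omega) X0 Kc (@H_norm_continuous R Omega) sF iN ck kM.
  have E u : (dpsi (Num.max 0 (e u)) * ellN N F u) = dpsi (`|H_val u| ^+ 2) * ell nu f (H_val u).
    by rewrite max_r// sqr_ge0.
  under eq_fun do rewrite E; move: il; under eq_fun do rewrite E; move=> il.
  by rewrite coercive_Rintegral// lee_fin.
- move=> Psi; rewrite integral_VinH// coercive_Rintegral ?hg//.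
  apply: (subq_integrable (@H_hausdorff R Omega) X0 Kc iN).
  exact: (cyl_test_subq nu_gt0 Bc f_dual Psi).
Qed.

Lemma Pfpsss_admissible : Pfpsss_on nu f B mu -> adm mu.
Proof.
move=> hP; have nX := Pfpsss_compl hP; have [[fin hpsi hPsi] nB] := hP.
have muX : mu X = 1%E.
  have : (mu (~` ~` X) = 1 - mu (~` X))%E by exact: probability_setC.
  by rewrite setCK nX sube0.
have iN : mu.-integrable (X : set (borelH Omega)) (EFin \o N).
  apply/integrableP; split.
    apply/measurable_EFinP; apply: (layer_measurable (@H_hausdorff R Omega) Kc) => c.
    by apply: compact_closed; [exact: H_hausdorff|exact: Kc].
  under eq_integral => u _ do rewrite /= ger0_norm ?dissipation_ge0//.
  rewrite dissipation_grad -enstrophy_integral//.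
  by rewrite lte_mul_pinfty// lee_fin ltW.
split=> //.
- move=> k M ck kM; have [psi [C1 psi0 mono]] := primitive_halfline ck kM.
  have := hpsi psi k C1 psi0 mono; rewrite integral_VinH// => H.
  have {}H := H (ex_intro _ M _).
  have : (\int[mu]_(u in (X : set (borelH Omega))) (k (`|H_val u| ^+ 2) * ell nu f (H_val u))%:E <= 0)%E.
    by apply: H => x _; have /andP[k0 k1] := kM x; rewrite ger0_norm.
  by rewrite /Rintegral => /fine_le0.
- by move=> Psi; have := hPsi Psi; rewrite integral_VinH// /Rintegral => ->.
Qed.

End admissible_measures.

Theorem mainTheorem4 (R : realType) (Omega : bounded_domain R) (nu : R)
    (nu_gt0 : 0 < nu) (f : L2vec Omega -> R) (f_dual : Vdual f)
    (B : set (Hspace Omega)) (B_weakly_compact : @compact (weakH Omega) B)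
    (Pfpsss_B_nonempty : Pfpsss_on nu f B !=set0)
    (phi : Hspace Omega -> R)
    (phi_continuous : weakV_seq_continuous (VinH Omega `&` B) phi)
    (phi_growth : exists C0 C1 delta : R,
      [/\ 0 <= C0, 0 <= C1, 0 < delta <= 2 &
          forall u : Hspace Omega, (VinH Omega `&` B) u ->
            `|phi u| <= C0 + C1 * `|grad (H_val u)| `^ (2 - delta)]) :
  exists (p : R) (q : Tcyl Omega -> R),
    [/\ minimum [set (\int[mu]_(u in VinH Omega `&` B) (phi u)%:E)%E
                  | mu in Pfpsss_on nu f B] p%:E,
        forall Psi, minimum [set dual_objective nu f phi Psi b | b in Bf nu f B]
                      (q Psi),
        has_sup (range q) &
        p = sup (range q)].
Proof.
set X := VinH Omega `&` B.
have Kc := sublevel_compactH nu_gt0 B_weakly_compact.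
have X0 u : X u -> 0 <= dissipation nu u by move=> _; exact: dissipation_ge0.
have sF := Vdual_subq nu_gt0 B f_dual.
have sphi := weakV_subq nu_gt0 phi_continuous phi_growth.
have [M hM] := weakly_compact_bounded B_weakly_compact.
have eE (u : Hspace Omega) : X u -> 0 <= `|H_val u| ^+ 2 <= M ^+ 2.
  move=> [_ Bu]; rewrite sqr_ge0/= lerXn2r ?nnegrE ?(le_trans _ (hM u Bu))//.
have [mu0 hmu0] := Pfpsss_B_nonempty.
have am0 := Pfpsss_admissible nu_gt0 B_weakly_compact hmu0.
have gsub := cyl_test_subq nu_gt0 B_weakly_compact f_dual.
have [p [q [hp hq hs pq]]] := minimax (@H_hausdorff R Omega) (@H_separated R Omega) X0 Kc
  (@H_norm_continuous R Omega) eE sF gsub (fun i j c => cyl_test_lin nu B_weakly_compact f_dual i j c)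
  (Tcyl_nonempty Omega) sphi am0.
exists p, q; split=> //.
- have E mu : Pfpsss_on nu f B mu ->
      (\int[mu]_(u in X) (phi u)%:E)%E = (\int[mu]_(u in X) phi u)%:E.
    move=> /(Pfpsss_admissible nu_gt0 B_weakly_compact)[_ iN _ _].
    apply: (coercive_Rintegral nu_gt0 B_weakly_compact).
    exact: (subq_integrable (@H_hausdorff R Omega) X0 Kc iN sphi).
  have [[mu am hmu] lb] := hp; split.
    have Pm := admissible_Pfpsss nu_gt0 B_weakly_compact f_dual am.
    by exists mu => //; rewrite E// hmu.
  move=> _ [nu' Pn <-]; rewrite E// lee_fin; apply: lb; exists nu' => //.
  exact: (Pfpsss_admissible nu_gt0 B_weakly_compact).
(* [Bf] and [bf] differ in encoding: [Bf] has the second weight as a component and compares norms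
   where [bf] compares their squares. *)
- move=> Psi; have [[[[t x] y] bb hb] lb] := hq Psi; split.
    case: bb => [[[Vx Bx] lx t1 yx]|[t01 [[Vx Bx] [Vy By]] exy ll lz]].
      exists (1, 0, x, x); first by left; exists x; exact: (And4 Bx Vx lx erefl).
      by move: hb; rewrite t1 yx /= subrr.
    have exy' : `|H_val x| = `|H_val y| by move/eqP : exy; rewrite eqrXn2// => /eqP.
    exists (t, 1 - t, x, y); last exact: hb.
    by right; exact: (And5 t01 erefl (And4 Bx Vx By Vy) exy' (conj ll lz)).
  move=> _ [[[[t1 t2] u1] u2] [[u [Bu Vu lu [-> -> -> ->]]]|[t01 -> [Bu1 Vu1 Bu2 Vu2] eu [ll lz]]] <-].
    apply: lb; exists (1, u, u); last by rewrite /= subrr.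
    by left; exact: (And4 (conj Vu Bu) lu erefl erefl).
  have eu' : `|H_val u1| ^+ 2 = `|H_val u2| ^+ 2 by rewrite eu.
  apply: lb; exists (t1, u1, u2); last reflexivity.
  by right; exact: (And5 t01 (conj (conj Vu1 Bu1) (conj Vu2 Bu2)) eu' ll lz).
Qed.
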